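(* Let $\lambda\in L^1(S^1,\mathbb{R})$ with $L:=\|e^\lambda\|_{L^1(S^1)}<\infty$. Then $\lambda$ satisfies $$(-\Delta)^{\frac12}\lambda=\kappa e^\lambda-1\quad\text{in }S^1$$ for some function $\kappa\in L^\infty(S^1,\mathbb{R})$ if and only if there exist a closed curve $\gamma\in W^{2,\infty}(S^1,\mathbb{C})$ with $|\dot\gamma|\equiv\frac{L}{2\pi}$, a holomorphic immersion $\Phi:\bar D^2\to\mathbb{C}$ and a diffeomorphism $\sigma:S^1\to S^1$ such that $\Phi\circ\sigma(z)=\gamma(z)$ for all $z\in S^1$, $$|\Phi'(z)|=e^{\lambda(z)},\quad z\in S^1,\qquad(\ast)$$ and the curvature of $\Phi(S^1)$ is $\kappa$. While $\Phi$ uniquely determines $\lambda$ via $(\ast)$, $\lambda$ determines $\Phi$ up to a rotation and a translation (i.e. if $\Phi,\hat\Phi$ are holomorphic immersions of $\bar D^2$ both satisfying $(\ast)$, then $\Phi=e^{i\theta_0}\hat\Phi+a$ for some $\theta_0\in\mathbb{R}$, $a\in\mathbb{C}$). Moreover $$|\Phi'(z)|=e^{\tilde\lambda(z)},\quad z\in\bar D^2,$$ where $\tilde\lambda$ is the harmonic extension of $\lambda$ to $D^2$.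
   Context: $D^2\subset\mathbb{C}$ is the open unit disk, $S^1=\partial D^2$ with measure $d\theta$. A holomorphic immersion $\Phi:\bar D^2\to\mathbb{C}$ is a function $\Phi\in C^1(\bar D^2,\mathbb{C})$, holomorphic in $D^2$, with $\Phi'(z):=\partial_z\Phi(z)\neq0$ for every $z\in\bar D^2$. For a curve $\gamma$ on $S^1$, $\dot\gamma$ denotes the derivative with respect to the angle. ''The curvature of $\Phi(S^1)$ is $\kappa$'' means: for a.e. $z\in S^1$, $\kappa(z)$ is the signed curvature at the point $z$ of the closed curve $\theta\mapsto\Phi(e^{i\theta})$, i.e. $\langle i\tau,\frac{d\tau}{ds}\rangle$ where $s$ is the arc length of this curve, $\tau$ its unit tangent vector, and $\langle\cdot,\cdot\rangle$ the real scalar product in $\mathbb{C}\cong\mathbb{R}^2$. For $\varphi\in C^\infty(S^1)$ with Fourier coefficients $\hat\varphi(n)=\frac1{2\pi}\int_{S^1}\varphi e^{-in\theta}d\theta$, $(-\Delta)^{\frac12}\varphi(\theta)=\sum_{n\in\mathbb{Z}}|n|\hat\varphi(n)e^{in\theta}$; for $u\in L^1(S^1)$, $(-\Delta)^{\frac12}u\in\mathcal{D}'(S^1)$ is defined by $\langle(-\Delta)^{\frac12}u,\varphi\rangle=\int_{S^1}u(-\Delta)^{\frac12}\varphi\,d\theta$, and the equation is in the sense of distributions. *)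

(* Defs.v *)
From HB Require Import structures.
From mathcomp Require Import all_boot all_order all_algebra.
From mathcomp Require Import complex.
From mathcomp Require Import all_classical all_reals all_analysis.

Set Implicit Arguments.
Unset Strict Implicit.
Unset Printing Implicit Defensive.

Import Order.TTheory GRing.Theory Num.Theory.
Import numFieldNormedType.Exports.

Local Open Scope classical_set_scope.
Local Open Scope ring_scope.
Local Open Scope complex_scope.

(* The regular module [R[i]^o] carries the usual topology and the complex derivative; the norm
   [`|z|] of [z] is an element of [R[i]], with zero imaginary part.

   A function on the unit circle is a function on [R[i]] of which only the
   values on the circle are used; it is integrated, differentiated and tested
   through the angle [t], i.e. by composition with [expi]. *)
Notation Cplx R := (R[i])^o.

Section Circle.
Context {R : realType}.
Notation C := (Cplx R).
Notation leb := (@lebesgue_measure R).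

Definition open_disk : set C := [set z | `|z| < 1].
Definition closed_disk : set C := [set z | `|z| <= 1].
Definition circle : set C := [set z | `|z| = 1].

Definition expi (t : R) : C := cos t +i* sin t.

Definition angles : set R := `[0, 2 * pi]%classic.

Definition circle_ae (P : R -> Prop) : Prop :=
  {ae leb, forall t, angles t -> P t}.

Definition circle_integral (f : R -> R) : R := \int[leb]_(t in angles) f t.

Definition circle_cintegral (f : R -> C) : C :=
  circle_integral (fun t => complex.Re (f t)) +i*
  circle_integral (fun t => complex.Im (f t)).

Definition circle_measurable (u : C -> R) : Prop :=
  measurable_fun angles (u \o expi).

Definition circle_L1 (u : C -> R) : Prop :=
  leb.-integrable angles (EFin \o (u \o expi)).

Definition circle_Linfty (u : C -> R) : Prop :=
  circle_measurable u /\ exists M : R, circle_ae (fun t => `|u (expi t)| <= M).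

Definition circle_cLinfty (u : C -> C) : Prop :=
  circle_Linfty (fun z => complex.Re (u z)) /\
  circle_Linfty (fun z => complex.Im (u z)).

(* [R[i]] is not a normed module over [R] in the library, so curves are
   differentiated componentwise. *)
Definition curve_derivable (c : R -> C) (t : R) : Prop :=
  derivable (fun s => complex.Re (c s)) t 1 /\
  derivable (fun s => complex.Im (c s)) t 1.

Definition curve_derive (c : R -> C) (t : R) : C :=
  derive1 (fun s => complex.Re (c s)) t +i*
  derive1 (fun s => complex.Im (c s)) t.

Definition curve_C1 (c : R -> C) : Prop :=
  (forall t, curve_derivable c t) /\ continuous (curve_derive c).

Definition circle_smooth (phi : C -> C) : Prop :=
  forall (n : nat) (t : R),
    curve_derivable (iter n curve_derive (phi \o expi)) t.

Definition fourier_coef (phi : C -> C) (n : int) : C :=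
  ((2 * pi)^-1)%:C *
  circle_cintegral (fun t => phi (expi t) * expi (- (n%:~R * t))).

(* Symmetric partial sums; for smooth [phi] the series converges absolutely. *)
Definition half_laplacian (phi : C -> C) (t : R) : C :=
  limn (fun N : nat => \sum_(k < N.*2.+1)
    let n : int := k%:Z - N%:Z in
    `|n|%:~R * fourier_coef phi n * expi (n%:~R * t) : C).

(* [(-Delta)^{1/2} u = f] in the sense of distributions, [u], [f] being L^1. *)
Definition half_laplacian_eq (u f : C -> R) : Prop :=
  forall phi : C -> C, circle_smooth phi ->
    circle_cintegral (fun t => (u (expi t))%:C * half_laplacian phi t) =
    circle_cintegral (fun t => (f (expi t))%:C * phi (expi t)).

Definition circle_weak_derivative (u v : C -> C) : Prop :=
  forall phi : C -> C, circle_smooth phi ->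
    circle_cintegral (fun t => u (expi t) * curve_derive (phi \o expi) t) =
    - circle_cintegral (fun t => v (expi t) * phi (expi t)).

Definition circle_W2infty (g : C -> C) : Prop :=
  exists g1 g2 : C -> C,
    [/\ circle_cLinfty g, circle_cLinfty g1 & circle_cLinfty g2] /\
    circle_weak_derivative g g1 /\ circle_weak_derivative g1 g2.

Definition constant_speed (g : C -> C) (v : R) : Prop :=
  forall t, curve_derivable (g \o expi) t /\
            `|curve_derive (g \o expi) t| = v%:C.

Definition circle_C1_map (s : C -> C) : Prop :=
  (forall z, circle z -> circle (s z)) /\ curve_C1 (s \o expi).

Definition circle_diffeo (s : C -> C) : Prop :=
  exists s' : C -> C,
    [/\ circle_C1_map s, circle_C1_map s',
        forall z, circle z -> s' (s z) = z &
        forall z, circle z -> s (s' z) = z].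

(* [dPhi] is [Phi']: the complex derivative inside the disk, and on the circle
   its continuous extension, which exists as [Phi] is C^1 up to the boundary.
   On the closed disk it is determined by [Phi]. *)
Definition holomorphic_immersion (Phi dPhi : C -> C) : Prop :=
  [/\ {within closed_disk, continuous Phi},
      {within closed_disk, continuous dPhi},
      forall z, open_disk z -> is_derive z 1 Phi (dPhi z) &
      forall z, closed_disk z -> dPhi z != 0].

(* [|Phi'| = e^lambda] on the circle; [lambda] is an L^1 class, hence a.e. *)
Definition conformal_factor (dPhi : C -> C) (lambda : C -> R) : Prop :=
  circle_ae (fun t => `|dPhi (expi t)| = (expR (lambda (expi t)))%:C).

Definition dotC (z w : C) : R :=
  complex.Re z * complex.Re w + complex.Im z * complex.Im w.

Definition unit_tangent (c : R -> C) (t : R) : C :=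
  curve_derive c t / `|curve_derive c t|.

(* Differentiation in the arc length [s] of [c] is [d/ds = |c'|^-1 d/dt]. *)
Definition arclength_derive (c f : R -> C) (t : R) : C :=
  curve_derive f t / `|curve_derive c t|.

Definition signed_curvature (c : R -> C) (t : R) : R :=
  dotC ('i * unit_tangent c t) (arclength_derive c (unit_tangent c) t).

Definition boundary_curvature (Phi : C -> C) (kappa : C -> R) : Prop :=
  let c := Phi \o expi in
  circle_ae (fun t =>
    [/\ curve_derivable c t, curve_derivable (unit_tangent c) t &
        kappa (expi t) = signed_curvature c t]).

Definition dir_derive (v : C) (u : C -> R) (z : C) : R :=
  derive1 (fun t : R => u (z + t%:C * v)) 0.

Definition dir_derivable (v : C) (u : C -> R) (z : C) : Prop :=
  derivable (fun t : R => u (z + t%:C * v)) 0 1.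

Definition disk_C2 (u : C -> R) : Prop :=
  forall z, open_disk z -> forall v w : C,
    [/\ dir_derivable v u z, dir_derivable w (dir_derive v u) z &
        {for z, continuous (dir_derive w (dir_derive v u))}].

Definition laplacian (u : C -> R) (z : C) : R :=
  dir_derive 1 (dir_derive 1 u) z + dir_derive 'i (dir_derive 'i u) z.

(* [lt] is harmonic in the open disk with boundary values [lambda], attained in
   L^1 by the dilates of [lt]: this determines [lt] in the open disk for every
   L^1 function [lambda]. On the circle, [lt] is a representative of
   [lambda]. *)
Definition harmonic_extension (lambda lt : C -> R) : Prop :=
  [/\ disk_C2 lt,
      forall z, open_disk z -> laplacian lt z = 0,
      (fun r : R => (\int[leb]_(t in angles)
         `|lt (r%:C * expi t) - lambda (expi t)|%:E)%E) @ 1^'- --> 0%:E &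
      circle_ae (fun t => lt (expi t) = lambda (expi t))].

End Circle.

(* Main.v *)
Require Import Defs.
From HB Require Import structures.
From mathcomp Require Import all_boot all_order all_algebra.
From mathcomp Require Import complex.
From mathcomp Require Import all_classical all_reals all_analysis.
From mathcomp Require Import measurable_realfun.
From mathcomp Require Import ring lra zify.

Import Order.TTheory GRing.Theory Num.Theory.
Import numFieldNormedType.Exports.

(** Everything rests on a logarithm of the derivative. If [Phi] is a holomorphic immersion,
    then [Phi' = exp F] with [F] continuous on the closed disk and holomorphic inside
    ([immersion_log]), and [Re F = lambda] on the circle. The boundary curve then has speed
    [exp (Re F)] and tangent [i exp (i (t + Im F))], so the definition of the curvature reads

      [kappa e^lambda = 1 + d/dt Im F (e^(i t))],

    and since [Im F] is the conjugate function of [Re F], its angular derivative is the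
    half-Laplacian of [lambda]: on the Fourier side this says that [F] has no negative
    coefficients ([conj_half_laplacian]).

    From the immersion to the equation, what has to be shown is that [Im F] is Lipschitz, so
    that the identity above holds both almost everywhere and for Fourier coefficients. The
    constant speed parametrization is of class W^(2,oo), hence its velocity is Lipschitz
    ([weak_llip]); the tangent of [Phi] is this velocity, normalized and composed with a
    change of parameter ([tangent_llip]), and the angle of a Lipschitz unit vector is
    Lipschitz. This gives [immersion_half_laplacian].

    From the equation to the immersion, let [F] be the analytic completion of the Poisson
    integral of [lambda] and [f = kappa e^lambda - 1]. The difficulty is the continuity of [F]
    up to the circle, knowing only that [lambda] and [e^lambda] are integrable. The equation
    says [|n| lambda^(n) = f^(n)]. It bounds the oscillation of [Im F(z) - Im F(q z)] by the
    L^1 distance of [f] to its Poisson integral at radius [q], hence by [1 / 2] for [q] close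
    to 1, and then the mean value property of [exp (2 (F(z) - F(q z)))] bounds the integral of
    [e^(2 lambda)] ([pk_exp_bound], [trunc_exp_bound]). Thus [f] is square integrable, and
    [lambda^(n) = f^(n) / |n|] is absolutely summable by Cauchy-Schwarz ([acoef_summable]).
    Now [F] is continuous on the closed disk, [Re F = lambda] and [Im F] is a primitive of [f]
    on the circle ([boundary_log]). A primitive [Phi] of [exp F] is the immersion
    ([exp_immersion]), and its reparametrization by arc length is of class W^(2,oo)
    ([exp_arclength]).

    If two immersions have the same [lambda], the difference of their logarithms is imaginary
    on the circle and has no negative Fourier coefficients, so it is a constant
    ([immersion_unique]); and [Re F] is the harmonic extension of [lambda]
    ([immersion_harmonic]).

    The complex analysis needed on the way is developed from Fourier coefficients on circles:
    a function holomorphic in the disk is the sum of a power series because its coefficients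
    on the circle of radius [r] solve a differential equation in [r] ([holo_fc], [holo_ps]),
    and boundary values are reached through the Poisson kernel ([pk_approx], [pk_L1]). *)

Local Open Scope classical_set_scope.
Local Open Scope ring_scope.
Local Open Scope complex_scope.
Set Implicit Arguments.
Unset Strict Implicit.
Unset Printing Implicit Defensive.

Notation nc := (@ComplexField.Normc.normc _).
Notation Re := (@complex.Re _).
Notation Im := (@complex.Im _).

(** * Complex numbers and points of the circle *)

Section Cplx.
Context {R : realType}.
Notation C := (Cplx R).
Implicit Types (z w : C) (t : R).

Lemma ncE z : `|z| = (nc z)%:C :> R[i]. Proof. by []. Qed.
Lemma ReD z w : Re (z + w) = Re z + Re w. Proof. by case: z w => [a b] [c d]. Qed.
Lemma ImD z w : Im (z + w) = Im z + Im w. Proof. by case: z w => [a b] [c d]. Qed.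
Lemma ReN z : Re (- z) = - Re z. Proof. by case: z. Qed.
Lemma ImN z : Im (- z) = - Im z. Proof. by case: z. Qed.
Lemma ReM z w : Re (z * w) = Re z * Re w - Im z * Im w. Proof. by case: z w => [a b] [c d]. Qed.
Lemma ImM z w : Im (z * w) = Re z * Im w + Im z * Re w.
Proof. by case: z w => [a b] [c d] /=; rewrite addrC [b * c]mulrC. Qed.
Lemma ceqP z w : Re z = Re w -> Im z = Im w -> z = w.
Proof. by case: z w => [a b] [c d] /= -> ->. Qed.
Definition cE := (ReD, ImD, ReN, ImN, ReM, ImM).

Lemma nc_ge0 z : 0 <= nc z. Proof. by case: z => a b /=; exact: sqrtr_ge0. Qed.
Lemma ncM z w : nc (z * w) = nc z * nc w. Proof. exact: ComplexField.Normc.normcM. Qed.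
Lemma ncD z w : nc (z + w) <= nc z + nc w. Proof. exact: le_normcD. Qed.
Lemma ncN z : nc (- z) = nc z. Proof. exact: normcN. Qed.
Lemma ncB z w : nc (z - w) = nc (w - z). Proof. by rewrite -ncN opprB. Qed.
Lemma nc0 : nc (0 : C) = 0. Proof. exact: ComplexField.Normc.normc0. Qed.
Lemma nc1 : nc (1 : C) = 1. Proof. exact: ComplexField.Normc.normc1. Qed.
Lemma nc_eq0 z : nc z = 0 -> z = 0. Proof. exact: ComplexField.Normc.eq0_normc. Qed.
Lemma nc_gt0 z : (0 < nc z) = (z != 0).
Proof.
rewrite lt_neqAle nc_ge0 andbT; congr negb.
by apply/eqP/eqP => [/esym/nc_eq0|->]; rewrite ?nc0.
Qed.
Lemma ncV z : nc z^-1 = (nc z)^-1. Proof. exact: ComplexField.Normc.normcV. Qed.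
Lemma ncX z n : nc (z ^+ n) = nc z ^+ n.
Proof. by elim: n => [|n IH]; rewrite ?expr0 ?nc1// !exprS ncM IH. Qed.
Lemma ncR (x : R) : nc (x%:C : C) = `|x|.
Proof. by rewrite /= expr0n addr0 sqrtr_sqr. Qed.
Lemma ncsq z : nc z ^+ 2 = Re z ^+ 2 + Im z ^+ 2.
Proof. by case: z => a b /=; rewrite sqr_sqrtr// addr_ge0 ?sqr_ge0. Qed.
Lemma Re_le_nc z : `|Re z| <= nc z.
Proof.
rewrite -(@ler_pXn2r _ 2)// ?nnegrE ?nc_ge0// ncsq -normrX ger0_norm ?sqr_ge0//.
by rewrite lerDl sqr_ge0.
Qed.
Lemma Im_le_nc z : `|Im z| <= nc z.
Proof.
rewrite -(@ler_pXn2r _ 2)// ?nnegrE ?nc_ge0// ncsq -normrX ger0_norm ?sqr_ge0//.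
by rewrite lerDr sqr_ge0.
Qed.
Lemma nc_le_ReIm z : nc z <= `|Re z| + `|Im z|.
Proof.
rewrite -(@ler_pXn2r _ 2)// ?nnegrE ?nc_ge0// ?addr_ge0// ncsq sqrrD.
rewrite -!normrX !(ger0_norm (sqr_ge0 _)).
by rewrite -addrA lerD2l lerDr mulrn_wge0// mulr_ge0.
Qed.
Lemma ncC (z : C) : nc (z^*%C : C) = nc z.
Proof. by case: z => a b /=; rewrite sqrrN. Qed.

Lemma ncBD z w u : nc (z - w) <= nc (z - u) + nc (u - w).
Proof. by apply: le_trans (ncD _ _); rewrite addrA subrK. Qed.
Lemma nc_distD z w : nc z - nc w <= nc (z - w).
Proof. by rewrite lerBlDr (le_trans _ (ncD _ _))// subrK. Qed.

Lemma Re_sum (I : Type) (s : seq I) (P : pred I) (G : I -> C) :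
  Re (\sum_(i <- s | P i) G i) = \sum_(i <- s | P i) Re (G i).
Proof.
by elim/big_rec2: _ => // i y1 y2 _ <-; rewrite ReD.
Qed.
Lemma Im_sum (I : Type) (s : seq I) (P : pred I) (G : I -> C) :
  Im (\sum_(i <- s | P i) G i) = \sum_(i <- s | P i) Im (G i).
Proof.
by elim/big_rec2: _ => // i y1 y2 _ <-; rewrite ImD.
Qed.
Lemma nc_sum (I : Type) (s : seq I) (P : pred I) (G : I -> C) :
  nc (\sum_(i <- s | P i) G i) <= \sum_(i <- s | P i) nc (G i).
Proof.
elim/big_rec2: _ => [|i y1 y2 _ IH]; first by rewrite nc0.
by rewrite (le_trans (ncD _ _))// lerD2l.
Qed.

Lemma expiD (a b : R) : expi (a + b) = expi a * expi b :> C.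
Proof. by apply: ceqP; rewrite !cE /= ?cosD// sinD addrC. Qed.
Lemma expi0 : expi (0 : R) = 1 :> C.
Proof. by rewrite /expi cos0 sin0. Qed.
Lemma nc_expi (t : R) : nc (expi t : C) = 1.
Proof. by rewrite /= cos2Dsin2 sqrtr1. Qed.
Lemma expi_neq0 (t : R) : expi t != 0 :> C.
Proof. by rewrite -nc_gt0 nc_expi. Qed.
Lemma expiN (t : R) : expi (- t) = (expi t)^-1 :> C.
Proof.
apply: (mulfI (expi_neq0 t)).
by rewrite -expiD subrr expi0 divff ?expi_neq0.
Qed.
Lemma expiN_conj (t : R) : expi (- t) = ((expi t)^*)%C :> C.
Proof. by rewrite /expi cosN sinN. Qed.
Lemma expiX n (t : R) : expi t ^+ n = expi (n%:R * t) :> C.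
Proof.
elim: n => [|n IH]; first by rewrite mul0r expi0.
by rewrite exprS IH -expiD -[n.+1]add1n natrD mulrDl mul1r.
Qed.
Lemma expi_2pi : expi (2 * pi : R) = 1 :> C.
Proof. by rewrite /expi mulrC mulr_natr cos2pi sin2pi. Qed.
Lemma expi_period (t : R) : expi (t + 2 * pi) = expi t :> C.
Proof. by rewrite expiD expi_2pi mulr1. Qed.
Lemma expi_2pin (n : nat) : expi (n%:R * (2 * pi) : R) = 1 :> C.
Proof. by rewrite -expiX expi_2pi expr1n. Qed.
Lemma expi_2piz (n : int) : expi (n%:~R * (2 * pi) : R) = 1 :> C.
Proof.
case: n => n; first exact: expi_2pin.
by rewrite NegzE mulrNz mulNr expiN expi_2pin invr1.
Qed.

End Cplx.

(** * Limits and derivatives of complex-valued functions *)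

Section Diff.
Context {R : realType}.
Notation C := (Cplx R).
Implicit Types (z w : C) (t : R).

Lemma Cgt0P (e : R[i]) : 0 < e -> exists2 r : R, 0 < r & e = r%:C.
Proof.
case: e => a b; rewrite ltcE /= => /andP[/eqP -> a0]; by exists a.
Qed.

(** The norm of [R[i]^o] has values in [R[i]]; with real radii, estimates can be handed over to
    real arithmetic. *)
Lemma cvgCP (T : Type) (F : set_system T) (FF : Filter F) (f : T -> C) (l : C) :
  f @ F --> l <-> (forall e : R, 0 < e -> \forall x \near F, nc (l - f x) < e).
Proof.
split.
- move=> /cvgrPdist_lt H e e0.
  have e0' : 0 < (e%:C : R[i]) by rewrite ltcR.
  near=> x.
  have : `|l - f x| < e%:C by near: x; exact: H.
  by rewrite ncE ltcR.
- move=> H; apply/cvgrPdist_lt => e /Cgt0P[r r0 ->].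
  near=> x; rewrite ncE ltcR; near: x; exact: H.
Unshelve. all: by end_near. Qed.

Lemma cvgC_ReIm (T : Type) (F : set_system T) (FF : Filter F) (f : T -> C) (l : C) :
  f @ F --> l <-> ((Re \o f) @ F --> Re l) /\ ((Im \o f) @ F --> Im l).
Proof.
split.
- move=> /cvgCP H; split; apply/cvgrPdist_lt => e e0; near=> x.
  + rewrite /= -ReN -ReD; apply: le_lt_trans (Re_le_nc _) _; near: x; exact: H.
  + rewrite /= -ImN -ImD; apply: le_lt_trans (Im_le_nc _) _; near: x; exact: H.
- move=> [/cvgrPdist_lt HR /cvgrPdist_lt HI]; apply/cvgCP => e e0.
  have e2 : 0 < e / 2 by rewrite divr_gt0.
  near=> x; apply: le_lt_trans (nc_le_ReIm _) _; rewrite (splitr e) !cE.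
  by apply: ltrD; near: x; [exact: HR|exact: HI].
Unshelve. all: by end_near. Qed.

Lemma cvg_nc (T : Type) (F : set_system T) (FF : Filter F) (f : T -> C) (l : C) :
  f @ F --> l -> (nc \o f) @ F --> nc l.
Proof.
move=> /cvgCP H; apply/cvgrPdist_lt => e e0; near=> x.
rewrite /= ltr_norml; have h : nc (l - f x) < e by near: x; exact: H.
by have := nc_distD l (f x); have := nc_distD (f x) l; rewrite (ncB (f x)); lra.
Unshelve. all: by end_near. Qed.

Lemma contRe : continuous (Re : C -> R).
Proof. by move=> z; have [h _] := (@cvgC_ReIm _ (nbhs z) _ id z).1 cvg_id. Qed.
Lemma contIm : continuous (Im : C -> R).
Proof. by move=> z; have [_ h] := (@cvgC_ReIm _ (nbhs z) _ id z).1 cvg_id. Qed.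
Lemma contnc : continuous (nc : C -> R).
Proof. by move=> z; exact: (@cvg_nc _ (nbhs z) _ id z cvg_id). Qed.
Lemma continuousC (T : topologicalType) (f : T -> C) :
  continuous (Re \o f) -> continuous (Im \o f) -> continuous f.
Proof. by move=> hR hI x; apply/cvgC_ReIm; split; [exact: hR|exact: hI]. Qed.
Lemma continuousC_Re (T : topologicalType) (f : T -> C) :
  continuous f -> continuous (Re \o f).
Proof. by move=> h x; have /cvgC_ReIm[] := h x. Qed.
Lemma continuousC_Im (T : topologicalType) (f : T -> C) :
  continuous f -> continuous (Im \o f).
Proof. by move=> h x; have /cvgC_ReIm[] := h x. Qed.
Lemma contRC : continuous (fun x : R => x%:C : C).
Proof. by apply: continuousC => x; [exact: cvg_id|exact: cvg_cst]. Qed.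
Lemma cont_expi : continuous (expi : R -> C).
Proof. by apply: continuousC; [exact: continuous_cos|exact: continuous_sin]. Qed.

Lemma nbhsCP (z : C) (P : set C) :
  nbhs z P <-> exists2 d : R, 0 < d & forall w, nc (w - z) < d -> P w.
Proof.
split.
- move=> /nbhs_ballP[e /= /Cgt0P[r r0 ->] H]; exists r => // w wz; apply: H.
  by rewrite /ball /= ncE ltcR ncB.
- move=> [d d0 H]; apply/nbhs_ballP; exists (d%:C) => /=; first by rewrite ltcR.
  by move=> w; rewrite /ball /= ncE ltcR ncB; exact: H.
Qed.

Lemma is_deriveP (K : numFieldType) (f : K^o -> K^o) (a d : K) :
  is_derive a 1 f d <->
  forall e : K, 0 < e -> exists2 d0 : K, 0 < d0 & forall h, `|h| < d0 ->
     `|f (a + h) - f a - h * d| <= e * `|h|.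
Proof.
split.
- move=> [df fd] e e0; have := df; rewrite /derivable.
  move=> /cvg_ex[l] cl; have ld : l = d.
    by rewrite -fd /derive; apply/esym/cvg_lim => //.
  move: cl; rewrite ld => /cvgrPdist_le /(_ _ e0).
  rewrite near_withinE => /nbhs_ballP[r /= r0 H]; exists r => // h hr.
  have [->|h0] := eqVneq h 0; first by rewrite addr0 mul0r !subrr normr0 mulr0.
  have /H : ball (0:K^o) r h by rewrite /ball /= sub0r normrN.
  move=> /(_ h0); rewrite /= [X in `|d - X|]/(_ *: _) /=.
  rewrite mulr1 => hh.
  have -> : f (a + h) - f a - h * d = - (h * (d - h^-1 * (f (h + a) - f a))).
    by rewrite mulrBr mulrA divff// mul1r opprB addrC [h + a]addrC addrC.
  by rewrite normrN normrM mulrC ler_wpM2r.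
- move=> H.
  have cl : (fun h => h^-1 *: ((f \o shift a) (h *: (1:K^o)) - f a)) @ 0^' --> (d : K^o).
    apply/cvgrPdist_le => e e0; have [r r0 {}H] := H _ e0.
    rewrite near_withinE; apply/nbhs_ballP; exists r => //= h hr h0.
    have {}hr : `|h| < r by move: hr; rewrite /ball /= sub0r normrN.
    have := H _ hr; rewrite [(h *: _ : K^o)]mulr1 /= [_ *: _]/(_ * _) => hh.
    have -> : d - h^-1 * (f (h + a) - f a) = - (h^-1 * (f (a + h) - f a - h * d)).
      by rewrite [in RHS]mulrBr mulrA mulVf// mul1r opprB [h + a]addrC.
    rewrite normrN normrM normfV ler_pdivrMl ?normr_gt0//.
    by rewrite [leRHS]mulrC.
  split; first by apply/cvg_ex; exists d.
  by apply/cvg_lim.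
Qed.

(** Derivatives are handled by first-order expansions rather than by difference quotients, so
    that the complex and the real case can be combined. *)
Lemma is_deriveC (f : C -> C) (a d : C) :
  is_derive a 1 f d <->
  forall e : R, 0 < e -> exists2 d0 : R, 0 < d0 & forall h : C, nc h < d0 ->
     nc (f (a + h) - f a - h * d) <= e * nc h.
Proof.
split=> [/(@is_deriveP R[i]) H e e0|H].
- have e0' : 0 < (e%:C : R[i]) by rewrite ltcR.
  have [r0 /Cgt0P[r rp ->] {}H] := H _ e0'; exists r => // h hr.
  have := H h; rewrite !ncE ltcR => /(_ hr).
  by rewrite -rmorphM /= lecR.
- apply/(@is_deriveP R[i]) => e0 /Cgt0P[e ep ->].
  have [r r0 {}H] := H _ ep; exists r%:C; first by rewrite ltcR.
  by move=> h; rewrite !ncE ltcR -rmorphM /= lecR; exact: H.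
Qed.

(** [curve_derive] as a relation, which carries derivability along and makes the usual rules
    composable. *)
Definition cder (c : R -> C) t (v : C) : Prop :=
  is_derive t 1 (fun s => Re (c s)) (Re v) /\ is_derive t 1 (fun s => Im (c s)) (Im v).

Lemma cderP (c : R -> C) t v : cder c t v <->
  forall e : R, 0 < e -> exists2 d : R, 0 < d & forall h, `|h| < d ->
     nc (c (t + h) - c t - h%:C * v) <= e * `|h|.
Proof.
split.
- move=> [/(@is_deriveP R) HR /(@is_deriveP R) HI] e e0.
  have e2 : 0 < e / 2 by rewrite divr_gt0.
  have [d1 d10 H1] := HR _ e2; have [d2 d20 H2] := HI _ e2.
  exists (Num.min d1 d2); first by rewrite lt_min d10.
  move=> h; rewrite lt_min => /andP[/H1 h1 /H2 h2].
  apply: le_trans (nc_le_ReIm _) _; rewrite !cE /= !mul0r subr0 addr0.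
  by rewrite (splitr e) mulrDl lerD.
- move=> H; split; apply/(@is_deriveP R) => e e0; have [d d0 {}H] := H _ e0;
    exists d => // h /H; apply: le_trans.
  + by apply: le_trans (Re_le_nc _); rewrite !cE /= !mul0r subr0.
  + by apply: le_trans (Im_le_nc _); rewrite !cE /= !mul0r addr0.
Qed.

Lemma cder_unique c t v w : cder c t v -> cder c t w -> v = w.
Proof. by move=> [[_ h1] [_ h2]] [[_ h3] [_ h4]]; apply: ceqP; congruence. Qed.

Lemma cder_derivable c t v : cder c t v -> curve_derivable c t.
Proof. by move=> [h1 h2]; split; [exact: (@ex_derive _ _ _ _ _ _ _ h1)|exact: (@ex_derive _ _ _ _ _ _ _ h2)]. Qed.
Lemma cder_derive c t v : cder c t v -> curve_derive c t = v.
Proof.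
by move=> [[_ h1] [_ h2]]; rewrite /curve_derive !derive1E h1 h2; case: v {h1 h2}.
Qed.
Lemma derivable_cder c t : curve_derivable c t -> cder c t (curve_derive c t).
Proof. by move=> [h1 h2]; split; [apply: (DeriveDef h1)|apply: (DeriveDef h2)]; rewrite -derive1E. Qed.

Lemma cder_eq c t v w : cder c t v -> v = w -> cder c t w.
Proof. by move=> ? <-. Qed.

Lemma is_derive_near (f g : R -> R) t d :
  (\forall s \near t, f s = g s) -> is_derive t 1 f d -> is_derive t 1 g d.
Proof.
move=> fg; have fgt := nbhs_singleton fg.
move=> /(@is_deriveP R) H; apply/(@is_deriveP R) => e e0.
have [r r0 {}H] := H _ e0; move: fg => /nbhs_ballP[r' /= r'0 fg].
exists (Num.min r r'); first by rewrite lt_min r0.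
move=> h; rewrite lt_min => /andP[hr hr']; rewrite -fgt -fg; first exact: H.
by rewrite /ball /= opprD addNKr normrN.
Qed.

Lemma cder_near c c' t v : (\forall s \near t, c s = c' s) -> cder c t v -> cder c' t v.
Proof.
move=> cc [h1 h2]; split; [move: h1|move: h2]; apply: is_derive_near;
 by apply: filterS cc => s ->.
Qed.

Lemma cder_ext c c' t v : (forall s, c s = c' s) -> cder c t v -> cder c' t v.
Proof. by move=> cc; apply: cder_near; near do exact: cc.
Unshelve. all: by end_near. Qed.

Lemma cder_cst (k : C) t : cder (fun=> k) t 0.
Proof. by split; exact: is_derive_cst. Qed.

Lemma cderD c c' t v v' : cder c t v -> cder c' t v' ->
  cder (fun s => c s + c' s) t (v + v').
Proof.
move=> [h1 h2] [h3 h4]; split; rewrite ?cE.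
- by under eq_fun do rewrite ReD; exact: is_deriveD.
- by under eq_fun do rewrite ImD; exact: is_deriveD.
Qed.

Lemma cderN c t v : cder c t v -> cder (fun s => - c s) t (- v).
Proof.
move=> [h1 h2]; split; rewrite ?cE.
- by under eq_fun do rewrite ReN; exact: is_deriveN.
- by under eq_fun do rewrite ImN; exact: is_deriveN.
Qed.

Lemma cderB c c' t v v' : cder c t v -> cder c' t v' ->
  cder (fun s => c s - c' s) t (v - v').
Proof. by move=> h1 h2; apply: cderD => //; exact: cderN. Qed.

Lemma cderM c c' t v v' : cder c t v -> cder c' t v' ->
  cder (fun s => c s * c' s) t (v * c' t + c t * v').
Proof.
move=> [h1 h2] [h3 h4]; split; rewrite ?cE.
- under eq_fun do rewrite ReM.
  apply: (@is_derive_eq _ _ _ _ _ _ _ _ (is_deriveB (is_deriveM h1 h3) (is_deriveM h2 h4))).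
  rewrite /GRing.scale /=; ring.
- under eq_fun do rewrite ImM.
  apply: (@is_derive_eq _ _ _ _ _ _ _ _ (is_deriveD (is_deriveM h1 h4) (is_deriveM h2 h3))).
  rewrite /GRing.scale /=; ring.
Qed.

Lemma cderZ (k : C) c t v : cder c t v -> cder (fun s => k * c s) t (k * v).
Proof. by move=> h; apply: cder_eq (cderM (cder_cst k t) h) _; rewrite mul0r add0r. Qed.

Lemma cder_real (u : R -> R) t d : is_derive t 1 u d -> cder (fun s => (u s)%:C) t d%:C.
Proof. by move=> h; split => //=; exact: is_derive_cst. Qed.

Lemma cder_comp c (u : R -> R) t d v : is_derive t 1 u d -> cder c (u t) v ->
  cder (fun s => c (u s)) t (d%:C * v).
Proof.
move=> h [h1 h2]; split; rewrite !cE /= mul0r ?subr0 ?addr0 mulrC.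
- exact: (@is_derive1_comp _ (fun s => Re (c s)) u _ _ _ h1).
- exact: (@is_derive1_comp _ (fun s => Im (c s)) u _ _ _ h2).
Qed.

Lemma cder_expi t : cder expi t ('i * expi t).
Proof.
split; rewrite !cE /= ?mul0r ?mul1r ?sub0r ?add0r.
- exact: is_derive_cos.
- exact: is_derive_sin.
Qed.

Definition cexp z : C := (expR (Re z))%:C * expi (Im z).

Lemma cexpD z w : cexp (z + w) = cexp z * cexp w.
Proof. by rewrite /cexp !cE expRD expiD rmorphM /= mulrACA. Qed.
Lemma cexp0 : cexp 0 = 1.
Proof. by rewrite /cexp /= expR0 expi0 mulr1. Qed.
Lemma nc_cexp z : nc (cexp z) = expR (Re z).
Proof. by rewrite ncM ncR nc_expi mulr1 ger0_norm// expR_ge0. Qed.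
Lemma cexp_neq0 z : cexp z != 0.
Proof. by rewrite -nc_gt0 nc_cexp expR_gt0. Qed.
Lemma cexpN z : cexp (- z) = (cexp z)^-1.
Proof. by apply: (mulfI (cexp_neq0 z)); rewrite -cexpD subrr cexp0 divff ?cexp_neq0. Qed.

Lemma cder_cexp c t v : cder c t v -> cder (fun s => cexp (c s)) t (cexp (c t) * v).
Proof.
move=> [h1 h2]; rewrite /cexp.
have e1 : is_derive t 1 (fun s => expR (Re (c s))) (Re v * expR (Re (c t))).
  rewrite mulrC; exact: (@is_derive1_comp _ _ _ _ _ _ (is_derive_expR _) h1).
have e2 := cder_comp h2 (cder_expi _).
apply: cder_eq (cderM (cder_real e1) e2) _.
apply: ceqP; rewrite !cE /=; ring.
Qed.

Lemma is_deriveVr (u : R -> R) t d : u t != 0 -> is_derive t 1 u d ->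
  is_derive t 1 (fun s => (u s)^-1) (- (u t) ^- 2 * d).
Proof. by move=> u0 h; exact: (@is_deriveV _ u t d 1 u0 h). Qed.

(** The inverse is the conjugate divided by the squared norm, so the product rule and the real
    inverse suffice. *)
Lemma cderV c t v : c t != 0 -> cder c t v -> cder (fun s => (c s)^-1) t (- v / c t ^+ 2).
Proof.
move=> c0 [h1 h2].
pose n s := Re (c s) * Re (c s) + Im (c s) * Im (c s).
have hn : is_derive t 1 n (2 * (Re (c t) * Re v + Im (c t) * Im v)).
  apply: (@is_derive_eq _ _ _ _ _ _ _ _ (is_deriveD (is_deriveM h1 h1) (is_deriveM h2 h2))).
  rewrite /GRing.scale /=; ring.
have n0 : n t != 0.
  by rewrite /n -!expr2 -ncsq expf_neq0// gt_eqF// nc_gt0.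
have hv := is_deriveVr n0 hn.
have hc : cder (fun s => (Re (c s) -i* Im (c s)) * ((n s)^-1)%:C) t
   ((Re v -i* Im v) * ((n t)^-1)%:C +
   (Re (c t) -i* Im (c t)) * (- (n t) ^- 2 * (2 * (Re (c t) * Re v + Im (c t) * Im v)))%:C).
  apply: cderM; last exact: cder_real.
  by split=> //=; exact: is_deriveN.
have key s : (c s)^-1 = (Re (c s) -i* Im (c s)) * ((n s)^-1)%:C.
  rewrite /n; case: (c s) => a b; apply: ceqP => /=;
    rewrite -!expr2 ?mulr0 ?subr0 ?add0r ?mulNr //.
apply: (cder_ext (fun s => esym (key s))).
apply: cder_eq hc _.
have -> : - v / c t ^+ 2 = - v * (c t)^-1 * (c t)^-1 by rewrite expr2 invfM mulrA.
rewrite key.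
move: n0; rewrite /n; case: (c t) => a b; case: v {h1 h2 hn hv} => x y /= n0.
by apply: ceqP; rewrite !cE /=; field.
Qed.

Lemma cder_continuous c t v : cder c t v -> continuous_at t c.
Proof.
move=> [[h1 _] [h2 _]]; apply/cvgC_ReIm; split.
- by have /derivable1_diffP/differentiable_continuous := h1.
- by have /derivable1_diffP/differentiable_continuous := h2.
Qed.

(** Near [t] the increment of [c] is at most [K * `|h|], hence an error of [g] that is small
    with respect to the increment of [c] is small with respect to [h]. *)
Lemma is_derive_cder (g : C -> C) (c : R -> C) t (d v : C) :
  is_derive (c t) 1 g d -> cder c t v -> cder (fun s => g (c s)) t (d * v).
Proof.
move=> /is_deriveC Hg hc; have /cderP Hc := hc.
apply/cderP => e e0.
pose K := nc v + 1 + nc d; have K0 : 0 < K by rewrite /K; have := nc_ge0 v; have := nc_ge0 d; lra.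
have [r r0 {}Hg] := Hg _ (divr_gt0 e0 (mulr_gt0 (ltr0n _ 2) K0)).
have [r1 r10 Hc1] := Hc _ ltr01.
have [r2 r20 Hc2] := Hc _ (divr_gt0 e0 (mulr_gt0 (ltr0n _ 2) K0)).
exists (Num.min r1 (Num.min r2 (r / K))).
  by rewrite !lt_min r10 r20 divr_gt0.
move=> h; rewrite !lt_min => /and3P[/Hc1 h1 /Hc2 h2 h3].
pose k := c (t + h) - c t.
have kK : nc k <= K * `|h|.
  have -> : k = (k - h%:C * v) + h%:C * v by rewrite subrK.
  rewrite (le_trans (ncD _ _))// ncM ncR /K.
  have := nc_ge0 d; have := normr_ge0 h; rewrite -/k in h1; nra.
have kr : nc k < r.
  by rewrite (le_lt_trans kK)// mulrC -ltr_pdivlMr.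
have := Hg _ kr; rewrite /k addrCA subrr addr0 -/k => hg.
have -> : g (c (t + h)) - g (c t) - h%:C * (d * v) =
   (g (c (t + h)) - g (c t) - k * d) + (k - h%:C * v) * d.
  by ring.
rewrite (le_trans (ncD _ _))// ncM.
have a1 : nc (g (c (t + h)) - g (c t) - k * d) <= e / 2 * `|h|.
  apply: (le_trans hg); have -> : e / 2 * `|h| = e / (2 * K) * (K * `|h|).
    by field; rewrite gt_eqF.
  by rewrite ler_wpM2l// divr_ge0 ?mulr_ge0 ?ltW.
have a2 : nc (k - h%:C * v) * nc d <= e / 2 * `|h|.
  rewrite -/k in h2.
  apply: (@le_trans _ _ (e / (2 * K) * `|h| * K)).
    apply: ler_pM => //; rewrite ?nc_ge0// /K; have := nc_ge0 v; lra.
  rewrite le_eqVlt; apply/orP; left; apply/eqP; field.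
  by rewrite gt_eqF.
by have := lerD a1 a2; lra.
Qed.

(** Holomorphy, as the chain rule along curves: in this form it passes to products, quotients
    and compositions, and it is what is used for integration along circles and segments. The
    continuity of [g'] provides the bounds on compact disks. *)
Definition holo (g g' : C -> C) : Prop :=
  (forall z, nc z < 1 -> continuous_at z g') /\
  (forall c t v, nc (c t) < 1 -> cder c t v -> cder (fun s => g (c s)) t (g' (c t) * v)).

Lemma is_derive_holo (g g' : C -> C) :
  (forall z, nc z < 1 -> continuous_at z g') ->
  (forall z, nc z < 1 -> is_derive z 1 g (g' z)) -> holo g g'.
Proof. by move=> h1 h2; split=> // c t v c1 hc; apply: is_derive_cder => //; exact: h2. Qed.

Lemma is_derive_contC (g : C -> C) z d : is_derive z 1 g d -> continuous_at z g.
Proof.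
move=> /is_deriveC /(_ _ ltr01)[r r0 H]; apply/(cvgCP (nbhs_filter z)) => e e0.
pose K := 1 + nc d; have K0 : 0 < K by rewrite /K; have := nc_ge0 d; lra.
apply/nbhsCP; exists (Num.min r (e / K)); first by rewrite lt_min r0 divr_gt0.
move=> w; rewrite lt_min => /andP[/H]; rewrite mul1r => h1 h2.
have {h1}h1 : nc (g w - g z - (w - z) * d) <= nc (w - z).
  have E : z + (w - z) = w by ring.
  by move: h1; rewrite E.
have -> : g z - g w = - ((g w - g z - (w - z) * d) + (w - z) * d) by ring.
rewrite ncN (le_lt_trans (ncD _ _))// ncM.
move: h2; rewrite ltr_pdivlMr// /K; nra.
Qed.

Lemma open_diskE z : open_disk z <-> nc z < 1.
Proof. by rewrite /open_disk /= ncE -ltcR. Qed.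
Lemma closed_diskE z : closed_disk z <-> nc z <= 1.
Proof. by rewrite /closed_disk /= ncE -lecR. Qed.
Lemma circleE z : circle z <-> nc z = 1.
Proof. by rewrite /circle /= ncE; split => [[]|->]. Qed.

End Diff.

(** * Integration over the circle *)

Section CircleIntegral.
Context {R : realType}.
Notation C := (Cplx R).
Notation leb := (@lebesgue_measure R).
Notation mR := (measurableTypeR R).
Notation ang := (@angles R).
Notation ci := (@circle_integral R).
Notation cint := (@circle_cintegral R).
Implicit Types (z w : C) (t : R) (u v : R -> R) (c d : R -> C).

Definition cintb u : Prop := leb.-integrable ang (EFin \o u).
Definition cintbC c : Prop := cintb (Re \o c) /\ cintb (Im \o c).

Lemma pi2_gt0 : 0 < 2 * pi :> R. Proof. by rewrite mulr_gt0// pi_gt0. Qed.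
Lemma m_ang : measurable (ang : set mR). Proof. exact: measurable_itv. Qed.
Lemma leb_ang : leb ang = (2 * pi)%:E.
Proof. by rewrite lebesgue_measure_itv /= lte_fin pi2_gt0 oppr0 addr0. Qed.
Lemma leb_ang_fin : (leb ang < +oo)%E. Proof. by rewrite leb_ang ltry. Qed.
Lemma angP t : ang t <-> 0 <= t <= 2 * pi.
Proof. by rewrite /angles /= in_itv. Qed.

Lemma cintb_within u : {within ang, continuous u} -> cintb u.
Proof. by move=> h; apply: continuous_compact_integrable => //; exact: segment_compact. Qed.
Lemma cintb_cont u : continuous u -> cintb u.
Proof. by move=> h; apply: cintb_within; exact: continuous_subspaceT. Qed.
Lemma cintbC_cont c : continuous c -> cintbC c.
Proof. by move=> h; split; apply: cintb_cont; [exact: continuousC_Re|exact: continuousC_Im]. Qed.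
Lemma cintb_meas u : cintb u -> measurable_fun (ang : set mR) u.
Proof. by move=> /measurable_int /measurable_EFinP. Qed.
Lemma cintbD u v : cintb u -> cintb v -> cintb (fun t => u t + v t).
Proof. by move=> hu hv; exact: (integrableD m_ang hu hv). Qed.
Lemma cintbN u : cintb u -> cintb (fun t => - u t).
Proof. by move=> hu; exact: (integrableN hu). Qed.
Lemma cintbB u v : cintb u -> cintb v -> cintb (fun t => u t - v t).
Proof. by move=> hu hv; exact: (integrableB m_ang hu hv). Qed.
Lemma cintbZ k u : cintb u -> cintb (fun t => k * u t).
Proof. by move=> hu; exact: (integrableZl m_ang k hu). Qed.
Lemma cintb_norm u : cintb u -> cintb (fun t => `|u t|).
Proof. by move=> hu; exact: (integrable_norm hu). Qed.
Lemma cintb_cst (k : R) : cintb (fun=> k).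
Proof. by apply: cintb_cont; exact: cst_continuous. Qed.

Lemma bounded_fnP u (D : set R) M : (forall t, D t -> `|u t| <= M) -> [bounded u x | x in D].
Proof.
move=> h; exists M; split; first exact: num_real.
by move=> M' MM' x Dx; apply: le_trans (h _ Dx) (ltW MM').
Qed.

Lemma cintb_bdd u M : measurable_fun (ang : set mR) u -> (forall t, ang t -> `|u t| <= M) -> cintb u.
Proof.
move=> mu h; apply: measurable_bounded_integrable => //; [exact: m_ang|exact: leb_ang_fin|].
exact: bounded_fnP h.
Qed.

Lemma cintb_Mbdd u v M : cintb u -> measurable_fun (ang : set mR) v ->
  (forall t, ang t -> `|v t| <= M) -> cintb (fun t => u t * v t).
Proof.
by move=> hu mv hv; exact: (integrableMl m_ang hu mv (bounded_fnP hv)).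
Qed.

Lemma cont_meas u : continuous u -> measurable_fun (ang : set mR) u.
Proof. by move=> h; apply: cintb_meas; exact: cintb_cont. Qed.

Lemma cont_bdd_ang u : continuous u -> exists M, forall t, ang t -> `|u t| <= M.
Proof.
move=> h; have cf : {within ang, continuous (fun t => `|u t|)}.
  by apply: continuous_subspaceT => t; apply: cvg_norm; exact: h.
have [m _ hm] := EVT_max (ltW pi2_gt0) cf.
by exists `|u m| => t; rewrite angP => ht; apply: hm; rewrite in_itv.
Qed.

Lemma cintb_Mcont u v : cintb u -> continuous v -> cintb (fun t => u t * v t).
Proof.
by move=> hu hv; have [M hM] := cont_bdd_ang hv; apply: (cintb_Mbdd hu (cont_meas hv) hM).
Qed.

Lemma cintb_sum (I : Type) (s : seq I) (P : pred I) (G : I -> R -> R) :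
  (forall i, P i -> cintb (G i)) -> cintb (fun t => \sum_(i <- s | P i) G i t).
Proof.
move=> h; elim: s => [|i s IH].
  by rewrite (_ : (fun=> _) = (fun=> 0)); [exact: cintb_cst|apply/funext => t; rewrite big_nil].
have [Pi|nPi] := boolP (P i).
- rewrite (_ : (fun=> _) = (fun t => G i t + \sum_(i <- s | P i) G i t)).
    by apply: cintbD => //; exact: h.
  by apply/funext => t; rewrite big_cons Pi.
- rewrite (_ : (fun=> _) = (fun t => \sum_(i <- s | P i) G i t))//.
  by apply/funext => t; rewrite big_cons (negbTE nPi).
Qed.

Lemma eq_cintb u v : (forall t, ang t -> u t = v t) -> cintb u -> cintb v.
Proof.
move=> h; apply: eq_integrable; first exact: m_ang.
by move=> t /set_mem ht; rewrite /= h.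
Qed.

Lemma ciD u v : cintb u -> cintb v -> ci (fun t => u t + v t) = ci u + ci v.
Proof. by move=> hu hv; exact: (RintegralD m_ang hu hv). Qed.
Lemma ciB u v : cintb u -> cintb v -> ci (fun t => u t - v t) = ci u - ci v.
Proof. by move=> hu hv; exact: (RintegralB m_ang hu hv). Qed.
Lemma ciZ k u : cintb u -> ci (fun t => k * u t) = k * ci u.
Proof. by move=> hu; apply: RintegralZl => //; exact: m_ang. Qed.
Lemma ciN u : cintb u -> ci (fun t => - u t) = - ci u.
Proof.
move=> hu; rewrite -mulN1r -ciZ//; congr circle_integral.
by apply/funext => t; rewrite mulN1r.
Qed.
Lemma ci_cst k : ci (fun=> k) = k * (2 * pi).
Proof.
rewrite /circle_integral Rintegral_cst; last exact: m_ang.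
by rewrite [X in fine X](_ : _ = (2 * pi)%:E)//; exact: leb_ang.
Qed.
Lemma ci0 : ci (fun=> 0) = 0. Proof. by rewrite ci_cst mul0r. Qed.
Lemma eq_ci u v : (forall t, ang t -> u t = v t) -> ci u = ci v.
Proof. by move=> h; apply: eq_Rintegral => t /set_mem; exact: h. Qed.
Lemma le_ci u v : cintb u -> cintb v -> (forall t, ang t -> u t <= v t) -> ci u <= ci v.
Proof. by move=> hu hv; exact: (le_Rintegral m_ang hu hv). Qed.
Lemma ci_ge0 u : (forall t, ang t -> 0 <= u t) -> 0 <= ci u.
Proof. by move=> h; exact: Rintegral_ge0. Qed.
Lemma norm_ci u : cintb u -> `|ci u| <= ci (fun t => `|u t|).
Proof. by move=> hu; exact: (le_normr_Rintegral m_ang hu). Qed.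
Lemma ci_bound u M : cintb u -> (forall t, ang t -> `|u t| <= M) -> `|ci u| <= M * (2 * pi).
Proof.
move=> hu h; apply: (le_trans (norm_ci hu)); rewrite -ci_cst; apply: le_ci => //.
- exact: cintb_norm.
- exact: cintb_cst.
Qed.

Lemma ae_imp (P Q : R -> Prop) : (forall t, ang t -> P t -> Q t) ->
  circle_ae P -> circle_ae Q.
Proof.
move=> PQ [N [mN N0 sub]]; exists N; split => // t /= nQ; apply: sub => /= h; apply: nQ.
by move=> ht; apply: PQ => //; exact: h.
Qed.
Lemma ae_and (P Q : R -> Prop) : circle_ae P -> circle_ae Q -> circle_ae (fun t => P t /\ Q t).
Proof.
move=> [N [mN N0 subN]] [M [mM M0 subM]]; exists (N `|` M); split.
- exact: measurableU.
- by rewrite measureU0.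
- move=> t /= h; have [hP|nP] := pselect (ang t -> P t); last by left; apply: subN.
  right; apply: subM => /= hQ; apply: h => ht; split; [exact: hP|exact: hQ].
Qed.
Lemma ae_all (P : R -> Prop) : (forall t, ang t -> P t) -> circle_ae P.
Proof. by move=> h; exists set0; split => // t /=; apply; exact: h. Qed.

Lemma ae_eq_ci u v : measurable_fun (ang : set mR) u -> measurable_fun (ang : set mR) v ->
  circle_ae (fun t => u t = v t) -> ci u = ci v.
Proof.
move=> mu mv h; congr fine; apply: ae_eq_integral.
- exact: m_ang.
- exact/measurable_EFinP.
- exact/measurable_EFinP.
- have [N [mN N0 sub]] := h; exists N; split => // t /= nQ; apply: sub => /= h'; apply: nQ.
  by move=> ht; rewrite h'.
Qed.

Lemma ci_abs0 u : cintb u -> ci (fun t => `|u t|) = 0 -> circle_ae (fun t => u t = 0).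
Proof.
move=> hu h.
have h0 : (\int[leb]_(t in ang) `|(EFin \o u) t| = 0)%E.
  rewrite -[LHS]fineK; last by apply: (integrable_fin_num m_ang); exact: (cintb_norm hu).
  by congr (_%:E); exact: h.
have /(ae_eq_integral_abs leb m_ang) := h0.
move=> /(_ (measurable_int _ hu))[N [mN N0 sub]]; exists N; split => // t /= nQ.
by apply: sub => /= h'; apply: nQ => ht; have [] := h' ht.
Qed.

Lemma cintbC_D c d : cintbC c -> cintbC d -> cintbC (fun t => c t + d t).
Proof.
move=> [h1 h2] [h3 h4]; split.
- by apply: eq_cintb (cintbD h1 h3) => t _ /=; rewrite ReD.
- by apply: eq_cintb (cintbD h2 h4) => t _ /=; rewrite ImD.
Qed.
Lemma cintbC_Z k c : cintbC c -> cintbC (fun t => k * c t).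
Proof.
move=> [h1 h2]; split.
- by apply: eq_cintb (cintbB (cintbZ (Re k) h1) (cintbZ (Im k) h2)) => t _ /=; rewrite ReM.
- by apply: eq_cintb (cintbD (cintbZ (Re k) h2) (cintbZ (Im k) h1)) => t _ /=; rewrite ImM.
Qed.
Lemma cintbC_N c : cintbC c -> cintbC (fun t => - c t).
Proof.
by move=> /(cintbC_Z (-1)) h; rewrite (_ : (fun=> _) = (fun t => -1 * c t))//;
  apply/funext => t; rewrite mulN1r.
Qed.
Lemma cintbC_B c d : cintbC c -> cintbC d -> cintbC (fun t => c t - d t).
Proof. by move=> h1 h2; apply: cintbC_D => //; exact: cintbC_N. Qed.
Lemma cintbC_M c d : cintbC c -> continuous d -> cintbC (fun t => c t * d t).
Proof.
move=> [h1 h2] hd; have hr := continuousC_Re hd; have hi := continuousC_Im hd; split.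
- by apply: eq_cintb (cintbB (cintb_Mcont h1 hr) (cintb_Mcont h2 hi)) => t _ /=; rewrite ReM.
- by apply: eq_cintb (cintbD (cintb_Mcont h1 hi) (cintb_Mcont h2 hr)) => t _ /=; rewrite ImM.
Qed.
Lemma cintbC_real u : cintb u -> cintbC (fun t => (u t)%:C).
Proof. by move=> h; split => //; exact: cintb_cst. Qed.
Lemma cintbC_cst k : cintbC (fun=> k).
Proof. by split; exact: cintb_cst. Qed.
Lemma eq_cintbC c d : (forall t, ang t -> c t = d t) -> cintbC c -> cintbC d.
Proof. by move=> h [h1 h2]; split; [apply: eq_cintb h1|apply: eq_cintb h2] => t /h /= ->. Qed.
Lemma cintbC_sum (I : Type) (s : seq I) (P : pred I) (G : I -> R -> C) :
  (forall i, P i -> cintbC (G i)) -> cintbC (fun t => \sum_(i <- s | P i) G i t).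
Proof.
move=> h; split.
- apply: (eq_cintb (u := fun t => \sum_(i <- s | P i) Re (G i t))).
    by move=> t _ /=; rewrite Re_sum.
  by apply: cintb_sum => i /h[].
- apply: (eq_cintb (u := fun t => \sum_(i <- s | P i) Im (G i t))).
    by move=> t _ /=; rewrite Im_sum.
  by apply: cintb_sum => i /h[].
Qed.

Lemma eq_cint c d : (forall t, ang t -> c t = d t) -> cint c = cint d.
Proof. by move=> h; congr (_ +i* _); apply: eq_ci => t /h ->. Qed.
Lemma cintD c d : cintbC c -> cintbC d -> cint (fun t => c t + d t) = cint c + cint d.
Proof.
move=> [h1 h2] [h3 h4]; apply: ceqP; rewrite /= -ciD//; apply: eq_ci => t _.
- by rewrite ReD.
- by rewrite ImD.
Qed.
Lemma cintZ k c : cintbC c -> cint (fun t => k * c t) = k * cint c.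
Proof.
move=> [h1 h2]; apply: ceqP; rewrite !cE /= -!ciZ// -?ciD -?ciB; try exact: cintbZ.
- by apply: eq_ci => t _; rewrite ReM.
- by apply: eq_ci => t _; rewrite ImM.
Qed.
Lemma cintN c : cintbC c -> cint (fun t => - c t) = - cint c.
Proof.
by move=> h; rewrite -mulN1r -cintZ//; apply: eq_cint => t _; rewrite mulN1r.
Qed.
Lemma cintB c d : cintbC c -> cintbC d -> cint (fun t => c t - d t) = cint c - cint d.
Proof. by move=> h1 h2; rewrite cintD ?cintN//; exact: cintbC_N. Qed.
Lemma cint_real u : cint (fun t => (u t)%:C) = (ci u)%:C.
Proof. by apply: ceqP => //=; exact: ci0. Qed.
Lemma cint_cst k : cint (fun=> k) = k * (2 * pi)%:C.
Proof. by apply: ceqP; rewrite !cE /= ci_cst mulr0 ?subr0 ?add0r. Qed.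
Lemma cint_conj c : cintbC c -> cint (fun t => (c t)^*%C) = (cint c)^*%C.
Proof.
move=> [h1 h2]; apply: ceqP => /=; first by apply: eq_ci => t _; case: (c t).
by rewrite -ciN//; apply: eq_ci => t _; case: (c t).
Qed.
Lemma cint_sum (I : Type) (s : seq I) (P : pred I) (G : I -> R -> C) :
  (forall i, P i -> cintbC (G i)) ->
  cint (fun t => \sum_(i <- s | P i) G i t) = \sum_(i <- s | P i) cint (G i).
Proof.
move=> h; elim: s => [|i s IH].
  by rewrite big_nil -[RHS](mul0r (2 * pi)%:C) -cint_cst; apply: eq_cint => t _; rewrite big_nil.
rewrite big_cons; case: ifPn => Pi.
- by rewrite -IH -cintD; [apply: eq_cint => t _; rewrite big_cons Pi|exact: h|exact: cintbC_sum].
- by rewrite -IH; apply: eq_cint => t _; rewrite big_cons (negbTE Pi).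
Qed.

Lemma cint_bound c M : cintbC c -> (forall t, ang t -> nc (c t) <= M) ->
  nc (cint c) <= 4 * pi * M.
Proof.
move=> [h1 h2] h; apply: (le_trans (nc_le_ReIm _)).
have hr := @ci_bound _ M h1 (fun t ht => le_trans (Re_le_nc _) (h t ht)).
have hi := @ci_bound _ M h2 (fun t ht => le_trans (Im_le_nc _) (h t ht)).
by have := lerD hr hi; rewrite /=; lra.
Qed.

Lemma ae_eq_cint c d : cintbC c -> cintbC d ->
  circle_ae (fun t => c t = d t) -> cint c = cint d.
Proof.
move=> [h1 h2] [h3 h4] h; congr (_ +i* _);
  (apply: ae_eq_ci; [by apply: cintb_meas|by apply: cintb_meas|]);
  by apply: ae_imp h => t _ ->.
Qed.

Lemma FTC2_seg u v (a b : R) : a <= b -> (forall t, is_derive t 1 u (v t)) -> continuous v ->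
  \int[leb]_(t in `[a, b]) v t = u b - u a.
Proof.
rewrite le_eqVlt => /predU1P[->|ab] hu cv.
  by rewrite subrr set_itv1 Rintegral_set1.
rewrite /Rintegral (@continuous_FTC2 _ v u a b)//.
- exact: continuous_subspaceT.
- have cu : continuous u.
    by move=> t; apply: differentiable_continuous; apply/derivable1_diffP; exact: (@ex_derive _ _ _ _ _ _ _ (hu t)).
  split.
  + by move=> t _; exact: (@ex_derive _ _ _ _ _ _ _ (hu t)).
  + by apply: cvg_at_right_filter; exact: cu.
  + by apply: cvg_at_left_filter; exact: cu.
- by move=> t _; rewrite derive1E; exact: (@derive_val _ _ _ _ _ _ _ (hu t)).
Qed.

Lemma cint_der c d : (forall t, cder c t (d t)) -> continuous d ->
  cint d = c (2 * pi) - c 0.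
Proof.
move=> h hd; apply: ceqP; rewrite !cE /= /circle_integral.
- apply: (@FTC2_seg (fun t => Re (c t)) (fun t => Re (d t)) 0 (2 * pi) (ltW pi2_gt0)).
    by move=> t; have [] := h t.
  exact: continuousC_Re.
- apply: (@FTC2_seg (fun t => Im (c t)) (fun t => Im (d t)) 0 (2 * pi) (ltW pi2_gt0)).
    by move=> t; have [] := h t.
  exact: continuousC_Im.
Qed.

Lemma le_eps (a b : R) : (forall e, 0 < e -> a <= b + e) -> a <= b.
Proof. by move=> h; apply/ler_addgt0Pr. Qed.

End CircleIntegral.

(** * Fourier coefficients and Poisson integrals *)

Section Fourier.
Context {R : realType}.
Notation C := (Cplx R).
Notation ang := (@angles R).
Notation ci := (@circle_integral R).
Notation cint := (@circle_cintegral R).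
Notation cintb := (@cintb R).
Notation cintbC := (@cintbC R).
Implicit Types (z w : C) (t s x r : R) (u v : R -> R) (c d : R -> C) (n m : int) (N : nat).

Lemma RCM x y : (x * y)%:C = x%:C * y%:C :> C.
Proof. by apply: ceqP; rewrite !cE /= ?mulr0 ?mul0r ?subr0 ?addr0. Qed.
Lemma RCD x y : (x + y)%:C = x%:C + y%:C :> C.
Proof. by apply: ceqP; rewrite !cE /= ?addr0. Qed.
Lemma RCN x : (- x)%:C = - x%:C :> C.
Proof. by apply: ceqP; rewrite !cE /= ?oppr0. Qed.
Lemma RCB x y : (x - y)%:C = x%:C - y%:C :> C.
Proof. by rewrite RCD RCN. Qed.
Lemma RCX x k : (x ^+ k)%:C = x%:C ^+ k :> C.
Proof. by elim: k => [|k IH]; rewrite ?expr0// !exprS RCM IH. Qed.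
Lemma RC_sum (I : Type) (q : seq I) (P : pred I) (G : I -> R) :
  (\sum_(i <- q | P i) G i)%:C = \sum_(i <- q | P i) (G i)%:C :> C.
Proof. by elim/big_rec2: _ => // i y1 y2 _ <-; rewrite RCD. Qed.
Lemma conjM z w : ((z * w)^*%C : C) = z^*%C * w^*%C.
Proof. by case: z w => [a b] [c d]; apply: ceqP => /=; ring. Qed.
Lemma conjB z w : ((z - w)^*%C : C) = z^*%C - w^*%C.
Proof. by case: z w => [a b] [c d]; apply: ceqP => /=; ring. Qed.
Lemma addCJ z : z + z^*%C = (2 * Re z)%:C :> C.
Proof. by case: z => [a b]; apply: ceqP => /=; ring. Qed.

Section ContC.
Variable T : topologicalType.
Implicit Types (f g : T -> C) (a : T).
Lemma ccst a z : continuous_at a (fun=> z : C). Proof. exact: cvg_cst. Qed.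
Lemma ccD f g a : continuous_at a f -> continuous_at a g -> continuous_at a (fun y => f y + g y).
Proof. move=> h1 h2; exact: (@cvgD _ _ _ _ (nbhs_filter a) _ _ _ _ h1 h2). Qed.
Lemma ccN f a : continuous_at a f -> continuous_at a (fun y => - f y).
Proof. move=> h1; exact: (@cvgN _ _ _ _ (nbhs_filter a) _ _ h1). Qed.
Lemma ccB f g a : continuous_at a f -> continuous_at a g -> continuous_at a (fun y => f y - g y).
Proof. by move=> h1 h2; apply: ccD; [exact: h1|apply: ccN; exact: h2]. Qed.
Lemma ccM f g a : continuous_at a f -> continuous_at a g -> continuous_at a (fun y => f y * g y).
Proof. move=> h1 h2; exact: (@cvgM _ _ _ (nbhs_filter a) _ _ _ _ h1 h2). Qed.
Lemma ccV f a : f a != 0 -> continuous_at a f -> continuous_at a (fun y => (f y)^-1).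
Proof. move=> h0 h1; exact: (@cvgV _ _ _ (nbhs_filter a) _ _ h0 h1). Qed.
Lemma ccR (u : T -> R) a : continuous_at a u -> continuous_at a (fun y => (u y)%:C : C).
Proof. by move=> h; apply: (@continuous_comp _ _ _ u (fun x => x%:C : C)) => //; exact: contRC. Qed.
Lemma ccexpi (u : T -> R) a : continuous_at a u -> continuous_at a (fun y => expi (u y) : C).
Proof. by move=> h; apply: (@continuous_comp _ _ _ u (fun x => expi x : C)) => //; exact: cont_expi. Qed.
Lemma ccRe f a : continuous_at a f -> continuous_at a (fun y => Re (f y)).
Proof. by move=> h; apply: (@continuous_comp _ _ _ f (@complex.Re R)) => //; exact: contRe. Qed.
Lemma ccIm f a : continuous_at a f -> continuous_at a (fun y => Im (f y)).
Proof. by move=> h; apply: (@continuous_comp _ _ _ f (@complex.Im R)) => //; exact: contIm. Qed.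
Lemma ccnc f a : continuous_at a f -> continuous_at a (fun y => nc (f y)).
Proof. by move=> h; apply: (@continuous_comp _ _ _ f (@ComplexField.Normc.normc R)) => //; exact: contnc. Qed.
Lemma ccexp f a : continuous_at a f -> continuous_at a (fun y => cexp (f y)).
Proof.
move=> h; apply: ccM; last by apply: ccexpi; exact: ccIm.
apply: ccR; apply: (@continuous_comp _ _ _ (fun y => Re (f y)) expR); last exact: continuous_expR.
exact: ccRe.
Qed.
Lemma ccsum (I : Type) (q : seq I) (P : pred I) (G : I -> T -> C) a :
  (forall i, P i -> continuous_at a (G i)) ->
  continuous_at a (fun y => \sum_(i <- q | P i) G i y).
Proof.
move=> h; elim: q => [|i q IH].
  by rewrite (_ : (fun=> _) = (fun=> 0)); [exact: ccst|apply/funext => t; rewrite big_nil].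
rewrite (_ : (fun=> _) = (fun y => (if P i then G i y else 0) + \sum_(i <- q | P i) G i y)).
  apply: ccD; last exact: IH.
  by case Pi : (P i); [exact: h|exact: ccst].
by apply/funext => t; rewrite big_cons; case: ifP => // _; rewrite add0r.
Qed.
End ContC.

Lemma tsub_cont t s : continuous_at s (fun s : R => t - s).
Proof. by apply: cvgB; [exact: cvg_cst|exact: cvg_id]. Qed.

(** The characters of the circle. *)
Definition en n t : C := expi (n%:~R * t).
(** [fourier_coef] for a function of the angle. *)
Definition fc c n : C := ((2 * pi)^-1)%:C * cint (fun t => c t * expi (- (n%:~R * t))).
Definition symsum N (G : int -> C) : C := \sum_(k < N.*2.+1) G (k%:Z - N%:Z).

Lemma symsumE N G : symsum N G = G 0 + \sum_(k < N) (G k.+1%:Z + G (- k.+1%:Z)).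
Proof.
elim: N => [|N IH]; first by rewrite /symsum big_ord_recl !big_ord0 /= subrr.
transitivity (G (- N.+1%:Z) + (symsum N G + G N.+1%:Z)).
  rewrite /symsum doubleS big_ord_recl big_ord_recr /=; congr (_ + (_ + _)).
  - by congr G; lia.
  - by apply: eq_bigr => i _; congr G; rewrite /= /bump /=; lia.
  - by congr G; rewrite /bump /=; lia.
rewrite IH big_ord_recr /=; ring.
Qed.

Lemma eq_symsum N G H : (forall n, G n = H n) -> symsum N G = symsum N H.
Proof. by move=> h; apply: eq_bigr. Qed.

Lemma symsum_delta N m (z : C) : (`|m| <= N)%N ->
  symsum N (fun n => if n == m then z else 0) = z.
Proof.
move=> hm; have hk : (absz (m + N%:Z)%R < N.*2.+1)%N by lia.
rewrite /symsum (bigD1 (Ordinal hk)) //= ifT; last by apply/eqP; lia.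
rewrite big1 ?addr0// => i ik; rewrite ifF//; apply/negbTE; apply: contra ik => /eqP h.
by apply/eqP/val_inj => /=; lia.
Qed.

Lemma nc_en n t : nc (en n t) = 1. Proof. exact: nc_expi. Qed.
Lemma enD n m t : en (n + m) t = en n t * en m t.
Proof. by rewrite /en intrD mulrDl expiD. Qed.
Lemma enDt n t s : en n (t + s) = en n t * en n s.
Proof. by rewrite /en mulrDr expiD. Qed.
Lemma en0 t : en 0 t = 1. Proof. by rewrite /en mul0r expi0. Qed.
Lemma enN n t : en (- n) t = expi (- (n%:~R * t)).
Proof. by rewrite /en intrN mulNr. Qed.
Lemma en_conj n t : (en n t)^*%C = en (- n) t.
Proof. by rewrite enN expiN_conj. Qed.
Lemma en_nat (k : nat) t : en k%:Z t = expi t ^+ k.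
Proof. by rewrite expiX. Qed.
Lemma cont_en n : continuous (en n).
Proof.
move=> t; apply: (@continuous_comp _ _ _ (fun t => n%:~R * t) expi); last exact: cont_expi.
exact: mulrl_continuous.
Qed.
Lemma en_2pi n : en n (2 * pi) = 1. Proof. exact: expi_2piz. Qed.
Lemma en_0 n : en n 0 = 1. Proof. by rewrite /en mulr0 expi0. Qed.

Lemma cder_en n t : cder (en n) t ('i * (n%:~R : R)%:C * en n t).
Proof.
have h : is_derive t 1 (fun t => n%:~R * t) (n%:~R : R).
  by apply: (@is_derive_eq _ _ _ _ _ _ _ _ (is_deriveZ _ (is_derive_id t 1))); rewrite /GRing.scale /= mulr1.
by apply: cder_eq (cder_comp h (cder_expi _)) _; rewrite mulrA [_%:C * _]mulrC.
Qed.

Lemma nC_neq0 n : n != 0 -> (n%:~R : R)%:C != 0 :> C.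
Proof. by move=> n0; rewrite -nc_gt0 ncR normr_gt0 intr_eq0. Qed.
Lemma i_neq0 : ('i : C) != 0.
Proof. by rewrite -nc_gt0 /= expr0n add0r expr1n sqrtr1. Qed.

Lemma cint_en n : cint (en n) = if n == 0 then (2 * pi)%:C else 0.
Proof.
case: eqP => [->|/eqP n0].
  by rewrite -[RHS]mul1r -cint_cst; apply: eq_cint => t _; rewrite en0.
have hin : 'i * (n%:~R : R)%:C != 0 :> C by rewrite mulf_neq0 ?i_neq0 ?nC_neq0.
rewrite (@cint_der _ (fun t => ('i * (n%:~R : R)%:C)^-1 * en n t)).
- by rewrite en_2pi en_0 subrr.
- by move=> t; apply: cder_eq (cderZ _ (cder_en n t)) _; rewrite mulrA mulVf// mul1r.
- exact: cont_en.
Qed.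

Lemma twopiC : ((2 * pi)^-1)%:C * (2 * pi)%:C = 1 :> C.
Proof. by rewrite -rmorphM /= mulVf// gt_eqF// pi2_gt0. Qed.

Lemma fc_en m n : fc (en m) n = if n == m then 1 else 0.
Proof.
rewrite /fc (@eq_cint _ _ (en (m - n))) ?cint_en; last by move=> t _; rewrite enD enN.
by rewrite subr_eq0 eq_sym; case: eqP => _; rewrite ?mulr0 ?twopiC.
Qed.

Lemma cont_enN n : continuous (fun t => expi (- (n%:~R * t)) : C).
Proof. by rewrite (_ : (fun=> _) = en (- n)); [exact: cont_en|apply/funext => t; rewrite enN]. Qed.

Lemma cintbC_fc c n : cintbC c -> cintbC (fun t => c t * expi (- (n%:~R * t))).
Proof. by move=> h; apply: cintbC_M => //; exact: cont_enN. Qed.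

Lemma eq_fc c d n : (forall t, ang t -> c t = d t) -> fc c n = fc d n.
Proof. by move=> h; congr (_ * _); apply: eq_cint => t /h ->. Qed.
Lemma fcD c d n : cintbC c -> cintbC d -> fc (fun t => c t + d t) n = fc c n + fc d n.
Proof.
move=> hc hd; rewrite /fc -mulrDr -cintD; try exact: cintbC_fc.
by congr (_ * _); apply: eq_cint => t _; rewrite mulrDl.
Qed.
Lemma fcZ k c n : cintbC c -> fc (fun t => k * c t) n = k * fc c n.
Proof.
move=> hc; rewrite /fc mulrCA -(cintZ k); last exact: cintbC_fc.
by congr (_ * _); apply: eq_cint => t _; rewrite mulrA.
Qed.
Lemma fcB c d n : cintbC c -> cintbC d -> fc (fun t => c t - d t) n = fc c n - fc d n.
Proof.
move=> hc hd; rewrite -[- fc d n]mulN1r -fcZ// -fcD//; last exact: cintbC_Z.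
by apply: eq_fc => t _; rewrite mulN1r.
Qed.
Lemma ae_eq_fc c d n : cintbC c -> cintbC d -> circle_ae (fun t => c t = d t) -> fc c n = fc d n.
Proof.
move=> hc hd h; congr (_ * _); apply: ae_eq_cint; try exact: cintbC_fc.
by apply: ae_imp h => t _ ->.
Qed.
Lemma fc_conj c n : cintbC c -> fc (fun t => (c t)^*%C) n = (fc c (- n))^*%C.
Proof.
move=> hc; rewrite /fc conjM -cint_conj; last exact: cintbC_fc.
congr (_ * _); first by rewrite /= oppr0.
by apply: eq_cint => t _; rewrite conjM -!enN en_conj opprK.
Qed.
Lemma fc_sum (I : Type) (q : seq I) (P : pred I) (G : I -> R -> C) n :
  (forall i, P i -> cintbC (G i)) ->
  fc (fun t => \sum_(i <- q | P i) G i t) n = \sum_(i <- q | P i) fc (G i) n.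
Proof.
move=> h; rewrite /fc -mulr_sumr -cint_sum; last by move=> i /h; exact: cintbC_fc.
by congr (_ * _); apply: eq_cint => t _; rewrite mulr_suml.
Qed.

Lemma cint_le d v : cintbC d -> cintb v -> (forall t, ang t -> nc (d t) <= v t) ->
  nc (cint d) <= 2 * ci v.
Proof.
move=> [h1 h2] hv h; apply: (le_trans (nc_le_ReIm _)) => /=.
have a : `|ci (fun t => Re (d t))| <= ci v.
  apply: (le_trans (norm_ci h1)); apply: le_ci => //; first exact: cintb_norm.
  by move=> t ht; apply: le_trans (h t ht); exact: Re_le_nc.
have b : `|ci (fun t => Im (d t))| <= ci v.
  apply: (le_trans (norm_ci h2)); apply: le_ci => //; first exact: cintb_norm.
  by move=> t ht; apply: le_trans (h t ht); exact: Im_le_nc.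
lra.
Qed.

Lemma fc_bound c : cintbC c -> exists B, forall n, nc (fc c n) <= B.
Proof.
move=> hc; have [h1 h2] := hc.
exists ((2 * pi)^-1 * (2 * ci (fun t => `|Re (c t)| + `|Im (c t)|))) => k.
rewrite ncM ncR ger0_norm ?invr_ge0 ?(ltW pi2_gt0)// ler_wpM2l ?invr_ge0 ?(ltW pi2_gt0)//.
apply: cint_le; [exact: cintbC_fc|by apply: cintbD; exact: cintb_norm|].
by move=> t _; rewrite ncM nc_expi mulr1; exact: nc_le_ReIm.
Qed.

Lemma fc_close c d n e : cintbC c -> cintbC d -> (forall t, ang t -> nc (c t - d t) <= e) ->
  nc (fc c n - fc d n) <= 2 * e.
Proof.
move=> hc hd h; rewrite -fcB// ncM ncR ger0_norm ?invr_ge0 ?(ltW pi2_gt0)//.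
rewrite ler_pdivrMl ?pi2_gt0//.
apply: le_trans (@cint_bound _ _ e _ _) _.
- by apply: cintbC_fc; exact: cintbC_B.
- by move=> t ht; rewrite ncM nc_expi mulr1; exact: h.
- lra.
Qed.

(** The Poisson kernel. *)
Definition pker r x : R := Re ((1 + r%:C * expi x) / (1 - r%:C * expi x) : C).
(** The symmetric partial sums of the Fourier series of the Poisson kernel. *)
Definition psym r N x : C := symsum N (fun n => (r ^+ `|n|%N)%:C * en n x).

Lemma nc_rexpi r x : 0 <= r -> nc (r%:C * expi x : C) = r.
Proof. by move=> r0; rewrite ncM ncR nc_expi mulr1 ger0_norm. Qed.
Lemma nc_1B w : 1 - nc w <= nc (1 - w).
Proof. by have := nc_distD 1 w; rewrite nc1. Qed.
Lemma B1_neq0 w : nc w < 1 -> 1 - w != 0.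
Proof. by move=> h; rewrite -nc_gt0; have := nc_1B w; lra. Qed.

Lemma pkerE r x : pker r x = (1 - r ^+ 2) / nc (1 - r%:C * expi x : C) ^+ 2.
Proof.
rewrite /pker; set w : C := r%:C * expi x.
have hw : Re w ^+ 2 + Im w ^+ 2 = r ^+ 2.
  by rewrite -ncsq /w ncM ncR nc_expi mulr1 real_normK ?num_real.
rewrite ncsq -hw; case: w {hw} => a b /=.
by rewrite !(add0r, addr0, sub0r); ring.
Qed.

Lemma pker_ge0 r x : 0 <= r < 1 -> 0 <= pker r x.
Proof.
move=> /andP[r0 r1]; rewrite pkerE divr_ge0 ?sqr_ge0// subr_ge0.
by rewrite expr_le1// ltW.
Qed.

Lemma cont_pker r : 0 <= r < 1 -> continuous (pker r).
Proof.
move=> /andP[r0 r1]; rewrite /pker => x; apply: ccRe.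
have hc : continuous_at x (fun x => r%:C * expi x : C).
  by apply: ccM; [exact: ccst|exact: cont_expi].
apply: ccM; first by apply: ccD; [exact: ccst|exact: hc].
apply: ccV; first by apply: B1_neq0; rewrite nc_rexpi.
by apply: ccB; [exact: ccst|exact: hc].
Qed.

Lemma pkerN r x : pker r (- x) = pker r x.
Proof.
rewrite !pkerE; congr (_ / _ ^+ _).
rewrite -ncC conjB conjM expiN_conj conjcK conjc_real; congr (nc (_ - _)).
by apply: ceqP; rewrite //= oppr0.
Qed.

Lemma psymE r N x : psym r N x = (2 * Re (\sum_(k < N.+1) (r%:C * expi x : C) ^+ k) - 1)%:C.
Proof.
rewrite /psym symsumE /= expr0 en0 mulr1 big_ord_recl expr0 ReD /=.
rewrite (_ : 2 * _ - 1 = 1 + 2 * Re (\sum_(i < N) (r%:C * expi x : C) ^+ i.+1)); last by ring.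
rewrite RCD; congr (_ + _).
rewrite Re_sum mulr_sumr RC_sum; apply: eq_bigr => k _.
rewrite -mulrDr exprMn -RCX -en_nat -en_conj addCJ -RCM; congr (_%:C).
by rewrite ReM /= mul0r subr0 mulrCA.
Qed.

(** The partial sums are geometric sums, so the remainder is explicit. *)
Lemma pker_psym r N x : 0 <= r < 1 ->
  nc ((pker r x)%:C - psym r N x) <= 2 * (r ^+ N.+1 / (1 - r)).
Proof.
move=> /andP[r0 r1]; rewrite psymE /pker -RCB ncR.
set w : C := r%:C * expi x; have nw : nc w = r by exact: nc_rexpi.
have w1 : 1 - w != 0 by apply: B1_neq0; rewrite nw.
have -> : (1 + w) / (1 - w) = 2 * (1 - w)^-1 - 1 :> C by field.
have hs : \sum_(k < N.+1) w ^+ k = (1 - w ^+ N.+1) / (1 - w).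
  apply: (mulIf w1); rewrite mulfVK// mulrC.
  have := subrXX_comm N.+1 (@mulrC _ (1 : R[i]) w : GRing.comm 1 w).
  rewrite expr1n => ->; congr (_ * _); apply: eq_bigr => i _.
  by rewrite expr1n mul1r.
rewrite hs mulrBl mul1r.
have -> : Re (2 * (1 - w)^-1 - 1) - (2 * Re ((1 - w)^-1 - w ^+ N.+1 / (1 - w)) - 1) =
   2 * Re (w ^+ N.+1 / (1 - w)).
  by rewrite !ReD !ReN [Re (2 * _)]ReM /=; ring.
rewrite normrM ger0_norm// ler_wpM2l//.
apply: (le_trans (Re_le_nc _)); rewrite ncM ncV ncX nw.
rewrite ler_wpM2l ?exprn_ge0// lef_pV2 ?posrE ?subr_gt0//; last by rewrite nc_gt0.
by have := nc_1B w; rewrite nw.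
Qed.

Lemma small_expr r e : 0 <= r < 1 -> 0 < e -> exists N0, forall N, (N0 <= N)%N -> r ^+ N < e.
Proof.
move=> /andP[r0 r1] e0; have : `|r| < 1 by rewrite ger0_norm.
move=> /cvg_expr /cvgrPdist_lt /(_ _ e0)[N0 _ H]; exists N0 => N /H /=.
by rewrite sub0r normrN ger0_norm// exprn_ge0.
Qed.

(** The Poisson integrals of real ([pk]) and complex ([PK]) functions: the former can be
    compared by inequalities, the latter have Fourier coefficients. *)
Definition pk r u t : R := (2 * pi)^-1 * ci (fun s => pker r (t - s) * u s).
Definition PK r c t : C := ((2 * pi)^-1)%:C * cint (fun s => (pker r (t - s))%:C * c s).

Lemma cont_pkert r t : 0 <= r < 1 -> continuous (fun s => pker r (t - s)).
Proof.
move=> hr s; apply: (@continuous_comp _ _ _ (fun s => t - s) (pker r)); last exact: cont_pker.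
exact: tsub_cont.
Qed.

Lemma cintb_pk r u t : 0 <= r < 1 -> cintb u -> cintb (fun s => pker r (t - s) * u s).
Proof.
move=> hr hu; apply: (eq_cintb (u := fun s => u s * pker r (t - s))); first by move=> s _; rewrite mulrC.
by apply: cintb_Mcont => //; exact: cont_pkert.
Qed.

Lemma PK_ReIm r c t : PK r c t = pk r (Re \o c) t +i* pk r (Im \o c) t.
Proof.
apply: ceqP; rewrite /PK /pk !cE /= mul0r ?subr0 ?addr0; congr (_ * _); apply: eq_ci => s _.
- by rewrite ReM /= mul0r subr0.
- by rewrite ImM /= mul0r addr0.
Qed.

Lemma PK_real r u t : PK r (fun s => (u s)%:C) t = (pk r u t)%:C.
Proof.
rewrite PK_ReIm; apply: ceqP => //=.
rewrite /pk (eq_ci (v := fun=> 0)) ?ci0 ?mulr0// => s _; exact: mulr0.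
Qed.

Lemma cont_rent (k : C) n t : continuous (fun s => k * en n (t - s)).
Proof.
move=> s; apply: ccM; first exact: ccst.
by apply: (@continuous_comp _ _ _ (fun s => t - s) (en n)); [exact: tsub_cont|exact: cont_en].
Qed.

Lemma ReRM x z : Re (x%:C * z) = x * Re z.
Proof. by rewrite ReM /= mul0r subr0. Qed.
Lemma ImRM x z : Im (x%:C * z) = x * Im z.
Proof. by rewrite ImM /= mul0r addr0. Qed.

Lemma cintbC_pk r c t : 0 <= r < 1 -> cintbC c -> cintbC (fun s => (pker r (t - s))%:C * c s).
Proof.
move=> hr hc; apply: (eq_cintbC (c := fun s => c s * (pker r (t - s))%:C)); first by move=> s _; rewrite mulrC.
apply: cintbC_M; first exact: hc.
by move=> s; apply: ccR; exact: cont_pkert.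
Qed.

(** The Fourier series of the kernel converges uniformly, so it can be integrated against an L^1
    function term by term. *)
Lemma PK_sum r c : 0 <= r < 1 -> cintbC c -> exists B, forall t N,
  nc (PK r c t - symsum N (fun n => (r ^+ `|n|%N)%:C * fc c n * en n t)) <= B * r ^+ N.
Proof.
move=> hr hc; have [h1 h2] := hc; have /andP[r0 r1] := hr.
exists ((2 * pi)^-1 * (2 * (2 * (r / (1 - r)) * ci (fun s => `|Re (c s)| + `|Im (c s)|)))) => t N.
have hps : continuous (psym r N \o (fun s => t - s)).
  rewrite (_ : _ \o _ = (fun s => symsum N (fun n => (r ^+ `|n|%N)%:C * en n (t - s))))//.
  move=> s; apply: ccsum => i _; apply: ccM; first exact: ccst.
  apply: (@continuous_comp _ _ _ (fun s => t - s) (en (i%:Z - N%:Z))); last exact: cont_en.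
  exact: tsub_cont.
have -> : symsum N (fun n => (r ^+ `|n|%N)%:C * fc c n * en n t) =
    ((2 * pi)^-1)%:C * cint (fun s => c s * psym r N (t - s)).
  rewrite /symsum; under eq_bigr do rewrite /fc.
  under eq_cint do rewrite /psym /symsum mulr_sumr.
  rewrite cint_sum; last first.
    by move=> i _; apply: cintbC_M; [exact: hc|exact: cont_rent].
  rewrite mulr_sumr; apply: eq_bigr => i _; set n := (i%:Z - N%:Z).
  rewrite mulrCA -!mulrA; congr (_ * _).
  rewrite mulrA mulrC mulrA -cintZ; last exact: cintbC_fc.
  by apply: eq_cint => s _; rewrite enDt /en mulrN; ring.
rewrite -mulrBr -cintB; last 2 first.
- apply: (eq_cintbC (c := fun s => c s * (pker r (t - s))%:C)); first by move=> s _; rewrite mulrC.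
  apply: cintbC_M; [exact: hc|move=> s]; apply: ccR; exact: cont_pkert.
- exact: cintbC_M.
rewrite ncM ncR ger0_norm ?invr_ge0 ?(ltW pi2_gt0)// -[leRHS]mulrA ler_wpM2l ?invr_ge0 ?(ltW pi2_gt0)//.
have hv : cintb (fun s => 2 * (r ^+ N.+1 / (1 - r)) * (`|Re (c s)| + `|Im (c s)|)).
  by apply: cintbZ; apply: cintbD; exact: cintb_norm.
apply: le_trans (@cint_le _ _ _ hv _) _.
- apply: cintbC_B; last exact: cintbC_M.
  apply: (eq_cintbC (c := fun s => c s * (pker r (t - s))%:C)); first by move=> s _; rewrite mulrC.
  apply: cintbC_M; [exact: hc|move=> s]; apply: ccR; exact: cont_pkert.
- move=> s _; rewrite [c s * _]mulrC -mulrBl ncM.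
  by apply: ler_pM; rewrite ?nc_ge0 ?pker_psym// nc_le_ReIm.
- rewrite ciZ; last by apply: cintbD; exact: cintb_norm.
  by rewrite exprS le_eqVlt; apply/orP; left; apply/eqP; ring.
Qed.

Lemma PK_cvg r c t e : 0 <= r < 1 -> cintbC c -> 0 < e -> exists N0, forall N, (N0 <= N)%N ->
  nc (PK r c t - symsum N (fun n => (r ^+ `|n|%N)%:C * fc c n * en n t)) < e.
Proof.
move=> hr hc e0; have [B hB] := PK_sum hr hc.
have B1 : 0 < `|B| + 1 by have := normr_ge0 B; lra.
have [N0 hN] := small_expr hr (divr_gt0 e0 B1); exists N0 => N /hN h.
apply: (le_lt_trans (hB t N)); move: h; rewrite ltr_pdivlMr// => h.
have : 0 <= r ^+ N by rewrite exprn_ge0//; case/andP: hr.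
by have := ler_norm B; nra.
Qed.

Lemma nc_small_eq z w : (forall e, 0 < e -> nc (z - w) < e) -> z = w.
Proof.
move=> h; apply/eqP; rewrite -subr_eq0; apply/eqP/nc_eq0/eqP.
rewrite eq_le nc_ge0 andbT leNgt; apply/negP => h0; have := h _ h0; by rewrite ltxx.
Qed.

(** Poisson integrals are identified below through the sum of their Fourier series. *)
Lemma PK_eq r c t z : 0 <= r < 1 -> cintbC c ->
  (forall e, 0 < e -> exists N0, forall N, (N0 <= N)%N ->
  nc (z - symsum N (fun n => (r ^+ `|n|%N)%:C * fc c n * en n t)) < e) -> PK r c t = z.
Proof.
move=> hr hc h; apply: nc_small_eq => e e0; have e2 : 0 < e / 2 by rewrite divr_gt0.
have [N1 h1] := h _ e2; have [N2 h2] := PK_cvg t hr hc e2.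
have {}h1 := h1 _ (leq_maxl N1 N2); have {}h2 := h2 _ (leq_maxr N1 N2).
rewrite (splitr e) (le_lt_trans (ncBD _ _ _) (ltrD h2 _))// ncB; exact: h1.
Qed.

Lemma PK_en r m t : 0 <= r < 1 -> PK r (en m) t = (r ^+ `|m|%N)%:C * en m t.
Proof.
move=> hr; apply: PK_eq => //; first by apply: cintbC_cont; exact: cont_en.
move=> e e0; exists `|m|%N => N hN.
rewrite (@eq_symsum N _ (fun n => if n == m then (r ^+ `|m|%N)%:C * en m t else 0)); last first.
  by move=> n; rewrite fc_en; case: eqP => [->|_]; rewrite ?mulr1// mulr0 mul0r.
by rewrite symsum_delta// subrr nc0.
Qed.

Lemma pk_1 r t : 0 <= r < 1 -> pk r (fun=> 1) t = 1.
Proof.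
move=> hr; apply: complexI; rewrite -PK_real.
rewrite (_ : (fun=> _) = en 0); last by apply/funext => s; rewrite en0.
by rewrite PK_en// en0 mulr1 expr0.
Qed.

Lemma ci_pker r t : 0 <= r < 1 -> ci (fun s => pker r (t - s)) = 2 * pi.
Proof.
move=> hr; have := pk_1 t hr; rewrite /pk (eq_ci (v := fun s => pker r (t - s))); last by move=> s _; rewrite mulr1.
by move=> /(congr1 (fun x => 2 * pi * x)); rewrite mulrA divff ?mul1r ?mulr1// gt_eqF// pi2_gt0.
Qed.

(** The real part of [PK_en] for the first character. *)
Lemma pk_cos r t : 0 <= r < 1 -> (2 * pi)^-1 * ci (fun s => pker r (t - s) * cos (t - s)) = r.
Proof.
move=> hr; have h := PK_en 1 t hr.
have h2 : en (-1) t * PK r (en 1) t = r%:C.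
  by rewrite h expr1 mulrCA -enD addNr en0 mulr1.
have {}h2 : Re (en (-1) t * PK r (en 1) t) = r by rewrite h2.
rewrite -[RHS]h2.
have hen : cintbC (en 1) by apply: cintbC_cont; exact: cont_en.
rewrite /PK mulrCA -(cintZ (en (-1) t)); last exact: cintbC_pk.
rewrite ReRM; congr (_ * _); apply: eq_ci => s _.
rewrite mulrCA ReRM; congr (_ * _).
rewrite /en !cE /=.
have -> : (-1)%:~R * t = - t by rewrite mulrN1z mulN1r.
by rewrite !mul1r cosN sinN cosB; ring.
Qed.

Lemma cos1_2pi x : 0 < x < 2 * pi -> cos x < 1.
Proof.
move=> /andP[x0 x1]; have h : 0 < sin (x / 2) by apply: sin_gt0_pi; rewrite divr_gt0//= ltr_pdivrMr// mulrC.
have -> : x = (x / 2) *+ 2 by rewrite -mulr_natr divfK.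
rewrite cos_mulr2n; have := sin2cos2 (x / 2); have := exprn_gt0 2 h.
set a := sin (x / 2) ^+ 2; set b := cos (x / 2) ^+ 2; rewrite -mulr_natr; lra.
Qed.

(** The pairs of angles at which [u] differs by at least [e] form a compact set on which [1 -
    cos (t - s)] does not vanish, because [u] has the same value at both ends; let [m] be its
    positive minimum there. As in the theorem of Korovkin, the Poisson integrals of [1] and
    [cos] then control those of every continuous function. *)
Lemma korovkin u e : continuous u -> u 0 = u (2 * pi) -> 0 < e ->
  exists2 K, 0 <= K & forall s t, ang s -> ang t -> `|u s - u t| <= e + K * (1 - cos (t - s)).
Proof.
move=> cu u0 e0.
pose D : set (R * R) := (ang `*` ang) `&` [set p | e <= `|u p.1 - u p.2|].
have cD : compact D.
  apply: compact_closedI; first by apply: compact_setX; exact: segment_compact.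
  have cg : continuous (fun p : R * R => `|u p.1 - u p.2|).
    move=> p; apply: cvg_norm; apply: cvgB.
      by apply: (@continuous_comp _ _ _ fst u); [exact: cvg_fst|exact: cu].
    by apply: (@continuous_comp _ _ _ snd u); [exact: cvg_snd|exact: cu].
  by have := closed_comp (fun p _ => cg p) (@closed_ge R e).
have [[p0 Dp0]|D0] := pselect (D !=set0); last first.
  exists 0 => // s t hs ht; rewrite mul0r addr0 leNgt; apply/negP => h; apply: D0.
  by exists (s, t); split => //=; exact: ltW.
have cf : {within D, continuous (fun p : R * R => 1 - cos (p.2 - p.1))}.
  apply: continuous_subspaceT => p; apply: cvgB; first exact: cvg_cst.
  apply: (@continuous_comp _ _ _ (fun p : R * R => p.2 - p.1) cos); last exact: continuous_cos.
  by apply: cvgB; [exact: cvg_snd|exact: cvg_fst].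
have [[s0 t0] + hmin] := compact_EVT_min (ex_intro _ p0 Dp0) cD cf.
rewrite inE => -[[/angP /= hs0 /angP /= ht0] /= hst].
set m := 1 - cos (t0 - s0) in hmin.
have m0 : 0 < m.
  rewrite /m; have [h|h|h] := ltgtP s0 t0.
  - case: (ltP (t0 - s0) (2 * pi)) => h'; first by rewrite subr_gt0; apply: cos1_2pi; lra.
    have [es et] : s0 = 0 /\ t0 = 2 * pi by split; lra.
    by move: hst; rewrite es et u0 subrr normr0; lra.
  - rewrite -cosN opprB.
    case: (ltP (s0 - t0) (2 * pi)) => h'; first by rewrite subr_gt0; apply: cos1_2pi; lra.
    have [es et] : t0 = 0 /\ s0 = 2 * pi by split; lra.
    by move: hst; rewrite es et u0 subrr normr0; lra.
  - by move: hst; rewrite h subrr normr0; lra.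
have [M hM] := cont_bdd_ang cu.
have M0 : 0 <= M by apply: le_trans (hM 0 _) => //; apply/angP; rewrite lexx (ltW (@pi2_gt0 R)).
exists (2 * M / m); first by rewrite divr_ge0 ?mulr_ge0// ltW.
move=> s t hs ht; have c1 := cos_le1 (t - s).
case: (leP e `|u s - u t|) => h; last first.
  have : 0 <= 2 * M / m * (1 - cos (t - s)) by rewrite mulr_ge0 ?subr_ge0// divr_ge0 ?mulr_ge0// ltW.
  lra.
have : m <= 1 - cos (t - s) by apply: (hmin (s, t)); rewrite inE.
move=> hm; have : 2 * M <= 2 * M / m * (1 - cos (t - s)).
  by rewrite mulrAC ler_pdivlMr// ler_wpM2l// mulr_ge0.
have := ler_normB (u s) (u t); have := hM _ hs; have := hM _ ht; lra.
Qed.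

(** By [korovkin] the error is at most [e / 2] plus [K] times the Poisson integral of [1 - cos
    (t - s)], which is [1 - r]. *)
Lemma pk_approx u e : continuous u -> u 0 = u (2 * pi) -> 0 < e ->
  exists2 r0, 0 <= r0 < 1 & forall r t, r0 <= r < 1 -> ang t -> `|pk r u t - u t| <= e.
Proof.
move=> cu u0 e0; have e2 : 0 < e / 2 by rewrite divr_gt0.
have [K K0 hK] := korovkin cu u0 e2.
pose d := Num.min 1 (e / 2 / (K + 1)).
have K1 : 0 < K + 1 by lra.
have d0 : 0 < d by rewrite lt_min ltr01 divr_gt0.
have dle : d <= 1 by rewrite ge_min lexx.
exists (1 - d); first by lra.
move=> r t /andP[rd r1] ht.
have r0 : 0 <= r by lra.
have hr : 0 <= r < 1 by rewrite r0.
have hu := cintb_cont cu; have p1 := pk_1 t hr; have pc := pk_cos t hr.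
have cp : cintb (fun s => pker r (t - s)) by apply: cintb_cont; exact: cont_pkert.
have i2pi : 0 <= (2 * pi)^-1 :> R by rewrite invr_ge0 (ltW (@pi2_gt0 R)).
have ccs : continuous (fun s => cos (t - s)).
  move=> s; apply: (@continuous_comp _ _ _ (fun s => t - s) cos); last exact: continuous_cos.
  exact: tsub_cont.
have cpc : cintb (fun s => pker r (t - s) * cos (t - s)) by apply: cintb_Mcont.
have E : pk r u t - u t = (2 * pi)^-1 * ci (fun s => pker r (t - s) * u s - u t * pker r (t - s)).
  rewrite ciB; [|exact: cintb_pk|exact: cintbZ].
  by rewrite mulrBr ciZ// ci_pker// /pk mulrCA mulVf ?mulr1// gt_eqF// pi2_gt0.
rewrite E normrM ger0_norm//.
have hb : cintb (fun s => pker r (t - s) * u s - u t * pker r (t - s)).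
  by apply: cintbB; [exact: cintb_pk|exact: cintbZ].
apply: (@le_trans _ _ ((2 * pi)^-1 * ci (fun s => (e / 2 + K) * pker r (t - s) - K * (pker r (t - s) * cos (t - s))))).
  rewrite ler_wpM2l//; apply: (le_trans (norm_ci hb)); apply: le_ci.
  - exact: cintb_norm.
  - by apply: cintbB; exact: cintbZ.
  - move=> s hs; rewrite [u t * _]mulrC -mulrBr normrM ger0_norm ?pker_ge0//.
    apply: (@le_trans _ _ (pker r (t - s) * (e / 2 + K * (1 - cos (t - s))))).
      by rewrite ler_wpM2l ?pker_ge0//; exact: hK.
    by rewrite le_eqVlt; apply/orP; left; apply/eqP; ring.
rewrite ciB; [|exact: cintbZ|exact: cintbZ].
rewrite !ciZ// ci_pker// mulrBr.
have -> : (2 * pi)^-1 * (K * ci (fun s => pker r (t - s) * cos (t - s))) = K * r by rewrite mulrCA pc.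
have -> : (2 * pi)^-1 * ((e / 2 + K) * (2 * pi)) = e / 2 + K.
  by rewrite mulrCA mulVf ?mulr1// gt_eqF// pi2_gt0.
have hd : d <= e / 2 / (K + 1) by rewrite ge_min lexx orbT.
have : K * (1 - r) <= e / 2.
  apply: (@le_trans _ _ ((K + 1) * d)); first by apply: ler_pM; lra.
  by move: hd; rewrite ler_pdivlMr// mulrC.
lra.
Qed.

End Fourier.

(** * Poisson integrals of integrable functions *)

Section PoissonL1.
Context {R : realType}.
Notation C := (Cplx R).
Notation ci := (@circle_integral R).
Notation cintb := (@cintb R).
Notation cintbC := (@cintbC R).
Implicit Types (z w : C) (t s x r : R) (u v : R -> R) (c d : R -> C) (n m : int) (N : nat).

Lemma uniform_limit_cont (T : topologicalType) (f : T -> C) (a : T) :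
  (forall e, 0 < e -> exists g : T -> C, continuous_at a g /\ forall y, nc (f y - g y) <= e) ->
  continuous_at a f.
Proof.
move=> h; apply/(cvgCP (nbhs_filter a)) => e e0.
have e4 : 0 < e / 4 by rewrite divr_gt0.
have [g [/(cvgCP (nbhs_filter a)) cg hg]] := h _ e4.
have {}cg := cg _ e4; near=> y.
have h1 : nc (g a - g y) < e / 4 by near: y.
have h2 := hg a; have h3 := hg y.
have -> : f a - f y = (f a - g a) + (g a - g y) + (g y - f y) by ring.
have := ncD (f a - g a + (g a - g y)) (g y - f y).
have := ncD (f a - g a) (g a - g y).
rewrite (ncB (g y)); lra.
Unshelve. all: by end_near. Qed.

Lemma cont_symsum N (G : int -> R -> C) : (forall n, continuous (G n)) ->
  continuous (fun t => symsum N (fun n => G n t)).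
Proof. by move=> h t; apply: ccsum => i _; exact: h. Qed.

Lemma cont_Zen z n : continuous (fun t => z * en n t).
Proof. by move=> t; apply: ccM; [exact: ccst|exact: cont_en]. Qed.

(** A uniform limit of trigonometric polynomials. *)
Lemma cont_PK r c : 0 <= r < 1 -> cintbC c -> continuous (PK r c).
Proof.
move=> hr hc t; apply: uniform_limit_cont => e e0; have [B hB] := PK_sum hr hc.
have B1 : 0 < `|B| + 1 by have := normr_ge0 B; lra.
have [N0 hN] := small_expr hr (divr_gt0 e0 B1).
exists (fun t => symsum N0 (fun n => (r ^+ `|n|%N)%:C * fc c n * en n t)); split.
  by apply: cont_symsum => n; exact: cont_Zen.
move=> y; apply: (le_trans (hB y N0)); have := hN N0 (leqnn _); rewrite ltr_pdivlMr// => h.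
have : 0 <= r ^+ N0 by rewrite exprn_ge0//; case/andP: hr.
by have := ler_norm B; nra.
Qed.

Lemma cont_pk r u : 0 <= r < 1 -> cintb u -> continuous (pk r u).
Proof.
move=> hr hu t; have h : continuous (PK r (fun s => (u s)%:C)).
  by apply: cont_PK => //; exact: cintbC_real.
have := @ccRe _ _ _ t (h t).
by rewrite (_ : (fun y => _) = pk r u)//; apply/funext => y; rewrite PK_real.
Qed.

Lemma cintbC_en n : cintbC (en n).
Proof. by apply: cintbC_cont; exact: cont_en. Qed.

Lemma fc_symsum N (G : int -> C) n : (`|n| <= N)%N ->
  fc (fun t => symsum N (fun m => G m * en m t)) n = G n.
Proof.
move=> hn; rewrite fc_sum; last by move=> i _; apply: cintbC_cont; exact: cont_Zen.
rewrite -[RHS](symsum_delta (N := N) (m := n))//; apply: eq_bigr => i _.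
rewrite fcZ; last exact: cintbC_en.
by rewrite fc_en [n == _]eq_sym; case: eqP => [->|]; rewrite ?mulr1 ?mulr0.
Qed.

Lemma fc_PK r c n : 0 <= r < 1 -> cintbC c -> fc (PK r c) n = (r ^+ `|n|%N)%:C * fc c n.
Proof.
move=> hr hc; have [B hB] := PK_sum hr hc.
apply: nc_small_eq => e e0.
have B1 : 0 < 2 * (`|B| + 1) by have := normr_ge0 B; lra.
have [N0 hN] := small_expr hr (divr_gt0 e0 B1).
pose N := maxn N0 `|n|%N; have {hN}hN := hN N (leq_maxl _ _).
rewrite -(@fc_symsum N (fun m => (r ^+ `|m|%N)%:C * fc c m) n) ?leq_maxr//.
have h := @fc_close _ (PK r c) (fun t => symsum N (fun m => (r ^+ `|m|%N)%:C * fc c m * en m t)) n (B * r ^+ N).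
apply: (le_lt_trans (h _ _ _)).
- by apply: cintbC_cont; exact: cont_PK.
- by apply: cintbC_cont; apply: cont_symsum => m; exact: cont_Zen.
- by move=> t _; exact: hB.
- move: hN; rewrite ltr_pdivlMr// => hN.
  have : 0 <= r ^+ N by rewrite exprn_ge0//; case/andP: hr.
  by have := ler_norm B; nra.
Qed.

(** The Poisson integral is the sum of a series formed with the Fourier coefficients. *)
Lemma PK_fc_eq r c d t : 0 <= r < 1 -> cintbC c -> cintbC d -> (forall n, fc c n = fc d n) ->
  PK r c t = PK r d t.
Proof.
move=> hr hc hd h; apply: PK_eq => // e e0.
have [N0 H] := PK_cvg t hr hd e0; exists N0 => N /H.
by rewrite (@eq_symsum _ N _ (fun n => (r ^+ `|n|%N)%:C * fc c n * en n t))// => n; rewrite h.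
Qed.

Lemma ci_pk r u : 0 <= r < 1 -> cintb u -> ci (pk r u) = ci u.
Proof.
move=> hr hu; have h := fc_PK 0 hr (cintbC_real hu).
have i2 : ((2 * pi)^-1)%:C != 0 :> C by rewrite -nc_gt0 ncR normr_gt0 gt_eqF// invr_gt0 pi2_gt0.
apply: complexI; apply: (mulfI i2); move: h; rewrite expr0 mul1r /fc.
rewrite (@eq_cint _ _ (fun t => (pk r u t)%:C)); last by move=> t _; rewrite PK_real mul0r oppr0 expi0 mulr1.
rewrite [X in _ = _ * X -> _](@eq_cint _ _ (fun t => (u t)%:C)); last by move=> t _; rewrite mul0r oppr0 expi0 mulr1.
by rewrite !cint_real.
Qed.

Lemma pkB r u v t : 0 <= r < 1 -> cintb u -> cintb v ->
  pk r (fun s => u s - v s) t = pk r u t - pk r v t.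
Proof.
move=> hr hu hv; rewrite /pk -mulrBr -ciB; try exact: cintb_pk.
by congr (_ * _); apply: eq_ci => s _; rewrite mulrBr.
Qed.

Lemma pk_norm_le r u t : 0 <= r < 1 -> cintb u -> `|pk r u t| <= pk r (fun s => `|u s|) t.
Proof.
move=> hr hu; have i2pi : 0 <= (2 * pi)^-1 :> R by rewrite invr_ge0 (ltW (@pi2_gt0 R)).
rewrite /pk normrM ger0_norm// ler_wpM2l//; apply: le_trans (norm_ci _) _; first exact: cintb_pk.
rewrite le_eqVlt; apply/orP; left; apply/eqP; apply: eq_ci => s _.
by rewrite normrM ger0_norm// pker_ge0.
Qed.

Lemma pk_contract r u : 0 <= r < 1 -> cintb u -> ci (fun t => `|pk r u t|) <= ci (fun t => `|u t|).
Proof.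
move=> hr hu; rewrite -(ci_pk hr (cintb_norm hu)); apply: le_ci.
- by apply: cintb_norm; apply: cintb_cont; exact: cont_pk.
- by apply: cintb_cont; apply: cont_pk => //; exact: cintb_norm.
- by move=> t _; exact: pk_norm_le.
Qed.

(** Continuous functions are dense, but [pk_approx] needs equal values at both ends of the
    interval of angles. A density proportional to the Poisson kernel at a radius close to 1 has
    the value 1 at both ends and a small integral; multiplying by one minus this function makes
    both values 0. *)
Lemma L1_dense u e : cintb u -> 0 < e ->
  exists g, [/\ continuous g, g 0 = g (2 * pi) & ci (fun t => `|u t - g t|) <= e].
Proof.
move=> hu e0; have e2 : 0 < e / 2 by rewrite divr_gt0.
have [g_ [cg ig]] := approximation_continuous_integrable m_ang leb_ang_fin hu.
move=> /fine_cvgP[_ /cvgrPdist_lt /(_ _ e2)[n _ /(_ n (leqnn n))]].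
rewrite sub0r normrN => hn.
pose h := g_ n; have ch : continuous h := cg n.
have hh : ci (fun t => `|u t - h t|) < e / 2.
  by apply: le_lt_trans hn; rewrite /circle_integral /Rintegral /comp ler_norm.
have [M hM] := cont_bdd_ang ch.
have M0 : 0 <= M by apply: le_trans (hM 0 _) => //; apply/angP; rewrite lexx (ltW (@pi2_gt0 R)).
(* The integral of [k] is [2 * pi * dl / (2 - dl)], so this choice makes [M * ci k] small. *)
pose dl := Num.min (1 / 2) (e / 2 / (M * (2 * pi) + 1)).
have MP : 0 < M * (2 * pi) + 1 by have := @pi2_gt0 R; nra.
have dl0 : 0 < dl by rewrite lt_min !divr_gt0.
have dl1 : dl <= 1 / 2 by rewrite ge_min lexx.
pose r := 1 - dl; have hr : 0 <= r < 1 by rewrite /r; lra.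
pose k t := (1 - r) / (1 + r) * pker r t.
have r1 : 0 < 1 + r by rewrite /r; lra.
have r2 : 0 < 1 - r by rewrite /r; lra.
have ck : continuous k by move=> t; apply: cvgM; [exact: cvg_cst|exact: cont_pker].
have pk0 : pker r 0 = (1 + r) / (1 - r).
  rewrite pkerE expi0 mulr1 -RCB ncR real_normK ?num_real//.
  by field; rewrite gt_eqF.
have k0 : k 0 = 1 by rewrite /k pk0; field; rewrite !gt_eqF.
have k2 : k (2 * pi) = 1.
  have E : pker r (2 * pi) = pker r 0 by rewrite /pker expi_2pi expi0.
  have -> : k (2 * pi) = k 0 by rewrite /k E.
  exact: k0.
have kpos t : 0 <= k t by rewrite /k mulr_ge0 ?pker_ge0// divr_ge0// ltW.
have cik : ci k <= 2 * pi * dl.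
  rewrite ciZ; last by apply: cintb_cont; exact: cont_pker.
  have -> : ci (pker r) = 2 * pi.
    by rewrite -(ci_pker 0 hr); apply: eq_ci => s _; rewrite sub0r pkerN.
  rewrite mulrC ler_wpM2l ?(ltW (@pi2_gt0 R))// ler_pdivrMr// /r; nra.
exists (fun t => h t * (1 - k t)); split.
- by move=> t; apply: cvgM; [exact: ch|apply: cvgB; [exact: cvg_cst|exact: ck]].
- by rewrite k0 k2 subrr !mulr0.
have ih := cintb_cont ch; have ik := cintb_cont ck.
apply: (@le_trans _ _ (ci (fun t => `|u t - h t| + M * k t))).
  apply: le_ci.
  - apply: cintb_norm; apply: cintbB => //; apply: cintb_Mcont => //.
    by move=> t; apply: cvgB; [exact: cvg_cst|exact: ck].
  - by apply: cintbD; [apply: cintb_norm; exact: cintbB|exact: cintbZ].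
  - move=> t ht; have -> : u t - h t * (1 - k t) = (u t - h t) + h t * k t by ring.
    rewrite (le_trans (ler_normD _ _))// lerD2l normrM (ger0_norm (kpos t)).
    by rewrite ler_wpM2r//; exact: hM.
rewrite ciD; [|by apply: cintb_norm; exact: cintbB|exact: cintbZ].
rewrite ciZ//.
have hdl : dl <= e / 2 / (M * (2 * pi) + 1) by rewrite ge_min lexx orbT.
move: hdl; rewrite ler_pdivlMr// => hdl.
have : M * ci k <= M * (2 * pi * dl) by rewrite ler_wpM2l.
nra.
Qed.

(** Taking Poisson integrals contracts the L^1 norm, and on a dense set of continuous functions
    it converges uniformly. *)
Lemma pk_L1 u e : cintb u -> 0 < e ->
  exists2 r0, 0 <= r0 < 1 & forall r, r0 <= r < 1 -> ci (fun t => `|pk r u t - u t|) <= e.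
Proof.
move=> hu e0; have e3 : 0 < e / 3 by rewrite divr_gt0.
have [g [cg g0 hg]] := L1_dense hu e3.
have e6 : 0 < e / 3 / (2 * pi) by rewrite divr_gt0// pi2_gt0.
have [r0 hr0 H] := pk_approx cg g0 e6; exists r0 => // r hr.
have hr' : 0 <= r < 1 by move: hr hr0 => /andP[h1 ->] /andP[h2 _]; rewrite (le_trans h2).
have ig := cintb_cont cg.
have iu := cintb_cont (cont_pk hr' hu); have igp := cintb_cont (cont_pk hr' ig).
have i1 : cintb (fun t => `|u t - g t|) by apply: cintb_norm; exact: cintbB.
have i2 : cintb (fun t => `|pk r (fun s => u s - g s) t|).
  by apply: cintb_norm; apply: cintb_cont; apply: cont_pk => //; exact: cintbB.
apply: (@le_trans _ _ (ci (fun t => `|pk r (fun s => u s - g s) t| + (e / 3 / (2 * pi) + `|u t - g t|)))).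
  apply: le_ci.
  - by apply: cintb_norm; exact: cintbB.
  - by apply: cintbD => //; apply: cintbD => //; exact: cintb_cst.
  - move=> t ht; rewrite pkB//.
    have -> : pk r u t - u t = (pk r u t - pk r g t) + ((pk r g t - g t) - (u t - g t)) by ring.
    rewrite (le_trans (ler_normD _ _))// lerD2l (le_trans (ler_normB _ _))// lerD2r.
    exact: H.
rewrite ciD//; last by apply: cintbD => //; exact: cintb_cst.
rewrite ciD ?ci_cst//; last exact: cintb_cst.
rewrite divfK ?gt_eqF ?pi2_gt0//.
have := pk_contract hr' (cintbB hu ig); lra.
Qed.

End PoissonL1.

(** * Power series in the unit disk *)

Section PowerSeries.
Context {R : realType}.
Notation C := (Cplx R).
Implicit Types (z w h : C) (t s x r : R) (a : nat -> C) (b : nat -> R) (N : nat).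

Lemma nc_tri3 (x y u v : C) : nc (x - y) <= nc (x - u) + nc (u - v) + nc (v - y).
Proof. by apply: le_trans (ncBD _ _ v) _; rewrite lerD2r; exact: ncBD. Qed.

Lemma nc_tri3_lt (x y u v : C) e : nc (x - u) <= e / 4 -> nc (u - v) < e / 2 -> nc (v - y) <= e / 4 ->
  nc (x - y) < e.
Proof. by move=> h1 h2 h3; have := nc_tri3 x y u v; lra. Qed.

Lemma bsum_cvg b T : (forall k, 0 <= b k) -> (forall N, \sum_(k < N) b k <= T) ->
  exists s, (fun N => \sum_(k < N) b k) @ \oo --> s.
Proof.
move=> b0 bT; have h : cvgn (fun N => \sum_(k < N) b k).
  apply: nondecreasing_is_cvgn.
  - apply/nondecreasing_seqP => n; by rewrite big_ord_recr /= lerDl.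
  - by exists T => _ [n _ <-].
by move/cvg_ex : h.
Qed.

(** Convergence of series by its definition, which suits estimates of tails that are uniform in
    a parameter. *)
Definition cvs (u : nat -> C) (l : C) : Prop :=
  forall e, 0 < e -> exists N0, forall N, (N0 <= N)%N -> nc (l - \sum_(k < N) u k) < e.

Lemma cvs_unique u l l' : cvs u l -> cvs u l' -> l = l'.
Proof.
move=> h1 h2; apply: nc_small_eq => e e0; have e2 : 0 < e / 2 by rewrite divr_gt0.
have [N1 {}h1] := h1 _ e2; have [N2 {}h2] := h2 _ e2.
have {}h1 := h1 _ (leq_maxl N1 N2); have {}h2 := h2 _ (leq_maxr N1 N2).
by rewrite (splitr e) (le_lt_trans (ncBD _ _ _) (ltrD h1 _))// ncB; exact: h2.
Qed.

Lemma sum_split_ge (F : nat -> C) (N M : nat) : (N <= M)%N ->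
  \sum_(k < M) F k - \sum_(k < N) F k = \sum_(N <= k < M) F k.
Proof.
by move=> NM; rewrite -!(big_mkord xpredT) (big_cat_nat (n := N))//=; ring.
Qed.
Lemma sumR_split_ge (F : nat -> R) (N M : nat) : (N <= M)%N ->
  \sum_(k < M) F k - \sum_(k < N) F k = \sum_(N <= k < M) F k.
Proof.
by move=> NM; rewrite -!(big_mkord xpredT) (big_cat_nat (n := N))//=; ring.
Qed.

(** The Weierstrass test. Adding the majorant makes the real and imaginary parts series of
    nonnegative terms with bounded partial sums. *)
Lemma cvs_exists u b T : (forall k, nc (u k) <= b k) -> (forall N, \sum_(k < N) b k <= T) ->
  exists l, cvs u l.
Proof.
move=> ub bT; have b0 k : 0 <= b k by rewrite (le_trans (nc_ge0 _) (ub k)).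
have [s cs] := bsum_cvg b0 bT.
have part (g : C -> R) : (forall z, `|g z| <= nc z) ->
  exists l : R, (fun N => \sum_(k < N) g (u k)) @ \oo --> l.
  move=> gn; have gb k : - b k <= g (u k) <= b k by rewrite -ler_norml (le_trans (gn _)).
  have p0 k : 0 <= g (u k) + b k by have := gb k; lra.
  have pT N : \sum_(k < N) (g (u k) + b k) <= T + T.
    apply: (@le_trans _ _ (\sum_(k < N) (b k + b k))); last by rewrite big_split /= lerD ?bT.
    by apply: ler_sum => k _; have := gb k; lra.
  have [l cl] := bsum_cvg p0 pT; exists (l - s).
  have -> : (fun N => \sum_(k < N) g (u k)) = (fun N => \sum_(k < N) (g (u k) + b k) - \sum_(k < N) b k).
    by apply/funext => N; rewrite big_split /= addrK.
  exact: cvgB.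
have [x cx] := part _ Re_le_nc; have [y cy] := part _ Im_le_nc.
exists (x +i* y) => e e0.
have /cvgCP/(_ e e0)[N0 _ H] : (fun N => \sum_(k < N) u k : C) @ \oo --> (x +i* y : C).
  apply/cvgC_ReIm; split => /=.
  - have -> : (Re \o fun N => \sum_(k < N) u k : C) = (fun N => \sum_(k < N) Re (u k)).
      by apply/funext => N; rewrite /= Re_sum.
    exact: cx.
  - have -> : (Im \o fun N => \sum_(k < N) u k : C) = (fun N => \sum_(k < N) Im (u k)).
      by apply/funext => N; rewrite /= Im_sum.
    exact: cy.
by exists N0 => N /H.
Qed.

Definition series_limit u : C := xget 0 [set l | cvs u l].
Lemma series_limitP u b T : (forall k, nc (u k) <= b k) -> (forall N, \sum_(k < N) b k <= T) -> cvs u (series_limit u).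
Proof. by move=> h1 h2; have [l hl] := cvs_exists h1 h2; exact: (@xgetPex _ 0 [set l | cvs u l] (ex_intro _ l hl)). Qed.

Lemma cvs_tail u l b T N : cvs u l -> (forall k, nc (u k) <= b k) ->
  (forall M, (N <= M)%N -> \sum_(N <= k < M) b k <= T) -> nc (l - \sum_(k < N) u k) <= T.
Proof.
move=> hl ub bT; apply: le_eps => e e0; have [N0 H] := hl _ e0.
pose M := maxn N N0; have {}H := H _ (leq_maxr N N0); rewrite -/M in H.
apply: (le_trans (ncBD _ _ (\sum_(k < M) u k))); rewrite addrC lerD ?(ltW H)//.
rewrite sum_split_ge ?leq_maxl// (le_trans (nc_sum _ _ _))//.
apply: le_trans (bT M (leq_maxl _ _)); apply: ler_sum => k _; exact: ub.
Qed.

Lemma btail_small b T e : (forall k, 0 <= b k) -> (forall N, \sum_(k < N) b k <= T) -> 0 < e ->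
  exists N0, forall N M, (N0 <= N)%N -> (N <= M)%N -> \sum_(N <= k < M) b k <= e.
Proof.
move=> b0 bT e0; have [s cs] := bsum_cvg b0 bT.
have e2 : 0 < e / 2 by rewrite divr_gt0.
move/cvgrPdist_lt : cs => /(_ _ e2)[N0 _ H]; exists N0 => N M hN hM.
rewrite -sumR_split_ge//; have := H N hN; have := H M (leq_trans hN hM) => /=.
by rewrite !ltr_norml; lra.
Qed.

Fact ps_key : unit. Proof. exact: tt. Qed.
(** Locked, since conversion would otherwise unfold the chosen limit. *)
Definition ps a z : C := locked_with ps_key (series_limit (fun k => a k * z ^+ k)).
Lemma psE a z : ps a z = series_limit (fun k => a k * z ^+ k).
Proof. by rewrite /ps unlock. Qed.
(** The radius of convergence is at least 1. *)
Definition rad1 a : Prop := forall r, 0 <= r < 1 -> exists M, forall n, nc (a n) * r ^+ n <= M.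

Lemma geo_sum_le r N : 0 <= r < 1 -> \sum_(k < N) r ^+ k <= (1 - r)^-1.
Proof.
move=> /andP[r0 r1]; have r2 : 0 < 1 - r by lra.
rewrite -[leRHS]mul1r ler_pdivlMr// mulrC.
have := subrXX 1 r N; rewrite expr1n => h.
rewrite (_ : \sum_(k < N) r ^+ k = \sum_(k < N) 1 ^+ (N.-1 - k) * r ^+ k); last first.
  by apply: eq_bigr => k _; rewrite expr1n mul1r.
by rewrite -h lerBlDr lerDl exprn_ge0.
Qed.

(** Comparison with a geometric series, through a radius [q] between [r] and 1. *)
Lemma rad1_sum a r : rad1 a -> 0 <= r < 1 -> exists Q, forall N, \sum_(k < N) nc (a k) * r ^+ k <= Q.
Proof.
move=> ha /andP[r0 r1]; pose q := (1 + r) / 2.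
have q1 : 0 <= q < 1 by rewrite /q; lra.
have [M hM] := ha _ q1; have q0 : 0 < q by rewrite /q; lra.
have M0 : 0 <= M by apply: le_trans (hM 0%N); rewrite mulr_ge0 ?nc_ge0 ?exprn_ge0//; lra.
have rq : 0 <= r / q < 1 by rewrite divr_ge0 ?(ltW q0)//= ltr_pdivrMr// mul1r /q; lra.
exists (M * (1 - r / q)^-1) => N.
apply: (@le_trans _ _ (\sum_(k < N) M * (r / q) ^+ k)).
  apply: ler_sum => k _; have -> : r ^+ k = q ^+ k * (r / q) ^+ k.
    by rewrite -exprMn mulrC divfK// gt_eqF.
  rewrite mulrA ler_wpM2r//; apply: exprn_ge0; by case/andP: rq.
by rewrite -mulr_sumr ler_wpM2l// geo_sum_le.
Qed.

Section Conv.
Variables (a : nat -> C) (r Q : R).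
Hypotheses (r0 : 0 <= r) (hQ : forall N, \sum_(k < N) nc (a k) * r ^+ k <= Q).

Let term_le z k : nc z <= r -> nc (a k * z ^+ k) <= nc (a k) * r ^+ k.
Proof.
move=> zr; rewrite ncM ncX ler_wpM2l ?nc_ge0//.
by rewrite lerXn2r ?nnegrE ?nc_ge0.
Qed.

Lemma ps_cvs z : nc z <= r -> cvs (fun k => a k * z ^+ k) (ps a z).
Proof. by move=> zr; rewrite psE; apply: (series_limitP (T := Q)) hQ => k; exact: term_le. Qed.

Lemma ps_tail e : 0 < e -> exists N0, forall N z, (N0 <= N)%N -> nc z <= r ->
  nc (ps a z - \sum_(k < N) a k * z ^+ k) <= e.
Proof.
move=> e0; have b0 k : 0 <= nc (a k) * r ^+ k by rewrite mulr_ge0 ?nc_ge0 ?exprn_ge0.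
have [N0 H] := btail_small b0 hQ e0; exists N0 => N z hN zr.
apply: (cvs_tail (ps_cvs zr) (fun k => term_le k zr)) => M; exact: H.
Qed.
End Conv.

Lemma rad1_cvs a z : rad1 a -> nc z < 1 -> cvs (fun k => a k * z ^+ k) (ps a z).
Proof.
move=> ha z1; have h : 0 <= nc z < 1 by rewrite nc_ge0.
by have [Q hQ] := rad1_sum ha h; exact: (ps_cvs (nc_ge0 z) hQ).
Qed.

Lemma ps_eq a z l : rad1 a -> nc z < 1 -> cvs (fun k => a k * z ^+ k) l -> ps a z = l.
Proof. by move=> ha z1; apply: cvs_unique; exact: rad1_cvs. Qed.

Lemma ps0 a : ps a 0 = a 0%N.
Proof.
have h : cvs (fun k => a k * 0 ^+ k) (a 0%N).
  move=> e e0; exists 1%N => N N1; case: N N1 => // N _.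
  rewrite big_ord_recl expr0 mulr1 big1 ?addr0 ?subrr ?nc0// => i _.
  by rewrite expr0n /= mulr0.
rewrite psE; have h2 := @xgetPex _ 0 [set l | cvs (fun k => a k * 0 ^+ k) l] (ex_intro _ _ h).
exact: cvs_unique h2 h.
Qed.

Lemma rad1_bdd a B : (forall n, nc (a n) <= B) -> rad1 a.
Proof.
move=> h r /andP[r0 r1]; exists B => n.
apply: (@le_trans _ _ (nc (a n) * 1)); last by rewrite mulr1.
by rewrite ler_wpM2l ?nc_ge0// exprn_ile1// ltW.
Qed.

Lemma rad1_nat a : rad1 a -> rad1 (fun n => (n%:R : R)%:C * a n).
Proof.
move=> ha r /andP[r0 r1]; pose q := (1 + r) / 2.
have q1 : 0 <= q < 1 by rewrite /q; lra.
have [M hM] := ha _ q1; have q0 : 0 < q by rewrite /q; lra.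
have M0 : 0 <= M by apply: le_trans (hM 0%N); rewrite mulr_ge0 ?nc_ge0 ?exprn_ge0//; lra.
have rq : 0 <= r / q < 1 by rewrite divr_ge0 ?(ltW q0)//= ltr_pdivrMr// mul1r /q; lra.
have /andP[y0 y1] := rq.
exists ((1 - r / q)^-1 * M) => n.
have -> : r ^+ n = (r / q) ^+ n * q ^+ n by rewrite -exprMn divfK// gt_eqF.
have hn : n%:R * (r / q) ^+ n <= (1 - r / q)^-1.
  apply: le_trans (geo_sum_le n rq).
  rewrite mulr_natl -[X in _ *+ X](card_ord n) -sumr_const; apply: ler_sum => k _.
  by apply: ler_wiXn2l; [exact: y0|exact: ltW|exact/ltnW/ltn_ord].
rewrite ncM ncR ger0_norm// mulrACA; apply: ler_pM => //.
- by rewrite mulr_ge0 ?exprn_ge0.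
- by rewrite mulr_ge0 ?nc_ge0 ?exprn_ge0 ?(ltW q0).
Qed.

(** The coefficients of the derivative ([dps]) and of the primitive ([ips]) of a power series.
    *)
Definition dps a n : C := (n.+1%:R : R)%:C * a n.+1.
Definition ips a n : C := if n is k.+1 then (k.+1%:R : R)^-1%:C * a k else 0.

Lemma rad1_dps a : rad1 a -> rad1 (dps a).
Proof.
move=> /rad1_nat ha r /andP[r0 r1]; pose q := (1 + r) / 2.
have q1 : 0 <= q < 1 by rewrite /q; lra.
have [M hM] := ha _ q1; have q0 : 0 < q by rewrite /q; lra.
exists (M / q) => n; rewrite ler_pdivlMr//; apply: le_trans (hM n.+1).
rewrite -mulrA ler_wpM2l ?nc_ge0// exprSr ler_wpM2r ?(ltW q0)//.
by rewrite lerXn2r ?nnegrE ?(ltW q0)// /q; lra.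
Qed.

Lemma rad1_ips a : rad1 a -> rad1 (ips a).
Proof.
move=> ha r /[dup] hr /andP[r0 r1]; have [M hM] := ha _ hr; exists M => n.
have M0 : 0 <= M by apply: le_trans (hM 0%N); rewrite mulr_ge0 ?nc_ge0 ?exprn_ge0//; lra.
case: n => [|n].
  by have -> : ips a 0 = 0 by []; rewrite nc0 mul0r.
rewrite ncM ncR ger0_norm ?invr_ge0// -mulrA ler_pdivrMl ?ltr0n//.
apply: (@le_trans _ _ M); last by rewrite ler_peMl// ler1n.
apply: le_trans (hM n); rewrite ler_wpM2l ?nc_ge0// exprSr.
by rewrite ler_piMr ?exprn_ge0// ltW.
Qed.

Lemma dps_ips a : dps (ips a) = a.
Proof.
apply/funext => n; rewrite /dps /ips mulrA -RCM divff ?mul1r//.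
Qed.

(** The second-order remainder of a power, by induction on the exponent. The factor [p ^+ 2] on
    the left avoids the exponent [k - 2] on the right. *)
Lemma pow_remainder z h p k : 0 <= p -> nc z <= p -> nc (z + h) <= p ->
  nc ((z + h) ^+ k - z ^+ k - h * ((k%:R : R)%:C * z ^+ k.-1)) * p ^+ 2 <= k%:R ^+ 2 * p ^+ k * nc h ^+ 2.
Proof.
move=> p0 zp whp; elim: k => [|k IH].
  by rewrite !expr0 subrr mul0r mulr0 subrr nc0 mul0r expr0n /= !mul0r.
have E : (z + h) ^+ k.+1 - z ^+ k.+1 - h * ((k.+1%:R : R)%:C * z ^+ k.+1.-1) =
  (z + h) * ((z + h) ^+ k - z ^+ k - h * ((k%:R : R)%:C * z ^+ k.-1)) + (k%:R : R)%:C * h ^+ 2 * z ^+ k.-1.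
  have -> : (k.+1%:R : R)%:C = (k%:R : R)%:C + 1 :> C by rewrite -addn1 natrD RCD.
  have -> : k.+1.-1 = k by [].
  rewrite !(exprSr _ k); case: k {IH} => [|k].
    by rewrite !expr0 (_ : (0%:R)%:C = 0 :> C)//; ring.
  have -> : k.+1.-1 = k by [].
  by rewrite !(exprSr _ k); ring.
rewrite E; apply: le_trans (ler_wpM2r _ (ncD _ _)) _; first exact: sqr_ge0.
rewrite mulrDl !ncM !ncX ncR ger0_norm//.
have h1 : nc (z + h) * nc ((z + h) ^+ k - z ^+ k - h * ((k%:R : R)%:C * z ^+ k.-1)) * p ^+ 2 <=
   p * (k%:R ^+ 2 * p ^+ k * nc h ^+ 2).
  by rewrite -mulrA; apply: ler_pM => //; rewrite ?nc_ge0// mulr_ge0 ?nc_ge0 ?sqr_ge0.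
have h2 : k%:R * nc h ^+ 2 * nc z ^+ k.-1 * p ^+ 2 <= k%:R * nc h ^+ 2 * p ^+ k.+1.
  case: k {IH E h1} => [|k]; first by rewrite !mul0r.
  have -> : p ^+ k.+2 = p ^+ k * p ^+ 2 by rewrite -exprD addn2.
  have -> : k.+1.-1 = k by [].
  rewrite -[leLHS]mulrA; apply: ler_wpM2l; first by rewrite mulr_ge0 ?sqr_ge0.
  by rewrite ler_wpM2r ?sqr_ge0// lerXn2r ?nnegrE ?nc_ge0.
apply: (le_trans (lerD h1 h2)).
have hA : 0 <= p * p ^+ k * nc h ^+ 2 by rewrite -exprS mulr_ge0 ?sqr_ge0 ?exprn_ge0.
have hB : 0 <= k%:R * (p * p ^+ k * nc h ^+ 2) by rewrite mulr_ge0.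
rewrite -natr1 (exprS p k).
set A := p * p ^+ k * nc h ^+ 2 in hA hB; set K : R := k%:R in hB *.
have -> : p * (K ^+ 2 * p ^+ k * nc h ^+ 2) = K ^+ 2 * A by rewrite /A; ring.
have -> : K * nc h ^+ 2 * (p * p ^+ k) = K * A by rewrite /A; ring.
have -> : (K + 1) ^+ 2 * (p * p ^+ k) * nc h ^+ 2 = K ^+ 2 * A + 2 * (K * A) + A by rewrite /A; ring.
lra.
Qed.

Lemma nc_split (A B D A' B' D' h : C) d : nc (A - A') <= d -> nc (B - B') <= d -> nc (D - D') <= d ->
  nc (A - B - h * D) <= d * (2 + nc h) + nc (A' - B' - h * D').
Proof.
move=> h1 h2 h3.
have -> : A - B - h * D = (A - A') - (B - B') - h * (D - D') + (A' - B' - h * D') by ring.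
have a1 := ncD ((A - A') - (B - B') - h * (D - D')) (A' - B' - h * D').
have a2 := ncD ((A - A') - (B - B')) (- (h * (D - D'))).
have a3 := ncD (A - A') (- (B - B')).
rewrite !ncN ncM in a2 a3; have a4 : nc h * nc (D - D') <= nc h * d by rewrite ler_wpM2l ?nc_ge0.
lra.
Qed.

(** By [pow_remainder] the remainder is at most [nc h ^+ 2] times the sum of [k^2 |a_k| p^(k -
    2)], which is finite for [p < 1]. *)
Lemma ps_is_derive a z : rad1 a -> nc z < 1 -> is_derive (z : C) 1 (ps a) (ps (dps a) z).
Proof.
move=> ha z1; pose p := (1 + nc z) / 2; have z0 := nc_ge0 z.
have p1 : 0 <= p < 1 by rewrite /p; lra.
have pz : nc z < p by rewrite /p; lra.
have p0 : 0 < p by rewrite /p; lra.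
have [Q hQ] := rad1_sum (rad1_nat (rad1_nat ha)) p1.
have Q0 : 0 <= Q by apply: le_trans (hQ 0%N); rewrite big_ord0.
apply/is_deriveC => e e0.
exists (Num.min (p - nc z) (e * p ^+ 2 / (Q + 1))).
  by rewrite lt_min subr_gt0 pz /= divr_gt0 ?mulr_gt0 ?exprn_gt0//; lra.
move=> h; rewrite lt_min => /andP[hp he].
have whp : nc (z + h) <= p by rewrite (le_trans (ncD _ _))//; lra.
have main : nc (ps a (z + h) - ps a z - h * ps (dps a) z) * p ^+ 2 <= Q * nc h ^+ 2.
  apply: le_eps => d d0.
  have [Q1 hQ1] := rad1_sum ha p1; have [Q2 hQ2] := rad1_sum (rad1_dps ha) p1.
  pose d' := d / (p ^+ 2 * (2 + nc h)).
  have pp : 0 < p ^+ 2 * (2 + nc h) by rewrite mulr_gt0 ?exprn_gt0//; have := nc_ge0 h; lra.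
  have d'0 : 0 < d' by rewrite divr_gt0.
  have [N1 H1] := ps_tail (ltW p0) hQ1 d'0; have [N2 H2] := ps_tail (ltW p0) hQ2 d'0.
  pose N := maxn N1 N2.
  have A1 := H1 N.+1 (z + h) (leq_trans (leq_maxl _ _) (leqnSn _)) whp.
  have A2 := H1 N.+1 z (leq_trans (leq_maxl _ _) (leqnSn _)) (ltW pz).
  have A3 := H2 N z (leq_maxr _ _) (ltW pz).
  have A4 : nc (\sum_(k < N.+1) a k * (z + h) ^+ k - \sum_(k < N.+1) a k * z ^+ k - h * \sum_(k < N) dps a k * z ^+ k) * p ^+ 2 <= Q * nc h ^+ 2.
    have -> : h * \sum_(k < N) dps a k * z ^+ k = \sum_(k < N.+1) h * (a k * ((k%:R : R)%:C * z ^+ k.-1)).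
      rewrite big_ord_recl /= mul0r !mulr0 add0r mulr_sumr; apply: eq_bigr => k _.
      by rewrite /dps /bump /= add1n add0n; ring.
    rewrite -!sumrB.
    have -> : \sum_(i < N.+1) (a i * (z + h) ^+ i - a i * z ^+ i - h * (a i * ((i%:R : R)%:C * z ^+ i.-1))) =
      \sum_(i < N.+1) a i * ((z + h) ^+ i - z ^+ i - h * ((i%:R : R)%:C * z ^+ i.-1)).
      by apply: eq_bigr => i _; ring.
    apply: le_trans (ler_wpM2r _ (nc_sum _ _ _)) _; first exact: sqr_ge0.
    apply: (@le_trans _ _ ((\sum_(k < N.+1) nc ((k%:R : R)%:C * ((k%:R : R)%:C * a k)) * p ^+ k) * nc h ^+ 2)).
      rewrite !mulr_suml; apply: ler_sum => k _; rewrite !ncM !ncR !(ger0_norm (ler0n _ _)).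
      have := pow_remainder k (ltW p0) (ltW pz) whp; move/(ler_wpM2l (nc_ge0 (a k))) => pr.
      rewrite -[leLHS]mulrA; apply: (le_trans pr).
      by rewrite le_eqVlt; apply/orP; left; apply/eqP; ring.
    by rewrite ler_wpM2r ?sqr_ge0.
  have B := nc_split h A1 A2 A3.
  have p2 : 0 <= p ^+ 2 by exact: sqr_ge0.
  apply: (le_trans (ler_wpM2r p2 B)); rewrite mulrDl addrC lerD//.
  rewrite le_eqVlt; apply/orP; left; apply/eqP; rewrite /d'; field.
  by rewrite !gt_eqF//; have := nc_ge0 h; lra.
have h0 := nc_ge0 h; have pp : 0 < p ^+ 2 by rewrite exprn_gt0.
move: he; rewrite ltr_pdivlMr ?(ltr_pwDr)// => he.
rewrite -(ler_pM2r pp); apply: (le_trans main); rewrite expr2.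
have : nc h * (nc h * (Q + 1)) <= nc h * (e * p ^+ 2) by rewrite ler_wpM2l// ltW.
nra.
Qed.

Lemma ps_cont a z : rad1 a -> nc z < 1 -> continuous_at z (ps a).
Proof. by move=> ha z1; apply: is_derive_contC (ps_is_derive ha z1). Qed.

Lemma ps_holo a : rad1 a -> holo (ps a) (ps (dps a)).
Proof.
move=> ha; apply: is_derive_holo => z z1; first exact: ps_cont (rad1_dps ha) z1.
exact: ps_is_derive.
Qed.

(** Continuity on the closed disk, without the subspace topology. *)
Definition cdc (f : C -> C) : Prop := forall z, nc z <= 1 -> forall e, 0 < e ->
  exists2 d, 0 < d & forall w, nc w <= 1 -> nc (w - z) < d -> nc (f w - f z) < e.

Lemma cdcP (f : C -> C) : {within closed_disk, continuous f} <-> cdc f.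
Proof.
split.
- move=> /subspace_continuousP H z z1 e e0.
  have /(cvgCP _)/(_ _ e0) := H z ((closed_diskE z).2 z1).
  rewrite near_withinE => /nbhsCP[d d0 h]; exists d => // w w1 wz.
  by rewrite ncB; apply: h => //; exact/closed_diskE.
- move=> H; apply/subspace_continuousP => z /closed_diskE z1.
  apply/(cvgCP _) => e e0; have [d d0 h] := H z z1 e e0.
  rewrite near_withinE; apply/nbhsCP; exists d => // w wz /closed_diskE w1.
  by rewrite ncB; exact: h.
Qed.

(** The partial sums converge uniformly on the closed disk. *)
Lemma ps_cdc a Q : (forall N, \sum_(k < N) nc (a k) <= Q) -> cdc (ps a).
Proof.
move=> hQ z z1 e e0; have e4 : 0 < e / 4 by rewrite divr_gt0.
have hQ' N : \sum_(k < N) nc (a k) * 1 ^+ k <= Q.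
  by under eq_bigr do rewrite expr1n mulr1; exact: hQ.
have [N0 H] := ps_tail (@ler01 R) hQ' e4.
pose P w := \sum_(k < N0) a k * w ^+ k.
have cP : continuous_at z P.
  apply: ccsum => k _; apply: ccM; first exact: ccst.
  by elim: (k : nat) => [|n IH]; [rewrite (_ : (fun=> _) = fun=> 1); [exact: ccst|apply/funext => y; rewrite expr0]
    |rewrite (_ : (fun y : C => _) = fun y => y * y ^+ n); [apply: ccM; [exact: cvg_id|exact: IH]|apply/funext => y; rewrite exprS]].
have e2 : 0 < e / 2 by rewrite divr_gt0.
move/(cvgCP (nbhs_filter z)) : cP => /(_ _ e2)/nbhsCP[d d0 h]; exists d => // w w1 wz.
have h1 := h w wz; have h2 := H N0 w (leqnn _) w1; have h3 := H N0 z (leqnn _) z1.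
rewrite -/(P w) in h2; rewrite -/(P z) in h3.
rewrite (ncB (P z)) in h1; rewrite (ncB (ps a z)) in h3; exact: (nc_tri3_lt h2 h1 h3).
Qed.

End PowerSeries.

(** * Taylor expansion of holomorphic functions *)

Section Holo.
Context {R : realType}.
Notation C := (Cplx R).
Notation leb := (@lebesgue_measure R).
Notation ang := (@angles R).
Notation ci := (@circle_integral R).
Notation cint := (@circle_cintegral R).
Notation cintbC := (@cintbC R).
Implicit Types (z w h : C) (t s x r : R) (a : nat -> C) (c d : R -> C) (N : nat).

Lemma nc_tri_half z w h e : nc (z - h) < e / 2 -> nc (w - h) < e / 2 -> nc (z - w) < e.
Proof. by move=> h1 h2; have := ncBD z w h; rewrite (ncB h w); lra. Qed.
Lemma nc_tri_third z w h e : 0 < e -> nc (z - h) <= e / 3 -> nc (w - h) < e / 3 -> nc (z - w) < e.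
Proof. by move=> e0 h1 h2; have := ncBD z w h; rewrite (ncB h w); lra. Qed.

Lemma cccomp (T : topologicalType) (f : T -> C) (g : C -> C) (y : T) :
  continuous_at y f -> continuous_at (f y) g -> continuous_at y (fun v => g (f v)).
Proof. exact: continuous_comp. Qed.
Lemma cccompR (T : topologicalType) (f : T -> R) (g : R -> C) (y : T) :
  continuous_at y f -> continuous_at (f y) g -> continuous_at y (fun v => g (f v)).
Proof. exact: continuous_comp. Qed.

Lemma RCV x : (x^-1)%:C = (x%:C)^-1 :> C.
Proof.
have [->|x0] := eqVneq x 0; first by rewrite !invr0.
have xC : x%:C != 0 :> C by rewrite -nc_gt0 ncR normr_gt0.
by apply: (mulfI xC); rewrite -RCM !divff.
Qed.

Lemma polar_unit z : nc z = 1 -> exists2 t, 0 <= t < 2 * pi & z = expi t.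
Proof.
move=> z1; have hz : Re z ^+ 2 + Im z ^+ 2 = 1 by rewrite -ncsq z1 expr1n.
have hre : -1 <= Re z <= 1 by rewrite -ler_norml -z1; exact: Re_le_nc.
have a0 := acos_ge0 hre; have a1 := acos_lepi hre.
have ca : cos (acos (Re z)) = Re z by rewrite acosK.
have sa : sin (acos (Re z)) = `|Im z|.
  by rewrite sin_acos// -sqrtr_sqr; congr Num.sqrt; rewrite -hz; ring.
have p0 := @pi_gt0 R.
case: (leP 0 (Im z)) => h.
- exists (acos (Re z)); first by lra.
  by apply: ceqP => //=; rewrite sa ger0_norm.
- have sm : sin (acos (Re z)) != 0 by rewrite sa normr_eq0 lt_eqF.
  have an0 : acos (Re z) != 0 by apply: contra sm => /eqP ->; rewrite sin0.
  exists (2 * pi - acos (Re z)).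
    by rewrite subr_ge0 ltrBlDr ltrDl lt_neqAle a0 andbT eq_sym an0; lra.
  have E : expi (2 * pi - acos (Re z)) = expi (- acos (Re z)) :> C by rewrite expiD expi_2pi mul1r.
  rewrite E; apply: ceqP; first by rewrite /= cosN ca.
  by rewrite /= sinN sa ltr0_norm// opprK.
Qed.

Lemma polar z : exists2 t, ang t & z = (nc z)%:C * expi t.
Proof.
have [->|z0] := eqVneq z 0.
  by exists 0; [apply/angP; rewrite lexx (ltW (@pi2_gt0 R))|rewrite nc0 mul0r].
have nz : nc z != 0 by rewrite gt_eqF// nc_gt0.
have nzC : (nc z)%:C != 0 :> C by rewrite -nc_gt0 ncR normr_gt0.
have h1 : nc (z / (nc z)%:C) = 1 by rewrite ncM ncV ncR ger0_norm ?nc_ge0// divff.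
have [t ht E] := polar_unit h1.
by exists t; [apply/angP; case/andP: ht => -> /ltW ->|rewrite -E mulrC divfK].
Qed.

(** In polar coordinates the ball is the image of a compact rectangle. *)
Lemma bounded_on_ball (g : C -> C) p : p < 1 -> (forall z, nc z < 1 -> continuous_at z g) ->
  exists B, forall z, nc z <= p -> nc (g z) <= B.
Proof.
move=> p1 cg.
case: (ltP p 0) => p0; first by exists 0 => z zp; have := nc_ge0 z; lra.
pose D : set (R * R) := `[0, p]%classic `*` ang.
have cD : compact D by apply: compact_setX; exact: segment_compact.
have D0 : D !=set0 by exists (0, 0); split => /=; rewrite ?in_itv /= ?lexx//; apply/angP; rewrite lexx (ltW (@pi2_gt0 R)).
pose f (q : R * R) := nc (g (q.1%:C * expi q.2)).
have cf : {within D, continuous f}.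
  apply: continuous_in_subspaceT => q; rewrite inE => -[/= q1 q2].
  apply: (@ccnc _ _ (fun q : R * R => g (q.1%:C * expi q.2)) q).
  have cc : continuous_at q (fun q : R * R => q.1%:C * expi q.2 : C).
    apply: ccM; first by apply: ccR; exact: cvg_fst.
    by apply: ccexpi; exact: cvg_snd.
  apply: (@cccomp _ (fun q : R * R => q.1%:C * expi q.2 : C) g); first exact: cc.
  have /andP[q0 qp] : 0 <= q.1 <= p by move: q1; rewrite in_itv.
  by apply: cg; rewrite nc_rexpi//; exact: le_lt_trans qp p1.
have [q _ hq] := compact_EVT_max D0 cD cf; exists (f q) => z zp.
have [t ht E] := polar z; have := hq (nc z, t); rewrite /f /= -E; apply.
by rewrite inE; split => //=; rewrite in_itv /= nc_ge0.
Qed.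

Lemma mean_value_le (u v : R -> R) (a b B : R) : a <= b -> (forall t, a <= t <= b -> is_derive t 1 u (v t)) ->
  (forall t, a <= t <= b -> `|v t| <= B) -> `|u b - u a| <= B * (b - a).
Proof.
move=> ab hu hv.
have h1 x : x \in `]a, b[ -> is_derive x 1 u (v x).
  by rewrite in_itv /= => /andP[x1 x2]; apply: hu; rewrite !ltW.
have h2 : {within `[a, b], continuous u}.
  apply: continuous_in_subspaceT => x; rewrite inE /= in_itv /= => hx.
  by apply: differentiable_continuous; apply/derivable1_diffP; exact: (@ex_derive _ _ _ _ _ _ _ (hu x hx)).
have [x + ->] := MVT_segment ab h1 h2.
rewrite in_itv /= => hx; rewrite normrM (@ger0_norm _ (b - a)) ?subr_ge0//.
by rewrite ler_wpM2r ?subr_ge0//; exact: hv.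
Qed.

(** The factor 2 comes from applying the mean value theorem to both components. *)
Lemma mean_value_leC c d (a b B : R) : a <= b -> (forall t, a <= t <= b -> cder c t (d t)) ->
  (forall t, a <= t <= b -> nc (d t) <= B) -> nc (c b - c a) <= 2 * B * (b - a).
Proof.
move=> ab hc hd; apply: (le_trans (nc_le_ReIm _)); rewrite !cE.
have h1 : `|Re (c b) - Re (c a)| <= B * (b - a).
  apply: (@mean_value_le (fun t => Re (c t)) (fun t => Re (d t))) => // t ht; first by have [] := hc t ht.
  by apply: le_trans (hd t ht); exact: Re_le_nc.
have h2 : `|Im (c b) - Im (c a)| <= B * (b - a).
  apply: (@mean_value_le (fun t => Im (c t)) (fun t => Im (d t))) => // t ht; first by have [] := hc t ht.
  by apply: le_trans (hd t ht); exact: Im_le_nc.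
by have := lerD h1 h2; lra.
Qed.

Lemma cder_cst_itv c (u v : R) : (forall t, u < t < v -> cder c t 0) ->
  forall x y, u < x < v -> u < y < v -> c x = c y.
Proof.
move=> hc; have main x y : x <= y -> u < x < v -> u < y < v -> c x = c y.
  move=> xy hx hy; apply: nc_small_eq => e e0.
  have := @mean_value_leC c (fun=> 0) x y 0 xy; rewrite mulr0 mul0r ncB => h.
  apply: le_lt_trans (h _ _) e0 => t ht; first by apply: hc; lra.
  by rewrite nc0.
by move=> x y hx hy; case: (leP x y) => [|/ltW] h; [exact: main|exact/esym/main].
Qed.

Lemma cder_seg z w t : cder (fun s => z + s%:C * w) t w.
Proof.
apply: cder_eq (cderD (cder_cst z t) (cderM (cder_real (is_derive_id t 1)) (cder_cst w t))) _.
by rewrite mulr0 addr0 add0r mul1r.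
Qed.

Lemma seg_in z w t p : 0 <= t <= 1 -> nc z <= p -> nc w <= p -> nc (z + t%:C * (w - z)) <= p.
Proof.
move=> /andP[t0 t1] hz hw.
have -> : z + t%:C * (w - z) = (1 - t)%:C * z + t%:C * w by rewrite RCB; ring.
apply: (le_trans (ncD _ _)); rewrite !ncM !ncR !ger0_norm ?subr_ge0//.
have : (1 - t) * nc z <= (1 - t) * p by rewrite ler_wpM2l ?subr_ge0.
have : t * nc w <= t * p by rewrite ler_wpM2l.
lra.
Qed.

Lemma holo_lip (g g' : C -> C) p : holo g g' -> p < 1 ->
  exists2 B, 0 <= B & forall z w, nc z <= p -> nc w <= p -> nc (g w - g z) <= B * nc (w - z).
Proof.
move=> [cg' hg] p1; have [B hB] := bounded_on_ball p1 cg'.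
exists (2 * `|B|); first by rewrite mulr_ge0.
move=> z w hz hw.
have := @mean_value_leC (fun s => g (z + s%:C * (w - z))) (fun s => g' (z + s%:C * (w - z)) * (w - z)) 0 1 (`|B| * nc (w - z)) ler01.
rewrite mul1r mul0r addr0 (_ : z + (w - z) = w); last by ring.
rewrite subr0 mulr1 mulrA; apply.
- move=> t ht; apply: hg (cder_seg _ _ _).
  by apply: le_lt_trans p1; exact: seg_in.
- move=> t ht; rewrite ncM ler_wpM2r ?nc_ge0//; apply: le_trans (ler_norm _).
  by apply: hB; exact: seg_in.
Qed.

Lemma holo_cont (g g' : C -> C) z : holo g g' -> nc z < 1 -> continuous_at z g.
Proof.
move=> hg z1; pose p := (1 + nc z) / 2; have p1 : p < 1 by rewrite /p; lra.
have zp : nc z < p by rewrite /p; lra.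
have [B B0 hB] := holo_lip hg p1.
apply/(cvgCP (nbhs_filter z)) => e e0; apply/nbhsCP.
exists (Num.min (p - nc z) (e / (B + 1))).
  by rewrite lt_min subr_gt0 zp divr_gt0//; lra.
move=> w; rewrite lt_min => /andP[h1 h2].
have wp : nc w <= p by have := nc_distD w z; lra.
rewrite ncB; apply: le_lt_trans (hB _ _ (ltW zp) wp) _.
move: h2; rewrite ltr_pdivlMr; last by lra.
by have := nc_ge0 (w - z); nra.
Qed.

Lemma is_derive_under (G G' : R -> R -> R) (u v r B : R) : u < r < v ->
  (forall p t, u < p < v -> is_derive p 1 (G ^~ t) (G' p t)) ->
  (forall p, u < p < v -> continuous (G p)) ->
  (forall p t, u < p < v -> ang t -> `|G' p t| <= B) ->
  is_derive r 1 (fun p => ci (G p)) (ci (G' r)).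
Proof.
move=> hr hd hc hB.
have inI p : (`]u, v[%classic : set R) p -> u < p < v by rewrite /= in_itv.
have Ir : (`]u, v[%classic : set R) r by rewrite /= in_itv.
have E p t : u < p < v -> partial1of2 G p t = G' p t.
  by move=> hp; rewrite partial1of2E; exact: (@derive_val _ _ _ _ _ _ _ (hd p t hp)).
have intf p : (`]u, v[%classic : set R) p -> leb.-integrable ang (EFin \o G p).
  by move=> /inI hp; exact: cintb_cont (hc p hp).
have der1 p t : (`]u, v[%classic : set R) p -> ang t -> derivable (G ^~ t) p 1.
  by move=> /inI hp _; exact: (@ex_derive _ _ _ _ _ _ _ (hd p t hp)).
have G0 : forall t : R, 0 <= `|B| by [].
have iG : leb.-integrable ang (EFin \o (fun=> `|B|)) by exact: cintb_cst.
have ub p t : (`]u, v[%classic : set R) p -> ang t -> `|partial1of2 G p t| <= `|B|.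
  by move=> /inI hp ht; rewrite E//; apply: le_trans (hB p t hp ht) (ler_norm _).
split.
- exact: (@derivable_under_integral _ _ _ leb G ang m_ang r u v Ir intf der1 (fun=> `|B|) G0 iG ub).
- rewrite -derive1E.
  rewrite (@differentiation_under_integral _ _ _ leb G ang m_ang r u v Ir intf der1 (fun=> `|B|) G0 iG ub).
  by apply: eq_ci => t _; rewrite E.
Qed.

(** The dominated form of differentiation under the integral sign, with a constant majorant. *)
Lemma cder_under (G G' : R -> R -> C) (u v r B : R) : u < r < v ->
  (forall p t, u < p < v -> cder (G ^~ t) p (G' p t)) ->
  (forall p, u < p < v -> continuous (G p)) ->
  (forall p t, u < p < v -> ang t -> nc (G' p t) <= B) ->
  cder (fun p => cint (G p)) r (cint (G' r)).
Proof.
move=> hr hd hc hB; split => /=.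
- apply: (@is_derive_under (fun p t => Re (G p t)) (fun p t => Re (G' p t)) u v r B) => //.
  + by move=> p t hp; have [] := hd p t hp.
  + by move=> p hp; exact: continuousC_Re (hc p hp).
  + by move=> p t hp ht; apply: le_trans (hB p t hp ht); exact: Re_le_nc.
- apply: (@is_derive_under (fun p t => Im (G p t)) (fun p t => Im (G' p t)) u v r B) => //.
  + by move=> p t hp; have [] := hd p t hp.
  + by move=> p hp; exact: continuousC_Im (hc p hp).
  + by move=> p t hp ht; apply: le_trans (hB p t hp ht); exact: Im_le_nc.
Qed.

Lemma is_derive_exprn n r : is_derive r 1 (fun x : R => x ^+ n) (n%:R * r ^+ n.-1).
Proof.
have := @is_deriveX _ _ (id : R -> R) n r 1 1 (is_derive_id r 1).
have -> : (fun x : R => x ^+ n) = id ^+ n by apply/funext => x; rewrite exprfctE.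
move=> h; apply: (@is_derive_eq _ _ _ _ _ _ _ _ h).
by rewrite /GRing.scale /= mulr1 mulr_natl.
Qed.

Lemma cder_radial t r : cder (fun p : R => p%:C * expi t : C) r (expi t).
Proof.
apply: cder_eq (cderM (cder_real (is_derive_id r 1)) (cder_cst _ r)) _.
by rewrite mulr0 addr0 mul1r.
Qed.

Lemma cder_circ r t : cder (fun s : R => r%:C * expi s : C) t (r%:C * ('i * expi t)).
Proof. exact: cderZ (cder_expi t). Qed.

Section Coefficients.
Variables (g g' : C -> C).
Hypothesis hg : holo g g'.
Let J (n : int) r : C := cint (fun t => g (r%:C * expi t) * en (- n) t).
Let J' (n : int) r : C := cint (fun t => g' (r%:C * expi t) * expi t * en (- n) t).

Let ingt r t : 0 <= r < 1 -> nc (r%:C * expi t : C) < 1.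
Proof. by move=> /andP[r0 r1]; rewrite nc_rexpi. Qed.

Lemma cont_circ (f : C -> C) r : 0 <= r < 1 -> (forall z, nc z < 1 -> continuous_at z f) ->
  continuous (fun t => f (r%:C * expi t)).
Proof.
move=> hr cf t; apply: (@cccomp _ (fun t => r%:C * expi t : C) f).
  by apply: ccM; [exact: ccst|exact: cont_expi].
by apply: cf; exact: ingt.
Qed.

Let cg z : nc z < 1 -> continuous_at z g. Proof. exact: (holo_cont hg). Qed.

Let cJ n r : 0 <= r < 1 -> continuous (fun t => g (r%:C * expi t) * en (- n) t).
Proof. by move=> hr t; apply: ccM; [exact: (cont_circ hr cg)|exact: cont_en]. Qed.
Let cJ' n r : 0 <= r < 1 -> continuous (fun t => g' (r%:C * expi t) * expi t * en (- n) t).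
Proof.
move=> hr t; apply: ccM; last exact: cont_en.
by apply: ccM; [apply: (cont_circ hr); case: hg|exact: cont_expi].
Qed.

Let cder_J n r : 0 < r < 1 -> cder (J n) r (J' n r).
Proof.
move=> /andP[r0 r1]; pose q := (1 + r) / 2; have q1 : q < 1 by rewrite /q; lra.
have [B hB] := bounded_on_ball q1 (proj1 hg).
apply: (@cder_under (fun r t => g (r%:C * expi t) * en (- n) t)
  (fun r t => g' (r%:C * expi t) * expi t * en (- n) t) 0 q r B); first by rewrite /q; lra.
- move=> p t /andP[p0 pq]; have p1 : nc (p%:C * expi t : C) < 1 by apply: ingt; lra.
  apply: cder_eq (cderM ((proj2 hg) _ _ _ p1 (cder_radial t p)) (cder_cst _ p)) _.
  by rewrite mulr0 addr0.
- by move=> p hp; apply: cJ; lra.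
- move=> p t /andP[p0 pq] _; rewrite !ncM nc_expi nc_en !mulr1; apply: hB.
  by rewrite nc_rexpi ltW.
Qed.

(* The integrand is the angular derivative of [g (r e^(i t)) e^(- i n t)]. *)
Let ode n r : 0 < r < 1 -> r%:C * J' n r = (n%:~R : R)%:C * J n r.
Proof.
move=> hr; have hr' : 0 <= r < 1 by lra.
have h : cint (fun t => r%:C * 'i * (g' (r%:C * expi t) * expi t * en (- n) t) +
   (- ('i * (n%:~R : R)%:C)) * (g (r%:C * expi t) * en (- n) t)) = 0.
  rewrite (@cint_der _ (fun t => g (r%:C * expi t) * en (- n) t)).
  - by rewrite expi_2pi expi0 en_2pi en_0 subrr.
  - move=> t; apply: cder_eq (cderM ((proj2 hg) _ _ _ (ingt t hr') (cder_circ r t)) (cder_en _ t)) _.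
    by rewrite intrN RCN; ring.
  - move=> t; apply: ccD; apply: ccM; [exact: ccst|exact: cJ'|exact: ccst|exact: cJ].
move: h; rewrite cintD; last 2 first.
- by apply: cintbC_Z; apply: cintbC_cont; exact: cJ'.
- by apply: cintbC_Z; apply: cintbC_cont; exact: cJ.
rewrite !cintZ; last 2 first.
- by apply: cintbC_cont; exact: cJ.
- by apply: cintbC_cont; exact: cJ'.
rewrite -/(J n r) -/(J' n r) => h.
have h2 : 'i * (r%:C * J' n r - (n%:~R : R)%:C * J n r) = 0 :> C by rewrite -[RHS]h; ring.
by move/eqP: h2; rewrite mulf_eq0 (negbTE (@i_neq0 R)) /= subr_eq0 => /eqP.
Qed.

Let J_bdd p : p < 1 -> exists B, forall n r, 0 <= r <= p -> nc (J n r) <= B.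
Proof.
move=> p1; have [B hB] := bounded_on_ball p1 cg; exists (4 * pi * B) => n r /andP[r0 rp].
apply: cint_bound; first by apply: cintbC_cont; apply: cJ; lra.
by move=> t _; rewrite ncM nc_en mulr1; apply: hB; rewrite nc_rexpi.
Qed.

Let half01 : 0 < (1 / 2 : R) < 1. Proof. by lra. Qed.

Let J_neg (m : nat) r : 0 < r < 1 -> J (- m.+1%:Z) r = 0.
Proof.
move=> hr; pose K p : C := (p ^+ m.+1)%:C * J (- m.+1%:Z) p.
have cK p : 0 < p < 1 -> cder K p 0.
  move=> hp; apply: cder_eq (cderM (cder_real (is_derive_exprn m.+1 p)) (cder_J _ hp)) _.
  have := ode (- m.+1%:Z) hp; rewrite intrN RCN => h.
  have -> : (p ^+ m.+1)%:C * J' (- m.+1%:Z) p = (p ^+ m)%:C * (p%:C * J' (- m.+1%:Z) p).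
    by rewrite exprSr RCM mulrA.
  by rewrite h /= RCM; ring.
have Kc p : 0 < p < 1 -> K p = K r by move=> hp; exact: (cder_cst_itv cK).
have [B hB] := @J_bdd (1 / 2) ltac:(lra).
have K0 : K r = 0.
  apply: nc_small_eq => e e0; rewrite subr0.
  have B0 : 0 < `|B| + 1 by have := normr_ge0 B; lra.
  pose p := Num.min (1 / 2) (e / (`|B| + 1) / 2).
  have p0 : 0 < p by rewrite lt_min !divr_gt0.
  have p1 : p <= 1 / 2 by rewrite ge_min lexx.
  have p2 : p <= e / (`|B| + 1) / 2 by rewrite ge_min lexx orbT.
  rewrite -(Kc p); last by lra.
  rewrite ncM ncR ger0_norm ?exprn_ge0 ?(ltW p0)//.
  have h1 := hB (- m.+1%:Z) p ltac:(lra).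
  have h2 : p ^+ m.+1 <= p.
    by rewrite exprSr ler_piMl ?(ltW p0)// exprn_ile1//; lra.
  apply: (@le_lt_trans _ _ (p * (`|B| + 1))).
    by apply: ler_pM; rewrite ?nc_ge0 ?exprn_ge0 ?(ltW p0)//; have := ler_norm B; lra.
  rewrite -ltr_pdivlMr//; lra.
have : (r ^+ m.+1)%:C != 0 :> C.
  by rewrite -nc_gt0 ncR normr_gt0 expf_neq0// gt_eqF//; case/andP: hr.
by move/eqP: K0; rewrite /K mulf_eq0 => /orP[/eqP -> |/eqP ->]//; rewrite eqxx.
Qed.

Let J_pos : exists a, forall (m : nat) r, 0 < r < 1 -> J m%:Z r = a m * (r ^+ m)%:C.
Proof.
exists (fun m => ((1 / 2) ^+ m : R)^-1%:C * J m%:Z (1 / 2)) => m r hr.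
pose K p : C := (p ^+ m)^-1%:C * J m%:Z p.
have cK p : 0 < p < 1 -> cder K p 0.
  move=> hp; have p0 : p != 0 by rewrite gt_eqF//; case/andP: hp.
  have dX : is_derive p 1 (fun x => (x ^+ m)^-1) (- (p ^+ m) ^- 2 * (m%:R * p ^+ m.-1)).
    by apply: (@is_deriveVr _ (fun x => x ^+ m)); [rewrite expf_neq0|exact: is_derive_exprn].
  apply: cder_eq (cderM (cder_real dX) (cder_J _ hp)) _.
  have pC : p%:C != 0 :> C by rewrite -nc_gt0 ncR normr_gt0.
  have h : J' m%:Z p = (m%:R : R)%:C * J m%:Z p / p%:C.
    by apply: (mulfI pC); rewrite ode//; field.
  have -> : - (p ^+ m) ^- 2 * (m%:R * p ^+ m.-1) = - (p ^+ m)^-1 * (m%:R / p).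
    case: m {K dX h} => [|m]; first by rewrite !mul0r !mulr0.
    have -> : m.+1.-1 = m by [].
    have X0 : p ^+ m != 0 by rewrite expf_neq0.
    by rewrite (exprSr p m); move: X0; set X := p ^+ m => X0; field; rewrite p0 X0.
  rewrite h (_ : (_ * _)%:C = - ((p ^- m)%:C * ((m%:R : R)%:C / p%:C)) :> C); last by rewrite -RCV -!RCM -RCN mulNr.
  by ring.
have e := cder_cst_itv cK hr half01.
have rm : r ^+ m != 0 by rewrite expf_neq0// gt_eqF//; case/andP: hr.
by rewrite -/(K (1 / 2)) -e /K mulrAC -RCM mulVf// mul1r.
Qed.

(** Let [J n r] be the integral of [g (r e^(i t)) e^(- i n t)]. Differentiating in [r] under the
    integral and integrating by parts in [t] give [r J' = n J], so [J n r] is a multiple of [r ^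
    n]; it is bounded near 0, so it vanishes for negative [n]. *)
Lemma holo_fc : exists a, rad1 a /\ forall r n, 0 < r < 1 ->
  fc (fun t => g (r%:C * expi t)) n = if n is Posz m then a m * (r ^+ m)%:C else 0.
Proof.
have [a ha] := J_pos.
have E r n : 0 < r < 1 -> fc (fun t => g (r%:C * expi t)) n =
    ((2 * pi)^-1)%:C * J n r.
  by move=> hr; congr (_ * _); apply: eq_cint => t _; rewrite enN.
exists (fun m => ((2 * pi)^-1)%:C * a m); split.
- move=> r /andP[r0 r1]; pose q := (1 + r) / 2; have q1 : q < 1 by rewrite /q; lra.
  have q0 : 0 < q by rewrite /q; lra.
  have hq : 0 < q < 1 by rewrite q0.
  have [B hB] := J_bdd q1; exists (`|(2 * pi)^-1| * B) => n.
  have hn := hB n%:Z q; rewrite ha// in hn.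
  rewrite ncM ncR -mulrA ler_wpM2l//; apply: le_trans (hn _); last by rewrite lexx (ltW q0).
  rewrite ncM ncR ger0_norm ?exprn_ge0 ?(ltW q0)// ler_wpM2l ?nc_ge0//.
  by rewrite lerXn2r ?nnegrE ?(ltW q0)// /q; lra.
- move=> r [m|m] hr; rewrite E//; first by rewrite ha// mulrA.
  by rewrite NegzE J_neg// mulr0.
Qed.
End Coefficients.

(** Without negative coefficients, the series of the Poisson integral is a power series. *)
Lemma PK_ps c a t r : 0 <= r < 1 -> cintbC c -> rad1 a ->
  (forall n, fc c n = if n is Posz m then a m else 0) ->
  PK r c t = ps a (r%:C * expi t).
Proof.
move=> hr hc ha hn; apply: PK_eq => // e e0; have /andP[r0 r1] := hr.
have w1 : nc (r%:C * expi t : C) < 1 by rewrite nc_rexpi.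
have [N0 H] := rad1_cvs ha w1 e0; exists N0 => N hN.
have -> : symsum N (fun n => (r ^+ `|n|%N)%:C * fc c n * en n t) =
   \sum_(k < N.+1) a k * (r%:C * expi t) ^+ k; last by apply: H; exact: leqW.
rewrite symsumE big_ord_recl; congr (_ + _).
  by rewrite hn /= !expr0 en0 mulr1 mul1r mulr1.
apply: eq_bigr => k _; rewrite !hn /= mulr0 mul0r addr0.
by rewrite exprMn -RCX -en_nat; ring.
Qed.

Lemma ps_dilate a r z : rad1 a -> 0 <= r <= 1 -> nc z < 1 ->
  ps (fun m => a m * (r ^+ m)%:C) z = ps a (r%:C * z).
Proof.
move=> ha /andP[r0 r1] z1.
have w1 : nc (r%:C * z) < 1.
  by rewrite ncM ncR ger0_norm// (le_lt_trans _ z1)// ler_piMl ?nc_ge0.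
have h : rad1 (fun m => a m * (r ^+ m)%:C).
  move=> q hq; have [M hM] := ha q hq; exists M => n; apply: le_trans (hM n).
  rewrite ncM ncR ger0_norm ?exprn_ge0// ler_wpM2r ?exprn_ge0//; first by case/andP: hq.
  by rewrite ler_piMr ?nc_ge0// exprn_ile1.
apply: ps_eq => // e e0; have [N0 H] := rad1_cvs ha w1 e0; exists N0 => N hN.
rewrite (eq_bigr (fun k : 'I_N => a k * (r%:C * z) ^+ k)); first exact: H.
by move=> k _; rewrite exprMn RCX mulrA.
Qed.

(** On the circle of radius [r], [holo_fc] and [PK_ps] express the Poisson integral of [g] at
    radius [q] as the value of the power series at [r q e^(i t)]; let [q] tend to 1. *)
Theorem holo_ps (g g' : C -> C) : holo g g' ->
  exists a, rad1 a /\ forall z, nc z < 1 -> g z = ps a z.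
Proof.
move=> hg; have [a [ha hfc]] := holo_fc hg; exists a; split => //.
have cg z : nc z < 1 -> continuous_at z g by exact: holo_cont hg.
have cp z : nc z < 1 -> continuous_at z (ps a) by move=> z1; exact: ps_cont.
have main r t : 0 < r < 1 -> ang t -> g (r%:C * expi t) = ps a (r%:C * expi t).
  move=> hr ht; have hr' : 0 <= r < 1 by lra.
  pose c s := g (r%:C * expi s); have cc : continuous c := cont_circ hr' cg.
  have hrad : rad1 (fun m => a m * (r ^+ m)%:C).
    move=> q hq; have [M hM] := ha q hq; exists M => n; apply: le_trans (hM n).
    rewrite ncM ncR ger0_norm ?exprn_ge0; try lra.
    rewrite ler_wpM2r ?exprn_ge0//; first by case/andP: hq.
    by rewrite ler_piMr ?nc_ge0// exprn_ile1; lra.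
  have hPK q : 0 <= q < 1 -> PK q c t = ps a ((r * q)%:C * expi t).
    move=> hq; rewrite (PK_ps t hq (cintbC_cont cc) hrad (fun n => hfc r n hr)).
    have q1 : nc (q%:C * expi t : C) < 1 by rewrite nc_rexpi; case/andP: hq.
    have r01 : 0 <= r <= 1 by lra.
    by rewrite (ps_dilate ha r01 q1) RCM mulrA.
  have z1 : nc (r%:C * expi t : C) < 1 by rewrite nc_rexpi; lra.
  apply: nc_small_eq => e e0; have e6 : 0 < e / 6 by rewrite divr_gt0.
  have cR : continuous (Re \o c) by exact: continuousC_Re.
  have cI : continuous (Im \o c) by exact: continuousC_Im.
  have c02 : c 0 = c (2 * pi) by rewrite /c expi0 expi_2pi.
  have [r1 hr1 H1] := pk_approx cR (congr1 Re c02) e6.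
  have [r2 hr2 H2] := pk_approx cI (congr1 Im c02) e6.
  have e3 : 0 < e / 3 by rewrite divr_gt0.
  have /(cvgCP (nbhs_filter _))/(_ _ e3)/nbhsCP[d d0 H3] := cp _ z1.
  pose q := Num.max (Num.max r1 r2) (1 - Num.min 1 d / 2).
  have dm : 0 < Num.min 1 d by rewrite lt_min ltr01.
  have dm1 : Num.min 1 d <= 1 by rewrite ge_min lexx.
  have dmd : Num.min 1 d <= d by rewrite ge_min lexx orbT.
  have q1 : q < 1 by rewrite !gt_max; case/andP: hr1 => _ ->; case/andP: hr2 => _ -> /=; lra.
  have qr1 : r1 <= q by rewrite !le_max lexx.
  have qr2 : r2 <= q by rewrite !le_max lexx orbT.
  have qd : 1 - Num.min 1 d / 2 <= q by rewrite le_max lexx orbT.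
  have q0 : 0 <= q by lra.
  have A1 := H1 q t ltac:(lra) ht; have A2 := H2 q t ltac:(lra) ht.
  have B : nc (c t - PK q c t) <= e / 3.
    apply: (le_trans (nc_le_ReIm _)); rewrite PK_ReIm !cE /=.
    by rewrite (distrC (Re _)) (distrC (Im _)); rewrite /= in A1 A2; lra.
  rewrite hPK in B; last by rewrite q0.
  have D : nc (ps a (r%:C * expi t) - ps a ((r * q)%:C * expi t)) < e / 3.
    apply: H3; rewrite -mulrBl -RCB ncM nc_expi mulr1 ncR.
    rewrite -[X in _ - X](mulr1 r) -mulrBr normrM ger0_norm; last by lra.
    rewrite distrC ger0_norm; last by lra.
    apply: (@le_lt_trans _ _ (1 - q)); last by lra.
    by rewrite ler_piMl; lra.
  exact: (nc_tri_third e0 B D).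
move=> z z1; have [t ht E] := polar z.
have [z0|z0] := eqVneq z 0; last first.
  by rewrite E; apply: main => //; rewrite nc_gt0 z0.
apply: nc_small_eq => e e0; have e2 : 0 < e / 2 by rewrite divr_gt0.
have /(cvgCP (nbhs_filter _))/(_ _ e2)/nbhsCP[d1 d10 H1] := cg _ z1.
have /(cvgCP (nbhs_filter _))/(_ _ e2)/nbhsCP[d2 d20 H2] := cp _ z1.
pose r := Num.min (Num.min d1 d2) 1 / 2.
have m0 : 0 < Num.min (Num.min d1 d2) 1 by rewrite !lt_min d10 d20 ltr01.
have m1 : Num.min (Num.min d1 d2) 1 <= d1 by rewrite !ge_min lexx.
have m2 : Num.min (Num.min d1 d2) 1 <= d2 by rewrite !ge_min lexx orbT.
have m3 : Num.min (Num.min d1 d2) 1 <= 1 by rewrite !ge_min lexx orbT.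
have hr : 0 < r < 1 by rewrite /r; lra.
have nw : nc (r%:C * expi t - z) = r by rewrite z0 subr0 nc_rexpi//; lra.
have h1 : nc (g z - g (r%:C * expi t)) < e / 2 by apply: H1; rewrite nw /r; lra.
have h2 : nc (ps a z - ps a (r%:C * expi t)) < e / 2 by apply: H2; rewrite nw /r; lra.
rewrite main// in h1.
exact: (nc_tri_half h1 h2).
Qed.

End Holo.

(** * Continuity on the closed disk, and the principal logarithm *)

Section Logarithm.
Context {R : realType}.
Notation C := (Cplx R).
Notation ang := (@angles R).
Implicit Types (z w h : C) (t s x r : R) (a : nat -> C) (c d : R -> C) (N : nat) (f g : C -> C).

Lemma cdc_within f : cdc f <-> forall z, nc z <= 1 -> f @ within closed_disk (nbhs z) --> f z.
Proof.
rewrite -cdcP subspace_continuousP; split => H z hz; apply: H; exact/closed_diskE.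
Qed.

Lemma cdc_cont f : (forall z, nc z <= 1 -> continuous_at z f) -> cdc f.
Proof. by move=> h; apply/cdc_within => z z1; apply: cvg_within_filter; exact: h. Qed.
Lemma cdcD f g : cdc f -> cdc g -> cdc (fun z => f z + g z).
Proof.
move=> /cdc_within hf /cdc_within hg; apply/cdc_within => z z1.
exact: (@cvgD _ _ _ _ (within_filter _ (nbhs_filter z)) _ _ _ _ (hf z z1) (hg z z1)).
Qed.
Lemma cdcM f g : cdc f -> cdc g -> cdc (fun z => f z * g z).
Proof.
move=> /cdc_within hf /cdc_within hg; apply/cdc_within => z z1.
exact: (@cvgM _ _ _ (within_filter _ (nbhs_filter z)) _ _ _ _ (hf z z1) (hg z z1)).
Qed.
Lemma cdc_comp f g : cdc f -> (forall z, nc z <= 1 -> continuous_at (f z) g) -> cdc (fun z => g (f z)).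
Proof.
move=> /cdc_within hf hg; apply/cdc_within => z z1.
exact: (@cvg_comp _ _ _ f g _ _ _ (hf z z1) (hg z z1)).
Qed.

Lemma cdc_interior f z : cdc f -> nc z < 1 -> continuous_at z f.
Proof.
move=> hf z1; apply/(cvgCP (nbhs_filter z)) => e e0; have [d d0 H] := hf z (ltW z1) e e0.
apply/nbhsCP; exists (Num.min d (1 - nc z)); first by rewrite lt_min d0 subr_gt0.
move=> w; rewrite lt_min => /andP[h1 h2]; rewrite ncB; apply: H => //.
by have := nc_distD w z; lra.
Qed.

Lemma compact_disk : compact (closed_disk : set C).
Proof.
pose D : set (R * R) := `[0, 1]%classic `*` ang.
have cD : compact D by apply: compact_setX; exact: segment_compact.
have cf : {within D, continuous (fun q : R * R => q.1%:C * expi q.2 : C)}.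
  apply: continuous_subspaceT => q.
  apply: ccM; first by apply: ccR; exact: cvg_fst.
  by apply: ccexpi; exact: cvg_snd.
have := continuous_compact cf cD; congr compact; apply/seteqP; split => z /=.
- move=> [[r t] [h _] <-]; apply/closed_diskE.
  have /andP[h1 h2] : 0 <= r <= 1 by move: h; rewrite /= in_itv.
  by rewrite nc_rexpi.
- move=> /closed_diskE z1; have [t ht E] := polar z; exists (nc z, t) => //.
  by split => //=; rewrite in_itv /= nc_ge0.
Qed.

Lemma nc_dilate r z : 0 <= r <= 1 -> nc z <= 1 -> nc (r%:C * z) <= 1.
Proof. by move=> /andP[r0 r1] z1; rewrite ncM ncR ger0_norm// mulr_ile1 ?nc_ge0. Qed.

(** A dilation by [r] close to 1 moves the points of the closed disk little, so by compactness a
    relation that holds locally near the diagonal holds between [z] and [r z], uniformly in [z].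
    *)
Lemma dilate_near (P : C -> C -> Prop) :
  (forall x : C, nc x <= 1 -> exists2 d, 0 < d & forall w1 w2, nc w1 <= 1 -> nc w2 <= 1 ->
    nc (w1 - x) < d -> nc (w2 - x) < d -> P w1 w2) ->
  exists2 r0, 0 <= r0 < 1 & forall r z, r0 <= r <= 1 -> nc z <= 1 -> P z (r%:C * z).
Proof.
move=> hP.
have /compact_near_coveringP nearK := compact_disk.
pose Q (r : R) (z : C) := 0 <= r <= 1 -> nc z <= 1 -> P z (r%:C * z).
have [|] := nearK R (nbhs (1 : R)) Q (nbhs_filter _).
  move=> x /closed_diskE x1; have [d d0 H] := hP x x1.
  have d2 : 0 < d / 2 by rewrite divr_gt0.
  exists ([set z | nc (z - x) < d / 2], [set r : R | `|1 - r| < d / 2]).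
    split; first by apply/nbhsCP; exists (d / 2).
    by apply/nbhs_ballP; exists (d / 2).
  move=> [z r] [/= hz hr] r01 z1; apply: H => //; first exact: nc_dilate.
  - lra.
  - have -> : r%:C * z - x = (z - x) - (1 - r)%:C * z by rewrite RCB; ring.
    apply: (le_lt_trans (ncD _ _)); rewrite ncN ncM ncR.
    have : `|1 - r| * nc z <= `|1 - r| by rewrite ler_piMr.
    lra.
move=> e /= e0 H.
pose m := Num.min e 1 / 2; have m0 : 0 < Num.min e 1 by rewrite lt_min e0 ltr01.
have m1 : Num.min e 1 <= 1 by rewrite ge_min lexx orbT.
have m2 : Num.min e 1 <= e by rewrite ge_min lexx.
exists (1 - m); first by rewrite /m; lra.
move=> r z hr z1; apply: (H r) => //.
- rewrite /ball /=; rewrite ger0_norm; rewrite /m in hr; lra.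
- exact/closed_diskE.
- rewrite /m in hr; lra.
Qed.

(** Uniform continuity on the closed disk, in the only form needed: for dilations. *)
Lemma cdc_dilate f e : cdc f -> 0 < e ->
  exists2 r0, 0 <= r0 < 1 & forall r z, r0 <= r <= 1 -> nc z <= 1 -> nc (f z - f (r%:C * z)) < e.
Proof.
move=> hf e0; apply: (@dilate_near (fun z w => nc (f z - f w) < e)) => x x1; have e2 : 0 < e / 2 by rewrite divr_gt0.
have [d d0 H] := hf x x1 _ e2; exists d => // w1 w2 h1 h2 h3 h4.
by apply: (nc_tri_half (h := f x)); exact: H.
Qed.

Lemma cexp_surj w : w != 0 -> exists k, cexp k = w.
Proof.
move=> w0; have [t _ E] := polar w; exists (ln (nc w) +i* t).
by rewrite /cexp /= lnK ?posrE ?nc_gt0.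
Qed.

(** The principal logarithm, used on the right half-plane only. *)
Definition Log w : C := ln (nc w) +i* asin (Im w / nc w).

Lemma Re_gt0_quot w : 0 < Re w -> 0 < nc w /\ -1 < Im w / nc w < 1.
Proof.
move=> h; have n0 : 0 < nc w by apply: lt_le_trans h _; apply: le_trans (ler_norm _) (Re_le_nc _).
split => //; rewrite -ltr_norml normrM normfV (@gtr0_norm _ (nc w))//.
rewrite ltr_pdivrMr// mul1r -(@ltr_pXn2r _ 2) ?nnegrE ?nc_ge0// real_normK ?num_real// ncsq.
by rewrite ltrDr exprn_gt0.
Qed.

Lemma cexp_Log w : 0 < Re w -> cexp (Log w) = w.
Proof.
move=> h; have [n0 hq] := Re_gt0_quot h.
have hq' : -1 <= Im w / nc w <= 1 by case/andP: hq => /ltW -> /ltW ->.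
rewrite /cexp /= lnK ?posrE//; apply: ceqP; rewrite !cE /= ?mul0r ?subr0 ?addr0.
- rewrite cos_asin//.
  have -> : 1 - (Im w / nc w) ^+ 2 = (Re w / nc w) ^+ 2.
    rewrite !expr_div_n; have := ncsq w; have : nc w ^+ 2 != 0 by rewrite expf_neq0// gt_eqF.
    move: (nc w ^+ 2) => X X0 E; apply: (mulIf X0); rewrite mulrBl !divfK// mul1r E; ring.
  by rewrite sqrtr_sqr ger0_norm ?divr_ge0 ?ltW// mulrC divfK// gt_eqF.
- by rewrite asinK ?in_itv//= mulrC divfK// gt_eqF.
Qed.

Lemma cont_Log w : 0 < Re w -> continuous_at w Log.
Proof.
move=> h; have [n0 hq] := Re_gt0_quot h; apply/(cvgC_ReIm (nbhs_filter w)); split => /=.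
- apply: (@continuous_comp _ _ _ (fun w => nc w) (@ln R)); first exact: contnc.
  exact: continuous_ln.
- apply: (@continuous_comp _ _ _ (fun w => Im w / nc w) (@asin R)); last exact: continuous_asin.
  apply: (@continuousM R C (fun w => Im w) (fun w => (nc w)^-1)); first exact: contIm.
  by apply: continuousV; [rewrite gt_eqF|exact: contnc].
Qed.

Lemma Log1 : Log 1 = 0.
Proof.
rewrite /Log nc1 ln1 mul0r; apply: ceqP => //=.
by rewrite -[X in asin X = _]sin0 sinK// in_itv /= oppr_le0 divr_ge0 ?pi_ge0.
Qed.

(** If [exp D = 1] along the segment, [D] is imaginary and [cos (Im D) = 1]. If [|Im D|] reached
    [2 pi] it would take the value [pi] on the way, which is impossible; and below [2 pi] only
    the value 0 is possible. *)
Lemma cexp1_seg (D : R -> C) : (forall s, 0 <= s <= 1 -> continuous_at s D) ->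
  (forall s, 0 <= s <= 1 -> cexp (D s) = 1) -> D 0 = 0 -> D 1 = 0.
Proof.
move=> cD hD D0.
have hre s : 0 <= s <= 1 -> Re (D s) = 0.
  by move=> hs; have := congr1 nc (hD s hs); rewrite nc_cexp nc1 -(@expR0 R) => /expR_inj.
have hcos s : 0 <= s <= 1 -> cos `|Im (D s)| = 1.
  move=> hs; have := hD s hs; rewrite /cexp hre// expR0 mul1r cos_norm.
  by move=> /(congr1 Re).
have p2 := @pi2_gt0 R; have p0 := @pi_gt0 R.
have small s : 0 <= s <= 1 -> `|Im (D s)| < 2 * pi -> Im (D s) = 0.
  move=> hs h; apply/eqP; rewrite -normr_eq0; apply/negP => /negP n0.
  have h1 : 0 < `|Im (D s)| < 2 * pi by rewrite h andbT lt_neqAle eq_sym n0 normr_ge0.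
  by have := cos1_2pi h1; rewrite hcos// ltxx.
have h1 : 0 <= (1 : R) <= 1 by rewrite ler01 lexx.
apply: ceqP; first exact: hre.
apply: small => //; rewrite ltNge; apply/negP => big.
have cI : {within `[0, 1], continuous (fun s => `|Im (D s)|)}.
  apply: continuous_in_subspaceT => s; rewrite inE /= in_itv /= => hs.
  by apply: cvg_norm; apply: ccIm; exact: cD.
have [] := @IVT R (fun s => `|Im (D s)|) 0 1 pi ler01 cI.
  rewrite D0 /= normr0 min_l ?max_r ?normr_ge0//; first by apply/andP; split; lra.
move=> s; rewrite in_itv /= => hs E; have := hcos s hs; rewrite E cospi; lra.
Qed.

End Logarithm.

(** * The logarithm of the derivative of an immersion *)

Section Structure.
Context {R : realType}.
Notation C := (Cplx R).
Implicit Types (z w h : C) (t s x r : R) (a : nat -> C) (c d : R -> C) (N : nat) (f g : C -> C).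

Lemma immersion_disk Phi dPhi : holomorphic_immersion (R:=R) Phi dPhi ->
  [/\ cdc Phi, cdc dPhi, holo Phi dPhi & forall z, nc z <= 1 -> dPhi z != 0].
Proof.
move=> [h1 h2 h3 h4]; have cd : cdc dPhi by exact/cdcP.
split => //; first exact/cdcP.
- apply: is_derive_holo => z z1; first exact: cdc_interior.
  by apply: h3; exact/open_diskE.
- by move=> z z1; apply: h4; exact/closed_diskE.
Qed.

(** [holo] determines the derivative, by differentiation along a segment through the point. *)
Lemma holo_derive_unique g g' a z : holo g g' -> rad1 a -> (forall z, nc z < 1 -> g z = ps a z) ->
  nc z < 1 -> g' z = ps (dps a) z.
Proof.
move=> [_ hg] ha E z1; have [_ hp] := ps_holo ha.
have i0 : z + 0%:C * 1 = z by rewrite mul0r addr0.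
have c0 : nc (z + (0 : R)%:C * 1) < 1 by rewrite i0.
have d1 := hg (fun s => z + s%:C * 1) 0 1 c0 (cder_seg z 1 0).
have d2 := hp (fun s => z + s%:C * 1) 0 1 c0 (cder_seg z 1 0).
rewrite i0 !mulr1 in d1 d2; apply: cder_unique d1 _; apply: cder_near d2.
apply/nbhs_ballP; exists (1 - nc z) => /=; first by rewrite subr_gt0.
move=> s; rewrite /ball /= sub0r normrN => hs; rewrite E// mulr1.
by apply: (le_lt_trans (ncD _ _)); rewrite ncR; lra.
Qed.

Lemma holo_quot (h0 h1 h2 : C -> C) : holo h0 h1 -> holo h1 h2 -> (forall z, nc z < 1 -> h0 z != 0) ->
  holo (fun z => h1 z / h0 z) (fun z => (h2 z * h0 z - h1 z * h1 z) / h0 z ^+ 2).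
Proof.
move=> H0 H1 nz; split.
- move=> z z1; have c0 := holo_cont H0 z1; have c1 := holo_cont H1 z1.
  have c2 := (proj1 H1) z z1.
  apply: (@ccM _ _ (fun z => h2 z * h0 z - h1 z * h1 z) (fun z => (h0 z ^+ 2)^-1)).
    apply: (@ccB _ _ (fun z => h2 z * h0 z) (fun z => h1 z * h1 z)).
      exact: (ccM c2 c0).
    exact: (ccM c1 c1).
  apply: (@ccV _ _ (fun z => h0 z ^+ 2)); first by rewrite expf_neq0// nz.
  rewrite (_ : (fun z => h0 z ^+ 2) = (fun z => h0 z * h0 z)); first exact: (ccM c0 c0).
  by apply/funext => y; rewrite expr2.
- move=> c t v c1 hc; have d0 := (proj2 H0) c t v c1 hc; have d1 := (proj2 H1) c t v c1 hc.
  have n0 := nz _ c1; apply: cder_eq (cderM d1 (cderV n0 d0)) _.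
  by field.
Qed.

(** Inside the disk a logarithm is a primitive of [Phi'' / Phi'], given by a power series. For
    [r] close to 1 the quotient of [Phi'] at [z] and at [r z] has positive real part on the
    whole closed disk, since [Phi'] is continuous and does not vanish there; adding the
    principal logarithm of this quotient to the logarithm at the interior point [r z] gives a
    logarithm that is continuous up to the circle. Both logarithms agree inside by [cexp1_seg].
    *)
Theorem immersion_log Phi dPhi : holomorphic_immersion (R:=R) Phi dPhi ->
  exists a F, [/\ rad1 a, cdc F, forall z, nc z < 1 -> F z = ps a z &
    forall z, nc z <= 1 -> dPhi z = cexp (F z)].
Proof.
move=> /immersion_disk[cP cdP hP nz].
have [b [hb Eb]] := holo_ps hP.
have dE z : nc z < 1 -> dPhi z = ps (dps b) z by move=> z1; exact: holo_derive_unique hP hb Eb z1.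
have hb1 := rad1_dps hb; have hb2 := rad1_dps hb1.
have H0 := ps_holo hb1; have H1 := ps_holo hb2.
have nz0 z : nc z < 1 -> ps (dps b) z != 0 by move=> z1; rewrite -dE//; apply: nz; exact: ltW.
have hq := holo_quot H0 H1 nz0.
have [d [hd Ed]] := holo_ps hq.
have z01 : nc (0 : C) < 1 by rewrite nc0.
have [k0 hk0] := cexp_surj (nz0 0 z01).
pose a n : C := if n is n'.+1 then ips d n else k0.
have ha : rad1 a.
  move=> r hr; have [M hM] := rad1_ips hd hr; exists (Num.max M (nc k0)) => -[|n].
    by rewrite expr0 mulr1 le_max lexx orbT.
  by rewrite le_max (hM n.+1).
have da : dps a = d by rewrite -[RHS]dps_ips; apply/funext => n.
have Ha := ps_holo ha; rewrite da in Ha.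
have main z : nc z < 1 -> dPhi z = cexp (ps a z).
  move=> z1; rewrite (dE _ z1).
  pose K s : C := ps (dps b) (0 + s%:C * z) * cexp (- ps a (0 + s%:C * z)).
  have hin s : 0 <= s <= 1 -> nc (0 + s%:C * z) < 1.
    move=> /andP[s0 s1]; rewrite add0r ncM ncR ger0_norm//.
    by apply: le_lt_trans z1; rewrite ler_piMl ?nc_ge0.
  have cK s : 0 <= s <= 1 -> cder K s 0.
    move=> hs; have hi := hin s hs; have sg := cder_seg 0 z s.
    have d1 := (proj2 H0) _ _ _ hi sg; have d2 := (proj2 Ha) _ _ _ hi sg.
    apply: cder_eq (cderM d1 (cder_cexp (cderN d2))) _.
    rewrite -(Ed _ hi); have := nz0 _ hi.
    by set X := ps (dps b) _; set Y := ps (dps (dps b)) _; set E := cexp _ => X0; field.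
  have KE : K 1 = K 0.
    apply: nc_small_eq => e e0; have := @mean_value_leC _ K (fun=> 0) 0 1 0 ler01 cK.
    rewrite mulr0 mul0r => h; apply: le_lt_trans (h _) e0 => t _; by rewrite nc0.
  move: KE; rewrite /K mul0r !addr0 mul1r add0r -hk0 [ps a 0]ps0 /= !cexpN mulfV; last exact: cexp_neq0.
  by move=> hq1; rewrite -[LHS](divfK (cexp_neq0 (ps a z))) hq1 mul1r; exact: erefl.
have [r0 hr0 Hr] : exists2 r0 : R, 0 <= r0 < 1 & forall r z, r0 <= r <= 1 -> nc z <= 1 ->
   nc (dPhi z - dPhi (r%:C * z)) < nc (dPhi (r%:C * z)).
  apply: (@dilate_near _ (fun z w => nc (dPhi z - dPhi w) < nc (dPhi w))) => x x1; have m0 : 0 < nc (dPhi x) by rewrite nc_gt0; exact: nz.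
  have m4 : 0 < nc (dPhi x) / 4 by rewrite divr_gt0.
  have [dl dl0 H] := cdP x x1 _ m4; exists dl => // w1 w2 v1 v2 v3 v4.
  have e1 := H w1 v1 v3; have e2 := H w2 v2 v4.
  have := ncBD (dPhi w1) (dPhi w2) (dPhi x); have := nc_distD (dPhi x) (dPhi w2).
  rewrite (ncB (dPhi x) (dPhi w2)).
  move: (nc (dPhi w1 - dPhi w2)) (nc (dPhi w1 - dPhi x)) (nc (dPhi w2 - dPhi x)) e1 e2 => A B D.
  move: (nc (dPhi x)) (nc (dPhi w2)) m0 m4 {H} => X Y; lra.
pose r := (1 + r0) / 2.
have hr : r0 <= r <= 1 by rewrite /r; lra.
have r01 : 0 <= r < 1 by rewrite /r; lra.
pose Q z : C := dPhi z / dPhi (r%:C * z).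
have rz1 z : nc z <= 1 -> nc (r%:C * z) < 1.
  move=> z1; rewrite ncM ncR ger0_norm; last by lra.
  by apply: le_lt_trans (_ : r < 1); [rewrite ler_piMr//; lra|lra].
have Qre z : nc z <= 1 -> 0 < Re (Q z).
  move=> z1; have h := Hr r z hr z1; have n0 : dPhi (r%:C * z) != 0 by apply: nz; exact/ltW/rz1.
  have : nc (1 - Q z) < 1.
    have -> : 1 - Q z = (dPhi (r%:C * z) - dPhi z) / dPhi (r%:C * z) by rewrite /Q; field.
    by rewrite ncM ncV ncB ltr_pdivrMr ?mul1r// nc_gt0.
  by have := Re_le_nc (1 - Q z); rewrite ReD ReN /=; move/(le_trans (ler_norm _)); lra.
have cdil z : nc z <= 1 -> continuous_at z (fun z : C => r%:C * z : C).
  by move=> _; apply: ccM; [exact: ccst|exact: cvg_id].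
have cdPr : cdc (fun z => dPhi (r%:C * z)).
  apply: cdc_cont => z z1; apply: (@cccomp _ _ (fun z => r%:C * z : C) dPhi); first exact: cdil.
  by apply: cdc_interior => //; exact: rz1.
have cQ : cdc Q.
  apply: cdcM => //; apply: (cdc_comp cdPr) => z z1.
  by apply: ccV; [apply: nz; exact/ltW/rz1|exact: cvg_id].
pose F z : C := ps a (r%:C * z) + Log (Q z).
have cF : cdc F.
  apply: cdcD.
    apply: cdc_cont => z z1; apply: (@cccomp _ _ (fun z => r%:C * z : C) (ps a)); first exact: cdil.
    by apply: ps_cont => //; exact: rz1.
  by apply: (cdc_comp cQ) => z z1; apply: cont_Log; exact: Qre.
have EF z : nc z <= 1 -> dPhi z = cexp (F z).
  move=> z1; rewrite /F cexpD cexp_Log ?Qre// -main ?rz1// /Q mulrC divfK//.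
  by apply: nz; exact/ltW/rz1.
exists a, F; split; [exact: ha|exact: cF| |exact: EF] => z z1.
pose D s : C := F (s%:C * z) - ps a (s%:C * z).
have hin s : 0 <= s <= 1 -> nc (s%:C * z) < 1.
  by move=> /andP[s0 s1]; rewrite ncM ncR ger0_norm// (le_lt_trans _ z1)// ler_piMl ?nc_ge0.
have D1 : D 1 = 0.
  apply: cexp1_seg.
  - move=> s hs; have cs : continuous_at s (fun s : R => s%:C * z : C).
      by apply: ccM; [exact: contRC|exact: ccst].
    apply: ccB; apply: (@cccomp _ _ (fun s : R => s%:C * z : C)); first exact: cs.
    + by apply: cdc_interior; [exact: cF|exact: hin].
    + exact: cs.
    + by apply: ps_cont; [exact: ha|exact: hin].
  - move=> s hs; have hi := hin s hs.
    by rewrite /D cexpD cexpN -EF ?(ltW hi)// -main// divff//; apply: nz; exact: ltW.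
  - have nz00 : dPhi 0 != 0 by apply: nz; rewrite nc0.
    by rewrite /D /F /Q mul0r mulr0 divff// Log1 addr0 subrr.
by move/eqP: D1; rewrite /D mul1r subr_eq0 => /eqP.
Qed.

End Structure.

(** * Boundary values and uniqueness of the immersion *)

Section Boundary.
Context {R : realType}.
Notation C := (Cplx R).
Implicit Types (z w h : C) (t s x r : R) (a : nat -> C) (c d : R -> C) (N : nat) (F G : C -> C) (n : int).

Lemma cdc_circ F : cdc F -> continuous (fun t => F (expi t)).
Proof.
move=> cF t; apply/(cvgCP (nbhs_filter t)) => e e0.
have z1 : nc (expi t : C) <= 1 by rewrite nc_expi.
have [d d0 H] := cF _ z1 e e0.
have /(cvgCP (nbhs_filter t))/(_ _ d0) := @cont_expi R t.
by apply: filterS => s hs; rewrite ncB; apply: H; rewrite ?nc_expi// ncB.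
Qed.

Lemma cdc_circ_in F r : cdc F -> 0 <= r <= 1 -> continuous (fun t => F (r%:C * expi t)).
Proof.
move=> cF hr t; apply/(cvgCP (nbhs_filter t)) => e e0.
have z1 s : nc (r%:C * expi s : C) <= 1 by apply: nc_dilate; rewrite ?nc_expi.
have [d d0 H] := cF _ (z1 t) e e0.
have /(cvgCP (nbhs_filter t))/(_ _ d0) := @cont_expi R t.
apply: filterS => s hs; rewrite ncB; apply: H; first exact: z1.
rewrite -mulrBr ncM ncR ncB; apply: le_lt_trans hs.
by rewrite ler_piMl ?nc_ge0// ger0_norm; lra.
Qed.

Lemma fc_ps_dilate a r n : rad1 a -> 0 <= r < 1 ->
  fc (fun t => ps a (r%:C * expi t)) n = if n is Posz m then a m * (r ^+ m)%:C else 0.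
Proof.
move=> ha hr; have /andP[r0 r1] := hr; have [Q hQ] := rad1_sum ha hr.
apply: nc_small_eq => e e0; have e4 : 0 < e / 4 by rewrite divr_gt0.
have [N0 H] := ps_tail r0 hQ e4; pose N := maxn N0 `|n|%N.+1.
pose P t := \sum_(k < N) a k * (r ^+ k)%:C * en k%:Z t.
have cps : continuous (fun t => ps a (r%:C * expi t)).
  by apply: (cont_circ hr) => z z1; exact: ps_cont.
have iZ (k : C) m : cintbC (fun t => k * en m t) by apply: cintbC_Z; exact: cintbC_en.
have iP : cintbC P by apply: cintbC_sum => k _; exact: iZ.
have -> : (if n is Posz m then a m * (r ^+ m)%:C else 0) = fc P n.
  rewrite fc_sum; last by move=> k _; exact: iZ.
  have E (k : 'I_N) : fc (fun t => a k * (r ^+ k)%:C * en k%:Z t) n =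
     a k * (r ^+ k)%:C * (if n == k%:Z then 1 else 0).
    by rewrite fcZ ?fc_en//; exact: cintbC_en.
  rewrite (eq_bigr _ (fun k _ => E k)) {E iP P}; case: n @N => m N.
    have mN : (m < N)%N by rewrite leq_max ltnSn orbT.
    rewrite (bigD1 (Ordinal mN)) //= eqxx mulr1 big1 ?addr0// => k.
    by rewrite -val_eqE /= eqz_nat eq_sym => /negbTE ->; rewrite mulr0.
  by rewrite big1// => k _; rewrite mulr0.
apply: (@le_lt_trans _ _ (2 * (e / 4))); last by lra.
apply: fc_close; [exact: cintbC_cont|exact: iP|].
move=> t _; have -> : P t = \sum_(k < N) a k * (r%:C * expi t) ^+ k.
  by apply: eq_bigr => k _; rewrite exprMn -RCX -en_nat mulrA.
by apply: H; [exact: leq_maxl|rewrite nc_rexpi].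
Qed.

Lemma bernoulli_le r m : 0 <= r <= 1 -> 1 - r ^+ m <= m%:R * (1 - r).
Proof.
move=> /andP[r0 r1]; elim: m => [|m IH]; first by rewrite expr0 subrr mul0r.
have h : r * (1 - r ^+ m) <= 1 - r ^+ m by rewrite ler_piMl// subr_ge0 exprn_ile1.
by rewrite exprS -natr1 mulrDl mul1r; move: IH h; rewrite mulrBr mulr1; lra.
Qed.

(** The restrictions to circles of radius [r < 1] converge uniformly to the boundary values, and
    so do their coefficients, which are those of the series times [r ^ n]. *)
Lemma fc_ps_boundary F a n : rad1 a -> cdc F -> (forall z, nc z < 1 -> F z = ps a z) ->
  fc (fun t => F (expi t)) n = if n is Posz m then a m else 0.
Proof.
move=> ha cF EF.
have close e : 0 < e -> exists2 r0, 0 <= r0 < 1 & forall r, r0 <= r < 1 ->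
    nc (fc (fun t => F (expi t)) n - fc (fun t => ps a (r%:C * expi t)) n) <= e.
  move=> e0; have e2 : 0 < e / 2 by rewrite divr_gt0.
  have [r0 hr0 H] := cdc_dilate cF e2; exists r0 => // r hr.
  have hr' : 0 <= r < 1 by lra.
  have -> : e = 2 * (e / 2) by field.
  apply: fc_close; first by apply: cintbC_cont; exact: cdc_circ.
    by apply: cintbC_cont; apply: (cont_circ hr') => z z1; exact: ps_cont.
  move=> t _; rewrite -EF ?nc_rexpi//; try lra.
  by apply/ltW/H; [lra|rewrite nc_expi].
apply: nc_small_eq => e e0; have e2 : 0 < e / 2 by rewrite divr_gt0.
have [r0 hr0 H] := close _ e2.
case: n {close} H => m H; last first.
  by have := H r0 ltac:(lra); rewrite fc_ps_dilate//; lra.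
pose K := m%:R * nc (a m) + 1; have K0 : 0 < K by rewrite ltr_wpDl// mulr_ge0 ?nc_ge0.
pose q := Num.max r0 (1 - e / 4 / K).
have q1 : q < 1 by rewrite gt_max; case/andP: hr0 => _ -> /=; rewrite ltrBlDr ltrDl !divr_gt0.
have q0 : r0 <= q by rewrite le_max lexx.
have qK : 1 - q <= e / 4 / K by rewrite lerBlDr -lerBlDl le_max lexx orbT.
have := H q ltac:(lra); rewrite fc_ps_dilate; [|exact: ha|lra] => h.
apply: le_lt_trans (ncBD _ _ (a m * (q ^+ m)%:C)) _.
have -> : a m * (q ^+ m)%:C - a m = - (a m * (1 - q ^+ m)%:C) by rewrite RCB; ring.
have b := @bernoulli_le q m ltac:(lra).
have q1m : q ^+ m <= 1 by apply: exprn_ile1; lra.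
rewrite ncN ncM ncR ger0_norm ?subr_ge0//.
have : nc (a m) * (1 - q ^+ m) <= K * (1 - q).
  rewrite mulrC; apply: le_trans (ler_wpM2r (nc_ge0 _) b) _.
  by rewrite mulrAC ler_wpM2r ?subr_ge0 ?(ltW q1)// lerDl.
have : K * (1 - q) <= e / 4 by rewrite mulrC -ler_pdivlMr.
lra.
Qed.

Lemma conformal_log dPhi F (l : C -> R) : (forall z, nc z <= 1 -> dPhi z = cexp (F z)) ->
  conformal_factor dPhi l -> circle_ae (fun t => Re (F (expi t)) = l (expi t)).
Proof.
move=> E; apply: ae_imp => t _; rewrite E ?nc_expi// ncE nc_cexp => /complexI.
exact: expR_inj.
Qed.

Lemma factor_unique dPhi (l l' : C -> R) :
  conformal_factor dPhi l -> conformal_factor dPhi l' ->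
  circle_ae (fun t => l' (expi t) = l (expi t)).
Proof.
move=> h1 h2; apply: ae_imp (ae_and h1 h2) => t _ [-> /complexI/expR_inj->//].
Qed.

Lemma ps_shift a b z : rad1 a -> rad1 b -> nc z < 1 -> (forall m, a m.+1 = b m.+1) ->
  ps a z = (a 0%N - b 0%N) + ps b z.
Proof.
move=> ha hb z1 ab; apply: ps_eq => // e e0; have [N0 H] := rad1_cvs hb z1 e0.
exists N0.+1 => -[//|N] hN; have := H N.+1 (leqW hN); congr (_ < _); congr nc.
rewrite !big_ord_recl !expr0 !mulr1.
rewrite [X in _ = _ - (_ + X)](eq_bigr (fun i : 'I_N => b (lift ord0 i) * z ^+ lift ord0 i)); first by ring.
by move=> k _; rewrite lift0 ab.
Qed.

(** On the circle the difference of the two logarithms is imaginary, so its coefficients at [n]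
    and [- n] are opposite conjugates; as those at negative indices vanish, the difference is a
    constant [i theta]. Hence the derivatives differ by the factor [expi theta], and the
    functions by a constant as well. *)
Theorem immersion_unique Phi dPhi Phi' dPhi' (l : C -> R) :
  holomorphic_immersion Phi dPhi -> conformal_factor dPhi l ->
  holomorphic_immersion Phi' dPhi' -> conformal_factor dPhi' l ->
  exists (theta0 : R) k, forall z, closed_disk z -> Phi z = expi theta0 * Phi' z + k.
Proof.
move=> im1 cf1 im2 cf2.
have [a [F [ha cF EF EP]]] := immersion_log im1; have [b [G [hb cG EG EP']]] := immersion_log im2.
have rF := conformal_log EP cf1; have rG := conformal_log EP' cf2.
have iF := cintbC_cont (cdc_circ cF); have iG := cintbC_cont (cdc_circ cG).
pose c t := F (expi t) - G (expi t); have ic : cintbC c by exact: cintbC_B.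
have fcc n : fc c n = if n is Posz m then a m - b m else 0.
  rewrite /c fcB// (fc_ps_boundary n ha cF EF) (fc_ps_boundary n hb cG EG); case: n => // m.
  by rewrite subrr.
have iN : cintbC (fun t => - c t) by exact: cintbC_N.
have iJ : cintbC (fun t => ((c t)^*)%C).
  split; first by apply: eq_cintb (proj1 ic) => t _ /=; case: (c t).
  by apply: eq_cintb (cintbN (proj2 ic)) => t _ /=; case: (c t).
have key n : - fc c n = ((fc c (- n))^*)%C.
  rewrite -fc_conj//; have -> : - fc c n = fc (fun t => - c t) n.
    by rewrite -mulN1r -fcZ//; apply: eq_fc => t _; rewrite mulN1r.
  apply: ae_eq_fc => //; apply: ae_imp (ae_and rF rG) => t _ [h1 h2].
  have cj w : Re (w^*%C) = Re w /\ Im (w^*%C) = - Im w by case: w.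
  have [jr ji] := cj (c t); apply: ceqP; rewrite ?jr ?ji !cE//.
  by rewrite h1 h2 subrr oppr0.
have ab m : a m.+1 = b m.+1.
  have := key m.+1%:Z; rewrite !fcc => h.
  have {h} : nc (a m.+1 - b m.+1) = 0 by rewrite -ncN h ncC nc0.
  by move=> /nc_eq0/eqP; rewrite subr_eq0 => /eqP.
have re0 : Re (a 0%N - b 0%N) = 0.
  have := key 0; rewrite oppr0 !fcc => /(congr1 Re); rewrite ReN /=.
  by case: (a 0%N - b 0%N) => u v /=; lra.
pose theta := Im (a 0%N - b 0%N).
have hth : cexp (a 0%N - b 0%N) = expi theta by rewrite /cexp re0 expR0 mul1r.
have dE z : nc z < 1 -> dPhi z = expi theta * dPhi' z.
  move=> z1; rewrite EP ?EP' ?(ltW z1)// EF// EG// (ps_shift ha hb z1 ab) cexpD hth.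
  exact: erefl.
have [c1 _ [_ d1] _] := immersion_disk im1; have [c2 _ [_ d2] _] := immersion_disk im2.
pose D z := Phi z - expi theta * Phi' z.
have cD : cdc D.
  rewrite /D; under eq_fun do rewrite -mulNr; apply: cdcD => //; apply: cdcM => //.
  by apply: cdc_cont => z _; exact: ccst.
have D0 z : nc z < 1 -> D z = D 0.
  move=> z1; pose K s := D (0 + s%:C * z).
  have cK s : 0 <= s <= 1 -> cder K s 0.
    move=> hs; have hi : nc (0 + s%:C * z) < 1.
      rewrite add0r ncM ncR ger0_norm; last by lra.
      by apply: le_lt_trans z1; rewrite ler_piMl ?nc_ge0; lra.
    apply: cder_eq (cderB (d1 _ _ _ hi (cder_seg 0 z s)) (cderZ (expi theta) (d2 _ _ _ hi (cder_seg 0 z s)))) _.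
    by rewrite dE// mulrA subrr.
  have : K 1 = K 0.
    apply: nc_small_eq => e e0; have := @mean_value_leC _ K (fun=> 0) 0 1 0 ler01 cK.
    by rewrite mulr0 mul0r => h; apply: le_lt_trans (h _) e0 => t _; rewrite nc0.
  by rewrite /K mul0r addr0 mul1r add0r.
exists theta, (D 0) => z /closed_diskE z1.
have -> : D 0 = D z; last by rewrite /D; ring.
apply: nc_small_eq => e e0; have [r0 hr0 H] := cdc_dilate cD e0.
pose r := (1 + r0) / 2; have := H r z ltac:(rewrite /r; lra) z1.
rewrite (D0 (r%:C * z)); first by rewrite ncB.
rewrite ncM ncR ger0_norm; last by rewrite /r; lra.
apply: (@le_lt_trans _ _ r); last by rewrite /r; lra.
by rewrite ler_piMr//; rewrite /r; lra.
Qed.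

End Boundary.

(** * The harmonic extension *)

Section Harmonic.
Context {R : realType}.
Notation C := (Cplx R).
Notation ang := (@angles R).
Notation ci := (@circle_integral R).
Notation leb := (@lebesgue_measure R).
Implicit Types (z w v h k : C) (t s x r : R) (a : nat -> C) (u : C -> R).

(** The factor [k] makes the statement apply to its own conclusion, which yields the second
    derivatives. *)
Lemma dir_is_derive u a k v z : rad1 a -> (forall z, nc z < 1 -> u z = Re (k * ps a z)) ->
  nc z < 1 -> is_derive (0 : R) 1 (fun t : R => u (z + t%:C * v)) (Re (k * v * ps (dps a) z)).
Proof.
move=> ha hu z1; have [_ hp] := ps_holo ha.
have i0 : z + (0 : R)%:C * v = z by rewrite mul0r addr0.
have c0 : nc (z + (0 : R)%:C * v) < 1 by rewrite i0.
have [d1 _] := cderZ k (hp _ 0 v c0 (cder_seg z v 0)).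
rewrite i0 in d1; have -> : k * v * ps (dps a) z = k * (ps (dps a) z * v) by ring.
apply: is_derive_near d1; apply/nbhs_ballP.
have n1 : 0 < nc v + 1 by rewrite ltr_wpDl ?nc_ge0.
have e0 : 0 < (1 - nc z) / (nc v + 1) by rewrite divr_gt0 ?subr_gt0.
exists ((1 - nc z) / (nc v + 1)) => //= s; rewrite /ball /= sub0r normrN => hs.
rewrite hu//; apply: (le_lt_trans (ncD _ _)); rewrite ncM ncR.
move: hs; rewrite ltr_pdivlMr// mulrDr mulr1; have := normr_ge0 s; lra.
Qed.

Lemma dir_deriveE u a k v z : rad1 a -> (forall z, nc z < 1 -> u z = Re (k * ps a z)) ->
  nc z < 1 -> dir_derive v u z = Re (k * v * ps (dps a) z).
Proof.
by move=> ha hu z1; have h := dir_is_derive v ha hu z1; rewrite /dir_derive derive1E; exact: (@derive_val _ _ _ _ _ _ _ h).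
Qed.

Lemma near_disk (T : Type) (f g : C -> T) z : nc z < 1 -> (forall z, nc z < 1 -> f z = g z) ->
  \forall w \near z, f w = g w.
Proof.
move=> z1 fg; apply/nbhsCP; exists (1 - nc z); first by rewrite subr_gt0.
by move=> w hw; apply: fg; have := nc_distD w z; lra.
Qed.

Section Re_ps.
Variables (u : C -> R) (a : nat -> C).
Hypotheses (ha : rad1 a) (hu : forall z, nc z < 1 -> u z = Re (ps a z)).

Let hu1 z : nc z < 1 -> u z = Re (1 * ps a z). Proof. by move=> z1; rewrite mul1r hu. Qed.
Let hu2 v z : nc z < 1 -> dir_derive v u z = Re (v * ps (dps a) z).
Proof. by move=> z1; rewrite (dir_deriveE v ha hu1 z1) mul1r. Qed.
Let hu3 v w z : nc z < 1 -> dir_derive w (dir_derive v u) z = Re (v * w * ps (dps (dps a)) z).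
Proof. by move=> z1; rewrite (dir_deriveE w (rad1_dps ha) (hu2 v) z1). Qed.

Lemma Re_ps_C2 : disk_C2 u.
Proof.
move=> z /open_diskE z1 v w; split.
- by have h := dir_is_derive v ha hu1 z1; exact: (@ex_derive _ _ _ _ _ _ _ h).
- by have h := dir_is_derive w (rad1_dps ha) (hu2 v) z1; exact: (@ex_derive _ _ _ _ _ _ _ h).
- have cc : continuous_at z (fun y => Re (v * w * ps (dps (dps a)) y)).
    apply: ccRe; apply: ccM; first exact: ccst.
    by apply: ps_cont => //; exact/rad1_dps/rad1_dps.
  rewrite /prop_for /continuous_at hu3//; apply: cvg_trans cc; apply: (@near_eq_cvg _ _ (nbhs z)).
  by apply: (near_disk z1) => y y1; rewrite hu3.
Qed.

Lemma Re_ps_laplacian z : open_disk z -> laplacian u z = 0.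
Proof.
move=> /open_diskE z1; rewrite /laplacian !hu3// !mul1r -expr2 sqr_i mulN1r ReN subrr//.
Qed.
End Re_ps.

(** The extension is [Re F]. It converges along dilations uniformly, hence in L^1, because [F]
    is uniformly continuous on the closed disk. *)
Theorem immersion_harmonic Phi dPhi (l : C -> R) : circle_L1 l ->
  holomorphic_immersion Phi dPhi -> conformal_factor dPhi l ->
  exists lt : C -> R, harmonic_extension l lt /\
    forall z, closed_disk z -> `|dPhi z| = (expR (lt z))%:C.
Proof.
move=> il im cf; have [a [F [ha cF EF EP]]] := immersion_log im.
have rF := conformal_log EP cf; exists (fun z => Re (F z)); split; last first.
  by move=> z /closed_diskE z1; rewrite ncE EP// nc_cexp.
have hu z : nc z < 1 -> Re (F z) = Re (ps a z) by move=> z1; rewrite EF.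
have il' : cintb (fun t => l (expi t)) := il.
split; [exact: Re_ps_C2 ha hu|exact: Re_ps_laplacian ha hu| |exact: rF].
pose D r t := Re (F (r%:C * expi t)) - l (expi t).
have iD r : 0 <= r <= 1 -> cintb (fun t => `|D r t|).
  move=> hr; apply: cintb_norm; apply: cintbB => //; apply: cintb_cont.
  by apply: continuousC_Re; exact: cdc_circ_in.
have fE r : 0 <= r <= 1 -> (\int[leb]_(t in ang) `|D r t|%:E)%E = (ci (fun t => `|D r t|))%:E.
  by move=> hr; rewrite /circle_integral /Rintegral fineK//; exact: (integrable_fin_num m_ang (iD r hr)).
have small e : 0 < e -> exists2 r0, 0 <= r0 < 1 & forall r, r0 <= r < 1 -> ci (fun t => `|D r t|) <= e.
  move=> e0; have e2 : 0 < e / (2 * pi) by rewrite divr_gt0 ?pi2_gt0.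
  have [r0 hr0 H] := cdc_dilate cF e2; exists r0 => // r hr.
  have hr' : 0 <= r <= 1 by lra.
  pose D' t := Re (F (r%:C * expi t)) - Re (F (expi t)).
  have iD' : cintb (fun t => `|D' t|).
    apply: cintb_norm; apply: cintb_cont => t; apply: cvgB.
      by apply: continuousC_Re; exact: cdc_circ_in.
    by apply: continuousC_Re; exact: cdc_circ.
  rewrite (ae_eq_ci (cintb_meas (iD r hr')) (cintb_meas iD')).
    rewrite -[leRHS](@divfK _ (2 * pi)) ?gt_eqF ?pi2_gt0// -ci_cst; apply: le_ci => //; first exact: cintb_cst.
    move=> t _; rewrite /D' -ReN -ReD; apply: le_trans (Re_le_nc _) _.
    by rewrite ncB; apply/ltW/H; rewrite ?nc_expi//; lra.
  by apply: ae_imp rF => t _ h; rewrite /D /D' h.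
have near1 r0 (P : R -> Prop) : 0 <= r0 < 1 -> (forall r, r0 <= r < 1 -> P r) -> \forall r \near (1:R)^'-, P r.
  move=> /andP[_ r1] h; near=> r; apply: h; apply/andP; split; near: r.
  - exact: nbhs_left_ge.
  - exact: nbhs_left_lt.
apply: (@cvg_trans _ ((fun r => (ci (fun t => `|D r t|))%:E) @ (1 : R)^'-)).
  apply: near_eq_cvg; apply: (near1 0) => [|r hr]; first by rewrite lexx ltr01.
  by rewrite /= fE//; lra.
apply: cvg_EFin; first by near=> r.
apply/cvgrPdist_le => e e0; have [r0 hr0 H] := small _ e0.
apply: (near1 r0) => // r hr; rewrite /= sub0r normrN ger0_norm ?H//.
by apply: ci_ge0.
Unshelve. all: by end_near. Qed.

End Harmonic.

(** * Primitives and derivatives along the circle *)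

Section Primitive.
Context {R : realType}.
Notation C := (Cplx R).
Notation leb := (@lebesgue_measure R).
Implicit Types (z w : C) (t s x : R) (u v : R -> R) (c d k : R -> C).

Lemma cder_eq_fun c1 c2 d : (forall t, cder c1 t (d t)) -> (forall t, cder c2 t (d t)) ->
  forall s t, c1 t - c1 s = c2 t - c2 s.
Proof.
move=> h1 h2; have main s t : s <= t -> c1 t - c1 s = c2 t - c2 s.
  move=> st; pose D x := c1 x - c2 x.
  have hD x : s <= x <= t -> cder D x 0 by move=> _; apply: cder_eq (cderB (h1 x) (h2 x)) _; rewrite subrr.
  have : D t = D s.
    apply: nc_small_eq => e e0; have := @mean_value_leC _ D (fun=> 0) s t 0 st hD.
    by rewrite mulr0 mul0r => h; apply: le_lt_trans (h _) e0 => x _; rewrite nc0.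
  rewrite /D => /eqP; rewrite subr_eq => /eqP ->; ring.
move=> s t; case: (leP s t) => [|/ltW] /main//; move=> h.
by rewrite -(opprB (c1 s)) h opprB.
Qed.

(** The integral from [- n] is a primitive on the right of [- n]. Normalized to vanish at 0,
    these primitives agree where they are defined, so at each point one can use a large enough
    [n]. *)
Lemma primR v : continuous v -> exists V : R -> R, V 0 = 0 /\ forall t, is_derive t 1 V (v t).
Proof.
move=> cv; pose F (n : nat) x := \int[leb]_(t in `[- n%:R, x]) v t.
have dF n x : - n%:R < x -> is_derive x 1 (F n) (v x).
  move=> nx; have iv : leb.-integrable `[- n%:R, x + 1] (EFin \o v).
    apply: continuous_compact_integrable; first exact: segment_compact.
    exact: continuous_subspaceT.
  have [h1 h2] := @continuous_FTC1_closed R v (- n%:R) x (x + 1) ltac:(lra) iv nx (cv x).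
  by apply: (DeriveDef h1); rewrite -derive1E.
have FF (n m : nat) x : - n%:R < x -> - m%:R < x -> (0 < n)%N -> (0 < m)%N -> F n x - F n 0 = F m x - F m 0.
  move=> nx mx n0 m0; pose D s : C := (F n s - F m s)%:C.
  pose q := minn n m; have qn : (q <= n)%N by rewrite /q; lia.
  have qm : (q <= m)%N by rewrite /q; lia.
  have q0 : 0 < (q%:R : R) by rewrite ltr0n /q; lia.
  have hD s : - (q%:R) < s < Num.max x 0 + 1 -> cder D s 0.
    move=> hs; have h1 : - (n%:R : R) < s.
      by have : (q%:R : R) <= n%:R; [rewrite ler_nat|lra].
    have h2 : - (m%:R : R) < s by have : (q%:R : R) <= m%:R; [rewrite ler_nat|lra].
    by apply: cder_eq (cder_real (is_deriveB (dF n s h1) (dF m s h2))) _; rewrite subrr.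
  have hx : - q%:R < x < Num.max x 0 + 1.
    have xm : x <= Num.max x 0 by rewrite le_max lexx.
    by apply/andP; split; [rewrite /q /minn; case: ifP|lra].
  have h0 : - q%:R < (0 : R) < Num.max x 0 + 1.
    have xm : 0 <= Num.max x 0 by rewrite le_max lexx orbT.
    by apply/andP; split; lra.
  have /complexI := cder_cst_itv hD hx h0; lra.
pose N x := (Num.truncn `|x|).+2.
have hN x : `|x| + 1 < (N x)%:R.
  by have := truncnS_gt `|x|; rewrite /N -(natr1 (Num.truncn `|x|).+1); lra.
exists (fun x => F (N x) x - F (N x) 0); split; first by rewrite subrr.
move=> t; have ht := hN t; apply: (@is_derive_near _ (fun x => F (N t) x - F (N t) 0)).
  apply/nbhs_ballP; exists 1; first exact: ltr01.
  move=> x; rewrite /ball /= => hx; have hx' := hN x.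
  have := ler_norm (- x); have := ler_norm (- t); rewrite !normrN => h1 h2.
  have h3 : `|x| < `|t| + 1 by have := lerB_dist x t; rewrite distrC in hx; lra.
  by apply: FF; [lra|lra| |].
have ht' : - (N t)%:R < t by have := ler_norm (- t); rewrite normrN; lra.
have h := is_deriveB (dF (N t) t ht') (is_derive_cst (F (N t) 0) t 1).
by apply: (@is_derive_eq _ _ _ _ _ _ _ _ h); rewrite subr0.
Qed.

Lemma primC k : continuous k -> exists K : R -> C, K 0 = 0 /\ forall t, cder K t (k t).
Proof.
move=> ck; have [V [V0 hV]] := primR (continuousC_Re ck); have [W [W0 hW]] := primR (continuousC_Im ck).
exists (fun t => V t +i* W t : C); split; first by rewrite V0 W0.
by move=> t; split; [exact: hV|exact: hW].
Qed.

Lemma frac_le (e d : R) : 0 < e -> 0 <= d -> 2 * (e / (2 * d + 1)) * d <= e.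
Proof.
move=> e0 d0; have d1 : 0 < 2 * d + 1 by lra.
have -> : 2 * (e / (2 * d + 1)) * d = e * (2 * d / (2 * d + 1)) by field; lra.
by rewrite ler_piMr ?(ltW e0)// ler_pdivrMr; lra.
Qed.

(** [Phi] is differentiable inside the disk only. On the circle of radius [r < 1] the increments
    of [Phi] are controlled by the angular derivative there; as [r] tends to 1 everything
    converges uniformly, so on the unit circle [Phi] is a primitive of the continuous limit of
    the angular derivatives. *)
Lemma cder_boundary Phi dPhi t : cdc Phi -> cdc dPhi -> holo Phi dPhi ->
  cder (fun t => Phi (expi t)) t ('i * expi t * dPhi (expi t)).
Proof.
move=> cP cdP [_ hP].
have ck : continuous (fun t => 'i * expi t * dPhi (expi t) : C).
  move=> s; apply: ccM; last exact: (cdc_circ cdP).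
  by apply: ccM; [exact: ccst|exact: cont_expi].
have [K [K0 hK]] := primC ck.
have E s : Phi (expi s) = K s + Phi (expi 0).
  suff main (x y : R) : x <= y -> Phi (expi y) - Phi (expi x) = K y - K x.
    case: (leP 0 s) => [|/ltW] /main; rewrite K0; first by rewrite subr0 => <-; ring.
    by rewrite sub0r => /(congr1 (fun z : C => - z)); rewrite opprK opprB => <-; ring.
  move=> xy; apply: nc_small_eq => e e0.
  have e4 : 0 < e / 4 by rewrite divr_gt0.
  have M0 : 0 < e / 4 / (2 * (y - x) + 1) by rewrite divr_gt0// ltr_wpDl// mulr_ge0 ?subr_ge0.
  have [r1 hr1 H1] := cdc_dilate cP e4; have [r2 hr2 H2] := cdc_dilate (cdcM (cdc_cont (fun z _ => cvg_id)) cdP) M0.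
  pose r := Num.max ((1 + r1) / 2) ((1 + r2) / 2).
  have hr : r1 <= r < 1 by rewrite le_max gt_max; lra.
  have hr' : r2 <= r < 1 by rewrite le_max gt_max; lra.
  have hi q : nc (r%:C * expi q : C) < 1 by rewrite nc_rexpi; lra.
  pose D q := Phi (r%:C * expi q) - K q.
  have hD q : x <= q <= y -> cder D q (dPhi (r%:C * expi q) * (r%:C * ('i * expi q)) - 'i * expi q * dPhi (expi q)).
    by move=> _; apply: cderB; [exact: hP (cder_circ r q)|exact: hK].
  have hB q : x <= q <= y -> nc (dPhi (r%:C * expi q) * (r%:C * ('i * expi q)) - 'i * expi q * dPhi (expi q)) <= e / 4 / (2 * (y - x) + 1).
    move=> _; have -> : dPhi (r%:C * expi q) * (r%:C * ('i * expi q)) - 'i * expi q * dPhi (expi q) =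
       'i * - (expi q * dPhi (expi q) - r%:C * expi q * dPhi (r%:C * expi q)) by ring.
    rewrite ncM ncN [nc 'i](_ : _ = 1) ?mul1r; last by rewrite /= expr0n expr1n add0r sqrtr1.
    by apply/ltW/H2; [lra|rewrite nc_expi].
  have h1 := H1 r (expi y) ltac:(lra) ltac:(by rewrite nc_expi).
  have h2 := H1 r (expi x) ltac:(lra) ltac:(by rewrite nc_expi).
  have h3 : 2 * (e / 4 / (2 * (y - x) + 1)) * (y - x) <= e / 4 by apply: frac_le => //; rewrite subr_ge0.
  have h4 := le_trans (mean_value_leC xy hD hB) h3.
  have -> : Phi (expi y) - Phi (expi x) - (K y - K x) =
    (Phi (expi y) - Phi (r%:C * expi y)) + (D y - D x) - (Phi (expi x) - Phi (r%:C * expi x)) by rewrite /D; ring.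
  apply: le_lt_trans (ncD _ _) _; rewrite ncN.
  have := ncD (Phi (expi y) - Phi (r%:C * expi y)) (D y - D x); lra.
apply: (@cder_ext _ (fun s => K s + Phi (expi 0))); first by move=> s; rewrite (E s).
by apply: cder_eq (cderD (hK t) (cder_cst _ t)) _; rewrite addr0.
Qed.
End Primitive.

(** * Lipschitz periodic functions *)

Section Periodic.
Context {R : realType}.
Notation C := (Cplx R).
Notation leb := (@lebesgue_measure R).
Notation mR := (measurableTypeR R).
Notation ang := (@angles R).
Notation ci := (@circle_integral R).
Notation cint := (@circle_cintegral R).
Implicit Types (z : C) (t s x : R) (u v : R -> R) (c d k : R -> C) (n : int).

Definition per (T : Type) (f : R -> T) : Prop := forall t, f (t + 2 * pi) = f t.

Lemma perZ (T : Type) (f : R -> T) t n : per f -> f (t + n%:~R * (2 * pi)) = f t.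
Proof.
move=> pf; have pN m s : f (s + m%:R * (2 * pi)) = f s.
  elim: m => [|m IH]; first by rewrite mul0r addr0.
  by rewrite -natr1 mulrDl mul1r addrA pf IH.
case: n => m; first exact: pN.
by rewrite NegzE intrN mulNr -[in RHS](subrK (m.+1%:R * (2 * pi)) t) pN.
Qed.

Lemma ang_reduce t : exists2 s, 0 <= s < 2 * pi & exists n, t = s + n%:~R * (2 * pi).
Proof.
have p0 := @pi2_gt0 R; pose n := Num.floor (t / (2 * pi)).
exists (t - n%:~R * (2 * pi)); last by exists n; rewrite subrK.
have := floor_le_tmp (t / (2 * pi)); have := floorD1_gt (t / (2 * pi)).
rewrite -/n ltr_pdivrMr// ler_pdivlMr// intrD mulrDl mul1r; lra.
Qed.

Lemma expi_per : per (expi : R -> C). Proof. exact: expi_period. Qed.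

Lemma expi_eq s t : expi s = expi t :> C -> exists n, s = t + n%:~R * (2 * pi).
Proof.
move=> E; have [x hx [n hn]] := ang_reduce (s - t); exists n.
have : expi x = 1 :> C.
  rewrite -(perZ x n expi_per) -hn expiD expiN E divff//; exact: expi_neq0.
move=> /(congr1 Re) /= c1; have [x0|x0] := eqVneq x 0; first by move: hn; rewrite x0 add0r; lra.
have : 0 < x < 2 * pi by case/andP: hx => h ->; rewrite andbT lt_neqAle eq_sym x0.
by move=> /cos1_2pi; rewrite c1 ltxx.
Qed.

Definition angle z : R := xget 0 [set t | expi t = z].
(** A choice of the angle turns a periodic function into a function on the circle. *)
Definition of_angle (T : Type) (f : R -> T) z : T := f (angle z).

Lemma angleK z : nc z = 1 -> expi (angle z) = z.
Proof. by move=> /polar_unit[t _ E]; apply: (@xgetPex _ 0 [set t | expi t = z]); exists t. Qed.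

Lemma of_angleE (T : Type) (f : R -> T) t : per f -> of_angle f (expi t) = f t.
Proof.
move=> pf; rewrite /of_angle; have := angleK (nc_expi t) => /expi_eq[n ->].
exact: perZ.
Qed.

(** A primitive gains the same amount over every period. *)
Lemma per_shift u : continuous u -> per u -> forall x, ci (fun t => u (t + x)) = ci u.
Proof.
move=> cu pu x; have [V [_ hV]] := primR cu.
have hs s t : is_derive t 1 (fun t => V (t + s)) (u (t + s)).
  have h := @is_derive1_comp _ V (fun t => t + s) t (u (t + s)) 1 (hV _).
  apply: (@is_derive_eq _ _ _ _ _ _ _ _ (h _)); last by rewrite mulr1.
  by apply: (@is_derive_eq _ _ _ _ _ _ _ _ (is_deriveD (is_derive_id t 1) (is_derive_cst s t 1))); rewrite addr0.
have E s : ci (fun t => u (t + s)) = V (2 * pi + s) - V (0 + s).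
  have cs : continuous (fun t => u (t + s)).
    move=> t; apply: (@continuous_comp _ _ _ (fun t => t + s)); last exact: cu.
    by apply: cvgD; [exact: cvg_id|exact: cvg_cst].
  exact: (@FTC2_seg R (fun t => V (t + s)) (fun t => u (t + s)) 0 (2 * pi) (ltW (pi2_gt0)) (hs s) cs).
have cst : (V (2 * pi + x) - V x)%:C = (V (2 * pi) - V 0)%:C :> C.
  have h t : cder (fun t => (V (t + 2 * pi) - V t)%:C : C) t 0.
    by apply: cder_eq (cder_real (is_deriveB (hs (2 * pi) t) (hV t))) _; rewrite pu subrr.
  have := cder_eq_fun h (cder_cst 0) 0 x; rewrite subrr add0r => /eqP.
  by rewrite subr_eq0 (addrC _ x) => /eqP.
have -> : ci u = ci (fun t => u (t + 0)) by apply: eq_ci => t _; rewrite addr0.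
by rewrite !E add0r !addr0; move/complexI: cst.
Qed.

(** Small increments only: for periodic functions this is as good as the global Lipschitz
    condition, and it is easier to verify and to multiply. *)
Definition llip c : Prop := exists (e M : R), 0 < e /\ forall t h, `|h| < e -> nc (c (t + h) - c t) <= M * `|h|.

Lemma llip_cont c : llip c -> continuous c.
Proof.
move=> [d [M [d0 H]]] t; apply/(cvgCP (nbhs_filter t)) => e e0.
have M0 : 0 < `|M| + 1 by have := normr_ge0 M; lra.
apply/nbhs_ballP; exists (Num.min d (e / (`|M| + 1))) => /=; first by rewrite lt_min d0 divr_gt0.
move=> s; rewrite /ball /= lt_min => /andP[h1 h2].
have := H t (s - t); rewrite (addrC t) subrK distrC => /(_ h1) h3.
rewrite ncB; apply: le_lt_trans h3 _; move: h2; rewrite ltr_pdivlMr//.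
have := ler_norm M; have := normr_ge0 (t - s); nra.
Qed.

(** Over a period the integral of every difference quotient vanishes. The quotients are bounded
    by the Lipschitz constant and converge almost everywhere to the derivative, so dominated
    convergence applies. *)
Lemma FTC_llip_real w v : llip (fun t => (w t)%:C) -> per w -> cintb v ->
  circle_ae (fun t => is_derive t 1 w (v t)) -> ci v = 0.
Proof.
move=> lw pw iv dw; have cw : continuous w.
  by move=> t; have h := llip_cont lw; exact: (ccRe (h t)).
have [d [M [d0 H]]] := lw.
pose h (n : nat) := d / n.+2%:R.
have h0 (n : nat) : 0 < h n by rewrite divr_gt0.
have hd (n : nat) : h n < d by rewrite ltr_pdivrMr// ltr_pMr// ltr1n.
pose f (n : nat) t := (h n)^-1 * (w (t + h n) - w t).
have csh (n : nat) : continuous (fun t => w (t + h n)).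
  move=> t; apply: (@continuous_comp _ _ _ (fun t => t + h n)); last exact: cw.
  by apply: cvgD; [exact: cvg_id|exact: cvg_cst].
have cd (n : nat) : continuous (fun t => w (t + h n) - w t) by move=> t; apply: cvgB; [exact: csh|exact: cw].
have cf (n : nat) : continuous (f n) by move=> t; apply: cvgM; [exact: cvg_cst|exact: cd].
have f0 (n : nat) : ci (f n) = 0.
  rewrite ciZ; last exact: cintb_cont.
  rewrite ciB; [|exact: cintb_cont|exact: cintb_cont].
  by rewrite per_shift// subrr mulr0.
have lim : circle_ae (fun t => (fun n : nat => (f n t)%:E) @ \oo --> (v t)%:E).
  apply: ae_imp dw => t _ /(@is_deriveP R) D.
  apply: cvg_EFin; first by near=> n.
  apply/cvgrPdist_le => e e0; have [r r0 {}D] := D e e0.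
  pose N := Num.truncn (d / r); near=> n.
  have nN : (N <= n)%N by near: n; exists N.
  have hr : h n < r.
    rewrite ltr_pdivrMr// mulrC -ltr_pdivrMr//.
    have := truncnS_gt (d / r); rewrite -/N => /lt_le_trans -> //.
    by rewrite ler_nat; lia.
  have := D (h n); rewrite gtr0_norm// => /(_ hr).
  have hn := gt_eqF (h0 n); rewrite /=.
  have -> : v t - f n t = - ((h n)^-1 * (w (t + h n) - w t - h n * v t)) by rewrite /f; field; rewrite hn.
  by rewrite normrN normrM (gtr0_norm (x := (h n)^-1)) ?invr_gt0// ler_pdivrMl// [h n * e]mulrC.
have mf (n : nat) : measurable_fun (ang : set mR) (EFin \o f n).
  by apply/measurable_EFinP; exact: cont_meas.
have mv : measurable_fun (ang : set mR) (EFin \o v) by apply/measurable_EFinP; exact: cintb_meas.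
have ig : leb.-integrable ang (EFin \o (fun=> M)) by exact: cintb_cst.
have bd : {ae leb, forall (x : mR) (n : nat), ang x -> (`|(EFin \o f n) x| <= (EFin \o (fun=> M)) x)%E}.
  apply: aeW => t n _ /=; rewrite lee_fin /f normrM gtr0_norm ?invr_gt0//.
  rewrite ler_pdivrMl// mulrC; have := H t (h n); rewrite (gtr0_norm (h0 n)) => /(_ (hd n)).
  have Ed x y : nc (x%:C - y%:C : C) = `|x - y| by rewrite -RCB ncR.
  by rewrite Ed mulrC.
have [_ _] := @dominated_convergence _ mR R leb ang m_ang (fun n : nat => EFin \o f n) (EFin \o v) _ mf mv lim ig bd.
have -> : (fun n : nat => \int[leb]_(x in ang) (EFin \o f n) x)%E = (fun=> 0%:E).
  apply/funext => n; rewrite -(f0 n) /circle_integral /Rintegral fineK//.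
  exact: (integrable_fin_num m_ang (cintb_cont (cf n))).
move=> /(cvg_unique (@ereal_hausdorff R))/(_ (cvg_cst _)).
by rewrite /circle_integral /Rintegral => ->.
Unshelve. all: by end_near. Qed.

Lemma llip_Re c : llip c -> llip (fun t => (Re (c t))%:C).
Proof.
move=> [d [M [d0 H]]]; exists d, M; split => // t h hd; apply: le_trans (H t h hd).
by rewrite -RCB ncR -ReN -ReD Re_le_nc.
Qed.
Lemma llip_Im c : llip c -> llip (fun t => (Im (c t))%:C).
Proof.
move=> [d [M [d0 H]]]; exists d, M; split => // t h hd; apply: le_trans (H t h hd).
by rewrite -RCB ncR -ImN -ImD Im_le_nc.
Qed.

Lemma FTC_llip c d : llip c -> per c -> cintbC d -> circle_ae (fun t => cder c t (d t)) -> cint d = 0.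
Proof.
move=> lc pc [i1 i2] h; apply: ceqP => /=.
- apply: (FTC_llip_real (llip_Re lc)) => //; first by move=> t; rewrite pc.
  by apply: ae_imp h => t _ [].
- apply: (FTC_llip_real (llip_Im lc)) => //; first by move=> t; rewrite pc.
  by apply: ae_imp h => t _ [].
Qed.

Lemma llip_bdd c : per c -> llip c -> exists2 B, 0 <= B & forall t, nc (c t) <= B.
Proof.
move=> pc lc; have cc : continuous (fun t => nc (c t)) by move=> t; apply: ccnc; exact: llip_cont.
have [B hB] := cont_bdd_ang cc; exists `|B| => // t.
have [s hs [n ->]] := ang_reduce t; rewrite perZ//.
apply: le_trans (ler_norm _) _; apply: le_trans (hB s _) (ler_norm _).
by apply/angP; lra.
Qed.

Lemma llipM c d : per c -> per d -> llip c -> llip d -> llip (fun t => c t * d t).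
Proof.
move=> pc pd lc ld; have [A A0 hA] := llip_bdd pc lc; have [B B0 hB] := llip_bdd pd ld.
have [e1 [M1 [e10 H1]]] := lc; have [e2 [M2 [e20 H2]]] := ld.
exists (Num.min e1 e2), (M1 * B + A * M2); split; first by rewrite lt_min e10.
move=> t h; rewrite lt_min => /andP[/(H1 t) h1 /(H2 t) h2].
have -> : c (t + h) * d (t + h) - c t * d t = (c (t + h) - c t) * d (t + h) + c t * (d (t + h) - d t) by ring.
apply: le_trans (ncD _ _) _; rewrite !ncM mulrDl lerD//.
- by rewrite mulrAC; apply: ler_pM; rewrite ?nc_ge0.
- by rewrite -mulrA; apply: ler_pM; rewrite ?nc_ge0.
Qed.

Lemma llip_der c d M : (forall t, cder c t (d t)) -> (forall t, nc (d t) <= M) -> llip c.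
Proof.
move=> h hM; exists 1, (2 * M); split => // t x _.
case: (leP 0 x) => x0.
- have := @mean_value_leC R c d t (t + x) M ltac:(lra) (fun s _ => h s) (fun s _ => hM s).
  by rewrite addrAC subrr add0r ger0_norm.
- have := @mean_value_leC R c d (t + x) t M ltac:(lra) (fun s _ => h s) (fun s _ => hM s).
  by rewrite ncB ltr0_norm// opprD addrA subrr add0r.
Qed.

Lemma bounded_derive_lip (u v : R -> R) (K : R) : (forall t, is_derive t 1 u (v t)) -> (forall t, `|v t| <= K) ->
  forall t h, `|u (t + h) - u t| <= 2 * K * `|h|.
Proof.
move=> hu hK; have Ed x y : nc (x%:C - y%:C : C) = `|x - y| by rewrite -RCB ncR.
have le x y : x <= y -> `|u y - u x| <= 2 * K * (y - x).
  move=> xy; rewrite -Ed; apply: (mean_value_leC xy (fun s _ => cder_real (hu s))) => s _; by rewrite ncR.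
move=> t h; case: (leP 0 h) => h0.
- have E : t + h - t = h by rewrite addrAC subrr add0r.
  by have := le t (t + h) ltac:(lra); rewrite E (ger0_norm h0).
- have E : t - (t + h) = - h by ring.
  by have := le (t + h) t ltac:(lra); rewrite distrC E (ltr0_norm h0).
Qed.

Lemma cder_shift c t (z : C) : cder c (t + 2 * pi) z -> cder (fun s => c (s + 2 * pi)) t z.
Proof.
have sh : is_derive t 1 (fun s => s + 2 * pi) 1.
  by apply: (@is_derive_eq _ _ _ _ _ _ _ _ (is_deriveD (is_derive_id t 1) (is_derive_cst (2 * pi) t 1))); rewrite addr0.
by move=> h; apply: cder_eq (cder_comp sh h) _; rewrite mul1r.
Qed.

Lemma per_cder c d : per c -> (forall t, cder c t (d t)) -> per d.
Proof.
move=> pc h t; apply: cder_unique (h t).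
by apply: cder_ext (cder_shift (h _)) => s; rewrite pc.
Qed.

Lemma llip_C1 c d : per c -> (forall t, cder c t (d t)) -> continuous d -> llip c.
Proof.
move=> pc h cd; have pd := per_cder pc h.
have cn : continuous (fun t => nc (d t)) by move=> t; apply: ccnc; exact: cd.
have [B hB] := cont_bdd_ang cn; apply: (llip_der (M := B) h) => t.
have [s hs [n ->]] := ang_reduce t; rewrite perZ//.
by apply: le_trans (ler_norm _) (hB s _); apply/angP; lra.
Qed.

End Periodic.

(** * Fourier coefficients of derivatives *)

Section FourierCalculus.
Context {R : realType}.
Notation C := (Cplx R).
Notation leb := (@lebesgue_measure R).
Notation mR := (measurableTypeR R).
Notation ang := (@angles R).
Notation cint := (@circle_cintegral R).
Implicit Types (z : C) (t s x r : R) (u v : R -> R) (c d k : R -> C) (n : int).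

Lemma per_en n : per (@en R n).
Proof. by move=> t; rewrite enDt en_2pi mulr1. Qed.
Lemma llip_en n : llip (@en R n).
Proof.
apply: (llip_C1 (per_en n) (@cder_en R n)) => t.
by apply: ccM; [exact: ccst|exact: cont_en].
Qed.

(** Integration by parts is [FTC_llip] for the product with a character. *)
Lemma fc_llip c d n : per c -> llip c -> cintbC d -> circle_ae (fun t => cder c t (d t)) ->
  fc d n = 'i * (n%:~R : R)%:C * fc c n.
Proof.
move=> pc lc id dc; have ic := cintbC_cont (llip_cont lc).
pose k : C := 'i * ((- n)%:~R : R)%:C.
have := @FTC_llip R (fun t => c t * en (- n) t) (fun t => d t * en (- n) t + c t * (k * en (- n) t)).
move=> /(_ (llipM pc (per_en _) lc (llip_en _)) _ _ _)/wrap[].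
- by move=> t; rewrite pc per_en.
- apply: cintbC_D; first by apply: cintbC_M => //; exact: cont_en.
  by apply: cintbC_M => // t; apply: ccM; [exact: ccst|exact: cont_en].
- by apply: ae_imp dc => t _ h; apply: cderM => //; exact: cder_en.
rewrite cintD; last 2 first.
- by apply: cintbC_M => //; exact: cont_en.
- by apply: cintbC_M => // t; apply: ccM; [exact: ccst|exact: cont_en].
rewrite (@eq_cint _ (fun t => c t * (k * en (- n) t)) (fun t => k * (c t * en (- n) t))); last by move=> t _; ring.
rewrite cintZ; last by apply: cintbC_M => //; exact: cont_en.
move/eqP; rewrite addr_eq0 => /eqP E.
have En : en (- n) = (fun t => expi (- (n%:~R * t))) :> (R -> C) by apply/funext => t; rewrite enN.
rewrite En in E; rewrite /fc E /k intrN RCN; ring.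
Qed.

Lemma fc_C1 c d n : per c -> (forall t, cder c t (d t)) -> continuous d ->
  fc d n = 'i * (n%:~R : R)%:C * fc c n.
Proof.
move=> pc h cd; apply: fc_llip => //; [exact: llip_C1 h cd|exact: cintbC_cont|].
by apply: ae_all => t _.
Qed.

Lemma pker_per r x : pker r (x + 2 * pi) = pker r x.
Proof. by rewrite /pker expi_period. Qed.

Lemma per_PK r c : per (PK r c).
Proof.
move=> t; rewrite /PK; congr (_ * _); apply: eq_cint => s _.
by rewrite addrAC pker_per.
Qed.

Lemma PK_approx c e : continuous c -> per c -> 0 < e ->
  exists2 r0, 0 <= r0 < 1 & forall r t, r0 <= r < 1 -> nc (PK r c t - c t) <= e.
Proof.
move=> cc pc e0; have e2 : 0 < e / 2 by rewrite divr_gt0.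
have c0 : c 0 = c (2 * pi) by rewrite -(pc 0) add0r.
have [r1 hr1 H1] := pk_approx (continuousC_Re cc) (congr1 Re c0) e2.
have [r2 hr2 H2] := pk_approx (continuousC_Im cc) (congr1 Im c0) e2.
exists (Num.max r1 r2); first by rewrite le_max gt_max; lra.
move=> r t; rewrite ge_max => hr; have [s hs [n ->]] := ang_reduce t.
rewrite (perZ _ _ (@per_PK r c)) perZ//; apply: le_trans (nc_le_ReIm _) _.
have ha : ang s by apply/angP; lra.
have := H1 r s ltac:(lra) ha; have := H2 r s ltac:(lra) ha.
by rewrite PK_ReIm !cE /=; lra.
Qed.

(** Equal coefficients give equal Poisson integrals, and these converge to the functions. *)
Lemma cont_fc_unique c d : continuous c -> continuous d -> per c -> per d ->
  (forall n, fc c n = fc d n) -> c =1 d.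
Proof.
move=> cc cd pc pd h t; apply: nc_small_eq => e e0; have e4 : 0 < e / 4 by rewrite divr_gt0.
have [r1 hr1 H1] := PK_approx cc pc e4; have [r2 hr2 H2] := PK_approx cd pd e4.
pose r := Num.max r1 r2; have hr : r1 <= r < 1 by rewrite le_max gt_max lexx; lra.
have hr' : r2 <= r < 1 by rewrite le_max gt_max lexx orbT; lra.
have := H1 r t hr; have := H2 r t hr'.
rewrite (PK_fc_eq t _ (cintbC_cont cc) (cintbC_cont cd) h); last by lra.
rewrite (ncB (PK r d t) (c t)) => h1 h2; have := ncBD (c t) (d t) (PK r d t); lra.
Qed.

Lemma fc_eq_shift c d : continuous c -> continuous d -> per c -> per d ->
  (forall n, n != 0 -> fc c n = fc d n) -> exists k : C, forall t, c t = d t + k.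
Proof.
move=> cc cd pc pd h; exists (fc c 0 - fc d 0) => t.
apply: (@cont_fc_unique c (fun t => d t + (fc c 0 - fc d 0))); [exact: cc| |exact: pc| |].
- by move=> s; apply: ccD; [exact: cd|exact: ccst].
- by move=> s; rewrite pd.
move=> n; have e0 : (fun=> fc c 0 - fc d 0) = (fun t => (fc c 0 - fc d 0) * en 0 t) :> (R -> C).
  by apply/funext => s; rewrite en0 mulr1.
rewrite fcD; [|exact: cintbC_cont|exact: cintbC_cst].
rewrite e0 fcZ ?fc_en; last exact: cintbC_en.
have [->|n0] := eqVneq n 0; first by rewrite mulr1 addrC subrK.
by rewrite mulr0 addr0 h.
Qed.

(** Truncating at the essential bound. *)
Lemma ae_clamp u (M : R) : measurable_fun (ang : set mR) u -> 0 <= M -> circle_ae (fun t => `|u t| <= M) ->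
  exists u', [/\ cintb u', forall t, `|u' t| <= M & circle_ae (fun t => u' t = u t)].
Proof.
move=> mu M0 hM; pose u' t := Num.max (- M) (Num.min (u t) M).
have bd t : `|u' t| <= M.
  by rewrite ler_norml /u' le_max lexx /= ge_max ge_min lexx orbT andbT; lra.
exists u'; split => //.
- apply: (@cintb_bdd _ _ M) => //.
  by apply: measurable_maxr; [exact: measurable_cst|apply: measurable_minr; [exact: mu|exact: measurable_cst]].
- apply: ae_imp hM => t _; rewrite ler_norml => /andP[h1 h2].
  by rewrite /u' min_l// max_r.
Qed.

Lemma ae_cintb u v : measurable_fun (ang : set mR) v -> cintb u -> circle_ae (fun t => u t = v t) -> cintb v.
Proof.
move=> mv /integrableP[mu iu] h; apply/integrableP; split; first exact/measurable_EFinP.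
rewrite (@ge0_ae_eq_integral _ mR R leb _ _ (fun t => `|(u t)%:E|)%E m_ang)//.
- by apply: measurableT_comp => //; exact/measurable_EFinP.
- by apply: measurableT_comp.
- have h2 : circle_ae (fun t => `|(v t)%:E|%E = `|(u t)%:E|%E) by apply: ae_imp h => t _ ->.
  exact: h2.
Qed.

Lemma ae_bdd_cintb u (M : R) : measurable_fun (ang : set mR) u -> 0 <= M -> circle_ae (fun t => `|u t| <= M) -> cintb u.
Proof.
by move=> mu M0 hM; have [u' [iu' _ h]] := ae_clamp mu M0 hM; exact: ae_cintb mu iu' h.
Qed.

(** The Poisson kernel is nonnegative with mean value 1. *)
Lemma pk_bdd r u (M : R) t : 0 <= r < 1 -> measurable_fun (ang : set mR) u -> 0 <= M ->
  circle_ae (fun t => `|u t| <= M) -> `|pk r u t| <= M.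
Proof.
move=> hr mu M0 hM; have [u' [iu' bd h]] := ae_clamp mu M0 hM.
have iu := ae_bdd_cintb mu M0 hM.
have -> : pk r u t = pk r u' t.
  rewrite /pk; congr (_ * _); apply: ae_eq_ci.
  - by apply: cintb_meas; exact: cintb_pk.
  - by apply: cintb_meas; exact: cintb_pk.
  - by apply: ae_imp h => s _ ->.
apply: le_trans (pk_norm_le t hr iu') _.
have -> : M = M * pk r (fun=> 1) t by rewrite pk_1// mulr1.
rewrite /pk mulrCA ler_wpM2l ?invr_ge0 ?(ltW pi2_gt0)//.
have iM := cintb_pk t hr (cintb_cst (1 : R)).
rewrite -ciZ//; apply: le_ci.
- by apply: cintb_pk => //; exact: cintb_norm.
- exact: cintbZ.
- by move=> s _; rewrite mulr1 mulrC ler_wpM2r ?pker_ge0.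
Qed.

(** The hypothesis on the coefficients says that [h] is the weak derivative of [w]. The Poisson
    integral of [w] is then, up to a constant, a primitive of that of [h], whose components are
    bounded by [M]; the resulting Lipschitz estimate does not depend on the radius and passes to
    the limit. *)
Lemma weak_llip (w h : R -> C) (M : R) : continuous w -> per w -> cintbC h -> 0 <= M ->
  circle_ae (fun t => `|Re (h t)| <= M) -> circle_ae (fun t => `|Im (h t)| <= M) ->
  (forall n, fc h n = 'i * (n%:~R : R)%:C * fc w n) ->
  forall s t, nc (w t - w s) <= 4 * M * `|t - s|.
Proof.
move=> cw pw ih M0 hR hI hfc.
have step r : 0 <= r < 1 -> forall s t, s <= t -> nc (PK r w t - PK r w s) <= 4 * M * (t - s).
  move=> hr; pose q := PK r h; have cq : continuous q by exact: cont_PK.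
  have qM t : nc (q t) <= 2 * M.
    rewrite /q PK_ReIm; apply: le_trans (nc_le_ReIm _) _ => /=.
    have := pk_bdd t hr (cintb_meas (proj1 ih)) M0 hR.
    have := pk_bdd t hr (cintb_meas (proj2 ih)) M0 hI; lra.
  have [W [W0 hW]] := primC cq.
  have q0 : cint q = 0.
    have := fc_PK 0 hr ih; rewrite hfc /= mulr0 mul0r mulr0 /fc => /eqP.
    rewrite mulf_eq0 => /orP[/eqP/(congr1 nc)|/eqP E].
      by rewrite nc0 ncR gtr0_norm ?invr_gt0 ?pi2_gt0// => /eqP; rewrite invr_eq0 gt_eqF ?pi2_gt0.
    by rewrite -[RHS]E; apply: eq_cint => t _; rewrite mul0r oppr0 expi0 mulr1.
  have pWx : per W.
    have hs t : cder (fun s => W (s + 2 * pi)) t (q t).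
      by apply: cder_eq (cder_shift (hW _)) _; exact: per_PK.
    move=> t; have := cder_eq_fun hs hW 0 t; rewrite add0r W0 subr0.
    have := cint_der hW cq; rewrite q0 W0 subr0 => <-; by rewrite subr0.
  have cW : continuous W by move=> t; exact: cder_continuous (hW t).
  have nE n : n != 0 -> fc (PK r w) n = fc W n.
    move=> n0; have E := fc_C1 n pWx hW cq.
    have nz : 'i * (n%:~R : R)%:C != 0 :> C by rewrite mulf_neq0 ?i_neq0 ?nC_neq0.
    have E1 := fc_PK n hr (cintbC_cont cw); have E2 := fc_PK n hr ih.
    apply: (mulfI nz); rewrite -E E1 [RHS]E2 hfc; ring.
  have [k hk] := fc_eq_shift (cont_PK hr (cintbC_cont cw)) cW (@per_PK r w) pWx nE.
  move=> s t st; rewrite !hk.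
  have -> : W t + k - (W s + k) = W t - W s by ring.
  by have := mean_value_leC st (fun x _ => hW x) (fun x _ => qM x); congr (_ <= _); ring.
have main s t : s <= t -> nc (w t - w s) <= 4 * M * (t - s).
  move=> st; apply: le_eps => e e0; have e2 : 0 < e / 2 by rewrite divr_gt0.
  have [r hr H] := PK_approx cw pw e2.
  have h1 := H r t ltac:(lra); have h2 := H r s ltac:(lra).
  have h3 := step r hr s t st.
  have := ncBD (w t) (w s) (PK r w t); have := ncBD (PK r w t) (w s) (PK r w s).
  rewrite (ncB (w t) (PK r w t)); lra.
move=> s t; case: (leP s t) => st.
- by rewrite ger0_norm ?subr_ge0//; exact: main.
- by rewrite ncB distrC ger0_norm ?subr_ge0 ?(ltW st)//; apply: main; exact: ltW.
Qed.

End FourierCalculus.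

(** * Angles of curves on the circle *)

Section Lift.
Context {R : realType}.
Notation C := (Cplx R).
Implicit Types (z : C) (t s x r : R) (u v : R -> R) (c d k : R -> C) (n : int).

Lemma orth_rot (x y a b : R) : 1 = x ^+ 2 + y ^+ 2 -> x * a + y * b = 0 ->
  a = - (x * b - y * a) * y /\ b = (x * b - y * a) * x.
Proof.
move=> e1 e2; split; apply/eqP; rewrite -subr_eq0.
- have -> : a - - (x * b - y * a) * y = a * (1 - (x ^+ 2 + y ^+ 2)) + x * (x * a + y * b) by ring.
  by rewrite -e1 e2 subrr !mulr0 addr0.
- have -> : b - (x * b - y * a) * x = b * (1 - (x ^+ 2 + y ^+ 2)) + y * (x * a + y * b) by ring.
  by rewrite -e1 e2 subrr !mulr0 addr0.
Qed.

(** Differentiating [|c|^2 = 1] shows [c' = i v c] with [v] real and continuous; a primitive of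
    [v] is the angle, up to a constant. *)
Lemma angle_lift c d : (forall t, cder c t (d t)) -> continuous d -> (forall t, nc (c t) = 1) ->
  exists th th' : R -> R, [/\ forall t, is_derive t 1 th (th' t), continuous th' & forall t, c t = expi (th t)].
Proof.
move=> h cd c1.
have cc : continuous c by move=> t; exact: cder_continuous (h t).
pose v t := Re (c t) * Im (d t) - Im (c t) * Re (d t).
have cv : continuous v.
  move=> t; apply: cvgB; apply: cvgM.
  - exact: ccRe (cc t).
  - exact: ccIm (cd t).
  - exact: ccIm (cc t).
  - exact: ccRe (cd t).
have orth t : Re (c t) * Re (d t) + Im (c t) * Im (d t) = 0.
  have [h1 h2] := h t.
  have D := is_deriveD (is_deriveM h1 h1) (is_deriveM h2 h2).
  have E : (fun s => Re (c s) * Re (c s) + Im (c s) * Im (c s)) = (fun=> 1).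
    by apply/funext => s; rewrite -!expr2 -ncsq c1 expr1n.
  have D' : is_derive t 1 (fun=> 1 : R) (Re (c t) *: Re (d t) + Re (c t) *: Re (d t) + (Im (c t) *: Im (d t) + Im (c t) *: Im (d t))).
    by rewrite -E.
  have := @derive_val _ _ _ _ _ _ _ D'; rewrite derive_cst /GRing.scale /=; lra.
have dE t : d t = 'i * (v t)%:C * c t.
  have := orth t; have := ncsq (c t); rewrite c1 expr1n.
  move=> e1 e2; have [h1 h2] := orth_rot e1 e2; rewrite -/(v t) in h1 h2.
  apply: ceqP; rewrite !cE /=; [rewrite {1}h1|rewrite {1}h2]; ring.
have [V [V0 hV]] := primR cv; pose th0 := angle (c 0).
have hth t : is_derive t 1 (fun t => V t + th0) (v t).
  by apply: (@is_derive_eq _ _ _ _ _ _ _ _ (is_deriveD (hV t) (is_derive_cst th0 t 1))); rewrite addr0.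
exists (fun t => V t + th0), v; split => // t.
pose D s := c s * expi (- (V s + th0)).
have hD s : cder D s 0.
  have hn : is_derive s 1 (fun s => - (V s + th0)) (- v s) by exact: is_deriveN.
  by apply: cder_eq (cderM (h s) (cder_comp hn (cder_expi _))) _; rewrite dE RCN; ring.
have := cder_eq_fun hD (cder_cst 0) 0 t; rewrite subrr /D V0 add0r !expiN angleK//.
have n0 : c 0 != 0 by rewrite -nc_gt0 c1.
rewrite divff// => /eqP; rewrite subr_eq0 => /eqP E.
by rewrite -[LHS](divfK (expi_neq0 (V t + th0))) E mul1r.
Qed.

Lemma expi_quot x y : expi x / expi y = expi (x - y) :> C.
Proof. by rewrite expiD expiN. Qed.

(** Near [t] the angle [u] is recovered from the unit vector by an arc sine, which is
    differentiable. *)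
Lemma expi_cder_inv u t (V : C) : continuous_at t u -> cder (fun s => expi (u s)) t V ->
  is_derive t 1 u (Im (V / expi (u t))).
Proof.
move=> cu h; pose q s := Im (expi (u s) / expi (u t) : C).
have qE s : q s = sin (u s - u t) by rewrite /q expi_quot.
have [_ dq] := cderM h (cder_cst (expi (u t))^-1 t); rewrite mulr0 addr0 -/q in dq.
have q0 : q t = 0 by rewrite qE subrr sin0.
have p2 : 0 < pi / 2 :> R by rewrite divr_gt0 ?pi_gt0.
have da : is_derive (q t) 1 (@asin R) 1.
  have := @is_derive1_asin R (q t); rewrite q0 expr0n subr0 sqrtr1 invr1; apply; lra.
have dc := is_deriveD (@is_derive1_comp _ (@asin R) q t _ _ da dq) (is_derive_cst (u t) t 1).
have dc' : is_derive t 1 (fun s => asin (q s) + u t) (Im (V / expi (u t))).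
  by apply: (@is_derive_eq _ _ _ _ _ _ _ _ dc); rewrite addr0 mul1r.
apply: is_derive_near dc'.
have : \forall s \near t, `|u t - u s| < pi / 2 by move/cvgrPdist_lt : cu; apply.
apply: filterS => s; rewrite distrC ltr_norml => hs.
by rewrite qE sinK ?subrK// in_itv /=; lra.
Qed.

(** The sine has slope at least [cos 1] on the unit interval. *)
Lemma expi_dist x y : `|x - y| <= 1 -> `|x - y| <= (cos 1)^-1 * nc (expi x - expi y : C).
Proof.
move=> h; have c0 := @cos1_gt0 R; rewrite ler_pdivlMl//.
have p2 : 2 <= pi :> R := @pi_ge2 R.
have main (a : R) : 0 <= a <= 1 -> cos 1 * a <= sin a.
  move=> /andP[a0 a1].
  have [b hb E] := MVT_segment a0 (fun s _ => is_derive_sin s) (continuous_subspaceT (@continuous_sin R)).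
  move: E hb; rewrite sin0 !subr0 in_itv /= => -> hb; rewrite ler_wpM2r//.
  rewrite leNgt ltr_cos ?in_itv /=; lra.
have -> : nc (expi x - expi y : C) = nc (expi (x - y) - 1 : C).
  have -> : expi x - expi y = (expi (x - y) - 1) * expi y :> C.
    by rewrite mulrBl mul1r -expiD subrK.
  by rewrite ncM nc_expi mulr1.
have : `|sin (x - y)| <= nc (expi (x - y) - 1 : C).
  by have := Im_le_nc (expi (x - y) - 1 : C); rewrite ImD ImN /= oppr0 addr0.
apply: le_trans; case: (leP 0 (x - y)) => s.
- rewrite ger0_norm in h *; last by []. by apply: le_trans (ler_norm _); apply: main; lra.
- rewrite ltr0_norm// in h *; rewrite -normrN -sinN; apply: le_trans (ler_norm _); apply: main; lra.
Qed.
End Lift.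

(** * The half-Laplacian on the Fourier side *)

Section Distribution.
Context {R : realType}.
Notation C := (Cplx R).
Notation ci := (@circle_integral R).
Notation cint := (@circle_cintegral R).
Implicit Types (z : C) (t s x r : R) (u v : R -> R) (c d : R -> C) (k N : nat) (n : int) (l f : C -> R).

Lemma inv_sq_sum N : \sum_(k < N) (k.+1%:R ^+ 2 : R)^-1 <= 2.
Proof.
suff : \sum_(k < N) (k.+1%:R ^+ 2 : R)^-1 <= 2 - 2 / N.+1%:R.
  by move=> h; apply: le_trans h _; rewrite lerBlDr lerDl divr_ge0.
elim: N => [|N IH]; first by rewrite big_ord0 divr1 subrr.
rewrite big_ord_recr /=; apply: le_trans (lerD IH (lexx _)) _.
have a0 : 0 < N.+1%:R :> R by rewrite ltr0n.
have -> : N.+2%:R = N.+1%:R + 1 :> R by rewrite natr1.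
move: a0; have : 1 <= N.+1%:R :> R by rewrite ler1n.
move: (N.+1%:R : R) => a a1 a0.
rewrite -subr_ge0.
have -> : 2 - 2 / (a + 1) - (2 - 2 / a + (a ^+ 2)^-1) = (a - 1) / (a ^+ 2 * (a + 1)).
  by field; rewrite ?gt_eqF//; lra.
by rewrite divr_ge0 ?subr_ge0// mulr_ge0 ?sqr_ge0//; lra.
Qed.

(** Grouping the terms of index [n] and [- n] gives a series dominated by the sum of the inverse
    squares. *)
Lemma fourier_series (g : int -> C) (B : R) : (forall n, n != 0 -> nc (g n) <= B / (n%:~R) ^+ 2) ->
  exists S : R -> C, [/\ continuous S, per S &
    forall e, 0 < e -> exists N0, forall N t, (N0 <= N)%N -> nc (S t - symsum N (fun n => g n * en n t)) <= e].
Proof.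
move=> hg.
pose u t k : C := if k is k'.+1 then g k%:Z * en k%:Z t + g (- k%:Z) * en (- k%:Z) t else g 0 * en 0 t.
pose b k : R := if k is k'.+1 then 2 * B * (k%:R ^+ 2)^-1 else nc (g 0).
have B0 : 0 <= B by have := hg 1 isT; rewrite expr1n divr1; apply: le_trans; exact: nc_ge0.
have ub t k : nc (u t k) <= b k.
  case: k => [|k] /=; first by rewrite ncM nc_en mulr1.
  have h1 := hg k.+1%:Z isT; have h2 := hg (- k.+1%:Z) isT.
  have e2 : ((- k.+1%:Z)%:~R : R) ^+ 2 = k.+1%:R ^+ 2 by rewrite intrN sqrrN.
  rewrite e2 in h2; apply: le_trans (ncD _ _) _; rewrite !ncM !nc_en !mulr1.
  by rewrite -mulrA mulr_natl mulr2n; exact: lerD.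
have b0 k : 0 <= b k by apply: le_trans (ub 0 k); exact: nc_ge0.
have bT N : \sum_(k < N) b k <= nc (g 0) + 4 * B.
  case: N => [|N]; first by rewrite big_ord0 addr_ge0 ?nc_ge0 ?mulr_ge0.
  rewrite big_ord_recl lerD2l /= -mulr_sumr.
  by have := inv_sq_sum N; have := B0; nra.
pose S t := series_limit (u t).
have hS t : cvs (u t) (S t) by apply: series_limitP (ub t) bT.
have sE N t : symsum N (fun n => g n * en n t) = \sum_(k < N.+1) u t k.
  by rewrite symsumE big_ord_recl.
have unif e : 0 < e -> exists N0, forall N t, (N0 <= N)%N -> nc (S t - symsum N (fun n => g n * en n t)) <= e.
  move=> e0; have [N0 H] := btail_small b0 bT e0; exists N0 => N t hN; rewrite sE.
  by apply: (cvs_tail (hS t) (ub t)) => M; apply: H; exact: leqW.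
exists S; split => //.
- move=> t; apply: uniform_limit_cont => e e0; have [N0 H] := unif e e0.
  exists (fun t => symsum N0 (fun n => g n * en n t)); split; last by move=> y; exact: H.
  by apply: cont_symsum => n; exact: cont_Zen.
- move=> t; rewrite /S; congr series_limit; apply/funext => -[|k]; rewrite /u ?per_en//.
Qed.

Lemma fc_uniform_limit (S : R -> C) (g : int -> C) n : continuous S ->
  (forall e, 0 < e -> exists N0, forall N t, (N0 <= N)%N -> nc (S t - symsum N (fun n => g n * en n t)) <= e) ->
  fc S n = g n.
Proof.
move=> cS h; apply: nc_small_eq => e e0; have e4 : 0 < e / 4 by rewrite divr_gt0.
have [N0 H] := h _ e4; pose N := maxn N0 `|n|%N.
rewrite -(@fc_symsum R N g n) ?leq_maxr//.
apply: le_lt_trans (fc_close (e := e / 4) n _ _ _) _; last by lra.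
- exact: cintbC_cont.
- by apply: cintbC_cont; apply: cont_symsum => m; exact: cont_Zen.
- by move=> t _; apply: H; exact: leq_maxl.
Qed.

Lemma cint_uniform_limit u (S : R -> C) (SN : nat -> R -> C) e : cintb u -> continuous S ->
  (forall N, continuous (SN N)) -> 0 < e ->
  (forall e, 0 < e -> exists N0, forall N t, (N0 <= N)%N -> nc (S t - SN N t) <= e) ->
  exists N0, forall N, (N0 <= N)%N ->
    nc (cint (fun t => (u t)%:C * S t) - cint (fun t => (u t)%:C * SN N t)) < e.
Proof.
move=> iu cS cSN e0 h; pose I := ci (fun t => `|u t|); have iuC := cintbC_real iu.
have I0 : 0 <= I by apply: ci_ge0.
have d0 : 0 < e / 4 / (I + 1) by rewrite !divr_gt0//; lra.
have [N0 H] := h _ d0; exists N0 => N hN; have {}H := fun t => H N t hN.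
rewrite -cintB; [|exact: cintbC_M iuC cS|exact: cintbC_M iuC (cSN N)].
apply: le_lt_trans (cint_le (v := fun t => e / 4 / (I + 1) * `|u t|) _ _ _) _.
- by apply: cintbC_B; [exact: cintbC_M iuC cS|exact: cintbC_M iuC (cSN N)].
- by apply: cintbZ; exact: cintb_norm.
- by move=> t _; rewrite -mulrBr ncM ncR mulrC ler_wpM2r.
rewrite ciZ; last exact: cintb_norm.
rewrite -/I; have : e / 4 / (I + 1) * I <= e / 4.
  rewrite -[leRHS]mulr1 -mulrA ler_wpM2l//; first lra.
  by rewrite mulrC ler_pdivrMr; lra.
lra.
Qed.

Lemma cint_symsum u N (g : int -> C) : cintb u ->
  cint (fun t => (u t)%:C * symsum N (fun n => g n * en n t)) =
  symsum N (fun n => (2 * pi)%:C * (g n * fc (fun t => (u t)%:C) (- n))).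
Proof.
move=> iu; have iuC := cintbC_real iu.
rewrite (@eq_cint _ _ (fun t => \sum_(k < N.*2.+1) g (k%:Z - N%:Z) * ((u t)%:C * en (k%:Z - N%:Z) t))); last first.
  by move=> t _; rewrite mulr_sumr; apply: eq_bigr => k _; ring.
rewrite cint_sum; last by move=> k _; apply: cintbC_Z; apply: cintbC_M => //; exact: cont_en.
apply: eq_bigr => k _; rewrite cintZ; last by apply: cintbC_M => //; exact: cont_en.
rewrite mulrCA; congr (_ * _); rewrite /fc mulrA [(2 * pi)%:C * _]mulrC twopiC mul1r.
by apply: eq_cint => t _; rewrite -enN opprK.
Qed.

Section Smooth.
Variable phi : C -> C.
Hypothesis hphi : circle_smooth phi.
Let p k := iter k curve_derive (phi \o expi).

Let dp k t : cder (p k) t (p k.+1 t). Proof. exact: derivable_cder (hphi k t). Qed.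
Let cp k : continuous (p k). Proof. by move=> t; exact: cder_continuous (dp k t). Qed.
Let pp k : per (p k).
Proof. elim: k => [|k IH]; first by move=> t; rewrite /p /= expi_period. exact: per_cder IH (dp k). Qed.

(** Three integrations by parts. *)
Lemma smooth_fc : exists B : R, forall n, nc (fc (fun t => phi (expi t)) n) * (`|n%:~R| ^+ 3) <= B.
Proof.
have [B hB] := fc_bound (cintbC_cont (@cp 3)); exists B => n.
have E k : fc (p k.+1) n = 'i * (n%:~R : R)%:C * fc (p k) n := fc_C1 n (@pp k) (dp k) (@cp k.+1).
have ni : nc ('i : C) = 1 by rewrite /= expr0n expr1n add0r sqrtr1.
have := hB n; rewrite !E; change (fun t => phi (expi t)) with (p 0); move: (fc (p 0) n) => X.
by rewrite !ncM ni ncR !mul1r; congr (_ <= _); ring.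
Qed.

(** By [smooth_fc] the coefficients decay like the inverse squares, so the limit that defines
    the half-Laplacian is uniform. *)
Lemma smooth_half_laplacian : exists2 g : int -> C,
  (forall n, g n = (`|n|%:~R : R)%:C * fc (fun t => phi (expi t)) n) &
  continuous (half_laplacian phi) /\
  forall e, 0 < e -> exists N0, forall N t, (N0 <= N)%N -> nc (half_laplacian phi t - symsum N (fun n => g n * en n t)) <= e.
Proof.
pose g n : C := (`|n|%:~R : R)%:C * fc (fun t => phi (expi t)) n; exists g => //.
have [B hB] := smooth_fc.
have gB n : n != 0 -> nc (g n) <= B / (n%:~R) ^+ 2.
  move=> n0; have nn : 0 < `|n%:~R : R| by rewrite normr_gt0 intr_eq0.
  have sq : (n%:~R : R) ^+ 2 = `|n%:~R| ^+ 2 by rewrite real_normK ?num_real.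
  rewrite sq ler_pdivlMr ?exprn_gt0// /g ncM ncR intr_norm normr_id.
  by apply: le_trans (hB n); rewrite !exprS expr0 mulr1 [leRHS]mulrC -!mulrA [leLHS]mulrCA; rewrite le_eqVlt; apply/orP; left; apply/eqP; ring.
have [S [cS pS hS]] := fourier_series gB.
suff -> : half_laplacian phi = S by [].
apply/funext => t; rewrite /half_laplacian.
rewrite (_ : (fun N : nat => _) = (fun N => symsum N (fun n => g n * en n t))); last first.
  apply/funext => N; apply: eq_bigr => k _; rewrite /g /en; congr (_ * _ * _).
  by rewrite rmorph_int.
apply: (@cvg_lim C); first exact: norm_hausdorff.
apply/(cvgCP eventually_filter) => e e0; have e2 : 0 < e / 2 by rewrite divr_gt0.
have [N0 H] := hS _ e2; exists N0 => // N /= hN.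
by apply: le_lt_trans (H N t hN) _; lra.
Qed.

Lemma smooth_series : forall e, 0 < e -> exists N0, forall N t, (N0 <= N)%N ->
  nc (phi (expi t) - symsum N (fun n => fc (fun t => phi (expi t)) n * en n t)) <= e.
Proof.
have [B hB] := smooth_fc; pose g := fc (fun t => phi (expi t)).
have gB n : n != 0 -> nc (g n) <= B / (n%:~R) ^+ 2.
  move=> n0; have nn : 1 <= `|n%:~R : R| by rewrite -intr_norm ler1z; lia.
  have sq : (n%:~R : R) ^+ 2 = `|n%:~R| ^+ 2 by rewrite real_normK ?num_real.
  rewrite sq ler_pdivlMr ?exprn_gt0//; last by lra.
  apply: le_trans (hB n); rewrite ler_wpM2l ?nc_ge0//.
  by rewrite [leRHS]exprS ler_peMl// exprn_ge0.
have [S [cS pS hS]] := fourier_series gB.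
have E t : phi (expi t) = S t.
  apply: (@cont_fc_unique _ (fun t => phi (expi t)) S (@cp 0) cS (@pp 0) pS) => n.
  by rewrite (fc_uniform_limit n cS hS).
by move=> e e0; have [N0 H] := hS _ e0; exists N0 => N t hN; rewrite E; exact: H.
Qed.
End Smooth.

(** Both sides of the equation pass to the limit along the Fourier sums of the test function,
    which converge uniformly, and for Fourier sums they agree term by term. *)
Theorem fourier_half_laplacian l f : cintb (fun t => l (expi t)) -> cintb (fun t => f (expi t)) ->
  (forall n, (`|n|%:~R : R)%:C * fc (fun t => (l (expi t))%:C) n = fc (fun t => (f (expi t))%:C) n) ->
  half_laplacian_eq l f.
Proof.
move=> il jf h phi hphi; have [g hg [cH uH]] := smooth_half_laplacian hphi.
have uS := smooth_series hphi.
have cphi : continuous (fun t => phi (expi t)).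
  by move=> t; exact: cder_continuous (derivable_cder (hphi 0%N t)).
apply: nc_small_eq => e e0; have e2 : 0 < e / 2 by rewrite divr_gt0.
have cS (g0 : int -> C) N : continuous (fun t => symsum N (fun n => g0 n * en n t)).
  by apply: cont_symsum => n; exact: cont_Zen.
have [N1 H1] := cint_uniform_limit il cH (cS g) e2 uH.
have [N2 H2] := cint_uniform_limit jf cphi (cS _) e2 uS.
pose N := maxn N1 N2; have {}H1 := H1 N (leq_maxl _ _); have {}H2 := H2 N (leq_maxr _ _).
rewrite cint_symsum// in H1; rewrite cint_symsum// in H2.
apply: nc_tri_half H1 _; rewrite (_ : symsum N _ = symsum N (fun n =>
    (2 * pi)%:C * (fc (fun t => phi (expi t)) n * fc (fun t => (f (expi t))%:C) (- n))))//.
apply: eq_symsum => n; rewrite hg -h normrN; ring.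
Qed.

(** The characters as functions of a point of the circle. *)
Definition zpow n z : C := if n is Posz m then z ^+ m else z^-1 ^+ `|n|%N.

Lemma zpow_expi n t : zpow n (expi t) = en n t.
Proof.
case: n => m; first by rewrite /zpow en_nat.
by rewrite /zpow -expiN expiX NegzE enN mulrN.
Qed.

Lemma zpow_iter n j : iter j curve_derive (zpow n \o expi) = (fun t => ('i * (n%:~R : R)%:C) ^+ j * en n t).
Proof.
elim: j => [|j IH] /=; first by apply/funext => t; rewrite expr0 mul1r /= zpow_expi.
apply/funext => t; rewrite IH; apply: cder_derive.
by apply: cder_eq (cderZ _ (cder_en n t)) _; rewrite exprSr -[RHS]mulrA.
Qed.

Lemma zpow_smooth n : circle_smooth (zpow n).
Proof.
move=> j t; rewrite zpow_iter; apply: cder_derivable; exact: cderZ (cder_en n t).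
Qed.

Lemma zpow_half_laplacian n t : half_laplacian (zpow n) t = (`|n|%:~R : R)%:C * en n t.
Proof.
apply: (@cvg_lim C); first exact: norm_hausdorff.
apply/(cvgCP eventually_filter) => e e0; exists `|n|%N => // N /= hN.
rewrite (_ : \sum_(k < N.*2.+1) _ = (`|n|%:~R : R)%:C * en n t) ?subrr ?nc0//.
rewrite -[RHS](symsum_delta (N := N) (m := n))//; apply: eq_bigr => k _.
have -> : fourier_coef (zpow n) (k%:Z - N%:Z) = if k%:Z - N%:Z == n then 1 else 0 :> C.
  rewrite -(fc_en n) /fourier_coef; congr (_ * _); apply: eq_cint => s _.
  by rewrite zpow_expi.
by case: eqP => [->|_]; rewrite ?mulr1 ?mulr0 ?mul0r// rmorph_int.
Qed.

(** The characters are test functions, and eigenfunctions of the half-Laplacian. *)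
Theorem half_laplacian_fourier l f n : cintb (fun t => l (expi t)) -> half_laplacian_eq l f ->
  (`|n|%:~R : R)%:C * fc (fun t => (l (expi t))%:C) n = fc (fun t => (f (expi t))%:C) n.
Proof.
move=> il /(_ (zpow (- n)) (zpow_smooth _)) E; rewrite /fc mulrCA; congr (_ * _).
have E' : cint (fun t => (l (expi t))%:C * ((`|n|%:~R : R)%:C * en (- n) t)) =
    cint (fun t => (f (expi t))%:C * en (- n) t).
  rewrite (@eq_cint _ _ (fun t => (l (expi t))%:C * half_laplacian (zpow (- n)) t)).
    by rewrite E; apply: eq_cint => t _; rewrite zpow_expi.
  by move=> t _; rewrite zpow_half_laplacian normrN.
rewrite (@eq_cint _ (fun t => (f (expi t))%:C * _) (fun t => (f (expi t))%:C * en (- n) t)); last first.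
  by move=> t _; rewrite enN.
rewrite -E' -cintZ; last by apply: cintbC_fc; exact: cintbC_real.
by apply: eq_cint => t _; rewrite enN; ring.
Qed.

End Distribution.

(** * Weak derivatives, bounds and conjugate functions *)

Section Tools.
Context {R : realType}.
Notation C := (Cplx R).
Notation cint := (@circle_cintegral R).
Implicit Types (z : C) (t s x r : R) (u v : R -> R) (c d : R -> C) (k N : nat) (n : int) (l f : C -> R).

Lemma per_uniform_cont u e : continuous u -> per u -> 0 < e ->
  exists2 dl : R, 0 < dl & forall t h, `|h| < dl -> `|u (t + h) - u t| < e.
Proof.
move=> cu pu e0; have e2 : 0 < e / 2 by rewrite divr_gt0.
have /compact_near_coveringP nearK := @segment_compact R 0 (2 * pi).
pose Q (h : R) (t : R) := `|u (t + h) - u t| < e.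
have [|] := nearK R (nbhs (0 : R)) Q (nbhs_filter _).
  move=> x _; have /cvgrPdist_lt/(_ _ e2)/nbhs_ballP[d /= d0 H] := cu x.
  have d2 : 0 < d / 2 by rewrite divr_gt0.
  exists (ball x (d / 2), ball (0 : R) (d / 2)); first by split; exact: nbhsx_ballx.
  move=> [t h] [/=]; rewrite /ball /= sub0r normrN => h1 h2; rewrite /Q.
  have a1 : `|u x - u (t + h)| < e / 2.
    apply: H; rewrite /ball /=; have -> : x - (t + h) = (x - t) - h by ring.
    by apply: le_lt_trans (ler_normB _ _) _; lra.
  have a2 : `|u x - u t| < e / 2 by apply: H; rewrite /ball /=; lra.
  have -> : u (t + h) - u t = (u x - u t) - (u x - u (t + h)) by ring.
  by apply: le_lt_trans (ler_normB _ _) _; lra.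
move=> d /= d0 H; exists d => // t h hd; have [s hs [n ->]] := ang_reduce t.
rewrite addrAC !perZ//; apply: (H h); first by rewrite /ball /= sub0r normrN.
by rewrite /= in_itv /=; lra.
Qed.

Lemma cont_nz_sign u : continuous u -> (forall t, u t != 0) ->
  (forall t, 0 < u t) \/ (forall t, u t < 0).
Proof.
move=> cu nz.
have key x y : u x < 0 -> 0 < u y -> False.
  move=> hx hy; have cw a b : {within `[a, b], continuous u} by exact: continuous_subspaceT.
  case: (leP x y) => [xy|/ltW xy].
  - have [|z _ E] := IVT xy (cw x y) (v := 0); first by rewrite ge_min (ltW hx) le_max (ltW hy) orbT.
    by have := nz z; rewrite E eqxx.
  - have [|z _ E] := IVT xy (cw y x) (v := 0); first by rewrite ge_min (ltW hx) orbT le_max (ltW hy).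
    by have := nz z; rewrite E eqxx.
case: (ltP 0 (u 0)) => h0; [left|right] => t; rewrite ltNge; apply/negP => ht.
- by apply: (key t 0) => //; rewrite lt_neqAle nz.
- by apply: (key 0 t); rewrite ?lt_neqAle ?nz// eq_sym nz.
Qed.

Lemma cder_bound c t z M : cder c t z -> (exists2 dl : R, 0 < dl & forall h, `|h| < dl -> nc (c (t + h) - c t) <= M * `|h|) ->
  nc z <= M.
Proof.
move=> /cderP H [dl dl0 hM]; apply: le_eps => e e0; have [d d0 {}H] := H e e0.
pose h := Num.min d dl / 2; have m0 : 0 < Num.min d dl by rewrite lt_min d0.
have m1 : Num.min d dl <= d by rewrite ge_min lexx.
have m2 : Num.min d dl <= dl by rewrite ge_min lexx orbT.
have h0 : 0 < h by rewrite divr_gt0.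
have e1 := H h; have e2 := hM h; rewrite (gtr0_norm h0) in e1 e2.
have {e1}e1 := e1 ltac:(rewrite /h; lra); have {e2}e2 := e2 ltac:(rewrite /h; lra).
rewrite -(ler_pM2l h0) -[X in X * nc z](gtr0_norm h0) -ncR -ncM.
have -> : h%:C * z = (c (t + h) - c t) - (c (t + h) - c t - h%:C * z) by ring.
apply: le_trans (ncD _ _) _; rewrite ncN; lra.
Qed.

(** The weak derivative is tested against a character. *)
Lemma weak_fc (u w : C -> C) n : cintbC (fun t => u (expi t)) -> cintbC (fun t => w (expi t)) ->
  circle_weak_derivative u w ->
  fc (fun t => w (expi t)) n = 'i * (n%:~R : R)%:C * fc (fun t => u (expi t)) n.
Proof.
move=> iu iw /(_ (zpow (- n)) (zpow_smooth _)) E.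
have dE t : curve_derive (zpow (- n) \o expi) t = 'i * ((- n)%:~R : R)%:C * en (- n) t.
  by have := zpow_iter (R := R) (- n) 1 => /(congr1 (fun g => g t)) /= ->; rewrite expr1.
rewrite (@eq_cint _ _ (fun t => ('i * ((- n)%:~R : R)%:C) * (u (expi t) * en (- n) t))) in E; last first.
  by move=> t _; rewrite dE; ring.
rewrite cintZ in E; last by apply: cintbC_M => //; exact: cont_en.
rewrite [in RHS](@eq_cint _ _ (fun t => w (expi t) * en (- n) t)) in E; last by move=> t _; rewrite zpow_expi.
have fcE (a : R -> C) : fc a n = ((2 * pi)^-1)%:C * cint (fun t => a t * en (- n) t).
  by rewrite /fc; congr (_ * _); apply: eq_cint => t _; rewrite enN.
rewrite !fcE -[cint (fun t => w _ * _)]opprK -E intrN RCN; ring.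
Qed.

Lemma Linfty_bound (u : C -> R) : circle_Linfty u ->
  exists M : R, [/\ 0 <= M, circle_ae (fun t => `|u (expi t)| <= M) & cintb (fun t => u (expi t))].
Proof.
move=> [mu [M hM]]; have h : circle_ae (fun t => `|u (expi t)| <= `|M|).
  by apply: ae_imp hM => t _ /le_trans -> //; exact: ler_norm.
by exists `|M|; split => //; apply: ae_bdd_cintb h.
Qed.

Lemma cLinfty_bound (w : C -> C) : circle_cLinfty w ->
  exists M : R, [/\ 0 <= M, circle_ae (fun t => `|Re (w (expi t))| <= M),
    circle_ae (fun t => `|Im (w (expi t))| <= M) & cintbC (fun t => w (expi t))].
Proof.
move=> [/Linfty_bound[M [M0 h1 i1]] /Linfty_bound[N [N0 h2 i2]]].
exists (Num.max M N); split; first by rewrite le_max M0.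
- by apply: ae_imp h1 => t _; rewrite le_max => ->.
- by apply: ae_imp h2 => t _; rewrite le_max => ->; rewrite orbT.
- by split.
Qed.

Lemma dotC_rot z (y s : R) : nc z = 1 -> dotC ('i * z) ('i * y%:C * z / s%:C) = y / s.
Proof.
move=> z1; have := ncsq z; rewrite z1 expr1n /dotC -RCV !cE /= => E.
have -> : y / s = y / s * (Re z ^+ 2 + Im z ^+ 2) by rewrite -E mulr1.
ring.
Qed.

Lemma fc_real_conj u n : cintb u -> fc (fun t => (u t)%:C) n = ((fc (fun t => (u t)%:C) (- n))^*)%C.
Proof.
move=> iu; rewrite -fc_conj; last exact: cintbC_real.
by apply: eq_fc => t _ /=; rewrite oppr0.
Qed.

(** [F] has no negative coefficients, so for [n < 0] those of [Re F] are [- i] times those of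
    [Im F], and multiplication by [|n| = - n] turns them into those of [f]. The case [n > 0]
    follows by conjugation because [l] and [f] are real. *)
Lemma conj_half_laplacian (F : C -> C) a l f n : rad1 a -> cdc F -> (forall z, nc z < 1 -> F z = ps a z) ->
  cintb (fun t => l (expi t)) -> cintb (fun t => f (expi t)) ->
  circle_ae (fun t => Re (F (expi t)) = l (expi t)) ->
  (forall n, fc (fun t => (f (expi t))%:C) n = 'i * (n%:~R : R)%:C * fc (fun t => (Im (F (expi t)))%:C) n) ->
  (`|n|%:~R : R)%:C * fc (fun t => (l (expi t))%:C) n = fc (fun t => (f (expi t))%:C) n.
Proof.
move=> ha cF EF il jf lae hf.
have cFc := cdc_circ cF; have iF := cintbC_cont cFc.
have iR : cintb (fun t => Re (F (expi t))) := proj1 iF.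
have iI : cintb (fun t => Im (F (expi t))) := proj2 iF.
have sum m : fc (fun t => F (expi t)) m = fc (fun t => (l (expi t))%:C) m + 'i * fc (fun t => (Im (F (expi t)))%:C) m.
  rewrite (@ae_eq_fc _ (fun t => (l (expi t))%:C) (fun t => (Re (F (expi t)))%:C)); last 3 first.
  - exact: cintbC_real.
  - exact: cintbC_real.
  - by apply: ae_imp lae => t _ ->.
  rewrite -fcZ; last exact: cintbC_real.
  rewrite -fcD; [|exact: cintbC_real|by apply: cintbC_Z; exact: cintbC_real].
  by apply: eq_fc => t _; apply: ceqP; rewrite !cE /=; ring.
have neg (m : nat) : (`|Negz m|%:~R : R)%:C * fc (fun t => (l (expi t))%:C) (Negz m) = fc (fun t => (f (expi t))%:C) (Negz m).
  have := sum (Negz m); rewrite (fc_ps_boundary _ ha cF EF) => /eqP.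
  rewrite eq_sym addr_eq0 hf => /eqP ->; have -> : `|Negz m| = - Negz m by rewrite ltr0_norm.
  by rewrite intrN RCN; ring.
case: n => [[|m]|m]; last exact: neg.
- by rewrite hf normr0 mulr0 !mul0r.
- rewrite (fc_real_conj _ il) (fc_real_conj _ jf) -NegzE -neg [RHS]conjM.
  by congr (_ * _); rewrite NegzE normrN; apply: ceqP; rewrite /= ?oppr0.
Qed.

End Tools.

(** * From the immersion to the equation *)

Section Backward.
Context {R : realType}.
Notation C := (Cplx R).
Notation ang := (@angles R).
Implicit Types (z : C) (t s x r : R) (u v : R -> R) (c d : R -> C) (k N : nat) (n : int) (l f : C -> R).

(** The velocity of the constant speed curve is Lipschitz by [weak_llip]. The unit tangent of
    [Phi] is this velocity, divided by [v] and composed with the lift of the inverse change of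
    parameter, up to a sign; the sign is constant because the derivative of the lift is
    continuous and does not vanish. *)
Lemma tangent_llip (Phi dPhi g s : C -> C) (v : R) : 0 < v ->
  holomorphic_immersion Phi dPhi -> circle_W2infty g -> constant_speed g v -> circle_diffeo s ->
  (forall z, circle z -> Phi (s z) = g z) ->
  llip (unit_tangent (Phi \o expi)).
Proof.
move=> v0 im W CS [s' [[s1 sC] [s1' sC'] ss' s's]] E.
have [cP cdP hP nz] := immersion_disk im.
pose c t := Phi (expi t); pose dc t : C := 'i * expi t * dPhi (expi t).
have hc t : cder c t (dc t) by exact: cder_boundary.
have cdc : continuous dc.
  move=> t; apply: ccM; last exact: (cdc_circ cdP).
  by apply: ccM; [exact: ccst|exact: cont_expi].
have circ_expi t : circle (expi t : C) by apply/circleE; exact: nc_expi.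
have [th [th' [hth cth' Eth]]] := angle_lift (fun t => derivable_cder (proj1 sC t)) (proj2 sC)
   (fun t => proj1 (circleE _) (s1 _ (circ_expi t))).
have [et [et' [het cet' Eet]]] := angle_lift (fun t => derivable_cder (proj1 sC' t)) (proj2 sC')
   (fun t => proj1 (circleE _) (s1' _ (circ_expi t))).
pose G t := g (expi t); pose dG := curve_derive G.
have hG t : cder G t (dG t) by exact: derivable_cder (proj1 (CS t)).
have nG t : nc (dG t) = v.
  by have := proj2 (CS t); rewrite ncE => /complexI.
have pG : per G by move=> t; rewrite /G expi_period.
have GE t : G t = c (th t) by rewrite /G -E// [s _]Eth.
have dGE t : dG t = (th' t)%:C * dc (th t).
  apply: cder_unique (hG t) _; apply: (@cder_ext _ (fun t => c (th t))); first by move=> x; rewrite GE.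
  exact: cder_comp (hth t) (hc _).
have cth : continuous th by move=> t; apply: (ccRe (cder_continuous (cder_real (hth t)))).
have cdG : continuous dG.
  rewrite (_ : dG = fun t => (th' t)%:C * dc (th t)); last by apply/funext => t; exact: dGE.
  move=> t; apply: ccM; first by apply: ccR; exact: cth'.
  by apply: (@cccompR _ _ th dc); [exact: cth|exact: cdc].
have pdG := per_cder pG hG.
have [g1 [g2 [[Wg Wg1 Wg2] [w1 w2]]]] := W.
have [_ [_ _ _ ig]] := cLinfty_bound Wg; have [_ [_ _ _ ig1]] := cLinfty_bound Wg1.
have [M [M0 hR hI ig2]] := cLinfty_bound Wg2.
have fc2 n : fc (fun t => g2 (expi t)) n = 'i * (n%:~R : R)%:C * fc dG n.
  by rewrite (weak_fc n ig1 ig2 w2) (weak_fc n ig ig1 w1) (fc_C1 n pG hG cdG).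
have lipG := weak_llip cdG pdG ig2 M0 hR hI fc2.
have cE t : c t = G (et t).
  rewrite /c -[expi t]s's// E; last by apply: s1'.
  by rewrite [s' _]Eet.
have dcE t : dc t = (et' t)%:C * dG (et t).
  apply: cder_unique (hc t) _; apply: (@cder_ext _ (fun t => G (et t))); first by move=> x; rewrite cE.
  exact: cder_comp (het t) (hG _).
have ndc t : nc (dc t) = `|et' t| * v by rewrite dcE ncM ncR nG.
have dc0 t : dc t != 0 by rewrite !mulf_neq0 ?i_neq0 ?expi_neq0// nz// nc_expi.
have et0 t : et' t != 0.
  by apply/eqP => h; have := dc0 t; rewrite dcE h mul0r eqxx.
have pdc : per dc by move=> t; rewrite /dc expi_period.
have cn : continuous (fun t => nc (dc t)) by move=> t; apply: ccnc; exact: cdc.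
have [B hB] := cont_bdd_ang cn.
have etB t : `|et' t| <= B / v.
  rewrite ler_pdivlMr// -ndc; have [x hx [n ->]] := ang_reduce t; rewrite perZ//.
  by apply: le_trans (ler_norm _) (hB x _); apply/angP; lra.
have etlip := bounded_derive_lip het etB.
have UE t : unit_tangent (Phi \o expi) t = (et' t / `|et' t|)%:C * (v^-1%:C * dG (et t)).
  rewrite /unit_tangent (cder_derive (hc t)) ncE ndc dcE RCM RCV RCM RCV invfM; ring.
(* The sign says whether the two parametrizations have the same orientation. *)
have sgn : exists e : R, `|e| = 1 /\ forall t, et' t / `|et' t| = e.
  have [pos|neg] := cont_nz_sign cet' et0.
  - by exists 1; rewrite normr1; split => // t; rewrite gtr0_norm// divff// gt_eqF.
  - exists (-1); rewrite normrN1; split => // t; rewrite ltr0_norm// invrN mulrN divff// lt_eqF.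
have [e [e1 he]] := sgn.
exists 1, (v^-1 * (4 * M * (2 * (B / v)))); split => // t h _.
rewrite !UE !he -mulrBr -mulrBr ncM ncM !ncR e1 mul1r (gtr0_norm (x := v^-1)) ?invr_gt0//.
rewrite -[leRHS]mulrA ler_wpM2l ?invr_ge0 ?(ltW v0)//.
apply: le_trans (lipG _ _) _; rewrite -!mulrA ler_wpM2l// ler_wpM2l//.
by have := etlip t h; rewrite !mulrA.
Qed.

(** With [Phi' = exp F] the unit tangent is [i e^(i (t + Im F))]. It is Lipschitz by
    [tangent_llip], hence so is [Im F], and where it is differentiable the curvature is the
    derivative of [t + Im F] divided by the speed [e^l]. This bounds the curvature and gives the
    hypothesis of [conj_half_laplacian]. *)
Theorem immersion_half_laplacian (l kappa : C -> R) Phi dPhi (g s : C -> C) (v : R) : 0 < v ->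
  circle_L1 l -> circle_measurable kappa ->
  holomorphic_immersion Phi dPhi -> circle_W2infty g -> constant_speed g v -> circle_diffeo s ->
  (forall z, circle z -> Phi (s z) = g z) -> conformal_factor dPhi l -> boundary_curvature Phi kappa ->
  circle_Linfty kappa /\ half_laplacian_eq l (fun z => kappa z * expR (l z) - 1).
Proof.
move=> v0 il mk im W CS df E cf bc.
have lU := tangent_llip v0 im W CS df E.
have [cP cdP hP nz] := immersion_disk im.
have [a [F [ha cF EF EP]]] := immersion_log im.
have lae := conformal_log EP cf.
pose c t := Phi (expi t); pose rr t := Im (F (expi t)); pose rho t := expR (Re (F (expi t))).
have cFc := cdc_circ cF.
have hc t : cder c t ('i * expi t * dPhi (expi t)) by exact: cder_boundary.
have dcE t : 'i * expi t * dPhi (expi t) = (rho t)%:C * ('i * expi (t + rr t)).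
  by rewrite EP ?nc_expi// /cexp expiD; ring.
have rho0 t : 0 < rho t by exact: expR_gt0.
have ni : nc ('i : C) = 1 by rewrite /= expr0n expr1n add0r sqrtr1.
have nU t : nc ('i * expi (t + rr t) : C) = 1 by rewrite ncM ni nc_expi mul1r.
have ndc t : nc ('i * expi t * dPhi (expi t)) = rho t by rewrite dcE ncM nU mulr1 ncR gtr0_norm.
have UE t : unit_tangent (Phi \o expi) t = 'i * expi (t + rr t).
  rewrite /unit_tangent (cder_derive (hc t)) ncE ndc dcE mulrC mulKf//.
  by rewrite -nc_gt0 ncR normr_gt0 gt_eqF.
have crr : continuous rr by move=> t; exact: ccIm (cFc t).
have prr : per rr by move=> t; rewrite /rr expi_period.
have [dl [M [dl0 HU]]] := lU.
have HU' t h : `|h| < dl -> nc (expi (t + h + rr (t + h)) - expi (t + rr t) : C) <= M * `|h|.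
  by move=> /(HU t); rewrite !UE -mulrBr ncM ni mul1r.
have M0 : 0 <= M.
  have h2 : `|dl / 2| = dl / 2 by rewrite ger0_norm ?divr_ge0 ?ltW.
  have := HU 0 (dl / 2); rewrite h2 => /(_ ltac:(lra)) h.
  have : 0 <= M * (dl / 2) by apply: le_trans h; exact: nc_ge0.
  by rewrite pmulr_lge0//; lra.
have lrr : llip (fun t => (rr t)%:C : C).
  have h2 : 0 < 1 / 2 :> R by lra.
  have [d2 d20 H2] := per_uniform_cont crr prr h2.
  exists (Num.min (Num.min dl d2) (1 / 2)), ((cos 1)^-1 * M + 1); split; first by rewrite !lt_min dl0 d20.
  move=> t h; rewrite !lt_min => /andP[/andP[hd /(H2 t) hd2] h12].
  rewrite -RCB ncR; pose x := t + h + rr (t + h); pose y := t + rr t.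
  have Exy : rr (t + h) - rr t = (x - y) - h by rewrite /x /y; ring.
  have xy1 : `|x - y| <= 1.
    have -> : x - y = (rr (t + h) - rr t) + h by rewrite Exy subrK.
    by apply: le_trans (ler_normD _ _) _; lra.
  rewrite Exy; apply: le_trans (ler_normB _ _) _; rewrite mulrDl mul1r lerD2r.
  apply: le_trans (expi_dist xy1) _; rewrite -mulrA ler_wpM2l ?invr_ge0 ?(ltW (@cos1_gt0 R))//.
  exact: HU'.
have curv : circle_ae (fun t => `|kappa (expi t)| <= M / rho t /\
    is_derive t 1 rr (kappa (expi t) * expR (l (expi t)) - 1)).
  apply: ae_imp (ae_and lae bc) => t _ [El [_ /derivable_cder dU kE]].
  set U' := curve_derive _ t in dU.
  have nU' : nc U' <= M by apply: cder_bound dU _; exists dl => // h; exact: HU.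
  have de : cder (fun s => expi (s + rr s)) t (- 'i * U').
    apply: cder_ext (cderZ (- 'i) dU) => x; rewrite UE mulrA mulNr -expr2 sqr_i opprK mul1r//.
  have cpsi : continuous_at t (fun s => s + rr s) by apply: cvgD; [exact: cvg_id|exact: crr].
  have hpsi := expi_cder_inv cpsi de; set y := Im _ in hpsi.
  have U'E : U' = 'i * y%:C * ('i * expi (t + rr t)).
    apply: cder_unique dU _.
    apply: (@cder_ext _ (fun x => 'i * expi (x + rr x))); first by move=> x; rewrite UE.
    have R1 : 'i * y%:C * ('i * expi (t + rr t)) = 'i * (y%:C * ('i * expi (t + rr t))) :> C by rewrite [RHS]mulrA.
    rewrite R1; exact: (cderZ 'i (cder_comp hpsi (cder_expi (t + rr t)))).
  have ky : kappa (expi t) = y / rho t.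
    rewrite kE /signed_curvature /arclength_derive -/U' UE (cder_derive (hc t)) ncE ndc U'E.
    exact: dotC_rot.
  split.
  - rewrite ky normrM [X in _ * X]gtr0_norm ?invr_gt0// ler_wpM2r ?invr_ge0 ?(ltW (rho0 t))//.
    by move: nU'; rewrite U'E ncM nU mulr1 ncM ni mul1r ncR.
  - rewrite -El ky -/(rho t) divfK ?gt_eqF//.
    have h := is_deriveB hpsi (is_derive_id t (1 : R)).
    apply: (is_derive_near _ h).
    by near=> x; rewrite /= !fctE addrAC subrr add0r.
have [K hK] : exists K : R, forall t, ang t -> (rho t)^-1 <= K.
  have cv : continuous (fun t => (rho t)^-1).
    move=> t; apply: continuousV; first by rewrite gt_eqF.
    apply: (@continuous_comp _ _ _ (fun t => Re (F (expi t))) expR); last exact: continuous_expR.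
    exact: ccRe (cFc t).
  by have [K H] := cont_bdd_ang cv; exists K => t /H; apply: le_trans; exact: ler_norm.
have [K' hK'] : exists K : R, forall t, ang t -> rho t <= K.
  have cv : continuous rho.
    move=> t; apply: (@continuous_comp _ _ _ (fun t => Re (F (expi t))) expR); last exact: continuous_expR.
    exact: ccRe (cFc t).
  by have [K'' H] := cont_bdd_ang cv; exists K'' => t /H; apply: le_trans; exact: ler_norm.
have kb : circle_ae (fun t => `|kappa (expi t)| <= M * K).
  apply: ae_imp curv => t ht [h _]; apply: le_trans h _; rewrite ler_wpM2l//; exact: hK.
have Lk : circle_Linfty kappa by split => //; exists (M * K).
split => //.
pose f z := kappa z * expR (l z) - 1.
have K0 : 0 <= K.
  by apply: le_trans (hK 0 _); [rewrite invr_ge0 ltW|apply/angP; rewrite lexx ltW ?pi2_gt0].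
have K'0 : 0 <= K'.
  by apply: le_trans (hK' 0 _); [rewrite ltW|apply/angP; rewrite lexx ltW ?pi2_gt0].
have jf : cintb (fun t => f (expi t)).
  apply: (@ae_bdd_cintb _ _ (M * K * K' + 1)).
  - apply: measurable_funB; last exact: measurable_cst.
    apply: measurable_funM; first exact: mk.
    apply: measurableT_comp; first exact: measurable_expR.
    exact: (cintb_meas (u := fun t => l (expi t)) il).
  - by rewrite addr_ge0// !mulr_ge0.
  - apply: ae_imp (ae_and kb lae) => t ht [h El]; rewrite /f -El -/(rho t).
    apply: le_trans (ler_normB _ _) _; rewrite normr1 lerD2r normrM (gtr0_norm (rho0 t)).
    by apply: ler_pM => //; [exact: ltW|exact: hK'].
apply: fourier_half_laplacian => // n.
apply: (conj_half_laplacian n ha cF EF il jf lae) => m.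
apply: fc_llip.
- by move=> t; rewrite expi_period.
- exact: lrr.
- exact: cintbC_real.
- by apply: ae_imp curv => t _ [_ h]; exact: cder_real.
Unshelve. all: by end_near. Qed.

End Backward.

(** * Exponential integrability *)

Section Regularity.
Context {R : realType}.
Notation C := (Cplx R).
Notation leb := (@lebesgue_measure R).
Notation mR := (measurableTypeR R).
Notation ang := (@angles R).
Notation ci := (@circle_integral R).
Notation cint := (@circle_cintegral R).
Implicit Types (z w : C) (t s x r : R) (u v : R -> R) (c d : R -> C) (k N : nat) (n : int) (a : nat -> C).

Lemma mul_ps_dps a z : rad1 a -> nc z < 1 -> z * ps (dps a) z = ps (fun n : nat => (n%:R : R)%:C * a n) z.
Proof.
move=> ha z1; apply/esym/ps_eq => //; first exact: rad1_nat.
move=> e e0; have [N0 H] := rad1_cvs (rad1_dps ha) z1 e0; exists N0.+1 => -[//|N] hN.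
rewrite big_ord_recl !mul0r add0r.
rewrite (eq_bigr (fun k : 'I_N => z * (dps a k * z ^+ k))); last first.
  by move=> k _; rewrite lift0 /dps exprS; ring.
rewrite -mulr_sumr -mulrBr ncM; apply: le_lt_trans (H N hN).
by rewrite ler_piMl ?nc_ge0// ltW.
Qed.

(** The Taylor coefficients of the analytic function whose real part is the Poisson integral of
    [u], normalized to be real at the origin. *)
Definition acoef u k : C := if k is k'.+1 then 2 * fc (fun t => (u t)%:C) k'.+1%:Z else fc (fun t => (u t)%:C) 0.

Lemma acoefS u k : acoef u k.+1 = 2 * fc (fun t => (u t)%:C) k.+1%:Z. Proof. by []. Qed.
Lemma acoef0 u : acoef u 0 = fc (fun t => (u t)%:C) 0. Proof. by []. Qed.
Lemma natC_two : (2 : C) = (2 : R)%:C. Proof. by rewrite rmorph_nat. Qed.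
Lemma nc_double z : nc (2 * z) = 2 * nc z. Proof. by rewrite natC_two ncM ncR ger0_norm. Qed.

Lemma cint_fc0 c : cint c = (2 * pi)%:C * fc c 0.
Proof.
rewrite /fc mulrA [(2 * pi)%:C * _]mulrC twopiC mul1r; apply: eq_cint => t _.
by rewrite mul0r oppr0 expi0 mulr1.
Qed.

Lemma fc_ps_dilate0 a r : rad1 a -> 0 <= r < 1 -> fc (fun t => ps a (r%:C * expi t)) 0 = a 0%N.
Proof. by move=> ha hr; rewrite (fc_ps_dilate (Posz 0) ha hr) expr0 mulr1. Qed.

Lemma rad1_acoef u : cintb u -> rad1 (acoef u).
Proof.
move=> iu; have [B hB] := fc_bound (cintbC_real iu).
apply: (@rad1_bdd _ _ (2 * B)) => -[|k]; rewrite ?acoef0 ?acoefS.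
- by apply: le_trans (hB 0) _; have := nc_ge0 (fc (fun t => (u t)%:C) 0); have := hB 0; lra.
- by rewrite nc_double ler_wpM2l.
Qed.

Lemma acoef0_real u : cintb u -> Im (acoef u 0) = 0.
Proof.
move=> iu; have := fc_real_conj 0 iu; rewrite oppr0 acoef0.
by move: (fc _ _) => z; case: z => x y /(congr1 (@complex.Im _)) /=; lra.
Qed.

Lemma pk_acoef r u t : 0 <= r < 1 -> cintb u -> pk r u t = Re (ps (acoef u) (r%:C * expi t)).
Proof.
move=> hr iu; have /andP[r0 r1] := hr; apply: complexI; rewrite -PK_real.
apply: PK_eq => //; first exact: cintbC_real.
move=> e e0; have w1 : nc (r%:C * expi t : C) < 1 by rewrite nc_rexpi.
have [N0 H] := rad1_cvs (rad1_acoef iu) w1 e0; exists N0 => N hN.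
set c := fun t => (u t)%:C : C.
have -> : symsum N (fun n => (r ^+ `|n|%N)%:C * fc c n * en n t) =
    (Re (\sum_(k < N.+1) acoef u k * (r%:C * expi t) ^+ k))%:C.
  have E0 : (r ^+ `|0|%N)%:C * fc c 0 * en 0 t = (Re (acoef u 0))%:C.
    rewrite en0 mulr1 [r ^+ _](expr0 r) mul1r; apply: ceqP => //.
    exact: acoef0_real.
  rewrite symsumE big_ord_recl ReD RCD expr0 mulr1 E0; congr (_ + _).
  rewrite Re_sum RC_sum; apply: eq_bigr => k _.
  have E1 : fc c (- k.+1%:Z) = ((fc c k.+1%:Z)^*)%C by rewrite /c (fc_real_conj _ iu) opprK.
  have E : (r ^+ k.+1)%:C * fc c (- k.+1%:Z) * en (- k.+1%:Z) t =
      (((r ^+ k.+1)%:C * fc c k.+1%:Z * en k.+1%:Z t)^*)%C.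
    rewrite E1; move: (fc c k.+1%:Z) => X; rewrite !conjM en_conj; congr (_ * _ * _).
    by apply: ceqP; rewrite /= ?oppr0.
  rewrite lift0 E addCJ exprMn -RCX -en_nat acoefS; congr (_ %:C).
  have -> : 2 * fc c k.+1%:Z * ((r ^+ k.+1)%:C * en k.+1%:Z t) = (2 : R)%:C * ((r ^+ k.+1)%:C * fc c k.+1%:Z * en k.+1%:Z t).
    by rewrite natC_two; ring.
  by rewrite ReRM.
by rewrite -RCB -ReN -ReD ncR; apply: le_lt_trans (Re_le_nc _) (H _ (leqW hN)).
Qed.

(** Poisson integrals multiply the coefficients by powers of the radius, and radii multiply. *)
Lemma PK_semigroup r q c t : 0 <= r < 1 -> 0 <= q < 1 -> cintbC c -> PK r (PK q c) t = PK (r * q) c t.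
Proof.
move=> hr hq ic; have hrq : 0 <= r * q < 1.
  by rewrite mulr_ge0 ?mulr_ilt1//; lra.
apply: PK_eq => //; first by apply: cintbC_cont; exact: cont_PK.
move=> e e0; have [N0 H] := PK_cvg t hrq ic e0; exists N0 => N /H.
rewrite (@eq_symsum _ N (fun n => (r ^+ `|n|%N)%:C * fc (PK q c) n * en n t) (fun n => ((r * q) ^+ `|n|%N)%:C * fc c n * en n t))//.
by move=> n; rewrite fc_PK// exprMn RCM; ring.
Qed.

Lemma pk_semigroup r q u t : 0 <= r < 1 -> 0 <= q < 1 -> cintb u -> pk r (pk q u) t = pk (r * q) u t.
Proof.
move=> hr hq iu; apply: complexI; rewrite -!PK_real -PK_semigroup//; last exact: cintbC_real.
by congr (PK r _ t); apply/funext => s; rewrite PK_real.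
Qed.

Lemma seg_le_ci u s t : cintb u -> 0 <= s -> s <= t -> t <= 2 * pi ->
  `|\int[leb]_(x in `[s, t]) u x| <= ci (fun x => `|u x|).
Proof.
move=> iu s0 st tp; have sub : `[s, t] `<=` (ang : set mR).
  by move=> x /=; rewrite in_itv /= => hx; apply/angP; lra.
have ms : measurable (`[s, t]%classic : set mR) by exact: measurable_itv.
have is_ : leb.-integrable `[s, t] (EFin \o u) by exact: (integrableS m_ang ms sub iu).
apply: le_trans (le_normr_Rintegral ms is_) _.
rewrite /circle_integral /Rintegral fine_le//.
- by apply: (integrable_fin_num ms); exact: (integrableS m_ang ms sub (cintb_norm iu)).
- by apply: (integrable_fin_num m_ang); exact: cintb_norm.
- apply: (ge0_subset_integral leb ms m_ang) => //.
  by apply/measurable_EFinP; apply: cintb_meas; exact: cintb_norm.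
Qed.

Lemma osc_mean_zero u (A : R) t : cintb u -> ci u = 0 ->
  (forall x y, ang x -> ang y -> `|u y - u x| <= A) -> ang t -> `|u t| <= A.
Proof.
move=> iu u0 osc ht; rewrite -(ler_pM2r (@pi2_gt0 R)).
have -> : `|u t| * (2 * pi) = `|ci (fun s => u t - u s)|.
  rewrite ciB//; last exact: cintb_cst.
  by rewrite u0 subr0 ci_cst normrM (ger0_norm (ltW (@pi2_gt0 R))).
apply: ci_bound; last by move=> s hs; exact: osc.
by apply: cintbB => //; exact: cintb_cst.
Qed.

Section Conjugate.
Variables (l f : R -> R).
Hypotheses (il : cintb l) (jf : cintb f).
Hypothesis hlf : forall n, (`|n|%:~R : R)%:C * fc (fun t => (l t)%:C) n = fc (fun t => (f t)%:C) n.
Let a := acoef l.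
Let ha : rad1 a := rad1_acoef il.

Let acoef_f : acoef f = (fun k => (k%:R : R)%:C * a k).
Proof.
apply/funext => -[|k]; first by rewrite acoef0 -hlf normr0 !mul0r.
rewrite /a !acoefS -hlf; have -> : `|k.+1%:Z|%:~R = k.+1%:R :> R by [].
ring.
Qed.

(** The angular derivative multiplies the coefficient of index [n] by [i n]; by the equation
    this turns the completion of [l] into that of [f], up to a factor [i]. *)
Lemma Im_ps_derive r t : 0 <= r < 1 -> is_derive t 1 (fun t => Im (ps a (r%:C * expi t))) (pk r f t).
Proof.
move=> hr; have w1 : nc (r%:C * expi t : C) < 1 by rewrite nc_rexpi; lra.
have [_ h] := (proj2 (ps_holo ha)) _ _ _ w1 (cder_circ r t).
apply: (is_derive_eq h); rewrite pk_acoef// acoef_f -mul_ps_dps//.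
have -> : ps (dps a) (r%:C * expi t) * (r%:C * ('i * expi t)) = 'i * (r%:C * expi t * ps (dps a) (r%:C * expi t)) by ring.
by rewrite ImM /=; ring.
Qed.

(** As a function of the angle, the difference has derivative [pk r (f - pk q f)], whose L^1
    norm is at most that of [f - pk q f], and it has mean value 0. *)
Lemma Im_ps_osc r q t : 0 <= r < 1 -> 0 <= q < 1 -> ang t ->
  `|Im (ps a (r%:C * expi t)) - Im (ps a ((r * q)%:C * expi t))| <= ci (fun t => `|f t - pk q f t|).
Proof.
move=> hr hq ht; have hrq : 0 <= r * q < 1 by rewrite mulr_ge0 ?mulr_ilt1//; lra.
pose H t := Im (ps a (r%:C * expi t)) - Im (ps a ((r * q)%:C * expi t)).
pose g t := f t - pk q f t.
have cpq : continuous (pk q f) by exact: cont_pk.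
have ipq := cintb_cont cpq; have ig : cintb g by exact: cintbB.
have dH s : is_derive s 1 H (pk r g s).
  apply: (is_derive_eq (is_deriveB (Im_ps_derive s hr) (Im_ps_derive s hrq))).
  by rewrite -pk_semigroup// -pkB.
have cH : continuous H.
  by move=> s; apply: (ccRe (cder_continuous (cder_real (dH s)))).
set A := ci _.
have osc x y : ang x -> ang y -> x <= y -> `|H y - H x| <= A.
  move=> /angP hx /angP hy xy; rewrite -(FTC2_seg xy dH); last exact: cont_pk.
  apply: le_trans (seg_le_ci _ _ xy _) _; try lra; first by apply: cintb_cont; exact: cont_pk.
  exact: pk_contract.
have osc' x y : ang x -> ang y -> `|H y - H x| <= A.
  by move=> hx hy; case: (leP x y) => [|/ltW] xy; [|rewrite distrC]; exact: osc.
have mean : ci H = 0.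
  have fc0 p : 0 <= p < 1 -> ci (fun t => Im (ps a (p%:C * expi t))) = 0.
    move=> hp; have := cint_fc0 (fun t => ps a (p%:C * expi t)); rewrite (fc_ps_dilate0 ha hp).
    by move=> /(congr1 Im) => E; apply: (etrans E); rewrite ImRM acoef0_real// mulr0.
  have ip p : 0 <= p < 1 -> cintb (fun t => Im (ps a (p%:C * expi t))).
    move=> hp; apply: cintb_cont; apply: continuousC_Im.
    by apply: (cont_circ hp) => z z1; exact: (ps_cont ha z1).
  have hH : ci H = _ - _ := ciB (ip r hr) (ip _ hrq).
  exact: (etrans hH (etrans (congr2 (fun x y : R => x - y) (fc0 r hr) (fc0 _ hrq)) (subr0 0))).
exact: (osc_mean_zero (cintb_cont cH) mean osc' ht).
Qed.

Let exp_ring (e x y p w : C) : e * (2 * (x * w - y * (p * w))) = e * (2 * (x - y * p)) * w.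
Proof. ring. Qed.

(** Fix [q] for which [f] is at distance at most [1 / 2] from [pk q f] in L^1. The function [E]
    with [E z = exp (2 (F z - F (q z)))], where [F] is the completion of [l], is holomorphic
    with [E 0 = 1], so the mean value of [Re E] is 1 on every circle. By [Im_ps_osc] the
    argument of [E] is at most 1, so [Re E] is at least [cos 1] times [|E|], and [|E|] is [exp
    (2 (pk r l - pk (r q) l))], in which the second term is bounded because [r q < q]. *)
Lemma pk_exp_bound : exists Q : R, forall r, 0 <= r < 1 -> ci (fun t => expR (2 * pk r l t)) <= Q.
Proof.
have [r0 hr0 Hr0] := pk_L1 jf (e := 1 / 2) ltac:(lra).
(* The bound [1 / 2] makes the argument of [E] at most 1, where the cosine is positive. *)
pose q := r0; have hq : 0 <= q < 1 by [].
have hA : ci (fun t => `|f t - pk q f t|) <= 1 / 2.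
  rewrite (@eq_ci _ _ (fun t => `|pk q f t - f t|)); last by move=> t _; rewrite distrC.
  by apply: Hr0; rewrite lexx /=; lra.
have q1 : q < 1 by case/andP: hq.
have [B hB] := bounded_on_ball q1 (fun z => @ps_cont R a z ha).
have hps := ps_holo ha; have cps z : nc z < 1 -> continuous_at z (ps a) by exact: ps_cont.
have qz z : nc z < 1 -> nc (q%:C * z) < 1.
  by move=> z1; rewrite ncM ncR ger0_norm; [|lra]; apply: le_lt_trans z1; rewrite ler_piMl ?nc_ge0//; lra.
pose E z := cexp (2 * (ps a z - ps a (q%:C * z))).
pose E' z := E z * (2 * (ps (dps a) z - ps (dps a) (q%:C * z) * q%:C)).
have cq z : continuous_at z (fun z : C => q%:C * z : C) by apply: ccM; [exact: ccst|exact: cvg_id].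
have hE : holo E E'.
  split.
  - move=> z z1; apply: ccM.
      apply: ccexp; apply: ccM; first exact: ccst.
      by apply: ccB; [exact: cps|apply: (@cccomp _ _ (fun z : C => q%:C * z : C)); [exact: cq|exact: cps (qz _ z1)]].
    apply: ccM; first exact: ccst.
    apply: ccB; first exact: (ps_cont (rad1_dps ha) z1).
    apply: ccM; last exact: ccst.
    by apply: (@cccomp _ _ (fun z : C => q%:C * z : C)); [exact: cq|exact: (ps_cont (rad1_dps ha) (qz _ z1))].
  - move=> c t v c1 hc; have d1 := (proj2 hps) c t v c1 hc.
    have d2 := (proj2 hps) _ t _ (qz _ c1) (cderZ q%:C hc).
    by apply: cder_eq (cder_cexp (cderZ 2 (cderB d1 d2))) _; exact: exp_ring.
have [b [hb Eb]] := holo_ps hE.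
have b0 : b 0%N = 1 by rewrite -ps0 -Eb ?nc0// /E mulr0 subrr mulr0 cexp0.
exists (expR (2 * B) * ((cos 1)^-1 * (2 * pi))) => r hr.
have cE : continuous (fun t => E (r%:C * expi t)) by apply: (cont_circ hr) => z z1; exact: holo_cont hE z1.
have mean : ci (fun t => Re (E (r%:C * expi t))) = 2 * pi.
  have Ee t : E (r%:C * expi t) = ps b (r%:C * expi t) by apply: Eb; rewrite nc_rexpi; lra.
  have := cint_fc0 (fun t => ps b (r%:C * expi t)); rewrite (fc_ps_dilate0 hb hr) b0 mulr1 => /(congr1 Re) => h.
  by rewrite -[RHS]h; apply: eq_ci => t _; rewrite Ee.
have hrq : 0 <= r * q < 1 by rewrite mulr_ge0 ?mulr_ilt1//; lra.
rewrite -mean -ciZ; last by apply: cintb_cont; exact: continuousC_Re.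
have cexpk : continuous (fun t => expR (2 * pk r l t)).
  move=> t; apply: (@continuous_comp _ _ _ (fun t => 2 * pk r l t) expR); last exact: continuous_expR.
  by apply: cvgM; [exact: cvg_cst|exact: cont_pk].
rewrite -ciZ; last by apply: cintbZ; apply: cintb_cont; exact: continuousC_Re.
apply: le_ci; first exact: cintb_cont.
  by do 2 apply: cintbZ; apply: cintb_cont; exact: continuousC_Re.
move=> t ht; have c0 := @cos1_gt0 R.
have ReE : Re (E (r%:C * expi t)) = expR (2 * (pk r l t - pk (r * q) l t)) *
    cos (2 * (Im (ps a (r%:C * expi t)) - Im (ps a ((r * q)%:C * expi t)))).
  have two z : Re (2 * z) = 2 * Re z /\ Im (2 * z) = 2 * Im z.
    by rewrite natC_two ReRM ImRM.
  rewrite /E /cexp ReRM (two _).1 (two _).2 mulrA -RCM [q * r]mulrC.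
  by rewrite ReD ReN ImD ImN !pk_acoef.
rewrite ReE; set X := 2 * (Im _ - _).
have hX : `|X| <= 1.
  by have := Im_ps_osc hr hq ht; rewrite /X normrM (@ger0_norm _ 2)//; lra.
have hcos : cos 1 <= cos X.
  rewrite -[leRHS]cos_norm leNgt ltr_cos ?in_itv /=; have := @pi_ge2 R; have := normr_ge0 X; lra.
have hB' : pk (r * q) l t <= B.
  rewrite pk_acoef//; apply: le_trans (ler_norm _) _; apply: le_trans (Re_le_nc _) _.
  apply: hB; rewrite nc_rexpi; last by case/andP: hrq.
  by rewrite ler_piMl//; lra.
have -> : 2 * pk r l t = 2 * pk (r * q) l t + 2 * (pk r l t - pk (r * q) l t) by ring.
rewrite expRD; set Y := expR (2 * (_ - _)).
have Y0 : 0 <= Y by exact: expR_ge0.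
apply: ler_pM; [exact: expR_ge0|exact: Y0|by rewrite ler_expR ler_wpM2l|].
by rewrite ler_pdivlMl// mulrC ler_wpM2l.
Qed.
End Conjugate.

End Regularity.

(** * Summability of the Fourier coefficients *)

Section Bessel.
Context {R : realType}.
Notation C := (Cplx R).
Notation mR := (measurableTypeR R).
Notation ang := (@angles R).
Notation ci := (@circle_integral R).
Notation cint := (@circle_cintegral R).
Implicit Types (z w : C) (t s x r y : R) (u v : R -> R) (c d : R -> C) (k N : nat) (n : int) (a : nat -> C).

Lemma cint_en_fc c n : cint (fun t => c t * en (- n) t) = (2 * pi)%:C * fc c n.
Proof.
rewrite /fc mulrA [(2 * pi)%:C * _]mulrC twopiC mul1r; apply: eq_cint => t _.
by rewrite enN.
Qed.

Lemma mulC_conj z : z * (z^*)%C = (nc z ^+ 2)%:C :> C.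
Proof. by rewrite ncsq; case: z => x y; apply: ceqP; rewrite /=; ring. Qed.

(** Integrate the nonnegative function [u^2 - 2 Re (u P) + |P|^2], where [P] is the Fourier sum
    over the positive indices up to [N]. *)
Lemma bessel u N (M : R) : measurable_fun (ang : set mR) u -> (forall t, ang t -> `|u t| <= M) ->
  \sum_(k < N) nc (fc (fun t => (u t)%:C) k.+1%:Z) ^+ 2 <= (2 * pi)^-1 * ci (fun t => u t ^+ 2).
Proof.
move=> mu hM; have iu := cintb_bdd mu hM; have iuC := cintbC_real iu.
pose g k := fc (fun t => (u t)%:C) k.+1%:Z; pose W := \sum_(k < N) nc (g k) ^+ 2.
pose P t : C := \sum_(k < N) g k * en k.+1%:Z t.
have cP : continuous P by move=> t; apply: ccsum => k _; exact: cont_Zen.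
have iP := cintbC_cont cP.
have WE : (2 * pi)%:C * W%:C = \sum_(k < N) (2 * pi)%:C * (g k * (g k)^*%C) :> C.
  by rewrite RC_sum mulr_sumr; apply: eq_bigr => k _; rewrite mulC_conj.
have uP : cint (fun t => (u t)%:C * P t) = (2 * pi)%:C * W%:C.
  rewrite WE (@eq_cint _ _ (fun t => \sum_(k < N) g k * ((u t)%:C * en k.+1%:Z t))); last first.
    by move=> t _; rewrite mulr_sumr; apply: eq_bigr => k _; ring.
  rewrite cint_sum; last by move=> k _; exact: (cintbC_Z _ (cintbC_M iuC (@cont_en R _))).
  apply: eq_bigr => k _; rewrite cintZ; last exact: (cintbC_M iuC (@cont_en R _)).
  rewrite -[k.+1%:Z]opprK cint_en_fc mulrCA; congr (_ * (_ * _)).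
  by rewrite (fc_real_conj _ iu) opprK.
have PP : cint (fun t => P t * (P t)^*%C) = (2 * pi)%:C * W%:C.
  rewrite WE (@eq_cint _ _ (fun t => \sum_(k < N) (g k)^*%C * (P t * en (- k.+1%:Z) t))); last first.
    move=> t _; rewrite {2}/P rmorph_sum mulr_sumr; apply: eq_bigr => k _.
    by rewrite [X in P t * X](conjM (g k) (en k.+1%:Z t)) en_conj; ring.
  rewrite cint_sum; last by move=> k _; exact: (cintbC_Z _ (cintbC_M iP (@cont_en R _))).
  apply: eq_bigr => k _; rewrite cintZ; last exact: (cintbC_M iP (@cont_en R _)).
  rewrite cint_en_fc mulrCA; congr (_ * _); rewrite mulrC; congr (_ * _).
  rewrite fc_sum; last by move=> i _; apply: cintbC_cont; exact: cont_Zen.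
  rewrite (bigD1 k)//= fcZ; last exact: cintbC_en.
  rewrite fc_en eqxx mulr1 big1 ?addr0// => i ik; rewrite fcZ; last exact: cintbC_en.
  by rewrite fc_en eqz_nat eqSS (inj_eq val_inj) eq_sym (negbTE ik) mulr0.
have iu2 : cintb (fun t => u t ^+ 2).
  apply: (@cintb_bdd _ _ (M ^+ 2)); first by apply: measurable_funX.
  by move=> t /hM h; rewrite normrX lerXn2r ?nnegrE// (le_trans _ h).
have iuP : cintb (fun t => Re ((u t)%:C * P t)) by exact: (proj1 (cintbC_M iuC cP)).
have cPP : continuous (fun t => nc (P t) ^+ 2).
  move=> t; rewrite (_ : (fun t => _) = (fun t => nc (P t) * nc (P t))); last by apply/funext => s; rewrite expr2.
  by apply: cvgM; apply: ccnc; exact: cP.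
have iPP := cintb_cont cPP.
have E1 : ci (fun t => Re ((u t)%:C * P t)) = 2 * pi * W.
  by have := congr1 (@complex.Re R) uP; rewrite -RCM.
have E2 : ci (fun t => nc (P t) ^+ 2) = 2 * pi * W.
  have := congr1 (@complex.Re R) PP; rewrite -RCM => h; rewrite -[RHS]h.
  by apply: eq_ci => t _; rewrite mulC_conj.
have pos : 0 <= ci (fun t => u t ^+ 2 - 2 * Re ((u t)%:C * P t) + nc (P t) ^+ 2).
  apply: ci_ge0 => t _; rewrite ReRM ncsq.
  have -> : u t ^+ 2 - 2 * (u t * Re (P t)) + (Re (P t) ^+ 2 + Im (P t) ^+ 2) =
    (u t - Re (P t)) ^+ 2 + Im (P t) ^+ 2 by ring.
  by rewrite addr_ge0 ?sqr_ge0.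
rewrite ciD// in pos; last by apply: cintbB => //; exact: cintbZ.
rewrite ciB// in pos; last exact: cintbZ.
rewrite ciZ// E1 E2 in pos.
rewrite -/W ler_pdivlMl ?pi2_gt0//; lra.
Qed.

Lemma expR_min_lip x y (k : R) :
  expR (2 * Num.min x k) - expR (2 * Num.min y k) <= 2 * expR (2 * k) * `|x - y|.
Proof.
set X := Num.min x k; set Y := Num.min y k.
have XY : `|X - Y| <= `|x - y|.
  rewrite /X /Y; case: (leP x k) => xk; case: (leP y k) => yk //.
  - have h1 : x - k <= 0 by lra. have h2 : x - y <= 0 by lra. by rewrite !ler0_norm//; lra.
  - have h1 : 0 <= k - y by lra. have h2 : 0 <= x - y by lra. by rewrite !ger0_norm//; lra.
  - by rewrite subrr normr0.
have Xk : X <= k by rewrite ge_min lexx orbT.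
have h := expR_ge1Dx (2 * Y - 2 * X).
have e0 := expR_gt0 (2 * X).
have E : expR (2 * Y) = expR (2 * X) * expR (2 * Y - 2 * X) by rewrite -expRD; congr expR; ring.
have h1 : expR (2 * X) * (1 + (2 * Y - 2 * X)) <= expR (2 * Y) by rewrite E ler_pM2l.
have h2 : expR (2 * X) <= expR (2 * k) by rewrite ler_expR; lra.
have h3 : X - Y <= `|x - y| by apply: le_trans XY; exact: ler_norm.
have h4 : expR (2 * X) * `|x - y| <= expR (2 * k) * `|x - y| by rewrite ler_wpM2r.
have h5 : expR (2 * X) * (X - Y) <= expR (2 * X) * `|x - y| by rewrite ler_pM2l.
have -> : 2 * expR (2 * k) * `|x - y| = 2 * (expR (2 * k) * `|x - y|) by rewrite mulrA.
move: (expR (2 * X)) (expR (2 * Y)) (expR (2 * k) * `|x - y|) h1 h4 h5 => a b c h1 h4 h5.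
have -> : a - b = a * (1 + (2 * Y - 2 * X)) - b + 2 * (a * (X - Y)) by ring.
lra.
Qed.

Lemma meas_exp_min u (b k : R) : measurable_fun (ang : set mR) u ->
  measurable_fun (ang : set mR) (fun t => expR (b * Num.min (u t) k)).
Proof.
move=> mu; apply: measurableT_comp; first exact: measurable_expR.
apply: measurable_funM; first exact: measurable_cst.
by apply: measurable_minr; [exact: mu|exact: measurable_cst].
Qed.

Lemma bdd_exp_min u (b k : R) t : 0 <= b -> `|expR (b * Num.min (u t) k)| <= expR (b * k).
Proof.
by move=> b0; rewrite ger0_norm ?expR_ge0// ler_expR ler_wpM2l// ge_min lexx orbT.
Qed.

Lemma cintb_exp_min u (b k : R) : 0 <= b -> measurable_fun (ang : set mR) u ->
  cintb (fun t => expR (b * Num.min (u t) k)).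
Proof.
move=> b0 mu; apply: (@cintb_bdd _ _ (expR (b * k))); first exact: meas_exp_min.
by move=> t _; exact: bdd_exp_min.
Qed.

(** After truncation the exponential is Lipschitz, so the bound passes from the Poisson
    integrals to [u] by convergence in L^1. *)
Lemma trunc_exp_bound u (Q : R) : cintb u -> (forall r, 0 <= r < 1 -> ci (fun t => expR (2 * pk r u t)) <= Q) ->
  forall k : R, ci (fun t => expR (2 * Num.min (u t) k)) <= Q.
Proof.
move=> iu hQ k; apply: le_eps => e e0.
have K0 : 0 < 2 * expR (2 * k) by rewrite mulr_gt0// expR_gt0.
have [r hr Hr] := pk_L1 iu (e := e / (2 * expR (2 * k))) ltac:(by rewrite divr_gt0).
have cpu : continuous (pk r u) by exact: cont_pk.
have ipu := cintb_cont cpu; have mu := cintb_meas iu; have mpu := cintb_meas ipu.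
have iexp : cintb (fun t => expR (2 * pk r u t)).
  apply: cintb_cont => t; apply: (@continuous_comp _ _ _ (fun t => 2 * pk r u t) expR); last exact: continuous_expR.
  by apply: cvgM; [exact: cvg_cst|exact: cpu].
have id : cintb (fun t => `|pk r u t - u t|) by apply: cintb_norm; exact: cintbB.
apply: (@le_trans _ _ (ci (fun t => expR (2 * pk r u t) + 2 * expR (2 * k) * `|pk r u t - u t|))).
  apply: le_ci; first exact: cintb_exp_min.
    by apply: cintbD => //; exact: cintbZ.
  move=> t _; have := expR_min_lip (u t) (pk r u t) k; rewrite distrC.
  have : expR (2 * Num.min (pk r u t) k) <= expR (2 * pk r u t).
    by rewrite ler_expR ler_wpM2l// ge_min lexx.
  lra.
rewrite ciD//; last exact: cintbZ.
rewrite ciZ//; apply: lerD; first exact: hQ.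
by rewrite -ler_pdivlMl// mulrC; apply: Hr; rewrite lexx; case/andP: hr.
Qed.

(** Let [g] be continuous and close to [exp u] in L^1, and truncate [u] at a bound [G] of [g].
    Where the truncation acts, [g <= G <= exp G <= exp u], so [exp G] is closer to [exp u] than
    [g] is. *)
Lemma trunc_exp_L1 u (e : R) : cintb (fun t => expR (u t)) -> measurable_fun (ang : set mR) u -> 0 < e ->
  exists k : R, ci (fun t => `|expR (u t) - expR (1 * Num.min (u t) k)|) <= e.
Proof.
move=> iu mu e0; have [g [cg _ hg]] := L1_dense iu e0; have [G hG] := cont_bdd_ang cg.
exists G; apply: le_trans hg; apply: le_ci.
- by apply: cintb_norm; apply: cintbB => //; exact: cintb_exp_min.
- by apply: cintb_norm; apply: cintbB => //; exact: cintb_cont.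
move=> t ht; rewrite mul1r; case: (leP (u t) G) => h; first by rewrite subrr normr0.
have h1 : g t <= expR G.
  have := hG t ht; have := ler_norm (g t); have := expR_ge1Dx G; lra.
have h2 : expR G <= expR (u t) by rewrite ler_expR ltW.
by rewrite !ger0_norm ?subr_ge0//; lra.
Qed.

Section Summable.
Variables (l f k : R -> R) (M : R).
Hypotheses (il : cintb l) (ie : cintb (fun t => expR (l t))).
Hypotheses (mk : measurable_fun (ang : set mR) k) (M0 : 0 <= M) (kM : forall t, `|k t| <= M).
Hypothesis fE : forall t, f t = k t * expR (l t) - 1.
Hypothesis hlf : forall n, (`|n|%:~R : R)%:C * fc (fun t => (l t)%:C) n = fc (fun t => (f t)%:C) n.

Lemma curv_cintb : cintb f.
Proof.
apply: (@eq_cintb _ (fun t => expR (l t) * k t - 1)); first by move=> t _; rewrite fE mulrC.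
apply: cintbB; last exact: cintb_cst.
by apply: (@cintb_Mbdd _ _ _ M) => // t _; exact: kM.
Qed.

(** [f] is bounded by a multiple of [exp l], plus 1, and the truncations of [exp (2 l)] have
    bounded integrals. For each [N] the truncation level is chosen such that the coefficients
    change by at most [1 / (N + 1)]; the inequality of Bessel for the truncated function then
    gives a bound that does not depend on [N]. *)
Lemma fourier_square_sum : exists Q : R, forall N, \sum_(j < N) nc (fc (fun t => (f t)%:C) j.+1%:Z) ^+ 2 <= Q.
Proof.
have jf := curv_cintb; have [Q hQ] := pk_exp_bound il jf hlf; have ml := cintb_meas il.
have hT := trunc_exp_bound il hQ.
pose W := (2 * pi)^-1 * (2 * M ^+ 2 * Q + 2 * (2 * pi)).
exists (2 * W + 2) => N.
have N1 : 0 < N.+1%:R :> R by rewrite ltr0n.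
pose e := (N.+1%:R)^-1 : R; have e0 : 0 < e by rewrite invr_gt0.
have M1 : 0 < M + 1 by rewrite ltr_wpDl.
have d0 : 0 < pi * e / (M + 1) := divr_gt0 (mulr_gt0 (pi_gt0 R) e0) M1.
have [b hb] := trunc_exp_L1 ie ml d0.
pose fk t := k t * expR (1 * Num.min (l t) b) - 1.
have mfk : measurable_fun (ang : set mR) fk.
  apply: measurable_funB; last exact: measurable_cst.
  by apply: measurable_funM => //; exact: meas_exp_min.
have bfk t : ang t -> `|fk t| <= M * expR (1 * b) + 1.
  move=> _; apply: le_trans (ler_normB _ _) _; rewrite normr1 lerD2r normrM.
  by apply: ler_pM => //; exact: bdd_exp_min.
have ifk := cintb_bdd mfk bfk.
have fk2 : ci (fun t => fk t ^+ 2) <= 2 * M ^+ 2 * Q + 2 * (2 * pi).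
  have i2 : cintb (fun t => expR (2 * Num.min (l t) b)) by exact: cintb_exp_min.
  apply: (@le_trans _ _ (ci (fun t => 2 * M ^+ 2 * expR (2 * Num.min (l t) b) + 2))).
    apply: le_ci.
    - apply: (@cintb_bdd _ _ ((M * expR (1 * b) + 1) ^+ 2)); first by apply: measurable_funX.
      by move=> t /bfk h; rewrite normrX lerXn2r ?nnegrE// (le_trans _ h).
    - by apply: cintbD; [exact: cintbZ|exact: cintb_cst].
    move=> t _; rewrite /fk; set X := expR (1 * _).
    have -> : expR (2 * Num.min (l t) b) = X ^+ 2 by rewrite /X expr2 -expRD; congr expR; ring.
    have k2 : k t ^+ 2 <= M ^+ 2 by rewrite -real_normK ?num_real// lerXn2r ?nnegrE.
    have : k t ^+ 2 * X ^+ 2 <= M ^+ 2 * X ^+ 2 by rewrite ler_wpM2r ?sqr_ge0.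
    have : 0 <= (k t * X + 1) ^+ 2 by exact: sqr_ge0.
    have -> : (k t * X + 1) ^+ 2 = k t ^+ 2 * X ^+ 2 + 2 * (k t * X) + 1 by ring.
    have -> : (k t * X - 1) ^+ 2 = k t ^+ 2 * X ^+ 2 - 2 * (k t * X) + 1 by ring.
    lra.
  rewrite ciD//; [|exact: cintbZ|exact: cintb_cst].
  by rewrite ciZ// ci_cst lerD2r ler_wpM2l// mulr_ge0 ?sqr_ge0.
have hW : \sum_(j < N) nc (fc (fun t => (fk t)%:C) j.+1%:Z) ^+ 2 <= W.
  apply: le_trans (bessel N mfk bfk) _; rewrite ler_wpM2l// invr_ge0; exact: ltW pi2_gt0.
have close n : nc (fc (fun t => (f t)%:C) n - fc (fun t => (fk t)%:C) n) <= e.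
  have ifC := cintbC_real jf; have ifkC := cintbC_real ifk.
  pose v t := M * `|expR (l t) - expR (1 * Num.min (l t) b)|.
  have iv : cintb v by apply: cintbZ; apply: cintb_norm; apply: cintbB => //; exact: cintb_exp_min.
  have h : nc (cint (fun t => ((f t)%:C - (fk t)%:C) * expi (- (n%:~R * t)))) <= 2 * ci v.
    apply: cint_le => //; first by apply: cintbC_fc; exact: cintbC_B.
    move=> t _; rewrite ncM nc_expi mulr1 -RCB ncR fE /fk /v.
    have -> : k t * expR (l t) - 1 - (k t * expR (1 * Num.min (l t) b) - 1) =
      k t * (expR (l t) - expR (1 * Num.min (l t) b)) by ring.
    by rewrite normrM ler_wpM2r.
  rewrite -fcB// /fc ncM ncR ger0_norm ?invr_ge0 ?(ltW pi2_gt0)// ler_pdivrMl ?pi2_gt0//.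
  apply: le_trans h _; rewrite /v ciZ; last by apply: cintb_norm; apply: cintbB => //; exact: cintb_exp_min.
  have : M * ci (fun t => `|expR (l t) - expR (1 * Num.min (l t) b)|) <= pi * e.
    apply: le_trans (ler_wpM2l M0 hb) _.
    rewrite mulrCA -[leRHS]mulr1 ler_wpM2l//; first by rewrite mulr_ge0 ?(ltW e0)// ltW// pi_gt0.
    by rewrite ler_pdivrMr; lra.
  lra.
apply: (@le_trans _ _ (\sum_(j < N) (2 * nc (fc (fun t => (fk t)%:C) j.+1%:Z) ^+ 2 + 2 * e ^+ 2))).
  apply: ler_sum => j _; have := close j.+1%:Z.
  set x := fc _ _; set y := fc _ _ => h.
  have h1 : nc x <= nc y + e by have := nc_distD x y; lra.
  have : nc x ^+ 2 <= (nc y + e) ^+ 2 by rewrite lerXn2r ?nnegrE ?nc_ge0 ?addr_ge0 ?nc_ge0 ?(ltW e0).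
  have : 0 <= (nc y - e) ^+ 2 by exact: sqr_ge0.
  have -> : (nc y - e) ^+ 2 = nc y ^+ 2 - 2 * (nc y * e) + e ^+ 2 by ring.
  have -> : (nc y + e) ^+ 2 = nc y ^+ 2 + 2 * (nc y * e) + e ^+ 2 by ring.
  lra.
rewrite big_split /= -mulr_sumr sumr_const card_ord.
have : (2 * e ^+ 2) *+ N <= 2.
  rewrite -mulr_natr -mulrA ler_piMr//.
  have eN : e * N%:R <= 1 by rewrite mulrC ler_pdivrMr// mul1r ler_nat.
  have e1 : e <= 1 by rewrite invf_le1// ler1n.
  by rewrite expr2 -mulrA mulr_ile1 ?(ltW e0)// mulr_ge0 ?(ltW e0).
lra.
Qed.

(** [n] times the coefficient of [l] is that of [f], so each term is at most the sum of the
    square of a coefficient of [f] and of [1 / n^2]. *)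
Lemma acoef_summable : exists Q : R, forall N, \sum_(j < N) nc (acoef l j) <= Q.
Proof.
have [Q hQ] := fourier_square_sum; exists (nc (acoef l 0) + (Q + 2)) => -[|N].
  rewrite big_ord0 addr_ge0 ?nc_ge0// addr_ge0//.
  by have := hQ 0%N; rewrite big_ord0.
rewrite big_ord_recl lerD2l.
apply: le_trans (lerD (hQ N) (@inv_sq_sum R N)); rewrite -big_split.
apply: ler_sum => j _; rewrite lift0 acoefS nc_double -hlf.
have n0 : 0 < j.+1%:R :> R by rewrite ltr0n.
change (`|j.+1%:Z|%:~R : R) with (j.+1%:R : R).
move: (fc (fun t => (l t)%:C) j.+1%:Z) (j.+1%:R : R) n0 => X y y0.
suff key : 2 * nc X <= nc (y%:C * X) ^+ 2 + y ^- 2 by exact: key.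
rewrite ncM ncR (gtr0_norm y0); move: (nc X) => x.
have E : y * x * y^-1 = x by rewrite mulrC mulKf// gt_eqF.
have -> : y ^- 2 = y^-1 ^+ 2 by rewrite exprVn.
have := sqr_ge0 (y * x - y^-1).
have -> : (y * x - y^-1) ^+ 2 = (y * x) ^+ 2 - 2 * (y * x * y^-1) + y^-1 ^+ 2 by ring.
rewrite E; lra.
Qed.
End Summable.

End Bessel.

(** * The analytic completion of a solution *)

Section BoundaryLog.
Context {R : realType}.
Notation C := (Cplx R).
Notation leb := (@lebesgue_measure R).
Notation mR := (measurableTypeR R).
Notation ang := (@angles R).
Notation ci := (@circle_integral R).
Implicit Types (z : C) (t s x r y : R) (u v w : R -> R) (c d : R -> C) (k N : nat) (n : int) (a : nat -> C).

Lemma ae_neq (a : R) : circle_ae (fun t => t != a).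
Proof.
exists [set a : mR]; split; first exact: measurable_set1.
- exact: lebesgue_measure_set1.
- by move=> t /= h; apply: contrapT => ta; apply: h => _; apply/eqP.
Qed.

(** The differentiation theorem of Lebesgue, applied to the extension of [u] by 0; the ends of
    the interval, where this extension may be wrong on one side, form a null set. *)
Lemma primitive_derive_ae u w : cintb u ->
  (forall t, ang t -> w t - w 0 = \int[leb]_(x in `[0, t]) u x) ->
  circle_ae (fun t => is_derive t 1 w (u t)).
Proof.
move=> iu hw; pose g : R -> R := u \_ ang.
have iT : leb.-integrable setT (EFin \o g).
  by have := (@integrable_mkcond _ mR R leb ang (EFin \o u) m_ang).1 iu; rewrite restrict_EFin.
have lg : locally_integrable [set: R] g by exact: (integrable_locally m_ang iu).
have iy y : leb.-integrable [set` Interval (BLeft (0 : R)) (BRight y)] (EFin \o g).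
  by apply: integrableS iT => //; exact: measurable_itv.
have F1 := FTC1 iy lg.
have F2 : circle_ae (fun t => (0 : R) < t -> derivable (fun x => \int[leb]_(t in [set` Interval (BLeft (0 : R)) (BRight x)]) g t) t 1 /\
    (fun x => \int[leb]_(t in [set` Interval (BLeft (0 : R)) (BRight x)]) g t)^`()%classic t = g t).
  have [N [mN N0 sub]] := F1; exists N; split => // t /= h; apply: sub => /= h2; apply: h => _ t0.
  by apply: h2; rewrite lte_fin.
apply: ae_imp (ae_and (ae_and (ae_neq 0) (ae_neq (2 * pi))) F2) => t ht [[t0 t2] H].
have /angP/andP[h0 h2] := ht.
have t0' : 0 < t by rewrite lt_neqAle eq_sym t0.
have t2' : t < 2 * pi by rewrite lt_neqAle t2.
have [D1 D2] := H t0'.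
have gt : g t = u t by rewrite /g patchE mem_set.
have DF := DeriveDef D1 (esym (derive1E _ _)); rewrite D2 gt in DF.
have DF' := is_deriveD DF (is_derive_cst (w 0) t 1); rewrite addr0 in DF'.
apply: is_derive_near DF'.
apply/nbhs_ballP; exists (Num.min t (2 * pi - t)); first by rewrite /= lt_min t0' subr_gt0.
move=> y; rewrite /ball /= lt_min => /andP[y1 y2].
have hy : ang y.
  by apply/angP; move: y1 y2; rewrite !ltr_norml; lra.
rewrite -[RHS](subrK (w 0)) hw//; congr (_ + _); apply: eq_Rintegral => x; rewrite inE /= in_itv /= => /andP[x0 xy].
rewrite /g patchE mem_set//; apply/angP; move/angP : hy; lra.
Qed.

Lemma triangle_quarters x x' y y' I e : 0 < e -> `|x - x'| <= e / 4 -> `|y - y'| <= e / 4 ->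
  `|x' - y' - I| <= e / 4 -> `|x - y - I| <= e.
Proof.
move=> e0 h1 h2 h3; have -> : x - y - I = (x - x') - (y - y') + (x' - y' - I) by ring.
apply: le_trans (ler_normD _ _) _; have := ler_normB (x - x') (y - y'); lra.
Qed.

Lemma weak_llip_real w u (M : R) : continuous w -> per w -> cintb u -> 0 <= M ->
  circle_ae (fun t => `|u t| <= M) ->
  (forall n, fc (fun t => (u t)%:C) n = 'i * (n%:~R : R)%:C * fc (fun t => (w t)%:C) n) ->
  llip (fun t => (w t)%:C).
Proof.
move=> cw pw iu M0 hM h.
have cwC : continuous (fun t => (w t)%:C : C) by move=> t; apply: ccR; exact: cw.
have pwC : per (fun t => (w t)%:C : C) by move=> t; rewrite pw.
have h0 : circle_ae (fun t => `|Im ((u t)%:C : C)| <= M) by apply: ae_all => t _; rewrite normr0.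
have L := weak_llip cwC pwC (cintbC_real iu) M0 hM h0 h.
exists 1, (4 * M); split => // t x _; have E : x = t + x - t by rewrite addrAC subrr add0r.
by rewrite [in leRHS]E; exact: L.
Qed.

(** [F] is the analytic completion of [l], continuous on the closed disk by [acoef_summable].
    Poisson integrals converge in L^1 to [l] and uniformly to [Re F], so both agree almost
    everywhere; and at radius [r] the imaginary part is a primitive of [pk r f], so in the limit
    it is a primitive of [f]. As [l] is now bounded, so is [f], and [Im F] is Lipschitz. *)
Theorem boundary_log (l kappa : C -> R) : cintb (fun t => l (expi t)) -> cintb (fun t => expR (l (expi t))) ->
  circle_Linfty kappa -> half_laplacian_eq l (fun z => kappa z * expR (l z) - 1) ->
  exists a F, [/\ rad1 a, cdc F, forall z, nc z < 1 -> F z = ps a z,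
    circle_ae (fun t => Re (F (expi t)) = l (expi t)) &
    llip (fun t => (Im (F (expi t)))%:C) /\
    circle_ae (fun t => is_derive t 1 (fun t => Im (F (expi t))) (kappa (expi t) * expR (l (expi t)) - 1))].
Proof.
move=> il ie Lk eqn; have [mk [M0 hM0]] := Lk.
have hM : circle_ae (fun t => `|kappa (expi t)| <= `|M0|).
  by apply: ae_imp hM0 => t _ /le_trans -> //; exact: ler_norm.
pose M := `|M0|; have [k [ik kM kE]] := ae_clamp mk (normr_ge0 M0) hM.
pose ll t := l (expi t); pose f t := k t * expR (ll t) - 1.
have fae : circle_ae (fun t => f t = kappa (expi t) * expR (l (expi t)) - 1).
  by apply: ae_imp kE => t _ E; rewrite /f E.
have jf : cintb f by exact: (curv_cintb ie (cintb_meas ik) kM (fun=> erefl)).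
have ml := cintb_meas (u := ll) il.
have mf0 : measurable_fun (ang : set mR) (fun t => kappa (expi t) * expR (l (expi t)) - 1).
  apply: measurable_funB; last exact: measurable_cst.
  by apply: measurable_funM; [exact: mk|apply: measurableT_comp; [exact: measurable_expR|exact: ml]].
have jf0 := ae_cintb mf0 jf fae.
have hlf n : (`|n|%:~R : R)%:C * fc (fun t => (ll t)%:C) n = fc (fun t => (f t)%:C) n.
  rewrite (half_laplacian_fourier n il eqn); apply: ae_eq_fc.
  - exact: (cintbC_real jf0).
  - exact: cintbC_real.
  - by apply: ae_imp fae => t _ ->.
have [Q hQ] := acoef_summable il ie (cintb_meas ik) (normr_ge0 M0) kM (fun=> erefl) hlf.
pose a := acoef ll; have ha : rad1 a := rad1_acoef il.
pose F := ps a; have cF : cdc F by exact: ps_cdc hQ.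
have cFc := cdc_circ cF.
have lae : circle_ae (fun t => Re (F (expi t)) = ll t).
  have cRe : continuous (fun t => Re (F (expi t))) by exact: continuousC_Re.
  have iRe := cintb_cont cRe.
  have h0 : ci (fun t => `|Re (F (expi t)) - ll t|) = 0.
    apply/eqP; rewrite eq_le ci_ge0// andbT; apply: le_eps => e e0; rewrite add0r.
    have e2 : 0 < e / 2 by rewrite divr_gt0.
    have e3 : 0 < e / 2 / (2 * pi) by rewrite divr_gt0// pi2_gt0.
    have [r1 hr1 H1] := pk_L1 il e2; have [r2 hr2 H2] := cdc_dilate cF e3.
    pose r := Num.max r1 r2.
    have hr : r1 <= r < 1 by rewrite le_max gt_max lexx; lra.
    have hr' : r2 <= r <= 1 by rewrite le_max lexx orbT ge_max; lra.
    have hr0 : 0 <= r < 1 by lra.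
    have ip : cintb (pk r ll) by apply: cintb_cont; exact: cont_pk.
    apply: (@le_trans _ _ (ci (fun t => e / 2 / (2 * pi) + `|pk r ll t - ll t|))).
      apply: le_ci.
      - by apply: cintb_norm; exact: cintbB.
      - by apply: cintbD; [exact: cintb_cst|apply: cintb_norm; exact: cintbB].
      move=> t _; have -> : Re (F (expi t)) - ll t = (Re (F (expi t)) - pk r ll t) + (pk r ll t - ll t) by ring.
      apply: le_trans (ler_normD _ _) _; rewrite lerD2r pk_acoef// -ReN -ReD.
      by apply: le_trans (Re_le_nc _) _; apply/ltW/H2; rewrite ?nc_expi.
    rewrite ciD; [|exact: cintb_cst|by apply: cintb_norm; exact: cintbB].
    by rewrite ci_cst divfK ?gt_eqF ?pi2_gt0//; have := H1 r hr; lra.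
  apply: ae_imp (ci_abs0 (cintbB iRe il) h0) => t _ /eqP; rewrite subr_eq0 => /eqP; exact.
pose rr t := Im (F (expi t)).
have prim t : ang t -> rr t - rr 0 = \int[leb]_(x in `[0, t]) f x.
  move=> /angP ht; apply/eqP; rewrite -subr_eq0 -normr_eq0 eq_le normr_ge0 andbT.
  have sub : `[0, t] `<=` (ang : set mR).
    by move=> x /=; rewrite in_itv /= => hx; apply/angP; lra.
  have ms : measurable (`[0, t]%classic : set mR) by exact: measurable_itv.
  apply: le_eps => e e0; rewrite add0r; have e4 : 0 < e / 4 by rewrite divr_gt0.
  have [r1 hr1 H1] := pk_L1 jf e4; have [r2 hr2 H2] := cdc_dilate cF e4.
  pose r := Num.max r1 r2.
  have hr : r1 <= r < 1 by rewrite le_max gt_max lexx; lra.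
  have hr' : r2 <= r <= 1 by rewrite le_max lexx orbT ge_max; lra.
  have hr0 : 0 <= r < 1 by lra.
  have cp : continuous (pk r f) by exact: cont_pk.
  have ip := cintb_cont cp.
  have t0 : 0 <= t by lra.
  have E := FTC2_seg t0 (fun s => Im_ps_derive il jf hlf s hr0) cp.
  have i1 : leb.-integrable `[0, t] (EFin \o pk r f) by exact: (integrableS m_ang ms sub ip).
  have i2 : leb.-integrable `[0, t] (EFin \o f) by exact: (integrableS m_ang ms sub jf).
  have B := RintegralB ms i1 i2.
  have S : `|\int[leb]_(x in `[0, t]) (pk r f x - f x)| <= e / 4.
    by apply: le_trans (seg_le_ci (cintbB ip jf) (lexx 0) t0 _) (H1 r hr); case/andP: ht.
  have near s : `|rr s - Im (ps a (r%:C * expi s))| <= e / 4.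
    rewrite /rr -ImN -ImD; apply: le_trans (Im_le_nc _) _; apply/ltW/H2 => //; by rewrite nc_expi.
  have n1 := near t; have n2 := near 0; rewrite B E -/a in S.
  exact: triangle_quarters e0 n1 n2 S.
have dae := primitive_derive_ae jf prim.
exists a, F; split => //; split; last first.
  by apply: ae_imp (ae_and dae fae) => t _ [h <-].
have crho : continuous (fun t => expR (Re (F (expi t)))).
  move=> t; apply: (@continuous_comp _ _ _ (fun t => Re (F (expi t))) expR); last exact: continuous_expR.
  exact: ccRe (cFc t).
have [K hK] := cont_bdd_ang crho.
have K0 : 0 <= K by apply: le_trans (hK 0 _); [|apply/angP; rewrite lexx ltW ?pi2_gt0].
have MK0 : 0 <= M * K + 1 by rewrite addr_ge0 ?mulr_ge0 ?normr_ge0.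
have fbd : circle_ae (fun t => `|f t| <= M * K + 1).
  apply: ae_imp lae => t ht E; rewrite /f -E; apply: le_trans (ler_normB _ _) _.
  by rewrite normr1 lerD2r normrM; apply: ler_pM => //; exact: hK.
have prr : per (fun t => (rr t)%:C : C) by move=> t; rewrite /rr expi_period.
have crr : continuous (fun t => (rr t)%:C : C) by move=> t; apply: ccR; exact: ccIm (cFc t).
have iF := cintbC_cont cFc; have irr := cintbC_cont crr.
have illC := cintbC_real (u := ll) il.
have sum m : fc (fun t => F (expi t)) m = fc (fun t => (ll t)%:C) m + 'i * fc (fun t => (rr t)%:C) m.
  rewrite -fcZ// -fcD//; last exact: cintbC_Z.
  apply: ae_eq_fc => //; first by apply: cintbC_D => //; exact: cintbC_Z.
  by apply: ae_imp lae => t _ E; apply: ceqP; rewrite !cE /= -?E; ring.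
have hfc n : fc (fun t => (f t)%:C) n = 'i * (n%:~R : R)%:C * fc (fun t => (rr t)%:C) n.
  rewrite -hlf; have := sum n; rewrite (fc_ps_boundary n ha cF (fun z _ => erefl)).
  case: n => [[|m]|m].
  - by rewrite normr0 mulr0 !mul0r.
  - rewrite /a acoefS => /eqP; rewrite addrC -subr_eq => /eqP E.
    have -> : `|m.+1%:Z| = m.+1%:Z by [].
    have -> : fc (fun t => (ll t)%:C) m.+1%:Z = 'i * fc (fun t => (rr t)%:C) m.+1%:Z by rewrite -E; ring.
    ring.
  - move=> /eqP; rewrite eq_sym addr_eq0 => /eqP ->.
    have -> : `|Negz m| = - Negz m by rewrite ltr0_norm.
    by rewrite intrN RCN; ring.
have prr' : per rr by move=> t; rewrite /rr expi_period.
exact: (weak_llip_real (continuousC_Im cFc) prr' jf MK0 fbd hfc).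
Qed.

End BoundaryLog.

(** * Changes of parameter of the circle *)

Section Reparametrization.
Context {R : realType}.
Notation leb := (@lebesgue_measure R).
Notation mR := (measurableTypeR R).
Notation ang := (@angles R).
Implicit Types (t x y : R).
Variables (p P : R -> R).
Hypotheses (cp : continuous p) (p0 : forall t, 0 < p t) (hP : forall t : R, is_derive t 1 P (p t)).

Let cP : continuous P.
Proof. by move=> t; apply: (ccRe (cder_continuous (cder_real (hP t)))). Qed.

Lemma repar_lt x y : x < y -> P x < P y.
Proof.
move=> xy; have [c _ E] := MVT_segment (ltW xy) (fun s _ => hP s) (continuous_subspaceT cP).
by rewrite -subr_gt0 E mulr_gt0// subr_gt0.
Qed.

Lemma repar_le x y : (P x <= P y) = (x <= y).
Proof.
apply/idP/idP; first by apply: contraTT; rewrite -!ltNge => /repar_lt.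
by rewrite le_eqVlt => /predU1P[->//|/repar_lt/ltW].
Qed.

Lemma repar_inj : injective P.
Proof. by move=> x y E; apply/eqP; rewrite eq_le -(repar_le x y) -(repar_le y x) E lexx. Qed.

Hypothesis P2 : per (fun t => P t - t).
Hypothesis P00 : P 0 = 0.

Lemma repar_shift t : P (t + 2 * pi) = P t + 2 * pi.
Proof. by have := P2 t => /=; lra. Qed.

Lemma repar_surj y : exists t, P t = y.
Proof.
have [y0 hy0 [n ->]] := ang_reduce y.
have pi20 := ltW (@pi2_gt0 R).
have P2pi : P (2 * pi) = 2 * pi by rewrite -[2 * pi]add0r repar_shift P00.
have [|t _ E] := IVT pi20 (continuous_subspaceT cP) (v := y0).
  by rewrite P00 P2pi min_l// max_r//; lra.
exists (t + n%:~R * (2 * pi)); have := perZ t n P2; rewrite /= E; lra.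
Qed.

Definition repar_inv y : R := xget 0 [set t | P t = y].
Notation T := repar_inv.

Lemma repar_invK y : P (T y) = y.
Proof. by have [t E] := repar_surj y; apply: (@xgetPex _ 0 [set t | P t = y]); exists t. Qed.
Lemma reparK t : T (P t) = t. Proof. by apply: repar_inj; rewrite repar_invK. Qed.

Lemma repar_inv_shift y : T (y + 2 * pi) = T y + 2 * pi.
Proof. by apply: repar_inj; rewrite repar_invK repar_shift repar_invK. Qed.

Lemma repar_inv_derive y : is_derive y 1 T (p (T y))^-1.
Proof.
rewrite -[X in is_derive X](repar_invK y); apply: is_derive_inverse.
- by near=> t; exact: reparK.
- by near=> t; exact: cP.
- by rewrite gt_eqF.
Unshelve. all: by end_near. Qed.

Lemma repar_inv_cont : continuous T.
Proof. by move=> t; apply: (ccRe (cder_continuous (cder_real (repar_inv_derive t)))). Qed.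

Lemma repar_inv_ang t : ang t -> ang (T t).
Proof.
move=> /angP ht; apply/angP;
have P2pi : P (2 * pi) = 2 * pi by rewrite -[2 * pi]add0r repar_shift P00.
by rewrite -(repar_le 0) -(repar_le _ (2 * pi)) P00 P2pi repar_invK.
Qed.

(* The image under [P] of the measure of density [p]; [m_leb] identifies it with Lebesgue
   measure. *)
Let m (A : set mR) : \bar R := (\int[leb]_(x in P @^-1` A) (p x)%:E)%E.

Let mPre (A : set mR) : measurable A -> measurable (P @^-1` A : set mR).
Proof. by move=> mA; rewrite -[X in measurable X]setTI; apply: (continuous_measurable_fun cP). Qed.
Let mp (A : set mR) : measurable_fun A (EFin \o p).
Proof. by apply/measurable_EFinP; apply: measurable_funTS; exact: continuous_measurable_fun. Qed.

Let m_set0 : m set0 = 0%E.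
Proof. by rewrite /m preimage_set0 integral_set0. Qed.
Let m_ge0 A : (0 <= m A)%E.
Proof. by apply: integral_ge0 => x _; rewrite lee_fin ltW. Qed.
Let m_sigma_additive : semi_sigma_additive m.
Proof.
move=> /= A mA tA mUA; rewrite /m preimage_bigcup ge0_integral_bigcup//.
- by apply: is_cvg_ereal_nneg_natsum_cond => n _ _; exact: m_ge0.
- by move=> k; exact: mPre.
- by move=> x _; rewrite lee_fin ltW.
- by move/trivIsetP : tA => tA; apply/trivIsetP => i j _ _ ij; rewrite -preimage_setI tA// preimage_set0.
Qed.

HB.instance Definition _ := isMeasure.Build _ mR R m m_set0 m_ge0 m_sigma_additive.

Let m_leb (A : set mR) : measurable A -> leb A = m A.
Proof.
apply: (lebesgue_measure_unique (mu := m)) => X /ocitvP[->|[[a b] /= ab ->]].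
  by rewrite !measure0.
rewrite lebesgue_measure_itv /= lte_fin ab /m.
have -> : P @^-1` `]a, b] = `]T a, T b]%classic.
  apply/seteqP; split => x; rewrite /= !in_itv /= -[a in a < P x](repar_invK a) -[b in P x <= b](repar_invK b) !ltNge !repar_le//.
have Tab : T a < T b by rewrite ltNge -repar_le !repar_invK -ltNge.
have F := FTC2_seg (ltW Tab) hP cp.
rewrite !repar_invK in F.
rewrite integral_itv_obnd_cbnd; last first.
  exact: mp.
have ii : leb.-integrable `[T a, T b] (EFin \o p).
  apply: continuous_compact_integrable; first exact: segment_compact.
  exact: continuous_subspaceT.
rewrite -EFinB -F /Rintegral fineK//; apply: (integrable_fin_num _ ii).
exact: measurable_itv.
Qed.

(** By uniqueness of Lebesgue measure, its density [p] is transported by [P] to Lebesgue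
    measure, so null sets are preserved. *)
Lemma repar_ae (Q : R -> Prop) : circle_ae Q -> circle_ae (fun t => Q (T t)).
Proof.
move=> [N [mN N0 sub]]; exists (T @^-1` N).
have mTN : measurable (T @^-1` N : set mR).
  by rewrite -[X in measurable X]setTI; apply: (continuous_measurable_fun repar_inv_cont).
split => //.
- rewrite m_leb// /m.
  have -> : P @^-1` (T @^-1` N) = N by apply/seteqP; split => x /=; rewrite reparK.
  by apply: null_set_integral => //; exact: mp.
- move=> t /= h; apply: sub => /= h2; apply: h => /repar_inv_ang; exact: h2.
Qed.

Lemma repar_inv_meas (u : R -> R) : measurable_fun (ang : set mR) u -> measurable_fun (ang : set mR) (fun t => u (T t)).
Proof.
move=> mu; apply: (measurable_comp m_ang _ mu).
- by move=> x [t ht <-]; exact: repar_inv_ang.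
- by apply: measurable_funTS; exact: continuous_measurable_fun repar_inv_cont.
Qed.

End Reparametrization.

(** * The immersion with a given logarithmic derivative *)

Section Immersion.
Context {R : realType}.
Notation C := (Cplx R).
Implicit Types (z : C) (t s x r y : R) (c d : R -> C) (k N : nat) (n : int) (a e : nat -> C) (F : C -> C).

(** The real and imaginary parts are bounded, so [bessel] applies to each of them. *)
Lemma bessel_cont c : continuous c -> exists Q : R, forall N, \sum_(j < N) nc (fc c j.+1%:Z) ^+ 2 <= Q.
Proof.
move=> cc; have cR := continuousC_Re cc; have cI := continuousC_Im cc.
have [M hM] := cont_bdd_ang cR; have [K hK] := cont_bdd_ang cI.
have h1 N := bessel N (cont_meas cR) hM; have h2 N := bessel N (cont_meas cI) hK.
exists (2 * ((2 * pi)^-1 * circle_integral (fun t => Re (c t) ^+ 2)) +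
  2 * ((2 * pi)^-1 * circle_integral (fun t => Im (c t) ^+ 2))) => N.
have iR := cintbC_real (cintb_cont cR); have iI := cintbC_real (cintb_cont cI).
have E n : fc c n = fc (fun t => (Re (c t))%:C) n + 'i * fc (fun t => (Im (c t))%:C) n.
  rewrite -fcZ// -fcD//; last exact: cintbC_Z.
  by apply: eq_fc => t _; apply: ceqP; rewrite !cE /=; ring.
apply: (@le_trans _ _ (\sum_(j < N) (2 * nc (fc (fun t => (Re (c t))%:C) j.+1%:Z) ^+ 2 +
   2 * nc (fc (fun t => (Im (c t))%:C) j.+1%:Z) ^+ 2))).
  apply: ler_sum => j _; rewrite E.
  move: (fc (fun t => (Re (c t))%:C) _) (fc (fun t => (Im (c t))%:C) _) => x y.
  have ni : nc ('i : C) = 1 by rewrite /= expr0n expr1n add0r sqrtr1.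
  have h : nc (x + 'i * y) <= nc x + nc y by apply: le_trans (ncD _ _) _; rewrite ncM ni mul1r.
  have : nc (x + 'i * y) ^+ 2 <= (nc x + nc y) ^+ 2.
    by rewrite lerXn2r ?nnegrE ?nc_ge0 ?addr_ge0 ?nc_ge0.
  move: (nc x) (nc y) (nc _ ^+ 2) => X Y Z; have := sqr_ge0 (X - Y); nra.
rewrite big_split /= -!mulr_sumr; apply: lerD; rewrite ler_wpM2l//; [exact: h1|exact: h2].
Qed.

Lemma ips_summable e (Q : R) : (forall N, \sum_(j < N) nc (e j.+1) ^+ 2 <= Q) ->
  exists B : R, forall N, \sum_(j < N) nc (ips e j) <= B.
Proof.
move=> hQ; exists (nc (e 0%N) + (Q + 2)).
have Q0 : 0 <= Q by have := hQ 0%N; rewrite big_ord0.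
have n0 : nc (ips e 0) = 0 by rewrite /ips nc0.
have n1 : nc (ips e 1) = nc (e 0%N) by rewrite /ips invr1 mul1r.
move=> [|[|N]].
- by rewrite big_ord0 !addr_ge0 ?nc_ge0.
- by rewrite big_ord_recl big_ord0 addr0 n0 !addr_ge0 ?nc_ge0.
rewrite big_ord_recl n0 add0r big_ord_recl.
rewrite [X in nc (ips e X)](_ : _ = 1%N)// n1 lerD2l.
apply: le_trans (lerD (hQ N) (@inv_sq_sum R N)); rewrite -big_split.
apply: ler_sum => j _; rewrite !lift0.
suff key : nc (ips e j.+2) <= nc (e j.+1) ^+ 2 + j.+1%:R ^- 2 by exact: key.
rewrite /ips ncM ncR ger0_norm ?invr_ge0//; move: (nc (e j.+1)) (nc_ge0 (e j.+1)) => x x0.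
have y0 : 0 < j.+1%:R :> R by rewrite ltr0n.
have h : (j.+2%:R : R)^-1 * x <= j.+1%:R^-1 * x.
  by rewrite ler_wpM2r// lef_pV2 ?posrE ?ltr0n// ler_nat.
apply: le_trans h _; have -> : (j.+1%:R : R) ^- 2 = j.+1%:R^-1 ^+ 2 by rewrite exprVn.
move: (j.+1%:R^-1) => y; have := sqr_ge0 (x - y); have := sqr_ge0 (x + y); nra.
Qed.

Lemma cont_cexp z : continuous_at z (@cexp R).
Proof. by apply: ccexp; exact: cvg_id. Qed.

Lemma holo_cexp a : rad1 a -> holo (fun z => cexp (ps a z)) (fun z => cexp (ps a z) * ps (dps a) z).
Proof.
move=> ha; have [_ h] := ps_holo ha; split.
- move=> z z1; apply: ccM; first by apply: ccexp; exact: (ps_cont ha z1).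
  exact: (ps_cont (rad1_dps ha) z1).
- move=> c t v c1 hc; apply: cder_eq (cder_cexp (h _ _ _ c1 hc)) _; rewrite mulrA; exact: erefl.
Qed.

(** Inside the disk, [exp F] is a power series, whose coefficients are the Fourier coefficients
    of its boundary values; these are square summable, so the coefficients of the primitive are
    summable and the primitive is continuous up to the circle. *)
Theorem exp_immersion a F : rad1 a -> cdc F -> (forall z, nc z < 1 -> F z = ps a z) ->
  exists Phi, holomorphic_immersion Phi (fun z => cexp (F z)).
Proof.
move=> ha cF EF; have [e [he Ee]] := holo_ps (holo_cexp ha).
have cG : cdc (fun z => cexp (F z)) by apply: (cdc_comp cF) => z _; exact: cont_cexp.
have EG z : nc z < 1 -> cexp (F z) = ps e z by move=> z1; rewrite EF//; exact: Ee.
have [Q hQ] := bessel_cont (cdc_circ cG).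
have fcE j : fc (fun t => cexp (F (expi t))) j.+1%:Z = e j.+1 := fc_ps_boundary j.+1%:Z he cG EG.
have hQ' N : \sum_(j < N) nc (e j.+1) ^+ 2 <= Q.
  by apply: le_trans (hQ N); apply: ler_sum => j _; rewrite fcE.
have [B hB] := ips_summable hQ'.
exists (ps (ips e)); split.
- by apply/cdcP; exact: ps_cdc hB.
- by apply/cdcP.
- move=> z /open_diskE z1; rewrite (EG _ z1); have h := ps_is_derive (rad1_ips he) z1.
  by rewrite dps_ips in h; exact: h.
- by move=> z _; exact: cexp_neq0.
Qed.

End Immersion.

(** * From the equation to the immersion *)

Section Forward.
Context {R : realType}.
Notation C := (Cplx R).
Notation leb := (@lebesgue_measure R).
Notation mR := (measurableTypeR R).
Notation ang := (@angles R).
Notation ci := (@circle_integral R).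
Implicit Types (z w : C) (t s x r y : R) (c d : R -> C) (k N : nat) (n : int).

Lemma llip_expi u : llip (fun t => (u t)%:C : C) -> llip (fun t => expi (u t) : C).
Proof.
move=> [d [M [d0 H]]]; exists d, (2 * M); split => // t h hd.
apply: (@le_trans _ _ (2 * `|u (t + h) - u t|)).
  have le x y : x <= y -> nc (expi y - expi x : C) <= 2 * 1 * (y - x).
    move=> xy; apply: (mean_value_leC xy (fun s _ => cder_expi s)) => s _.
    by rewrite ncM nc_expi /= expr0n expr1n add0r sqrtr1 mulr1.
  case: (leP (u t) (u (t + h))) => [xy|/ltW xy]; have := le _ _ xy; rewrite mulr1.
  - by rewrite ger0_norm ?subr_ge0.
  - by rewrite ncB distrC ger0_norm ?subr_ge0.
rewrite -mulrA ler_wpM2l//; have := H t h hd; by rewrite -RCB ncR.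
Qed.

Lemma llip_comp c u (K : R) : llip c -> (forall t h, `|u (t + h) - u t| <= K * `|h|) -> llip (fun t => c (u t)).
Proof.
move=> [d [M [d0 H]]] hu; exists (d / (`|K| + 1)), (`|M| * `|K|).
have K1 : 0 < `|K| + 1 by rewrite ltr_wpDl.
split; first by rewrite divr_gt0.
move=> t h; rewrite ltr_pdivlMr// => hd.
have e1 : `|u (t + h) - u t| <= `|K| * `|h|.
  by apply: le_trans (hu t h) _; rewrite ler_wpM2r// ler_norm.
have := H (u t) (u (t + h) - u t); rewrite [u t + _]addrC subrK => h1.
apply: le_trans (h1 _) _.
  by apply: le_lt_trans e1 _; rewrite mulrC; apply: le_lt_trans hd; rewrite ler_wpM2l// lerDl.
apply: (@le_trans _ _ (`|M| * `|u (t + h) - u t|)); first by rewrite ler_wpM2r// ler_norm.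
by rewrite -mulrA ler_wpM2l.
Qed.

Lemma cont_cLinfty (w : C -> C) : continuous (fun t => w (expi t)) -> circle_cLinfty w.
Proof.
move=> cw; split.
- have cR := continuousC_Re cw; split; first exact: (cont_meas cR).
  by have [M hM] := cont_bdd_ang cR; exists M; apply: ae_all.
- have cI := continuousC_Im cw; split; first exact: (cont_meas cI).
  by have [M hM] := cont_bdd_ang cI; exists M; apply: ae_all.
Qed.

Lemma smooth_llip (phi : C -> C) : circle_smooth phi ->
  [/\ llip (fun t => phi (expi t)), continuous (curve_derive (phi \o expi)) &
      forall t, cder (fun t => phi (expi t)) t (curve_derive (phi \o expi) t)].
Proof.
move=> hphi; have dp t : cder (fun t => phi (expi t)) t (curve_derive (phi \o expi) t) := derivable_cder (hphi 0%N t).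
have cp : continuous (curve_derive (phi \o expi)).
  by move=> t; exact: cder_continuous (derivable_cder (hphi 1%N t)).
split => //; apply: (llip_C1 _ dp cp) => t; by rewrite expi_period.
Qed.

(** Integration by parts: the product with a test function is Lipschitz and periodic, so
    [FTC_llip] applies. *)
Lemma llip_weak_derivative (u w : C -> C) : llip (fun t => u (expi t)) -> cintbC (fun t => w (expi t)) ->
  circle_ae (fun t => cder (fun t => u (expi t)) t (w (expi t))) -> circle_weak_derivative u w.
Proof.
move=> lu iw hd phi /smooth_llip[lp cdp dp].
have cu := llip_cont lu; have cp := llip_cont lp.
have pu : per (fun t => u (expi t)) by move=> t; rewrite expi_period.
have pp : per (fun t => phi (expi t)) by move=> t; rewrite expi_period.
have i1 : cintbC (fun t => w (expi t) * phi (expi t)) := cintbC_M iw cp.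
have i2 : cintbC (fun t => u (expi t) * curve_derive (phi \o expi) t) := cintbC_M (cintbC_cont cu) cdp.
have pup : per (fun t => u (expi t) * phi (expi t)) by move=> t; rewrite expi_period.
have := FTC_llip (llipM pu pp lu lp) pup (cintbC_D i1 i2).
have h : circle_ae (fun t => cder (fun t => u (expi t) * phi (expi t)) t
   (w (expi t) * phi (expi t) + u (expi t) * curve_derive (phi \o expi) t)).
  by apply: ae_imp hd => t _ h; apply: cderM => //; exact: dp.
move=> /(_ h); rewrite cintD// => /eqP; rewrite addrC addr_eq0 => /eqP; exact.
Qed.

Section Curve.
Variables (F Phi : C -> C) (l kappa : C -> R).
Hypotheses (cF : cdc F) (im : holomorphic_immersion Phi (fun z => cexp (F z))).
Hypothesis lae : circle_ae (fun t => Re (F (expi t)) = l (expi t)).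
Let rr t := Im (F (expi t)).
Let rho t := expR (Re (F (expi t))).
Hypothesis dae : circle_ae (fun t => is_derive t 1 rr (kappa (expi t) * expR (l (expi t)) - 1)).

Let U t : C := 'i * expi (t + rr t).

Let cFc : continuous (fun t => F (expi t)). Proof. exact: cdc_circ. Qed.
Let rho0 t : 0 < rho t. Proof. exact: expR_gt0. Qed.
Let ni : nc ('i : C) = 1. Proof. by rewrite /= expr0n expr1n add0r sqrtr1. Qed.
Let nU t : nc (U t) = 1. Proof. by rewrite ncM ni nc_expi mul1r. Qed.

Lemma exp_curve_derive t : cder (fun t => Phi (expi t)) t ((rho t)%:C * U t).
Proof.
have [cP cdP hP _] := immersion_disk im; apply: cder_eq (cder_boundary t cP cdP hP) _.
by rewrite /cexp /U expiD; ring.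
Qed.

Lemma exp_curve_tangent t : unit_tangent (Phi \o expi) t = U t.
Proof.
rewrite /unit_tangent (cder_derive (exp_curve_derive t)) ncE ncM nU mulr1 ncR (gtr0_norm (rho0 t)).
by rewrite mulrC mulKf// -nc_gt0 ncR normr_gt0 gt_eqF.
Qed.

(** This is where the equation enters: the tangent angle [t + Im F] has derivative [1 + (kappa
    e^l - 1)]. *)
Lemma exp_tangent_derive : circle_ae (fun t => cder U t ('i * (kappa (expi t) * rho t)%:C * U t)).
Proof.
apply: ae_imp (ae_and lae dae) => t _ [E h]; rewrite -E -/(rho t) in h.
have hpsi := is_deriveD (is_derive_id t (1 : R)) h.
have E2 : 1 + (kappa (expi t) * rho t - 1) = kappa (expi t) * rho t by ring.
rewrite E2 in hpsi.
have R1 : 'i * (kappa (expi t) * rho t)%:C * U t = 'i * ((kappa (expi t) * rho t)%:C * ('i * expi (t + rr t))) :> C.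
  by rewrite [RHS]mulrA.
rewrite R1; exact: (cderZ 'i (cder_comp hpsi (cder_expi (t + rr t)))).
Qed.

Lemma exp_boundary_curvature : boundary_curvature Phi kappa.
Proof.
apply: ae_imp exp_tangent_derive => t _ h.
have h' : cder (unit_tangent (Phi \o expi)) t ('i * (kappa (expi t) * rho t)%:C * U t).
  by apply: cder_ext h => s; rewrite exp_curve_tangent.
split; [exact: cder_derivable (exp_curve_derive t)|exact: cder_derivable h'|].
rewrite /signed_curvature /arclength_derive exp_curve_tangent (cder_derive h').
rewrite (cder_derive (exp_curve_derive t)) ncE ncM nU mulr1 ncR (gtr0_norm (rho0 t)) dotC_rot//.
by rewrite mulfK// gt_eqF.
Qed.

Hypothesis lrr : llip (fun t => (rr t)%:C : C).
Variables (L : R).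
Hypothesis normL : (\int[leb]_(t in ang) (expR (l (expi t)))%:E)%E = L%:E.
Hypothesis ie : cintb (fun t => expR (l (expi t))).
Hypothesis Lk : circle_Linfty kappa.

Let crho : continuous rho.
Proof.
move=> t; have h := @cFc t.
by apply: (@continuous_comp _ _ _ (fun t => Re (F (expi t))) expR); [exact: ccRe h|exact: continuous_expR].
Qed.
Let prho : per rho. Proof. by move=> t; rewrite /rho expi_period. Qed.

Let ci_rho : ci rho = L.
Proof.
have -> : L = ci (fun t => expR (l (expi t))) by rewrite /circle_integral /Rintegral normL.
apply: ae_eq_ci; [exact: cont_meas|exact: (cintb_meas ie)|].
by apply: ae_imp lae => t _ E; rewrite /rho E.
Qed.

Let rho_lb : exists2 K : R, 0 < K & forall t, (rho t)^-1 <= K.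
Proof.
have cv : continuous (fun t => (rho t)^-1).
  by move=> t; apply: continuousV; [rewrite gt_eqF|exact: crho].
have [K hK] := cont_bdd_ang cv; exists (`|K| + 1); first by rewrite ltr_wpDl.
move=> t; have [s hs [n ->]] := ang_reduce t; rewrite perZ//.
have := hK s ltac:(by apply/angP; lra); have := ler_norm (rho s)^-1; have := ler_norm K; lra.
Qed.

Lemma exp_length_gt0 : 0 < L.
Proof.
have [K K0 hK] := rho_lb; rewrite -ci_rho; apply: (@lt_le_trans _ _ (ci (fun=> K^-1))).
  by rewrite ci_cst mulr_gt0 ?invr_gt0 ?pi2_gt0.
apply: le_ci; [exact: cintb_cst|exact: cintb_cont|].
by move=> t _; rewrite -[rho t]invrK lef_pV2 ?posrE ?invr_gt0.
Qed.

(** Let [P] be the arc length normalized to have total length [2 pi], so [P' = rho / v], and let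
    [T] be its inverse. The curve [Phi (expi (T t))] has velocity [v U(T t)] and second
    derivative [v^2 i kappa(T t) U(T t)], where [kappa] is essentially bounded; the velocity is
    Lipschitz, so these are also weak derivatives. *)
Theorem exp_arclength : exists gamma sigma : C -> C,
  [/\ circle_W2infty gamma, constant_speed gamma (L / (2 * pi)), circle_diffeo sigma &
    forall z, circle z -> Phi (sigma z) = gamma z].
Proof.
have L0 := exp_length_gt0; have p0 := @pi2_gt0 R.
pose v := L / (2 * pi); have v0 : 0 < v by rewrite divr_gt0.
pose p t := rho t / v.
have cp : continuous p by move=> t; apply: cvgM; [exact: crho|exact: cvg_cst].
have pp t : 0 < p t by rewrite divr_gt0.
have [P [P0 hP]] := primR cp.
have pper : per p by move=> t; rewrite /p prho.
have ip : ci p = 2 * pi.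
  rewrite (@eq_ci _ _ (fun t => v^-1 * rho t)); last by move=> t _; rewrite mulrC.
  by rewrite ciZ ?ci_rho; [rewrite /v invfM invrK mulrAC mulVf ?gt_eqF// mul1r|exact: cintb_cont].
have P2 : per (fun t => P t - t).
  move=> t /=; have hs s : cder (fun s => (P (s + 2 * pi))%:C : C) s (p s)%:C.
    by apply: cder_eq (@cder_shift R (fun s => (P s)%:C) s _ (cder_real (hP _))) _; rewrite pper.
  have := cder_eq_fun hs (fun s => cder_real (hP s)) 0 t; rewrite add0r -!RCB P0 => /complexI.
  have : ci p = P (2 * pi) - P 0 := FTC2_seg (ltW p0) hP cp.
  rewrite ip P0; lra.
pose T := repar_inv P.
have PT y : P (T y) = y := repar_invK hP P2 P0 y.
have TP t : T (P t) = t := reparK pp hP P2 P0 t.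
have hT y : is_derive y 1 T (p (T y))^-1 := repar_inv_derive pp hP P2 P0 y.
have cT : continuous T := repar_inv_cont pp hP P2 P0.
have T2 y : T (y + 2 * pi) = T y + 2 * pi := repar_inv_shift pp hP P2 P0 y.
have P2' t : P (t + 2 * pi) = P t + 2 * pi := repar_shift P2 t.
pose sigma := of_angle (fun t => expi (T t) : C).
pose sigma' := of_angle (fun t => expi (P t) : C).
have sE t : sigma (expi t) = expi (T t) by apply: of_angleE => s; rewrite T2 expi_period.
have s'E t : sigma' (expi t) = expi (P t) by apply: of_angleE => s; rewrite P2' expi_period.
have circ z : circle z -> exists t, z = expi t.
  by move=> /circleE/polar_unit[t _ ->]; exists t.
have C1 (f g : R -> R) (s : C -> C) : (forall t, is_derive t 1 f (g t)) -> continuous g ->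
    (forall t, s (expi t) = expi (f t)) -> circle_C1_map s.
  move=> hf cg hs; have cf : continuous f by move=> t; apply: (ccRe (cder_continuous (cder_real (hf t)))).
  have hd t : cder (s \o expi) t ((g t)%:C * ('i * expi (f t))).
    by apply: cder_ext (cder_comp (hf t) (cder_expi _)) => x; rewrite /= hs.
  split; first by move=> z /circ[t ->]; rewrite hs; apply/circleE; exact: nc_expi.
  split; first by move=> t; exact: cder_derivable (hd t).
  rewrite (_ : curve_derive _ = fun t => (g t)%:C * ('i * expi (f t))); last first.
    by apply/funext => t; exact: cder_derive.
  move=> t; apply: ccM; first by apply: ccR; exact: cg.
  by apply: ccM; [exact: ccst|apply: ccexpi; exact: cf].
have cT' : continuous (fun y => (p (T y))^-1).
  have cpT : continuous (fun y => p (T y)).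
    by move=> y; apply: (@continuous_comp _ _ _ T p); [exact: cT|exact: cp].
  by move=> y; apply: (@continuousV _ _ (fun y => p (T y)) y); [rewrite gt_eqF|exact: cpT].
have diffeo : circle_diffeo sigma.
  exists sigma'; split.
  - exact: C1 hT cT' sE.
  - exact: C1 hP cp s'E.
  - by move=> z /circ[t ->]; rewrite sE s'E PT.
  - by move=> z /circ[t ->]; rewrite s'E sE TP.
pose gamma z := Phi (sigma z).
have gE t : gamma (expi t) = Phi (expi (T t)) by rewrite /gamma sE.
have vpT t : (p (T t))^-1 * rho (T t) = v.
  by rewrite /p invfM invrK mulrAC mulVf ?mul1r// gt_eqF.
have hg t : cder (fun t => gamma (expi t)) t (v%:C * U (T t)).
  apply: (@cder_ext _ (fun t => Phi (expi (T t)))); first by move=> x; rewrite gE.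
  by apply: cder_eq (cder_comp (hT t) (exp_curve_derive _)) _; rewrite mulrA -RCM vpT.
have speed : constant_speed gamma v.
  move=> t; split; first exact: cder_derivable (hg t).
  rewrite (_ : curve_derive _ t = v%:C * U (T t)); last exact: (cder_derive (hg t)).
  by rewrite ncE ncM nU mulr1 ncR gtr0_norm.
pose W z : C := 'i * z * expi (Im (F z)).
have WE t : W (expi t) = U t by rewrite /W /U expiD /rr; ring.
pose g1 z : C := v%:C * W (sigma z).
pose g2 z : C := (v ^+ 2)%:C * ('i * (kappa (sigma z))%:C * W (sigma z)).
have g1E t : g1 (expi t) = v%:C * U (T t) by rewrite /g1 sE WE.
have g2E t : g2 (expi t) = (v ^+ 2)%:C * ('i * (kappa (expi (T t)))%:C * U (T t)) by rewrite /g2 sE WE.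
have lU : llip U.
  have pe : per (expi : R -> C) by exact: expi_period.
  have le : llip (expi : R -> C).
    by apply: (llip_der (M := 1) (@cder_expi R)) => t; rewrite ncM ni nc_expi mulr1.
  have pr : per (fun t => expi (rr t) : C) by move=> t; rewrite /rr expi_period.
  have [d [M [d0 H]]] := llipM pe pr le (llip_expi lrr).
  exists d, M; split => // t h hd; rewrite /U -mulrBr ncM ni mul1r !expiD.
  by have := H t h hd; rewrite !expiD.
have cU := llip_cont lU.
have [K K0 hK] := rho_lb.
have Tlip : forall t h, `|T (t + h) - T t| <= 2 * (v * K) * `|h|.
  apply: (bounded_derive_lip hT) => t; rewrite ger0_norm ?invr_ge0 ?(ltW (pp _))//.
  by rewrite /p invfM invrK mulrC ler_wpM2l ?(ltW v0).
have lg1 : llip (fun t => g1 (expi t)).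
  have [d [M [d0 H]]] := llip_comp lU Tlip.
  exists d, (v * M); split => // t h hd; rewrite !g1E -mulrBr ncM ncR (gtr0_norm v0) -mulrA ler_wpM2l ?(ltW v0)//.
  exact: H.
have cg1 := llip_cont lg1.
have cUT : continuous (fun t => U (T t)).
  by move=> t; apply: (@cccompR _ _ T U); [exact: cT|exact: cU].
have [mk [M hM]] := Lk.
have hMT : circle_ae (fun t => `|kappa (expi (T t))| <= M) := repar_ae cp pp hP P2 P0 hM.
have mkT : measurable_fun (ang : set mR) (fun t => kappa (expi (T t))).
  exact: (repar_inv_meas pp hP P2 P0 (u := fun t => kappa (expi t)) mk).
have g2RI t : Re (g2 (expi t)) = kappa (expi (T t)) * (v ^+ 2 * - Im (U (T t))) /\
    Im (g2 (expi t)) = kappa (expi (T t)) * (v ^+ 2 * Re (U (T t))).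
  by rewrite g2E !cE /=; split; ring.
have Linf (u w : R -> R) (f : C -> R) : continuous w -> (forall t, `|w t| <= 1) -> (forall t, f (expi t) = kappa (expi (T t)) * (v ^+ 2 * w t)) ->
    circle_Linfty f.
  move=> cw w1 fE; split.
  - rewrite /circle_measurable (_ : f \o expi = fun t => kappa (expi (T t)) * (v ^+ 2 * w t)); last exact/funext.
    apply: measurable_funM; first exact: mkT.
    by apply: cont_meas => t; apply: cvgM; [exact: cvg_cst|exact: cw].
  - exists (M * v ^+ 2); apply: ae_imp hMT => t _ h; rewrite fE normrM.
    apply: ler_pM => //; rewrite normrM ger0_norm ?sqr_ge0//.
    by rewrite ler_piMr ?sqr_ge0.
have Lg2 : circle_cLinfty g2.
  split.
  - apply: (Linf _ (fun t => - Im (U (T t)))) => //.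
    + by move=> t; apply: cvgN; exact: ccIm (cUT t).
    + by move=> t; rewrite normrN; apply: le_trans (Im_le_nc _) _; rewrite nU.
    + by move=> t; exact: (g2RI t).1.
  - apply: (Linf _ (fun t => Re (U (T t)))) => //.
    + by move=> t; exact: ccRe (cUT t).
    + by move=> t; apply: le_trans (Re_le_nc _) _; rewrite nU.
    + by move=> t; exact: (g2RI t).2.
have [_ [_ _ _ ig2]] := cLinfty_bound Lg2.
have cg : continuous (fun t => gamma (expi t)) by move=> t; exact: cder_continuous (hg t).
have w1 : circle_weak_derivative gamma g1.
  apply: llip_weak_derivative.
  - apply: (llip_C1 _ hg); first by move=> t; rewrite expi_period.
    by move=> t; apply: ccM; [exact: ccst|exact: cUT].
  - exact: cintbC_cont.
  - by apply: ae_all => t _; rewrite g1E; exact: hg.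
have w2 : circle_weak_derivative g1 g2.
  apply: llip_weak_derivative => //.
  apply: ae_imp (repar_ae cp pp hP P2 P0 exp_tangent_derive) => t _ h.
  apply: (@cder_ext _ (fun t => v%:C * U (T t))); first by move=> x; rewrite g1E.
  apply: cder_eq (cderZ v%:C (cder_comp (hT t) h)) _.
  rewrite g2E; have := vpT t; move: (p (T t))^-1 (rho (T t)) (kappa _) (U _) => a b c w E.
  rewrite -E !RCX !RCM; ring.
exists gamma, sigma; split => //.
exists g1, g2; split => //; split => //; first exact: cont_cLinfty.
exact: cont_cLinfty.
Qed.

End Curve.

Lemma exp_cintb (l : C -> R) (L : R) : circle_L1 l ->
  (\int[leb]_(t in ang) (expR (l (expi t)))%:E)%E = L%:E -> cintb (fun t => expR (l (expi t))).
Proof.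
move=> il nL; have ml := cintb_meas (u := fun t => l (expi t)) il.
apply/integrableP; split; first by apply/measurable_EFinP; apply: measurableT_comp; [exact: measurable_expR|exact: ml].
under eq_integral do rewrite /= ger0_norm ?expR_ge0//.
by rewrite nL ltry.
Qed.

Theorem half_laplacian_immersion (l kappa : C -> R) (L : R) : circle_L1 l ->
  (\int[leb]_(t in ang) (expR (l (expi t)))%:E)%E = L%:E ->
  circle_Linfty kappa -> half_laplacian_eq l (fun z => kappa z * expR (l z) - 1) ->
  exists gamma Phi dPhi sigma : C -> C,
    [/\ circle_W2infty gamma /\ constant_speed gamma (L / (2 * pi)),
        holomorphic_immersion Phi dPhi,
        circle_diffeo sigma /\ (forall z, circle z -> Phi (sigma z) = gamma z),
        conformal_factor dPhi l & boundary_curvature Phi kappa].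
Proof.
move=> il nL Lk eqn.
have ie := exp_cintb il nL.
have [a [F [ha cF EF lae [lrr dae]]]] := boundary_log il ie Lk eqn.
have [Phi im] := exp_immersion ha cF EF.
have [gamma [sigma [W S D E]]] := exp_arclength cF im lae dae lrr nL ie Lk.
exists gamma, Phi, (fun z => cexp (F z)), sigma; split => //.
- by apply: ae_imp lae => t _ Et; rewrite ncE nc_cexp Et.
- exact: exp_boundary_curvature im lae dae.
Qed.

End Forward.

(** * The equivalence *)

Theorem theorem1p3 (R : realType) (lambda : Cplx R -> R) (L : R)
    (lambda_L1 : circle_L1 lambda)
    (norm_exp_lambda : (\int[@lebesgue_measure R]_(t in angles)
        (expR (lambda (expi t)))%:E)%E = L%:E) :
  [/\ forall kappa : Cplx R -> R, circle_measurable kappa ->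
        (circle_Linfty kappa /\
         half_laplacian_eq lambda
           (fun z => kappa z * expR (lambda z) - 1)) <->
        (exists gamma Phi dPhi sigma : Cplx R -> Cplx R,
          [/\ circle_W2infty gamma /\ constant_speed gamma (L / (2 * pi)),
              holomorphic_immersion Phi dPhi,
              circle_diffeo sigma /\
                (forall z, circle z -> Phi (sigma z) = gamma z),
              conformal_factor dPhi lambda &
              boundary_curvature Phi kappa]),
      forall (Phi dPhi : Cplx R -> Cplx R) (lambda' : Cplx R -> R),
        holomorphic_immersion Phi dPhi ->
        conformal_factor dPhi lambda -> conformal_factor dPhi lambda' ->
        circle_ae (fun t => lambda' (expi t) = lambda (expi t)),
      forall Phi dPhi Phi' dPhi' : Cplx R -> Cplx R,
        holomorphic_immersion Phi dPhi -> conformal_factor dPhi lambda ->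
        holomorphic_immersion Phi' dPhi' -> conformal_factor dPhi' lambda ->
        exists (theta0 : R) (a : Cplx R),
          forall z, closed_disk z -> Phi z = expi theta0 * Phi' z + a &
      forall Phi dPhi : Cplx R -> Cplx R,
        holomorphic_immersion Phi dPhi -> conformal_factor dPhi lambda ->
        exists lt : Cplx R -> R,
          harmonic_extension lambda lt /\
          forall z, closed_disk z -> `|dPhi z| = (expR (lt z))%:C].
Proof.
have ie := exp_cintb lambda_L1 norm_exp_lambda.
have speed Phi dPhi : holomorphic_immersion Phi dPhi -> conformal_factor dPhi lambda -> 0 < L / (2 * pi).
  move=> im cf; have [a [F [_ cF _ dE]]] := immersion_log im.
  have lae := conformal_log dE cf.
  by rewrite divr_gt0 ?pi2_gt0// (exp_length_gt0 cF lae norm_exp_lambda ie).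
split.
- move=> kappa mk; split.
    by move=> [Lk eqn]; exact: half_laplacian_immersion lambda_L1 norm_exp_lambda Lk eqn.
  move=> [gamma [Phi [dPhi [sigma [[W S] im [D E] cf cu]]]]].
  exact: immersion_half_laplacian (speed _ _ im cf) lambda_L1 mk im W S D E cf cu.
- by move=> Phi dPhi lambda' _; exact: factor_unique.
- move=> Phi dPhi Phi' dPhi' im cf im' cf'; exact: immersion_unique im cf im' cf'.
- move=> Phi dPhi im cf; exact: immersion_harmonic lambda_L1 im cf.
Qed.
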